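(* Let $n\ge 2$, $0<\beta<1$, $b\in \mathrm{Lip}_\beta(\mathbb{R}^n)$ and $0<\alpha<n-\beta$. Let $\tilde\Omega$ be homogeneous of degree $0$ on $\mathbb{R}^n$ and suppose there is a real number $r\ge n/(n-\alpha)$ such that $\tilde\Omega\in L^r(S^{n-1})$ and $$\int_0^1\frac{\tilde\omega_r(\delta)}{\delta^{1+\beta}}\,d\delta<+\infty .$$ Then $[b,T_{\tilde\Omega,\alpha}]$ is bounded from $H^{n/(n+\beta)}(\mathbb{R}^n)$ into weak $L^{n/(n-\alpha)}(\mathbb{R}^n)$; that is, there exists a positive constant $C$, independent of $f$ and $b$, such that for all $f\in H^{n/(n+\beta)}(\mathbb{R}^n)$ and all $\lambda>0$ $$\big|\{x\in\mathbb{R}^n: |[b,T_{\tilde\Omega,\alpha}]f(x)|>\lambda\}\big|\le C\,\big(\|b\|_{\mathrm{Lip}_\beta(\mathbb{R}^n)}\,\lambda^{-1}\,\|f\|_{H^{n/(n+\beta)}(\mathbb{R}^n)}\big)^{n/(n-\alpha)} .$$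
   Context: $S^{n-1}$ is the unit sphere of $\mathbb{R}^n$ with normalized Lebesgue measure $d\sigma$; $|E|$ denotes Lebesgue measure of $E\subset\mathbb{R}^n$. Integral modulus of order $r$ of $\tilde\Omega$: $\tilde\omega_r(\delta)=\sup_{|\rho|<\delta}\big(\int_{S^{n-1}}|\tilde\Omega(\rho z')-\tilde\Omega(z')|^r\,d\sigma(z')\big)^{1/r}$, where $\rho$ ranges over rotations of $\mathbb{R}^n$ and $|\rho|=\sup_{z'\in S^{n-1}}|\rho z'-z'|$. Lipschitz space: for $0<\beta\le1$, $\mathrm{Lip}_\beta(\mathbb{R}^n)$ is the set of functions $g$ with $\|g\|_{\mathrm{Lip}_\beta(\mathbb{R}^n)}=\sup_{x\ne y}\frac{|g(x)-g(y)|}{|x-y|^\beta}<\infty$. Commutator (defined formally by): $$[b,T_{\tilde\Omega,\alpha}]f(x)=\int_{\mathbb{R}^n}\frac{\tilde\Omega(x-y)}{|x-y|^{n-\alpha}}\,(b(x)-b(y))f(y)\,dy .$$ Hardy space and atoms: $H^p(\mathbb{R}^n)$ is the usual real Hardy space. For $0<p\le1\le \ell<\infty$, $p\neq \ell$, and an integer $s\ge[n(1/p-1)]$, where $[t]$ is the greatest integer less than or equal to $t$, a $(p,\ell)$-atom centered at $x_0$ is a function $a\in L^\ell(\mathbb{R}^n)$ supported in a ball $B(x_0,d)=\{x:|x-x_0|\le d\}$, $d>0$, with $\|a\|_{L^\ell}\le|B(x_0,d)|^{1/\ell-1/p}$ and $\int a(x)x^\gamma\,dx=0$ for $0\le|\gamma|\le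 s$. A distribution $f$ belongs to $H^p$ if and only if $f=\sum_j\lambda_ja_j$ in the sense of distributions with $(p,\ell)$-atoms $a_j$ and $\sum_j|\lambda_j|^p<\infty$, and $\|f\|_{H^p}\sim\inf(\sum_j|\lambda_j|^p)^{1/p}$ over all such decompositions. The formal operator acts on $f\in H^p$ through atomic decompositions, $[b,T_{\tilde\Omega,\alpha}]f=\sum_j\lambda_j[b,T_{\tilde\Omega,\alpha}]a_j$, with $(p,\ell)$-atoms, $1<\ell<n/\alpha$ (here $p=n/(n+\beta)$). *)

(* Defs.v *)
From HB Require Import structures.
From mathcomp Require Import all_boot all_order all_algebra.
From mathcomp Require Import all_classical all_reals all_analysis.
From mathcomp Require Import measurable_realfun.

Set Implicit Arguments.
Unset Strict Implicit.
Unset Printing Implicit Defensive.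

Import Order.TTheory GRing.Theory Num.Theory.
Import numFieldNormedType.Exports.

Local Open Scope classical_set_scope.
Local Open Scope ring_scope.

(* Points of R^n are row vectors, measurable sets are generated by the
   coordinates (equivalently, by the open sets). *)

Definition measure_matrix_display : measure_display.
Proof. exact: default_measure_display. Qed.

Definition matrix_entries (R : realType) (m n : nat) : set (set 'M[R]_(m, n)) :=
  \bigcup_(ij in [set: 'I_m * 'I_n])
    preimage_set_system setT (fun M : 'M[R]_(m, n) => M ij.1 ij.2)
      (@measurable _ (measurableTypeR R)).

Section matrix_measurable.
Context (R : realType) (m n : nat).

Let set0_entries : <<s @matrix_entries R m n >> set0.
Proof. exact: sigma_algebra0. Qed.

Let setC_entries (A : set 'M[R]_(m, n)) :
  <<s @matrix_entries R m n >> A -> <<s @matrix_entries R m n >> (~` A).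
Proof. exact: sigma_algebraC. Qed.

Let bigcup_entries (F : (set 'M[R]_(m, n))^nat) :
  (forall i, <<s @matrix_entries R m n >> (F i)) ->
  <<s @matrix_entries R m n >> (\bigcup_i (F i)).
Proof. exact: sigma_algebra_bigcup. Qed.

HB.instance Definition _ := @isMeasurable.Build measure_matrix_display
  'M[R]_(m, n) <<s @matrix_entries R m n >>
  set0_entries setC_entries bigcup_entries.

Lemma measurable_entry i j :
  measurable_fun setT ((fun M => M i j) : 'M[R]_(m, n) -> measurableTypeR R).
Proof.
move=> _ Y mY; apply: sub_sigma_algebra.
by exists (i, j) => //; exists Y.
Qed.

Lemma measurable_fun_entries d (T : measurableType d) (f : T -> 'M[R]_(m, n)) :
  (forall i j, measurable_fun setT ((fun t => f t i j) : T -> measurableTypeR R)) ->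
  measurable_fun setT f.
Proof.
move=> mf; apply: (@measurability _ _ _ _ _ _ (@matrix_entries R m n)) => //.
move=> _ [_ [[i j] _ [Y mY <-]] <-].
rewrite -comp_preimage.
have := mf i j measurableT Y mY.
by rewrite !setTI.
Qed.

End matrix_measurable.

Lemma product_sigma_finite d1 d2 (T1 : measurableType d1)
    (T2 : measurableType d2) (R : realType)
    (m1 : {sigma_finite_measure set T1 -> \bar R})
    (m2 : {sigma_finite_measure set T2 -> \bar R}) :
  sigma_finite setT (m1 \x m2)%E.
Proof.
have /sigma_finiteP[F [TF ndF Foo]] := sigma_finiteT m1.
have /sigma_finiteP[G [TG ndG Goo]] := sigma_finiteT m2.
exists (fun n => F n `*` G n).
  rewrite -setXTT TF TG predeqE => -[x y]; split.
    move=> [/= [n _ Fnx] [k _ Gky]]; exists (maxn n k) => //; split.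
    - by move: x Fnx; exact/subsetPset/ndF/leq_maxl.
    - by move: y Gky; exact/subsetPset/ndG/leq_maxr.
  by move=> [n _ []/= ? ?]; split; exists n.
move=> k; have [? ?] := Foo k; have [? ?] := Goo k.
split; first exact: measurableX.
by rewrite product_measure1E// lte_mul_pinfty// ge0_fin_numE.
Qed.

Section lebesgue_rV.
Context (R : realType).

Definition consrV n (u : measurableTypeR R * 'rV[R]_n) : 'rV[R]_n.+1 :=
  \row_i (if unlift 0 i is Some j then u.2 0 j else u.1).

Definition unconsrV n (v : 'rV[R]_n.+1) : measurableTypeR R * 'rV[R]_n :=
  (v 0 0, \row_i v 0 (lift 0 i)).

Lemma consrVK n : cancel (@consrV n) (@unconsrV n).
Proof.
case=> x v; rewrite /unconsrV /consrV /=; congr pair.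
  by rewrite mxE unlift_none.
by apply/rowP => i; rewrite !mxE liftK.
Qed.

Lemma measurable_consrV n : measurable_fun setT (@consrV n).
Proof.
apply: measurable_fun_entries => i j; rewrite ord1 {i}.
have [k ->|->] := unliftP 0 j.
  rewrite (_ : (fun _ => _) = (fun M : 'rV[R]_n => M 0 k) \o snd).
    by apply: measurableT_comp; [exact: measurable_entry|exact: measurable_snd].
  by apply/funext => u /=; rewrite mxE liftK.
rewrite (_ : (fun _ => _) = fst); first exact: measurable_fst.
by apply/funext => u /=; rewrite mxE unlift_none.
Qed.

Lemma measurable_unconsrV n : measurable_fun setT (@unconsrV n).
Proof.
apply: measurable_fun_pair; first exact: measurable_entry.
apply: measurable_fun_entries => i j.
by under eq_fun do rewrite mxE; exact: measurable_entry.
Qed.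

Section lebesgue_step.
Variables (n : nat) (mu : {sigma_finite_measure set 'rV[R]_n -> \bar R}).

#[local] Hint Extern 0 (measurable_fun _ (@consrV _)) =>
  solve [apply: measurable_consrV] : core.

Definition lebesgue_step : set 'rV[R]_n.+1 -> \bar R :=
  pushforward (@lebesgue_measure R \x mu)%E (@consrV n).

Let step0 : lebesgue_step set0 = 0%E.
Proof. by rewrite /lebesgue_step /pushforward preimage_set0 measure0. Qed.

Let step_ge0 A : (0 <= lebesgue_step A)%E.
Proof. by apply: measure_ge0. Qed.

Let step_sigma_additive : semi_sigma_additive lebesgue_step.
Proof. by apply: measure_semi_sigma_additive. Qed.

HB.instance Definition _ := isMeasure.Build _ _ _ lebesgue_step
  step0 step_ge0 step_sigma_additive.

Let step_sigma_finite : sigma_finite setT lebesgue_step.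
Proof.
have [F FT mF] : sigma_finite setT (@lebesgue_measure R \x mu)%E.
  exact: product_sigma_finite.
exists (fun i => @unconsrV n @^-1` F i).
  by rewrite -preimage_bigcup -FT preimage_setT.
move=> i; have [mFi Fioo] := mF i; split.
  by rewrite -[X in measurable X]setTI; exact: measurable_unconsrV.
rewrite /lebesgue_step /pushforward -comp_preimage.
rewrite (_ : _ \o _ = id) ?preimage_id//.
by apply/funext => u; exact: consrVK.
Qed.

HB.instance Definition _ := Measure_isSigmaFinite.Build _ _ _ lebesgue_step
  step_sigma_finite.

End lebesgue_step.

Fixpoint lebesgue_rV (n : nat) : {sigma_finite_measure set 'rV[R]_n -> \bar R} :=
  match n with
  | 0 => \d_(0 : 'rV[R]_0)
  | n'.+1 => lebesgue_step (lebesgue_rV n')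
  end.

End lebesgue_rV.

Section euclidean.
Context (R : realType) (n : nat).
Local Notation vec := 'rV[R]_n.
Implicit Types (x y z v : vec) (rho : 'M[R]_n).

(* the library's norm on matrices is the sup norm *)
Definition enorm x : R := Num.sqrt (\sum_i x 0 i ^+ 2).

Definition ecball x (d : R) : set vec := [set y | enorm (y - x) <= d].

Definition sphere : set vec := [set z | enorm z = 1].

Definition edir x : vec := (enorm x)^-1 *: x.

Lemma measurable_enorm :
  measurable_fun setT (enorm : vec -> measurableTypeR R).
Proof.
rewrite (_ : (enorm : _ -> _) =
    (@powR R ^~ 2^-1) \o (fun x : vec => \sum_i x 0 i ^+ 2)); last first.
  by apply/funext => x /=; rewrite powR12_sqrt // sumr_ge0 // => i _; exact: sqr_ge0.
apply: measurableT_comp; first exact: measurable_powR.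
by apply: measurable_sum => i; apply: measurable_funX; exact: measurable_entry.
Qed.

Lemma measurable_ecball0 (d : R) : measurable (ecball 0 d).
Proof.
rewrite (_ : ecball 0 d = enorm @^-1` `]-oo, d]); last first.
  by apply/seteqP; split=> x; rewrite /ecball /= in_itv /= subr0.
by rewrite -[X in measurable X]setTI; exact: measurable_enorm.
Qed.

Lemma measurable_edir : measurable_fun setT edir.
Proof.
apply: measurable_fun_entries => i j; rewrite /edir.
under eq_fun do rewrite mxE.
apply: measurable_funM; last exact: measurable_entry.
rewrite (_ : (fun _ => _) = (@powR R ^~ (-1)) \o enorm); last first.
  by apply/funext => x /=; rewrite powR_inv1 // sqrtr_ge0.
by apply: measurableT_comp measurable_enorm; exact: measurable_powR.
Qed.

(* Normalized surface measure, as the cone measure: the measure of a set A of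
   directions is the proportion of the unit ball lying in the cone over A.
   It is carried by the sphere but defined on the subsets of R^n. *)
Definition sphere_measure (A : set vec) : \bar R :=
  ((fine (lebesgue_rV R n (ecball 0 1)))^-1%:E *
   lebesgue_rV R n (edir @^-1` A `&` ecball 0 1))%E.

Let cone_measure (A : set vec) : \bar R :=
  lebesgue_rV R n (edir @^-1` A `&` ecball 0 1).

Let cone_measureE :
  cone_measure = pushforward (mrestr (lebesgue_rV R n) (measurable_ecball0 1)) edir.
Proof. by []. Qed.

#[local] Hint Extern 0 (measurable_fun _ edir) =>
  solve [apply: measurable_edir] : core.

Let sphere_measure0 : sphere_measure set0 = 0%E.
Proof. by rewrite /sphere_measure preimage_set0 set0I measure0 mule0. Qed.

Let sphere_measure_ge0 A : (0 <= sphere_measure A)%E.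
Proof.
by apply: mule_ge0; [rewrite lee_fin invr_ge0 fine_ge0|apply: measure_ge0].
Qed.

Let sphere_measure_sigma_additive : semi_sigma_additive sphere_measure.
Proof.
move=> F mF tF mUF.
rewrite (_ : (fun _ => _) = (fun k => (fine (lebesgue_rV R n (ecball 0 1)))^-1%:E *
    \sum_(0 <= i < k) cone_measure (F i))%E); last first.
  by apply/funext => k; rewrite ge0_sume_distrr// => i _; apply: measure_ge0.
apply: cvgeZl => //; rewrite cone_measureE.
by apply: measure_semi_sigma_additive.
Qed.

HB.instance Definition _ := isMeasure.Build _ _ _ sphere_measure
  sphere_measure0 sphere_measure_ge0 sphere_measure_sigma_additive.

End euclidean.

(* L^p of the completed measure: f need only agree almost everywhere with a
   Borel function of finite norm. The library's integral of a nonnegative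
   function is the supremum of the integrals of the simple Borel functions
   below it, so on such an f it is the usual Lebesgue integral. *)
Definition inLp d (T : measurableType d) (R : realType)
    (mu : {measure set T -> \bar R}) (p : R) (f : T -> R) : Prop :=
  exists2 g, g \in Lfun mu p%:E & f = g %[ae mu].

Section commutators.
Context (R : realType) (n : nat).
Local Notation vec := 'rV[R]_n.
Local Notation leb := (lebesgue_rV R n).
Local Notation sigma := (@sphere_measure R n).
Implicit Types (Omega b : vec -> R).

Definition homogeneous0 Omega :=
  forall (t : R) (x : vec), 0 < t -> Omega (t *: x) = Omega x.

Definition rotation : set 'M[R]_n :=
  [set rho | rho *m rho^T = 1%:M /\ \det rho = 1].

(* rotations act on row vectors from the right *)
Definition rotation_size (rho : 'M[R]_n) : \bar R :=
  ereal_sup [set (enorm (z *m rho - z))%:E | z in @sphere R n].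

Definition integral_modulus Omega (r delta : R) : \bar R :=
  ereal_sup [set ((\int[sigma]_(z in @sphere R n)
                     (`|Omega (z *m rho) - Omega z| `^ r)%:E) `^ r^-1)%E
            | rho in [set rho | rotation rho /\
                                (rotation_size rho < delta%:E)%E]].

Definition Lip_norm (beta : R) b : \bar R :=
  ereal_sup [set (`|b xy.1 - b xy.2| / enorm (xy.1 - xy.2) `^ beta)%:E
            | xy in [set xy : vec * vec | xy.1 != xy.2]].

Definition commutator_kernel Omega (alpha : R) b (x y : vec) : R :=
  Omega (x - y) / enorm (x - y) `^ (n%:R - alpha) * (b x - b y).

Definition commutator Omega (alpha : R) b (a : vec -> R) (x : vec) : R :=
  \int[leb]_y (commutator_kernel Omega alpha b x y * a y).

Definition atom (p l : R) (s : nat) (a : vec -> R) : Prop :=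
  exists (x0 : vec) (d : R),
    [/\ 0 < d,
        inLp leb l a,
        {ae leb, forall x, ~ ecball x0 d x -> a x = 0},
        ('N[leb]_l%:E[EFin \o a] <= leb (ecball x0 d) `^ (l^-1 - p^-1))%E &
        forall gamma : 'I_n -> nat, (\sum_i gamma i <= s)%N ->
          \int[leb]_x (a x * \prod_i x 0 i ^+ gamma i) = 0].

(* iterated partial derivative, along the coordinates listed in k *)
Definition partial (k : seq 'I_n) (phi : vec -> R) : vec -> R :=
  foldr (fun i psi => 'D_(delta_mx 0 i) psi) phi k.

Definition smooth (phi : vec -> R) : Prop :=
  forall k : seq 'I_n, continuous (partial k phi) /\
    forall i x, derivable (partial k phi) x (delta_mx 0 i).

Definition supported_in (K : set vec) (phi : vec -> R) : Prop :=
  forall x, ~ K x -> phi x = 0.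

Definition test_function (phi : vec -> R) : Prop :=
  smooth phi /\ exists2 K : set vec, compact K & supported_in K phi.

(* f is meaningful only on test functions; the second clause is continuity *)
Definition distribution (f : (vec -> R) -> R) : Prop :=
  (forall (c : R) phi psi, test_function phi -> test_function psi ->
     f (fun x => c * phi x + psi x) = c * f phi + f psi) /\
  (forall K : set vec, compact K -> exists (C : R) (N : nat),
     forall phi (M : R), test_function phi -> supported_in K phi ->
       (forall k x, (size k <= N)%N -> `|partial k phi x| <= M) ->
       `|f phi| <= C * M).

Definition coef_norm (p : R) (c : R^nat) : \bar R :=
  ((\sum_(0 <= j <oo) (`|c j| `^ p)%:E) `^ p^-1)%E.

Definition atomic_decomposition (p l : R) (s : nat) (f : (vec -> R) -> R)
    (c : R^nat) (a : (vec -> R)^nat) : Prop :=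
  [/\ forall j, atom p l s (a j),
      (\sum_(0 <= j <oo) (`|c j| `^ p)%:E < +oo)%E &
      forall phi, test_function phi ->
        series (fun j => c j * \int[leb]_x (a j x * phi x)) @ \oo --> f phi].

(* H^p through (p, l)-atoms with vanishing moments up to order s, and its
   atomic quasi-norm *)
Definition Hardy (p l : R) (s : nat) (f : (vec -> R) -> R) : Prop :=
  distribution f /\ exists c a, atomic_decomposition p l s f c a.

Definition Hardy_norm (p l : R) (s : nat) (f : (vec -> R) -> R) : \bar R :=
  ereal_inf [set coef_norm p c | c in
    [set c | exists a, atomic_decomposition p l s f c a]].

(* g is the almost everywhere sum of the series of c_j [b, T] a_j, where the
   integral defining each [b, T] a_j converges absolutely *)
Definition commutator_series Omega (alpha : R) b
    (c : R^nat) (a : (vec -> R)^nat) (g : vec -> R) : Prop :=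
  {ae leb, forall x,
    (forall j, (\int[leb]_y `|commutator_kernel Omega alpha b x y * a j y|%:E
                < +oo)%E) /\
    series (fun j => c j * commutator Omega alpha b (a j) x) @ \oo --> g x}.

Definition commutator_Hardy (p l : R) (s : nat) Omega (alpha : R) b
    (f : (vec -> R) -> R) (g : vec -> R) : Prop :=
  exists c a, atomic_decomposition p l s f c a /\
              commutator_series Omega alpha b c a g.

End commutators.

(* Main.v *)
(* Write q = n/(n-alpha). The kernel k(x) = Omega(x)/|x|^(n-alpha) is in weak L^q, and the Dini
   condition gives int_{|x|>2d} (|k(x-y)-k(x)| |x|^beta)^q dx <= A d^(beta q) for |y| <= d. Since an
   atom a on B(x0,d) has mean zero, |[b,T]a(x)| is at most the Lipschitz norm of b times the integral
   over y of |a(y)| d^beta K(x,y), where K(.,y) is bounded in weak L^q uniformly in x0, d and y, and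
   int |a| d^beta is bounded by a constant. As q > 1, a superposition of such functions of total mass M
   has weak L^q norm at most a constant times M, and the total mass of an atomic decomposition is
   controlled by sum |c_j| <= (sum |c_j|^p)^(1/p).
   The norm of f is an infimum over all decompositions while [b,T]f is computed from one of them, so the
   sum must be shown not to depend on the decomposition. For bounded b, pairing the sum with a Lipschitz
   cut-off psi amounts to pairing f with a bounded Hoelder function of order beta, and such pairings are
   determined by the values of f on mollified test functions; unbounded b are reached by truncation. *)
Require Import Defs.
From HB Require Import structures.
From mathcomp Require Import all_boot all_order all_algebra.
From mathcomp Require Import all_classical all_reals all_analysis.
From mathcomp Require Import measurable_realfun.
From mathcomp Require Import ring lra.

Set Implicit Arguments.
Unset Strict Implicit.
Unset Printing Implicit Defensive.

Import Order.TTheory GRing.Theory Num.Theory.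
Import numFieldNormedType.Exports.

Local Open Scope classical_set_scope.
Local Open Scope ring_scope.

(** The Dini hypothesis compares W(x rho) with W(x) for one rotation rho and all x, whereas the
    kernel requires W(x - y) - W(x), and the rotation carrying the direction of x to that of x - y
    varies with x. Both values are therefore compared with W(w), averaged over w in a small cube
    about x. A point w near u is, up to a positive factor, u moved by two reflections, along a
    coordinate vector e_i and along a vector a near e_i; the average over w is thus dominated by one
    over a, and once the integrals are exchanged, a and with it the rotation is fixed. No Jacobian
    is computed: the map from a to w is Lipschitz and reaches every w, and comparing volumes of
    cubes bounds Lebesgue measure by a multiple of the image measure. Weak L^q is expressed by: the
    integral of |F| over the set where |F| > t is at most A t^(1-q). For q > 1 this is equivalent to
    the usual condition, and it passes through a superposition by Tonelli. *)

Import HBNNSimple.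

(** * Integrals of functions that are Borel only up to a null set *)

Section lower_integral.
Context d (T : measurableType d) (R : realType) (mu : {measure set T -> \bar R}).
Local Open Scope ereal_scope.

(** The simple functions below [f] are among those below [g], so the comparison covers functions
    that are not Borel, such as [Omega] and the atoms. *)
Lemma le_lower_integral (D : set T) (f g : T -> \bar R) :
  (forall x, D x -> 0 <= f x) -> (forall x, D x -> f x <= g x) ->
  \int[mu]_(x in D) f x <= \int[mu]_(x in D) g x.
Proof.
move=> f0 fg; rewrite (integral_mkcond D) (integral_mkcond D g).
have F0 x : 0 <= (f \_ D) x by apply: erestrict_ge0.
have G0 x : 0 <= (g \_ D) x.
  by apply: erestrict_ge0 => t Dt; exact: le_trans (f0 _ Dt) (fg _ Dt).
rewrite !ge0_integralTE//; apply: le_ereal_sup => _ [h hf <-].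
exists h => // x; apply: le_trans (hf x) _.
by rewrite /patch; case: ifPn => // /set_mem; exact: fg.
Qed.

(** A simple function below [f] is almost everywhere below [g]; conversely, [g] set to 0 on the null
    set is measurable, keeps its integral and lies below [f]. This transfers integrals from [Omega]
    and the atoms to their Borel versions. *)
Lemma ge0_lower_integral_ae (D : set T) (f g : T -> \bar R) :
  measurable D -> measurable_fun D g ->
  (forall x, D x -> 0 <= f x) -> (forall x, D x -> 0 <= g x) ->
  {ae mu, forall x, D x -> f x = g x} ->
  \int[mu]_(x in D) f x = \int[mu]_(x in D) g x.
Proof.
move=> mD mg f0 g0 fg; apply/eqP; rewrite eq_le; apply/andP; split.
  rewrite [leLHS]integral_mkcond ge0_integralTE; last first.
    by move=> x; apply: erestrict_ge0.
  apply: ge_ereal_sup => _ [h hf <-].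
  rewrite -integralT_nnsfun [leRHS]integral_mkcond.
  apply: ae_ge0_le_integral => //.
  - by move=> x _; rewrite lee_fin; exact: fun_ge0.
  - exact/measurable_EFinP.
  - by move=> x _; apply: erestrict_ge0.
  - exact/(measurable_restrictT _ _).1.
  - case: fg => N [mN N0 subN]; exists N; split => // x /= nh; apply: subN => /= fgx.
    apply: nh => _; apply: le_trans (hf x) _.
    by rewrite /patch; case: ifPn => // /set_mem Dx; rewrite fgx.
case: fg => N [mN N0 subN].
have -> : \int[mu]_(x in D) g x = \int[mu]_(x in D) (g \_ (~` N)) x.
  apply: ge0_ae_eq_integral => //.
  - apply/(measurable_restrict g) => //; first exact: measurableC.
    by apply: measurable_funS mg => // x [].
  - by move=> x Dx; rewrite /patch; case: ifP => // _; exact: g0.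
  - exists N; split => // x /=; apply: contra_notP => Nx Dx.
    by rewrite /patch mem_set.
apply: le_lower_integral => x Dx; first by rewrite /patch; case: ifP => // _; exact: g0.
rewrite /patch; case: ifPn => [/set_mem Nx|_]; last exact: f0.
have : (~` [set x0 | D x0 -> f x0 = g x0]) x -> False by move/subN.
by move=> /contrapT ->.
Qed.

Lemma lower_integral_ae (f g : T -> \bar R) : measurable_fun setT g ->
  {ae mu, forall x, f x = g x} -> \int[mu]_x f x = \int[mu]_x g x.
Proof.
move=> mg fg; rewrite integralE [RHS]integralE; congr (_ - _).
  apply: ge0_lower_integral_ae => //; first exact: measurable_funepos.
  by apply: filterS fg => x fgx _; rewrite !funeposE fgx.
apply: ge0_lower_integral_ae => //; first exact: measurable_funeneg.
by apply: filterS fg => x fgx _; rewrite !funenegE fgx.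
Qed.

End lower_integral.

Lemma ge0_integral_mrestr d (T : measurableType d) (R : realType)
    (mu : {measure set T -> \bar R}) (D : set T) (mD : measurable D)
    (f : T -> \bar R) : measurable_fun setT f -> (forall x, 0 <= f x)%E ->
  (\int[mrestr mu mD]_x f x = \int[mu]_(x in D) f x)%E.
Proof.
move=> mf f0.
have mDC : measurable (~` D) by exact: measurableC.
rewrite [LHS](ge0_negligible_integral (N := ~` D))//; last first.
  by rewrite /= /mrestr setICl measure0.
rewrite setDE setTI setCK; apply: eq_measure_integral => A mA AD.
by rewrite /= /mrestr setIidl.
Qed.

Notation pushm mu mf :=
  (measure_function_pushforward__canonical__measure_function_Measure mu mf).

(** * Affine changes of variables for Lebesgue measure *)

Section affine_change_of_variables.
Context (R : realType).

(** Two measures that agree on half-open intervals are equal. A negative [t] exchanges the open and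
    the closed end of the interval, which leaves its length unchanged. *)
Lemma lebesgue_affine (t c : R) (A : set R) : t != 0%R -> measurable A ->
  (`|t|%:E * @lebesgue_measure R [set x | A (t * x + c)%R] = lebesgue_measure A)%E.
Proof.
move=> t0 mA.
pose phi : measurableTypeR R -> measurableTypeR R := fun x => (t * x + c)%R.
have mphi : measurable_fun setT phi.
  by apply: measurable_funD => //; exact: measurable_funM.
have ht : (0 <= `|t|)%R by [].
pose m := mscale (NngNum ht) (pushm (@lebesgue_measure R) mphi).
rewrite [RHS](@lebesgue_measure_unique R m)//.
move=> _ /= [[a b] _ <-] /=.
rewrite /m /mscale /= /pushforward lebesgue_measure_itv/=.
have /orP[tlt|tgt] : (t < 0)%R || (0 < t)%R by rewrite -neq_lt.
  rewrite (_ : phi @^-1` _ = `[((b - c) / t)%R, ((a - c) / t)%R[%classic); last first.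
    apply/seteqP; split => x /=; rewrite !in_itv /= /phi.
      by move=> /andP[ax xb]; apply/andP; split;
        rewrite ?ler_ndivrMr ?ltr_ndivlMr //; lra.
    by rewrite ler_ndivrMr ?ltr_ndivlMr // => /andP[? ?]; apply/andP; split; lra.
  rewrite lebesgue_measure_itv/= !lte_fin ltr_ndivrMr // divfK // ?lt_eqF //.
  rewrite ltrD2r; case: ifPn => _; last by rewrite mule0.
  rewrite -!EFinD -EFinM ltr0_norm //; congr EFin.
  by rewrite -mulrBl mulNr mulrC divfK //; lra.
rewrite (_ : phi @^-1` _ = `]((a - c) / t)%R, ((b - c) / t)%R]%classic); last first.
  apply/seteqP; split => x /=; rewrite !in_itv /= /phi.
    by move=> /andP[ax xb]; apply/andP; split;
      rewrite ?ler_pdivlMr ?ltr_pdivrMr //; lra.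
  by rewrite ler_pdivlMr ?ltr_pdivrMr // => /andP[? ?]; apply/andP; split; lra.
rewrite lebesgue_measure_itv/= !lte_fin ltr_pM2r ?invr_gt0 //.
rewrite ltrD2r; case: ifPn => _; last by rewrite mule0.
rewrite -!EFinD -EFinM gtr0_norm //; congr EFin.
by rewrite -mulrBl mulrC divfK //; lra.
Qed.

Lemma measurable_affine n (t : R) (v : 'rV[R]_n) :
  measurable_fun setT (fun x : 'rV[R]_n => t *: x + v).
Proof.
apply: measurable_fun_entries => i j.
under eq_fun do rewrite !mxE.
apply: measurable_funD => //; apply: measurable_funM => //.
exact: measurable_entry.
Qed.

(** Induction on the dimension: the map acts separately on the first coordinate and on the others,
    and a measure with product values on rectangles is the product measure. *)
Lemma leb_affine n (t : R) (v : 'rV[R]_n) (A : set 'rV[R]_n) :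
  t != 0%R -> measurable A ->
  ((`|t| ^+ n)%:E * lebesgue_rV R n [set x | A (t *: x + v)%R] =
  lebesgue_rV R n A)%E.
Proof.
move=> t0; elim: n v A => [|n IH] v A mA.
  rewrite expr0 mul1e; congr (lebesgue_rV R 0 _).
  apply/seteqP; split => x /=; rewrite (_ : t *: x + v = x)//;
  by apply/rowP => -[].
pose phi (u : measurableTypeR R * 'rV[R]_n) : measurableTypeR R * 'rV[R]_n :=
  ((t * u.1 + v 0%R 0%R)%R, t *: u.2 + \row_i v 0%R (lift 0%R i)).
have mphi : measurable_fun setT phi.
  apply: measurable_fun_pair.
    apply: measurable_funD => //; apply: measurable_funM => //.
  apply: (@measurableT_comp _ _ _ _ _ _
    (fun x : 'rV[R]_n => t *: x + \row_i v 0%R (lift 0%R i))).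
    exact: measurable_affine.
  exact: measurable_snd.
have ht : (0 <= `|t| ^+ n.+1)%R by exact: exprn_ge0.
pose P := (@lebesgue_measure R \x lebesgue_rV R n)%E.
pose m : {measure set _ -> \bar R} := mscale (NngNum ht) (pushm P mphi).
have mE B : m B = ((`|t| ^+ n.+1)%:E * P (phi @^-1` B))%E by [].
have H := @product_measure_unique _ _ _ _ R (@lebesgue_measure R)
  (lebesgue_rV R n) m.
have mcA : measurable (@consrV R n @^-1` A).
  by rewrite -[X in measurable X]setTI; exact: measurable_consrV.
rewrite /= /lebesgue_step /pushforward [RHS]H //; last first.
  move=> X Y mX mY.
  apply: (etrans (mE _)); rewrite (_ : phi @^-1` _ = [set x | X (t * x + v 0%R 0%R)%R] `*`
    [set x | Y (t *: x + \row_i v 0%R (lift 0%R i))]); last first.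
    by apply/seteqP; split => -[].
  rewrite /P product_measure1E//; last 2 first.
  - rewrite -[X in measurable X]setTI.
    have mg : measurable_fun setT (fun x : measurableTypeR R =>
      (t * x + v 0%R 0%R)%R : measurableTypeR R).
      by apply: measurable_funD => //; exact: measurable_funM.
    exact: mg.
  - rewrite -[X in measurable X]setTI; exact: (measurable_affine _ _ _ mY).
  have hX := lebesgue_affine (v 0%R 0%R) t0 mX.
  have hY := IH (\row_i v 0%R (lift 0%R i)) Y mY.
  by rewrite exprS EFinM muleACA; exact: (congr2 _ hX hY).
apply: esym; apply: (etrans (mE _)); congr (_ * P _)%E.
rewrite -comp_preimage; apply/seteqP; split => -[x u] /=;
  rewrite (_ : consrV (phi _) = t *: consrV (x, u) + v) //;
  apply/rowP => i; rewrite !mxE /=; case: unliftP => [j ->|->];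
  by rewrite ?mxE /=.
Qed.

End affine_change_of_variables.

Section lebesgue_integral_affine.
Context (R : realType) (n : nat).
Local Notation vec := 'rV[R]_n.
Local Notation leb := (lebesgue_rV R n).

Lemma integral_leb_affine (t : R) (v : vec) (F : vec -> \bar R) :
  t != 0%R -> measurable_fun setT F -> (forall x, 0 <= F x)%E ->
  ((`|t| ^+ n)%:E * \int[leb]_x F (t *: x + v)%R = \int[leb]_x F x)%E.
Proof.
move=> t0 mF F0.
have mphi := measurable_affine t v.
have ht : (0 <= `|t| ^+ n)%R by exact: exprn_ge0.
pose m : {measure set vec -> \bar R} := mscale (NngNum ht) (pushm leb mphi).
rewrite [RHS](eq_measure_integral m); last first.
  by move=> A mA _; exact: esym (leb_affine v t0 mA).
by rewrite /m ge0_integral_mscale//= ge0_integral_pushforward.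
Qed.

Lemma integral_leb_shift (v : vec) (F : vec -> \bar R) :
  measurable_fun setT F -> (forall x, 0 <= F x)%E ->
  (\int[leb]_x F (x + v)%R = \int[leb]_x F x)%E.
Proof.
move=> mF F0; rewrite -[RHS](@integral_leb_affine 1 v)// normr1 expr1n mul1e.
by under [RHS]eq_integral do rewrite scale1r.
Qed.

Lemma integral_leb_scale (t : R) (F : vec -> \bar R) : (0 < t)%R ->
  measurable_fun setT F -> (forall x, 0 <= F x)%E ->
  (\int[leb]_x F (t *: x)%R = (t ^- n)%:E * \int[leb]_x F x)%E.
Proof.
move=> t0 mF F0; rewrite -[in RHS](@integral_leb_affine t 0)// ?gt_eqF//.
rewrite gtr0_norm// muleA -EFinM mulVf ?mul1e ?gt_eqF ?exprn_gt0//.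
by under [RHS]eq_integral do rewrite addr0.
Qed.

End lebesgue_integral_affine.

(** * Euclidean and sup norms, balls and cubes *)

Section norms.
Context (R : realType) (n : nat).
Local Notation vec := 'rV[R]_n.
Implicit Types x y : vec.

Lemma supnorm_leP x s : 0 <= s -> (forall i, `|x 0 i| <= s) <-> `|x| <= s.
Proof.
move=> s0; rewrite [`|x|]mx_normrE; split=> [H|].
  by apply/bigmax_leP; split => // -[i j] _ /=; rewrite ord1.
by move=> /bigmax_leP[_ H] i; exact: (H (0, i)).
Qed.

Lemma supnorm_ge x i : `|x 0 i| <= `|x|.
Proof. by move: i; apply/supnorm_leP. Qed.

Lemma measurable_supnorm :
  measurable_fun setT (fun x : vec => `|x| : measurableTypeR R).
Proof.
suff H (s : seq ('I_1 * 'I_n)) : measurable_fun setT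
    (fun x : vec => \big[Num.max/0]_(ij <- s) `|x ij.1 ij.2| : measurableTypeR R).
  rewrite (_ : (fun _ => _) = fun x : vec =>
    \big[Num.max/0]_(ij <- index_enum _) `|x ij.1 ij.2| : measurableTypeR R)//.
  by apply/funext => x; rewrite [LHS]mx_normrE.
elim: s => [|a s IH].
  by under eq_fun do rewrite big_nil; exact: measurable_cst.
under eq_fun do rewrite big_cons.
apply: measurable_maxr => //; apply: measurableT_comp => //.
exact: measurable_entry.
Qed.

Lemma measurable_fun_addv d (T : measurableType d) (f g : T -> vec) :
  measurable_fun setT f -> measurable_fun setT g ->
  measurable_fun setT (fun t => f t + g t).
Proof.
move=> mf mg; apply: measurable_fun_entries => i j.
under eq_fun do rewrite mxE.
by apply: measurable_funD; (apply: (@measurableT_comp _ _ _ _ _ _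
  (fun v : vec => v i j : measurableTypeR R)); first exact: measurable_entry).
Qed.

Lemma measurable_fun_scalev d (T : measurableType d)
    (c : T -> measurableTypeR R) (f : T -> vec) :
  measurable_fun setT c -> measurable_fun setT f ->
  measurable_fun setT (fun t => c t *: f t).
Proof.
move=> mc mf; apply: measurable_fun_entries => i j.
under eq_fun do rewrite mxE.
apply: measurable_funM => //; apply: (@measurableT_comp _ _ _ _ _ _
  (fun v : vec => v i j : measurableTypeR R)) => //; exact: measurable_entry.
Qed.

Lemma measurable_fun_subv d (T : measurableType d) (f g : T -> vec) :
  measurable_fun setT f -> measurable_fun setT g ->
  measurable_fun setT (fun t => f t - g t).
Proof.
move=> mf mg; apply: measurable_fun_addv => //.
rewrite (_ : (fun _ => _) = fun t => (-1) *: g t); last first.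
  by apply/funext => t; rewrite scaleN1r.
exact: measurable_fun_scalev.
Qed.

Lemma enorm_ge0 x : 0 <= enorm x. Proof. exact: sqrtr_ge0. Qed.

Lemma sqr_enorm x : enorm x ^+ 2 = \sum_i x 0 i ^+ 2.
Proof. by rewrite sqr_sqrtr// sumr_ge0// => i _; exact: sqr_ge0. Qed.

Lemma enormZ t x : enorm (t *: x) = `|t| * enorm x.
Proof.
rewrite /enorm -sqrtr_sqr -sqrtrM ?sqr_ge0// mulr_sumr.
by congr Num.sqrt; apply: eq_bigr => i _; rewrite mxE exprMn.
Qed.

Lemma enormN x : enorm (- x) = enorm x.
Proof. by rewrite -scaleN1r enormZ normrN1 mul1r. Qed.

Lemma enormB x y : enorm (x - y) = enorm (y - x).
Proof. by rewrite -enormN opprB. Qed.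

Lemma supnorm_enorm x : `|x| <= enorm x.
Proof.
apply/supnorm_leP; first exact: enorm_ge0.
move=> i; rewrite -ler_sqr ?nnegrE ?enorm_ge0// sqr_enorm real_normK ?num_real//.
by rewrite (bigD1 i)//= lerDl sumr_ge0// => j _; exact: sqr_ge0.
Qed.

Lemma enorm_supnorm x : enorm x <= n%:R * `|x|.
Proof.
rewrite -ler_sqr ?nnegrE ?enorm_ge0 ?mulr_ge0// sqr_enorm.
apply: (@le_trans _ _ (\sum_(i < n) `|x| ^+ 2)).
  apply: ler_sum => i _; rewrite -[leLHS]real_normK ?num_real//.
  by rewrite ler_sqr ?nnegrE// supnorm_ge.
rewrite sumr_const card_ord -[leLHS]mulr_natl exprMn ler_wpM2r ?sqr_ge0//.
by rewrite -natrX ler_nat expnS expn1; case: (n) => // m; exact: leq_pmulr.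
Qed.

Lemma enorm_eq0 x : (enorm x == 0) = (x == 0).
Proof.
apply/eqP/eqP => [x0|->].
  apply/eqP; rewrite -normr_eq0 eq_le normr_ge0 andbT.
  by rewrite (le_trans (supnorm_enorm x))// x0.
by apply/eqP; rewrite eq_le enorm_ge0 andbT (le_trans (enorm_supnorm _))// normr0 mulr0.
Qed.

Lemma enorm_gt0 x : (0 < enorm x) = (x != 0).
Proof. by rewrite lt_def enorm_ge0 andbT enorm_eq0. Qed.

Definition dotv x y : R := \sum_i x 0 i * y 0 i.

Lemma dotv_le x y : dotv x y <= enorm x * enorm y.
Proof.
have [->|x0] := eqVneq x 0.
  rewrite /dotv big1 ?mulr_ge0 ?enorm_ge0// => i _; by rewrite mxE mul0r.
have [->|y0] := eqVneq y 0.
  rewrite /dotv big1 ?mulr_ge0 ?enorm_ge0// => i _; by rewrite mxE mulr0.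
have hx : 0 < enorm x by rewrite enorm_gt0.
have hy : 0 < enorm y by rewrite enorm_gt0.
(* Arithmetic-geometric mean inequality in each coordinate, with the weights |y|/|x| and |x|/|y| for
   which both sums of squares contribute |x| |y| / 2. *)
apply: (@le_trans _ _ (\sum_i ((enorm y / enorm x) * x 0 i ^+ 2 +
  (enorm x / enorm y) * y 0 i ^+ 2) / 2)).
  apply: ler_sum => i _.
  set a := enorm x in hx *; set b := enorm y in hy *.
  have -> : (b / a * x 0 i ^+ 2 + a / b * y 0 i ^+ 2) / 2 =
    x 0 i * y 0 i + (b * x 0 i - a * y 0 i) ^+ 2 / (2 * a * b).
    by field; rewrite !gt_eqF.
  by rewrite lerDl divr_ge0 ?sqr_ge0// ?mulr_ge0// ltW.
rewrite -mulr_suml big_split/= -!mulr_sumr -!sqr_enorm.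
rewrite !expr2 !mulrA !divfK ?gt_eqF//.
by rewrite (mulrC (enorm y)) -mulrDr -mulr2n; lra.
Qed.

Lemma ler_enormD x y : enorm (x + y) <= enorm x + enorm y.
Proof.
rewrite -ler_sqr ?nnegrE ?addr_ge0 ?enorm_ge0// sqr_enorm sqrrD !sqr_enorm.
rewrite (_ : \sum_i _ = \sum_i x 0 i ^+ 2 + dotv x y *+ 2 + \sum_i y 0 i ^+ 2).
  by rewrite lerD2r lerD2l lerMn2r/= dotv_le.
rewrite /dotv -sumrMnl -!big_split/=; apply: eq_bigr => i _.
by rewrite mxE sqrrD.
Qed.

Lemma ler_enormB x y : enorm x - enorm y <= enorm (x - y).
Proof. by rewrite lerBlDr -[X in enorm X <= _](subrK y) ler_enormD. Qed.

Lemma ler_dist_enorm x y : `|enorm x - enorm y| <= enorm (x - y).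
Proof. by rewrite ler_norml lerNl opprB ler_enormB andbT enormB ler_enormB. Qed.

End norms.

Section cubes.
Context (R : realType) (n : nat).
Local Notation vec := 'rV[R]_n.
Local Notation leb := (lebesgue_rV R n).
Implicit Types (x w : vec) (s d : R).

Lemma measurable_enorm_set (D : set R) : measurable D ->
  measurable [set x : vec | D (enorm x)].
Proof.
by move=> mD; rewrite -[X in measurable X]setTI; exact: (@measurable_enorm R n).
Qed.

Definition cube w s : set vec := [set z | `|z - w| <= s].

Lemma measurable_cube w s : measurable (cube w s).
Proof.
have m1 : measurable_fun setT (fun z : vec => `|z - w| : measurableTypeR R).
  apply: (@measurableT_comp _ _ _ _ _ _ (fun z : vec => `|z| : measurableTypeR R)).
    exact: measurable_supnorm.
  exact: measurable_fun_subv.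
have := m1 measurableT `]-oo, s]%classic (measurable_itv _).
by rewrite setTI; congr measurable; apply/seteqP; split => z /=; rewrite in_itv.
Qed.

Lemma leb_cube w s : 0 < s -> leb (cube w s) = ((2 * s) ^+ n)%:E.
Proof.
move=> s0.
(* The cube of side 2 about 0 is computed by induction along the construction of the measure as an
   iterated product; every other cube is an affine image of it. *)
have H m : lebesgue_rV R m [set z : 'rV[R]_m | forall i, `|z 0 i| <= 1] = (2 ^+ m)%:E.
  elim: m => [|m IH] /=; first by rewrite /dirac /= indicE mem_set// => -[].
  rewrite /lebesgue_step /pushforward.
  rewrite (_ : _ @^-1` _ = `[(-1)%R, 1%R] `*` [set z : 'rV[R]_m | forall i, `|z 0 i| <= 1]).
    rewrite product_measure1E//; last first.
      have -> : [set z : 'rV[R]_m | forall i, `|z 0 i| <= 1] =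
         (fun z => `|z| : measurableTypeR R) @^-1` `]-oo, 1].
        by apply/seteqP; split => z /=; rewrite in_itv/= => /supnorm_leP; apply.
      by rewrite -[X in measurable X]setTI; exact: measurable_supnorm.
    rewrite IH [X in (X * _)%E]lebesgue_measure_itv/= lte_fin ifT; last by lra.
    by rewrite -EFinD -EFinM exprS opprK.
  apply/seteqP; split => -[x u] /=.
    move=> H; split; first by have := H 0; rewrite mxE unlift_none/= in_itv/= ler_norml.
    by move=> i; have := H (lift 0 i); rewrite mxE liftK.
  rewrite in_itv/= -ler_norml => -[hx hu] i; rewrite mxE.
  by case: unliftP.
rewrite -(leb_affine w (lt0r_neq0 s0)); last exact: measurable_cube.
rewrite (_ : [set x | _] = [set z : vec | forall i, `|z 0 i| <= 1]).
  by rewrite H -EFinM gtr0_norm// -exprMn mulrC.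
apply/seteqP; split => z /=.
  rewrite /cube/= addrK normrZ gtr0_norm// => h; apply/supnorm_leP => //.
  by move: h; rewrite -ler_pdivlMl// mulVf ?gt_eqF.
move/supnorm_leP => /(_ ler01) h; rewrite /cube/= addrK normrZ gtr0_norm//.
by rewrite -[leRHS]mulr1 ler_wpM2l// ltW.
Qed.

Lemma ecball_cube x d : ecball x d `<=` cube x d.
Proof. by move=> z /=; apply: le_trans; exact: supnorm_enorm. Qed.

Lemma cube_ecball x d : cube x d `<=` ecball x (n%:R * d).
Proof.
move=> z h; apply: (le_trans (enorm_supnorm _)).
exact: ler_wpM2l.
Qed.

Lemma measurable_ecball x d : measurable (ecball x d).
Proof.
have m1 : measurable_fun setT (fun z : vec => enorm (z - x) : measurableTypeR R).
  apply: (@measurableT_comp _ _ _ _ _ _ (@enorm R n : vec -> measurableTypeR R)).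
    exact: measurable_enorm.
  exact: measurable_fun_subv.
have := m1 measurableT `]-oo, d]%classic (measurable_itv _).
by rewrite setTI; congr measurable; apply/seteqP; split => z /=; rewrite in_itv.
Qed.

Definition ballvol : R := fine (leb (ecball 0 1)).

Lemma leb_ecball01_fin : leb (ecball 0 1) \is a fin_num.
Proof.
rewrite ge0_fin_numE//; apply: le_lt_trans (_ : leb (cube 0 1) < +oo)%E.
  by apply: le_measure; rewrite ?inE; [exact: measurable_ecball|exact: measurable_cube|exact: ecball_cube].
by rewrite leb_cube// ltry.
Qed.

Lemma ballvol_gt0 : 0 < ballvol.
Proof.
rewrite -lte_fin fineK ?leb_ecball01_fin//.
have c0 : (0 : R) < (n.+1%:R)^-1 by rewrite invr_gt0.
apply: (@lt_le_trans _ _ (leb (cube 0 (n.+1%:R)^-1))).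
  by rewrite leb_cube// lte_fin exprn_gt0// mulr_gt0.
apply: le_measure; rewrite ?inE; [exact: measurable_cube|exact: measurable_ecball|].
apply: (subset_trans (@cube_ecball _ _)) => z /= h.
by apply: (le_trans h); rewrite ler_pdivrMr// mul1r ler_nat.
Qed.

Lemma leb_ecball x d : 0 < d -> leb (ecball x d) = (d ^+ n * ballvol)%:E.
Proof.
move=> d0; rewrite -(leb_affine x (lt0r_neq0 d0)); last exact: measurable_ecball.
rewrite gtr0_norm// EFinM fineK ?leb_ecball01_fin//; congr (_ * leb _)%E.
apply/seteqP; split => z; rewrite /ecball/= addrK enormZ gtr0_norm// subr0.
  by rewrite -ler_pdivlMl// mulVf ?gt_eqF.
by move=> h; rewrite -[leRHS]mulr1 ler_wpM2l// ltW.
Qed.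

Lemma integral_sphere_measure (F : vec -> \bar R) :
  measurable_fun setT F -> (forall x, 0 <= F x)%E ->
  (\int[@sphere_measure R n]_z F z =
   (ballvol^-1)%:E * \int[leb]_(x in ecball 0%R 1%R) F (edir x))%E.
Proof.
move=> mF F0.
have hc : 0 <= ballvol^-1 by rewrite invr_ge0 ltW// ballvol_gt0.
have mB := @measurable_ecball0 R n 1.
have mE := @measurable_edir R n.
pose m : {measure set vec -> \bar R} :=
  mscale (NngNum hc) (pushm (mrestr leb mB) mE).
rewrite (eq_measure_integral m); last by [].
rewrite /m ge0_integral_mscale//= ge0_integral_pushforward// preimage_setT.
by rewrite ge0_integral_mrestr//; [apply: measurableT_comp|move=> x; exact: F0].
Qed.

End cubes.

Lemma cvg_near_lt (R : realType) (u : (\bar R)^nat) (l e : \bar R) :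
  u @ \oo --> l -> (l < e)%E -> \forall k \near \oo, (u k < e)%E.
Proof.
move=> ul le; apply: (ul [set y | (y < e)%E]); apply: open_nbhs_nbhs.
by split => //; exact: open_ereal_lt_ereal.
Qed.

(** * Regularity of finite measures and their comparison on cubes *)

Section regularity.
Context (R : realType) (n : nat).
Local Notation vec := 'rV[R]_n.

(** Open sets in the form in which cubes test them. Measurability is built in because the
    sigma-algebra is the one generated by the coordinates. *)
Definition cube_open (U : set vec) : Prop :=
  measurable U /\ forall w, U w -> exists2 s, 0 < s & cube w s `<=` U.

Lemma cube_open_bigcup (U : (set vec)^nat) :
  (forall i, cube_open (U i)) -> cube_open (\bigcup_i U i).
Proof.
move=> oU; split; first by apply: bigcupT_measurable => i; case: (oU i).
move=> w [i _ Uw]; have [_ /(_ w Uw)[s s0 sU]] := oU i.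
by exists s => // z /sU ?; exists i.
Qed.

Lemma cube_openI (U V : set vec) :
  cube_open U -> cube_open V -> cube_open (U `&` V).
Proof.
move=> [mU oU] [mV oV]; split; first exact: measurableI.
move=> w [Uw Vw]; have [s s0 sU] := oU w Uw; have [t t0 tV] := oV w Vw.
exists (Num.min s t); first by rewrite lt_min s0.
by move=> z; rewrite /cube/= le_min => /andP[? ?]; split; [exact: sU|exact: tV].
Qed.

Lemma cube_openT : cube_open setT.
Proof. by split => // w _; exists 1. Qed.

Context (m : {finite_measure set vec -> \bar R}).

(** Approximation from inside by closed sets and from outside by open sets is asked for at once,
    which makes the class stable under complements. *)
Definition regular_set (E : set vec) : Prop := measurable E /\
  forall e : R, 0 < e -> exists U F, [/\ cube_open U, cube_open (~` F),
    F `<=` E, E `<=` U & (m (U `\` F) <= e%:E)%E].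

Lemma regular_setC E : regular_set E -> regular_set (~` E).
Proof.
move=> [mE rE]; split; first exact: measurableC.
move=> e /rE[U [F [oU oF FE EU UF]]]; exists (~` F), (~` U).
by split; rewrite ?setCK ?setDE ?setCK ?(setIC (~` F)) -?setDE//; exact: subsetC.
Qed.

(** All the outer sets are united, but only finitely many of the inner ones, so that their union
    stays closed; what is lost in this way tends to 0 by continuity from above of the finite
    measure. *)
Lemma regular_set_bigcup (E : (set vec)^nat) :
  (forall i, regular_set (E i)) -> regular_set (\bigcup_i E i).
Proof.
move=> rE; split; first by apply: bigcupT_measurable => i; case: (rE i).
move=> e e0.
(* Half of [e] is spread geometrically over the sets [E i]; the other half pays for the truncation
   at [N]. *)
have ei i : 0 < e / 2 / (2 ^ i.+1)%:R by rewrite !divr_gt0// ltr0n expn_gt0.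
have /choice[UF hUF] : forall i, exists UF : set vec * set vec,
    [/\ cube_open UF.1, cube_open (~` UF.2),
    UF.2 `<=` E i, E i `<=` UF.1 & (m (UF.1 `\` UF.2) <= (e / 2 / (2 ^ i.+1)%:R)%:E)%E].
  by move=> i; have [_ /(_ _ (ei i))[U [F ?]]] := rE i; exists (U, F).
pose U := \bigcup_i (UF i).1.
pose F N := \bigcup_(i in `I_N) (UF i).2.
have oF N : cube_open (~` F N).
  elim: N => [|N IH]; first by rewrite /F II0 bigcup_set0 setC0; exact: cube_openT.
  rewrite (_ : F N.+1 = F N `|` (UF N).2); last by rewrite /F IIS bigcup_setU bigcup_set1.
  by rewrite setCU; apply: cube_openI => //; case: (hUF N).
have oU : cube_open U by apply: cube_open_bigcup => i; case: (hUF i).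
have mFi i : measurable (UF i).2.
  by rewrite -[X in measurable X]setCK; apply: measurableC; case: (hUF i) => _ [].
have mF N : measurable (F N) by apply: bigcup_measurable => k _.
have mUF N : measurable (U `\` F N) by apply: measurableD => //; case: oU.
have ni : nonincreasing_seq (fun N => U `\` F N).
  move=> a b ab; apply/subsetPset => z [Uz Fz]; split => // Faz; apply: Fz.
  by case: Faz => i ia Fi; exists i => //=; exact: leq_trans ab.
have mfin N : (m (U `\` F N) < +oo)%E.
  by rewrite -ge0_fin_numE//; exact: fin_num_measure.
have mI : measurable (\bigcap_N (U `\` F N)) by exact: bigcapT_measurable.
have cv := @nonincreasing_cvg_mu _ _ _ m (fun N => U `\` F N) (mfin 0%N) mUF mI ni.
have le2 : (m (\bigcap_N (U `\` F N)) <= (e / 2)%:E)%E.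
  apply: (@le_trans _ _ (\sum_(0 <= i <oo) m ((UF i).1 `\` (UF i).2))%E).
    apply: measure_sigma_subadditive => //.
      by move=> i; apply: measurableD => //; case: (hUF i) => -[].
    move=> z zI; have [[i _ Uz] _] := zI 0%N I; exists i => //; split => // Fz.
    by have [_] := zI i.+1 I; apply; exists i => /=.
  apply: (@le_trans _ _ (\sum_(0 <= i <oo) (0 + (e / 2 / (2 ^ i.+1)%:R)%:E))%E).
    by apply: lee_nneseries => // i _; rewrite add0e; case: (hUF i).
  apply: (@le_trans _ _ (\sum_(0 <= i <oo) 0%E + (e / 2)%:E)%E).
    by apply: epsilon_trick => //; rewrite divr_ge0// ltW.
  by rewrite eseries0 ?add0e.
have : \forall N \near \oo, (m (U `\` F N) < e%:E)%E.
  have lt2 : (m (\bigcap_N (U `\` F N)) < e%:E)%E.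
    by apply: (le_lt_trans le2); rewrite lte_fin; lra.
  exact: (cvg_near_lt cv lt2).
move=> [N _ /(_ N (leqnn N)) hN].
exists U, (F N); split => //; last exact: ltW.
  move=> z [i _ Fz]; exists i => //.
  by case: (hUF i) => _ _ + _ _; exact.
move=> z [i _ Ez]; exists i => //; by case: (hUF i) => _ _ _ + _; exact.
Qed.

Lemma regular_set_ray (j : 'I_n) (t : R) : regular_set [set x | t < x 0 j].
Proof.
have mray (D : set R) : measurable D -> measurable [set x : vec | D (x 0 j)].
  by move=> mD; rewrite -[X in measurable X]setTI; exact: (@measurable_entry R 1 n 0 j).
have mgt c : measurable [set x : vec | c < x 0 j].
  have := mray _ (measurable_itv `]c, +oo[); congr measurable.
  by apply/seteqP; split => x /=; rewrite in_itv/= andbT.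
have mlt c : measurable [set x : vec | x 0 j < c].
  exact: (mray _ (measurable_itv `]-oo, c[)).
have cj (w z : vec) s : `|z - w| <= s -> `|z 0 j - w 0 j| <= s.
  by apply: le_trans; rewrite -[X in X <= _](_ : `|(z - w) 0 j| = _) ?supnorm_ge// !mxE.
have ogt c : cube_open [set x | c < x 0 j].
  split; first exact: mgt.
  move=> w /= cw; exists ((w 0 j - c) / 2); first by lra.
  by move=> z /cj/=; rewrite ler_norml => /andP[]; lra.
have olt c : cube_open [set x | x 0 j < c].
  split; first exact: mlt.
  move=> w /= cw; exists ((c - w 0 j) / 2); first by lra.
  by move=> z /cj/=; rewrite ler_norml => /andP[]; lra.
split; first exact: mgt.
move=> e e0.
pose F (k : nat) := [set x : vec | t + k.+1%:R^-1 <= x 0 j].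
have FC k : ~` F k = [set x | x 0 j < t + k.+1%:R^-1].
  by apply/seteqP; split => x /=; rewrite ltNge => /negP.
pose D k := [set x : vec | t < x 0 j] `\` F k.
have mD k : measurable (D k).
  by rewrite /D setDE FC; apply: measurableI; [exact: mgt|exact: mlt].
have ni : nonincreasing_seq D.
  move=> a b ab; apply/subsetPset => z [tz Fz]; split => // Faz; apply: Fz.
  rewrite /F/=; apply: le_trans Faz; rewrite lerD2l lef_pV2 ?posrE// ler_nat.
  exact: ab.
have DI : \bigcap_k D k = set0.
  apply/seteqP; split => // z zI; have [/= tz _] := zI 0%N I.
  have zt : 0 < z 0 j - t by lra.
  have [k hk] : exists k, k.+1%:R^-1 < z 0 j - t.
    have [k _ hk] := near_infty_natSinv_lt (PosNum zt); exists k.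
    exact: (hk k (leqnn k)).
  by have [_] := zI k I; apply; rewrite /F/= -lerBrDl ltW.
have mfin N : (m (D N) < +oo)%E.
  by rewrite -ge0_fin_numE//; exact: fin_num_measure.
have mI : measurable (\bigcap_N (D N)) by exact: bigcapT_measurable.
have cv := @nonincreasing_cvg_mu _ _ _ m D (mfin 0%N) mD mI ni.
have : \forall N \near \oo, (m (D N) < e%:E)%E.
  by apply: (cvg_near_lt cv); rewrite DI measure0 lte_fin.
move=> [N _ /(_ N (leqnn N)) hN].
exists [set x | t < x 0 j], (F N); split => //; last exact: ltW.
- by rewrite FC.
- move=> z; rewrite /F/=; apply: lt_le_trans; by rewrite ltrDl invr_gt0.
Qed.

Lemma regular_measurable E : measurable E -> regular_set E.
Proof.
have saR : sigma_algebra setT regular_set.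
  split.
  - split=> // e e0; exists set0, set0; rewrite setC0 setDv measure0 lee_fin ltW//.
    by split => //; exact: cube_openT.
  - by move=> A rA; rewrite setTD; exact: regular_setC.
  - exact: regular_set_bigcup.
move=> mE; apply: (smallest_sub saR _ mE) => _ [[i j] _ [Y mY <-]] /=.
rewrite setTI ord1 {i}.
have saY : sigma_algebra setT [set Y : set R | regular_set [set x : vec | Y (x 0 j)]].
  case: saR => r0 rC rU; split => //=.
  - by move=> A /rC; congr regular_set; apply/seteqP; split.
  - by move=> A /rU.
move: mY; rewrite RGenOInfty.measurableE => mY.
apply: (smallest_sub saY _ mY) => _ [t ->] /=.
have := regular_set_ray j t; congr regular_set.
by apply/seteqP; split => x /=; rewrite in_itv/= andbT.
Qed.

Lemma outer_regular E (e : R) : measurable E -> 0 < e ->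
  exists U, [/\ cube_open U, E `<=` U & (m U <= m E + e%:E)%E].
Proof.
move=> mE e0; have [_ /(_ _ e0)[U [F [oU oF FE EU UF]]]] := regular_measurable mE.
exists U; split => //.
have mF : measurable F.
  by rewrite -[X in measurable X]setCK; apply: measurableC; case: oF.
rewrite -(setDUK (subset_trans FE EU)) measureU//; last by rewrite setDIK.
  by apply: leeD => //; apply: le_measure; rewrite ?inE.
by apply: measurableD => //; case: oU.
Qed.

End regularity.

Section measure_comparison.
Context (R : realType) (n : nat).
Local Notation vec := 'rV[R]_n.
Local Notation leb := (lebesgue_rV R n).

(* Averaging over the cubes of side 2s replaces the covering lemma: with
   E_s the points of E whose cube of size s lies in U up to an m-null set,
   (2s)^n |E_s| is at most K times the (dw x dm)-measure of the pairs
   (w, z) with w in E_s, z in U and |z - w| <= s. *)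
Lemma leb_le_cubes (m : {finite_measure set vec -> \bar R}) (K s0 : R)
    (E : set vec) : measurable E -> 0 <= K -> 0 < s0 ->
  (forall w s, E w -> 0 < s -> s <= s0 ->
     (leb (cube w s) <= K%:E * m (cube w s))%E) ->
  (leb E <= K%:E * m E)%E.
Proof.
move=> mE K0 s00 hK.
(* By outer regularity [m E] may be replaced by [m U]; the excess e / (K + 1) is chosen so that K
   times it is at most [e]. *)
suff H U : cube_open U -> E `<=` U -> (leb E <= K%:E * m U)%E.
  apply/lee_addgt0Pr => e e0.
  have eK : 0 < e / (K + 1) by rewrite divr_gt0// ltr_wpDl.
  have [U [oU EU mU]] := outer_regular m mE eK.
  apply: (le_trans (H U oU EU)).
  apply: (@le_trans _ _ (K%:E * (m E + (e / (K + 1))%:E))%E).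
    by apply: lee_wpmul2l => //; rewrite lee_fin.
  rewrite ge0_muleDr//; last by rewrite lee_fin ltW.
  rewrite leeD2lE; last first.
    by rewrite fin_numM// fin_num_measure.
  rewrite -EFinM lee_fin mulrA ler_pdivrMr ?ltr_wpDl//; nra.
move=> [mU oU] EU.
pose S s := [set wz : vec * vec | `|wz.2 - wz.1| <= s].
have mS s : measurable (S s).
  have mf : measurable_fun setT (fun wz : vec * vec => `|wz.2 - wz.1| : measurableTypeR R).
    apply: (@measurableT_comp _ _ _ _ _ _ (fun z : vec => `|z| : measurableTypeR R)).
      exact: measurable_supnorm.
    by apply: measurable_fun_subv; [exact: measurable_snd|exact: measurable_fst].
  have := mf measurableT `]-oo, s]%classic (measurable_itv _).
  by rewrite setTI; congr measurable; apply/seteqP; split => z /=; rewrite in_itv.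
pose Es s := E `&` [set w | m (cube w s `\` U) = 0%E].
have mEs s : measurable (Es s).
  apply: measurableI => //.
  have mX : measurable (S s `\` (setT `*` U)).
    by apply: measurableD => //; exact: measurableX.
  have mphi := @measurable_fun_xsection _ _ _ _ _ m _ mX.
  have := mphi measurableT [set 0%E] (emeasurable_set1 _).
  rewrite setTI; congr measurable; apply/seteqP.
  have xE w : xsection (S s `\` setT `*` U) w = cube w s `\` U.
    apply/seteqP; split => z; rewrite /xsection/= inE /S/=.
      by move=> -[zs nU]; split => // Uz; apply: nU.
    by move=> -[zs nU]; split => // -[].
  by split => w /=; rewrite xE.
have key s : 0 < s -> s <= s0 -> (leb (Es s) <= K%:E * m U)%E.
  move=> sp ss0.
  pose T := S s `&` (Es s `*` U).
  have mT : measurable T by apply: measurableI => //; exact: measurableX.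
  have cs0 : 0 < (2 * s) ^+ n by rewrite exprn_gt0// mulr_gt0.
  have h1 : (((2 * s) ^+ n)%:E * leb (Es s) <=
      \int[leb]_w (K%:E * m (xsection T w)))%E.
    rewrite -integral_cst//; apply: (@le_trans _ _ (\int[leb]_(w in Es s) (K%:E * m (xsection T w)))%E).
      apply: le_lower_integral => w; first by rewrite lee_fin ltW.
      move=> -[Ew cU]; rewrite -(leb_cube w sp).
      apply: (le_trans (hK w s Ew sp ss0)).
      apply: lee_wpmul2l => //.
      have mc := @measurable_cube R n w s.
      rewrite (measureDI m mc mU).
      rewrite [X in (X + _)%E](_ : _ = 0%E) ?add0e; last exact: cU.
      apply: le_measure; rewrite ?inE.
      - exact: measurableI.
      - exact: measurable_xsection.
      - move=> z [zs Uz]; rewrite /xsection/= inE; split => //; split => //; by split.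
    rewrite integral_mkcond; apply: le_lower_integral => w _.
      by apply: erestrict_ge0 => ? _; exact: mule_ge0.
    by rewrite /patch; case: ifP => // _; exact: mule_ge0.
  have h2 : (\int[leb]_w (m (xsection T w)) = \int[m]_z (leb (ysection T z)))%E.
    have := @fubini_tonelli _ _ vec vec R leb m (EFin \o \1_T) _ _.
    rewrite (_ : (fun x => \int[m]_y _)%E = (fun w => m (xsection T w))); last first.
      apply/funext => w; rewrite -[xsection _ _]setIT -integral_indic//; last exact: measurable_xsection.
      by apply: eq_integral => z _ /=; rewrite !indicE mem_xsection.
    rewrite (_ : (fun y => \int[leb]_x _)%E = (fun z => leb (ysection T z))); last first.
      apply/funext => w; rewrite -[ysection _ _]setIT -integral_indic//; last exact: measurable_ysection.
      by apply: eq_integral => z _ /=; rewrite !indicE mem_ysection.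
    apply => //; first by apply/measurable_EFinP; exact: measurable_indic.
    by move=> x; rewrite /= lee_fin.
  have h3 : (\int[m]_z (leb (ysection T z)) <= ((2 * s) ^+ n)%:E * m U)%E.
    rewrite -integral_cst// [leRHS]integral_mkcond; apply: le_lower_integral => z _//.
    rewrite /patch; case: ifPn => [/set_mem Uz|/negP nU].
      rewrite -(leb_cube z sp); apply: le_measure; rewrite ?inE.
      - exact: measurable_ysection.
      - exact: measurable_cube.
      - by move=> w; rewrite /ysection/= inE => -[]; rewrite /S/= distrC.
    rewrite (_ : ysection T z = set0) ?measure0//.
    apply/seteqP; split => // w; rewrite /ysection/= inE => -[_ [_ /= Uz]].
    by apply: nU; rewrite inE.
  rewrite ge0_integralZl// ?h2 in h1; last first.
    exact: measurable_fun_xsection.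
  have : (((2 * s) ^+ n)%:E * leb (Es s) <= ((2 * s) ^+ n)%:E * (K%:E * m U))%E.
    by apply: (le_trans h1); rewrite muleCA; apply: lee_wpmul2l.
  by rewrite lee_pmul2l.
have scale (k : nat) : 0 < s0 / k.+1%:R /\ s0 / k.+1%:R <= s0.
  by rewrite divr_gt0// ler_pdivrMr// ler_peMr// ?ler1n// ltW.
(* The sizes s0 / (k + 1) decrease to 0, and around each point of [E] the cubes eventually lie in
   [U], so the sets [D k] increase to [E]. *)
pose D k := Es (s0 / k.+1%:R).
have ndD : nondecreasing_seq D.
  move=> a b ab; apply/subsetPset => w [Ew cw]; split => //.
  apply/eqP; rewrite /= eq_le measure_ge0 andbT -cw.
  apply: le_measure; rewrite ?inE; try by apply: measurableD => //; exact: measurable_cube.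
  move=> z [zw nU]; split => //; apply: (le_trans zw).
  by rewrite ler_pM2l// lef_pV2 ?posrE// ler_nat.
have UD : \bigcup_k D k = E.
  apply/seteqP; split => [w [k _ []]//|w Ew].
  have [s sp sU] := oU w (EU w Ew).
  have ss0 : 0 < s / s0 by rewrite divr_gt0.
  have [k _ hk] := near_infty_natSinv_lt (PosNum ss0).
  exists k => //; split => //=.
  rewrite (_ : _ `\` _ = set0) ?measure0//; apply/seteqP; split => // z [zw]; apply.
  apply: sU; apply: (le_trans zw).
  by have := hk k (leqnn k); rewrite /= ltr_pdivlMr// mulrC => /ltW.
have mUD : measurable (\bigcup_k D k) by rewrite UD.
have cv := @nondecreasing_cvg_mu _ _ _ leb D (fun k => mEs _) mUD ndD.
rewrite -UD -(cvg_lim _ cv)//; apply: lime_le; first by apply/cvg_ex; eexists; exact: cv.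
by apply: nearW => k; apply: key; case: (scale k).
Qed.

End measure_comparison.

(** * Reflections and rotations near the identity *)

Lemma det_rank1_update (R : realType) n (u : 'cV[R]_n) (v : 'rV[R]_n) :
  \det (1%:M + u *m v) = 1 + (v *m u) 0 0.
Proof.
(* The same block matrix is factored by eliminating either of its off-diagonal blocks; the two
   factorizations have the two sides of the identity as determinants. *)
pose M := block_mx (1%:M : 'M[R]_n) u (- v) (1%:M : 'M[R]_1).
have h1 : M = block_mx (1%:M + u *m v) u 0 1%:M *m block_mx 1%:M 0 (- v) 1%:M.
  by rewrite mulmx_block !mulmx1 !mul0mx !mulmx0 !mul1mx !add0r mulmxN addrK.
have h2 : M = block_mx 1%:M 0 (- v) 1%:M *m block_mx 1%:M u 0 (1%:M + v *m u).
  by rewrite mulmx_block !mulmx1 !mul0mx !mulmx0 !mul1mx !addr0 mulNmx addrCA addNr addr0.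
have : \det M = \det M by [].
rewrite {1}h1 h2 !det_mulmx !det_lblock !det_ublock !det1 !mulr1 !mul1r => ->.
by rewrite det_mx11 !mxE eqxx.
Qed.

Section reflections.
Context (R : realType) (n : nat).
Local Notation vec := 'rV[R]_n.
Implicit Types (a u w x y : vec).

Lemma dotvC x y : dotv x y = dotv y x.
Proof. by apply: eq_bigr => i _; rewrite mulrC. Qed.

Lemma dotvDl x y z : dotv (x + y) z = dotv x z + dotv y z.
Proof. by rewrite /dotv -big_split; apply: eq_bigr => i _; rewrite mxE mulrDl. Qed.

Lemma dotvZl c x y : dotv (c *: x) y = c * dotv x y.
Proof. by rewrite /dotv mulr_sumr; apply: eq_bigr => i _; rewrite mxE mulrA. Qed.

Lemma dotvDr x y z : dotv x (y + z) = dotv x y + dotv x z.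
Proof. by rewrite dotvC dotvDl !(dotvC x). Qed.

Lemma dotvZr c x y : dotv x (c *: y) = c * dotv x y.
Proof. by rewrite dotvC dotvZl dotvC. Qed.

Lemma dotvNr x y : dotv x (- y) = - dotv x y.
Proof. by rewrite -scaleN1r dotvZr mulN1r. Qed.

Lemma dotvNl x y : dotv (- x) y = - dotv x y.
Proof. by rewrite dotvC dotvNr dotvC. Qed.

Lemma dotvv x : dotv x x = enorm x ^+ 2.
Proof. by rewrite sqr_enorm; apply: eq_bigr => i _; rewrite expr2. Qed.

Lemma normr_dotv x y : `|dotv x y| <= enorm x * enorm y.
Proof.
rewrite ler_norml dotv_le andbT lerNl -dotvNl -[enorm x]enormN.
exact: dotv_le.
Qed.

Lemma mulmx_tr_dotv x y : x *m y^T = (dotv x y)%:M.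
Proof.
apply/matrixP => i j; rewrite !mxE !ord1 mulr1n.
by apply: eq_bigr => k _; rewrite mxE.
Qed.

(** Householder matrix of the reflection in the hyperplane orthogonal to [a]. *)
Definition refl a : 'M[R]_n := 1%:M - (2 / enorm a ^+ 2) *: (a^T *m a).

Lemma mul_refl x a : x *m refl a = x - (2 * dotv x a / enorm a ^+ 2) *: a.
Proof.
rewrite /refl mulmxBr mulmx1 -scalemxAr mulmxA mulmx_tr_dotv mul_scalar_mx.
by rewrite scalerA -!mulrA [X in _ - (2 * X) *: _]mulrC.
Qed.

Lemma tr_refl a : (refl a)^T = refl a.
Proof.
by rewrite /refl linearB /= trmx1 linearZ /= trmx_mul trmxK.
Qed.

Lemma enorm_refl x a : a != 0 -> enorm (x *m refl a) = enorm x.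
Proof.
move=> a0; have na : enorm a != 0 by rewrite enorm_eq0.
apply/eqP; rewrite -(@eqrXn2 _ 2)// ?enorm_ge0//; apply/eqP.
rewrite -!dotvv mul_refl dotvDl !dotvDr dotvNl !dotvNr dotvNl dotvZl !dotvZr (dotvC a x) dotvZl.
by rewrite (dotvv a); field.
Qed.

Lemma refl_mulK a : a != 0 -> refl a *m refl a = 1%:M.
Proof.
move=> a0; have na : enorm a != 0 by rewrite enorm_eq0.
apply/row_matrixP => i; rewrite !rowE mulmxA !mul_refl dotvDl dotvNl dotvZl dotvv mulmx1.
rewrite -addrA -opprD -scalerDl [X in X *: a](_ : _ = 0) ?scale0r ?subr0//.
by field.
Qed.

Lemma det_refl a : a != 0 -> \det (refl a) = -1.
Proof.
move=> a0; have na : enorm a != 0 by rewrite enorm_eq0.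
have -> : refl a = 1%:M + (- (2 / enorm a ^+ 2) *: a^T) *m a.
  by rewrite /refl -scalemxAl scaleNr.
rewrite det_rank1_update -scalemxAr mulmx_tr_dotv dotvv !mxE eqxx mulr1n.
by field.
Qed.

Lemma rotation_refl a a' : a != 0 -> a' != 0 -> rotation (refl a *m refl a').
Proof.
move=> a0 a'0; split; last by rewrite det_mulmx !det_refl// mulrNN mulr1.
by rewrite trmx_mul !tr_refl mulmxA -(mulmxA (refl a)) refl_mulK// mulmx1 refl_mulK.
Qed.

Lemma enorm_normalize_sub x y : y != 0 ->
  enorm ((enorm x)^-1 *: x - (enorm y)^-1 *: y) <= 2 * enorm (x - y) / enorm y.
Proof.
move=> y0; have hy : 0 < enorm y by rewrite enorm_gt0.
have [->|x0] := eqVneq x 0.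
  rewrite scaler0 !sub0r !enormN enormZ normfV ger0_norm ?enorm_ge0//.
  by rewrite mulVf ?gt_eqF// mulfK ?gt_eqF// ler1n.
have hx : 0 < enorm x by rewrite enorm_gt0.
have -> : (enorm x)^-1 *: x - (enorm y)^-1 *: y =
    ((enorm x)^-1 - (enorm y)^-1) *: x + (enorm y)^-1 *: (x - y).
  by rewrite scalerBl scalerBr addrA subrK.
apply: (le_trans (ler_enormD _ _)); rewrite !enormZ.
rewrite (_ : (enorm x)^-1 - (enorm y)^-1 = (enorm y - enorm x) / (enorm x * enorm y)); last first.
  by field; rewrite !gt_eqF.
rewrite !normrM !normfV normrM (gtr0_norm hx) (gtr0_norm hy).
rewrite (_ : `|enorm y - enorm x| / (enorm x * enorm y) * enorm x = `|enorm y - enorm x| / enorm y); last first.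
  by field; rewrite !gt_eqF.
have h : `|enorm y - enorm x| <= enorm (x - y).
  by rewrite ler_norml lerNl opprB ler_enormB/= enormB ler_enormB.
rewrite [X in _ + X]mulrC -mulrDl; apply: ler_wpM2r; last by lra.
by rewrite invr_ge0 ltW.
Qed.

End reflections.

Section reflection_parametrization.
Context (R : realType) (n : nat).
Local Notation vec := 'rV[R]_n.
Implicit Types (a u w x y : vec).

Definition basisv (i : 'I_n) : vec := delta_mx 0 i.

Lemma dotv_basis x i : dotv x (basisv i) = x 0 i.
Proof.
rewrite /dotv (bigD1 i)//= big1 ?addr0; first by rewrite mxE !eqxx mulr1.
by move=> j ji; rewrite mxE eqxx (negPf ji) mulr0.
Qed.

Lemma enorm_basis i : enorm (basisv i) = 1.
Proof.
apply/eqP; rewrite -(@eqrXn2 _ 2)// ?enorm_ge0// -dotvv dotv_basis mxE !eqxx.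
by rewrite expr1n.
Qed.

Lemma basis_neq0 i : basisv i != 0.
Proof. by rewrite -enorm_gt0 enorm_basis. Qed.

(** A product of two reflections, hence a rotation; it is the identity for a = e_i. *)
Definition near_rotation i a : 'M[R]_n := refl (basisv i) *m refl a.

(** With [a] normalized to [ha], the displacement of a unit vector is twice the difference of its
    projections on the two axes, at most 4 |ha - e|, and |ha - e| <= 4 c because |a| >= 1/2. *)
Lemma near_rotation_size i a c : enorm (a - basisv i) <= c -> c <= 1 / 2 ->
  (rotation_size (near_rotation i a) <= (16 * c)%:E)%E.
Proof.
move=> ac c2; apply: ge_ereal_sup => _ [z /= z1 <-]; rewrite lee_fin.
have na : 1 / 2 <= enorm a.
  have := ler_enormB (basisv i) a; rewrite enorm_basis enormB; lra.
have a0 : a != 0 by rewrite -enorm_gt0; lra.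
set y := z *m refl (basisv i).
have y1 : enorm y = 1 by rewrite /y enorm_refl ?basis_neq0.
have zE : z = y *m refl (basisv i) by rewrite /y -mulmxA refl_mulK ?basis_neq0// mulmx1.
rewrite /near_rotation mulmxA -/y [X in _ - X]zE !mul_refl enorm_basis expr1n divr1.
set e := basisv i; set ha := (enorm a)^-1 *: a.
have nha : enorm ha = 1.
  by rewrite enormZ normfV ger0_norm ?enorm_ge0// mulVf// gt_eqF//; lra.
have -> : (2 * dotv y a / enorm a ^+ 2) *: a = (2 * dotv y ha) *: ha.
  rewrite /ha dotvZr scalerA; congr (_ *: _); field; rewrite gt_eqF//; lra.
have hae : enorm (ha - e) <= 4 * c.
  have h := enorm_normalize_sub (basisv i) a0.
  rewrite enorm_basis invr1 scale1r in h; rewrite enormB; apply: (le_trans h).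
  rewrite enormB ler_pdivrMr; last by lra.
  have := enorm_ge0 (a - e); rewrite -/e in ac *; nra.
have -> : y - (2 * dotv y ha) *: ha - (y - (2 * dotv y e) *: e) =
   (- 2) *: (dotv y (ha - e) *: ha) + (- 2) *: (dotv y e *: (ha - e)).
  by rewrite dotvDr dotvNr; apply/rowP => j; rewrite !mxE; ring.
apply: (le_trans (ler_enormD _ _)).
rewrite !(enormZ (- 2)) !(enormZ (dotv _ _)) nha normrN ger0_norm//.
have := normr_dotv y (ha - e); have := normr_dotv y e.
rewrite y1 /e enorm_basis -/e => h1 h2.
have := enorm_ge0 (ha - e); have := normr_ge0 (dotv y e); nra.
Qed.

(** The reflection of [u] along [a] multiplied by |a|^2. This is polynomial in [a], hence has an
    explicit Lipschitz constant, and a function homogeneous of degree 0 does not see the factor. *)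
Definition reflP (u a : vec) : vec := enorm a ^+ 2 *: u - (2 * dotv u a) *: a.

Lemma reflPE u a : a != 0 -> reflP u a = enorm a ^+ 2 *: (u *m refl a).
Proof.
move=> a0; have na : enorm a != 0 by rewrite enorm_eq0.
rewrite mul_refl scalerBr scalerA; congr (_ - _ *: _); by field.
Qed.

Lemma reflP_lipschitz u a a' : enorm u <= 3 -> enorm a <= 2 -> enorm a' <= 2 ->
  enorm (reflP u a - reflP u a') <= 36 * enorm (a - a').
Proof.
move=> u3 a2 a'2.
have -> : reflP u a - reflP u a' = ((enorm a ^+ 2 - enorm a' ^+ 2) *: u) +
   (- 2) *: (dotv u (a - a') *: a + dotv u a' *: (a - a')).
  rewrite /reflP dotvDr dotvNr; apply/rowP => j; rewrite !mxE; ring.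
apply: (le_trans (ler_enormD _ _)); rewrite !enormZ normrN (ger0_norm (ler0n _ 2)).
have h1 : `|enorm a ^+ 2 - enorm a' ^+ 2| <= 4 * enorm (a - a').
  have h : `|enorm a - enorm a'| <= enorm (a - a').
    by rewrite ler_norml lerNl opprB ler_enormB/= enormB ler_enormB.
  rewrite subr_sqr normrM (ger0_norm (addr_ge0 (enorm_ge0 _) (enorm_ge0 _))).
  have := enorm_ge0 a; have := enorm_ge0 a'; have := enorm_ge0 (a - a').
  have := normr_ge0 (enorm a - enorm a'); nra.
have h2 : enorm (dotv u (a - a') *: a + dotv u a' *: (a - a')) <= 12 * enorm (a - a').
  apply: (le_trans (ler_enormD _ _)); rewrite !enormZ.
  have ha := normr_dotv u (a - a'); have hb := normr_dotv u a'.
  have p1 := enorm_ge0 (a - a'); have p2 := enorm_ge0 u.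
  have p3 := enorm_ge0 a; have p4 := enorm_ge0 a'.
  have q1 : `|dotv u (a - a')| <= 3 * enorm (a - a') by nra.
  have q2 : `|dotv u a'| <= 6 by nra.
  have := normr_ge0 (dotv u (a - a')); have := normr_ge0 (dotv u a'); nra.
have := enorm_ge0 (a - a'); have := enorm_ge0 u; have := normr_ge0 (enorm a ^+ 2 - enorm a' ^+ 2).
nra.
Qed.

(* A reflection exchanging u* and a vector of the same length as u has to be
   the one along their difference. *)
Lemma reflP_onto u i w d : 1 / 2 <= enorm u -> enorm u <= n%:R * `|u 0 i| ->
  enorm (w - u) <= d -> d <= (8 * n%:R)^-1 ->
  exists2 a, reflP (u *m refl (basisv i)) a = w & enorm (a - basisv i) <= (2 + 4 * n%:R) * d.
Proof.
move=> u12 ui wd dn.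
have n0 : (0 < n%:R :> R) by rewrite ltr0n (leq_ltn_trans _ (ltn_ord i)).
have nu : 0 < enorm u by lra.
have ui0 : 0 < `|u 0 i|.
  rewrite lt_def normr_ge0 andbT; apply/eqP => h; move: ui; rewrite h mulr0; lra.
have iui : 1 / 2 <= n%:R * `|u 0 i| by lra.
have dui : 4 * d <= `|u 0 i|.
  have h : d * (8 * n%:R) <= 1 by rewrite -ler_pdivlMr ?mul1r// mulr_gt0.
  have : n%:R * (4 * d) <= n%:R * `|u 0 i| by lra.
  by rewrite ler_pM2l.
have d0 : 0 <= d by apply: le_trans wd; exact: enorm_ge0.
set us := u *m refl (basisv i).
have usE : us = u - (2 * u 0 i) *: basisv i.
  by rewrite /us mul_refl enorm_basis expr1n divr1 dotv_basis.
have nus : enorm us = enorm u by rewrite /us enorm_refl ?basis_neq0.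
(* The value of |a|^2 is forced, since [reflP us a] has length |a|^2 |u|. *)
set k := enorm w / enorm u.
have wu : `|enorm w - enorm u| <= d.
  rewrite (le_trans _ wd)// ler_norml ler_enormB andbT lerNl opprB.
  by rewrite [enorm (w - u)]enormB ler_enormB.
have k1 : `|k - 1| <= 2 * d.
  rewrite /k -[X in _ - X](divff (lt0r_neq0 nu)) -mulrBl normrM normfV (gtr0_norm nu).
  rewrite ler_pdivrMr//; apply: (le_trans wu); nra.
have d18 : d <= 1 / 8.
  apply: (le_trans dn); rewrite div1r lef_pV2 ?posrE ?mulr_gt0//.
  by rewrite ler_peMr// ler1n -(ltr0n R).
have k0 : 0 < k by move: k1; rewrite ler_norml => /andP[]; lra.
set z := w - k *: us.
(* As [us] is [u] with its i-th coordinate reversed, [z] is close to u - us = 2 u_i e_i, which the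
   dominance of u_i keeps away from 0. *)
have zu : enorm (z - (2 * u 0 i) *: basisv i) <= 2 * d.
  have -> : z - (2 * u 0 i) *: basisv i = (w - u) - (k - 1) *: us.
    by rewrite /z usE; apply/rowP => j; rewrite !mxE; ring.
  apply: (le_trans (ler_enormD _ _)); rewrite enormN enormZ nus.
  have -> : `|k - 1| * enorm u = `|enorm w - enorm u|.
    rewrite -[X in _ * X](gtr0_norm nu) -normrM mulrBl mul1r /k divfK//; exact: lt0r_neq0.
  lra.
have nz : 0 < enorm z.
  have := ler_enormB ((2 * u 0 i) *: basisv i) z; rewrite [enorm (_ - z)]enormB.
  rewrite enormZ enorm_basis mulr1 normrM (ger0_norm (ler0n _ 2)); lra.
have z0 : z != 0 by rewrite -enorm_gt0.
pose t := Num.sqrt k; have t0 : 0 < t by rewrite sqrtr_gt0.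
have tk : t ^+ 2 = k by rewrite sqr_sqrtr// ltW.
(* [z] may point towards - e_i; this sign turns [a] towards e_i and leaves the reflection
   unchanged. *)
pose sg : R := Num.sg (u 0 i).
have sg1 : `|sg| = 1 by rewrite normr_sg -normr_gt0 ui0.
have sgu : sg * u 0 i = `|u 0 i| by rewrite /sg -normrEsg.
exists ((sg * t / enorm z) *: z).
  have nc : enorm ((sg * t / enorm z) *: z) ^+ 2 = k.
    rewrite enormZ !normrM normfV sg1 mul1r (gtr0_norm t0) (gtr0_norm nz) divfK ?gt_eqF//.
  rewrite /reflP nc dotvZr scalerA.
  have -> : 2 * (sg * t / enorm z * dotv us z) * (sg * t / enorm z) =
      2 * dotv us z * k / enorm z ^+ 2.
    have sg2 : sg ^+ 2 = 1 by rewrite -[sg ^+ 2]ger0_norm ?sqr_ge0// normrX sg1 expr1n.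
    rewrite -tk -[in RHS](mulr1 (t ^+ 2)) -sg2; field; exact: lt0r_neq0.
  (* This holds because [w] and [k *: us] have the same length. *)
  have hz : enorm z ^+ 2 = - 2 * k * dotv us z.
    rewrite -dotvv {1}/z dotvDl dotvNl dotvZl /z !dotvDr !dotvNr !dotvZr !dotvv nus.
    have -> : enorm w = k * enorm u by rewrite /k divfK// gt_eqF.
    rewrite (dotvC w us); ring.
  have -> : 2 * dotv us z * k / enorm z ^+ 2 = -1.
    have hz0 : enorm z ^+ 2 != 0 by rewrite expf_neq0// gt_eqF.
    by apply: (mulIf hz0); rewrite divfK// hz; ring.
  by rewrite scaleN1r opprK /z addrC subrK.
have -> : (sg * t / enorm z) *: z - basisv i =
  (t - 1) *: ((sg / enorm z) *: z) + sg *: ((enorm z)^-1 *: z - sg *: basisv i).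
  have sg2 : sg * sg = 1 by rewrite -expr2 -[sg ^+ 2]ger0_norm ?sqr_ge0// normrX sg1 expr1n.
  rewrite [X in _ - X = _](_ : _ = (sg * sg) *: basisv i); last by rewrite sg2 scale1r.
  by apply/rowP => j; rewrite !mxE; ring.
apply: (le_trans (ler_enormD _ _)); rewrite !enormZ sg1 mul1r normrM sg1 mul1r normfV (gtr0_norm nz).
rewrite mulVf ?gt_eqF// mulr1.
have t1 : `|t - 1| <= 2 * d.
  apply: le_trans k1; have -> : k - 1 = (t - 1) * (t + 1) by rewrite -tk; ring.
  by rewrite normrM ler_peMr// ger0_norm; lra.
have : enorm ((enorm z)^-1 *: z - sg *: basisv i) <= 4 * n%:R * d.
  have y0 : (2 * u 0 i) *: basisv i != 0.
    by rewrite -enorm_gt0 enormZ enorm_basis mulr1 normrM mulr_gt0// ger0_norm.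
  have := enorm_normalize_sub z y0.
  rewrite enormZ enorm_basis mulr1 normrM (ger0_norm (ler0n _ 2)) scalerA.
  have -> : (2 * `|u 0 i|)^-1 * (2 * u 0 i) = sg.
    have : u 0 i = sg * `|u 0 i| by rewrite -numEsg.
    move=> {2}->; field; exact: lt0r_neq0.
  move=> h; apply: (le_trans h); rewrite ler_pdivrMr ?mulr_gt0//.
  apply: (@le_trans _ _ (2 * (2 * d))); first by rewrite ler_pM2l.
  have : d * (1 / 2) <= d * (n%:R * `|u 0 i|) by rewrite ler_wpM2l.
  by lra.
lra.
Qed.

End reflection_parametrization.

Section measure_domination.
Context d (T : measurableType d) (R : realType).

Lemma le_integral_measure (mu nu : {measure set T -> \bar R}) (f : T -> \bar R) :
  (forall A, measurable A -> (mu A <= nu A)%E) -> (forall x, 0 <= f x)%E ->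
  (\int[mu]_x f x <= \int[nu]_x f x)%E.
Proof.
move=> munu f0; rewrite !ge0_integralTE//.
apply: ge_ereal_sup => _ [h hf <-].
apply: (@le_trans _ _ (sintegral nu h)); last by apply: ereal_sup_ubound; exists h.
rewrite !sintegralE; apply: lee_fsum => // x _.
have [x0|x0] := leP 0 x; first by apply: lee_wpmul2l => //; exact: munu.
rewrite (_ : h @^-1` _ = set0) ?measure0 ?mule0//.
by apply/seteqP; split => // t /= hx; move: x0; rewrite -hx ltNge fun_ge0.
Qed.

Lemma finite_measure_of (mu : {measure set T -> \bar R}) : (mu setT < +oo)%E ->
  exists m : {finite_measure set T -> \bar R}, forall A, m A = mu A.
Proof.
move=> muT.
by exists (mfrestr measurableT muT) => A; rewrite /= /mfrestr /mrestr setIT.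
Qed.

End measure_domination.

Section rotations_and_measure.
Context (R : realType) (n : nat).
Local Notation vec := 'rV[R]_n.
Local Notation leb := (lebesgue_rV R n).
Implicit Types (a u w x y : vec).

Lemma measurable_mulmx (rho : 'M[R]_n) : measurable_fun setT (fun x : vec => x *m rho).
Proof.
apply: measurable_fun_entries => i j; under eq_fun do rewrite mxE.
apply: measurable_sum => k; apply: measurable_funM => //.
exact: measurable_entry.
Qed.

Lemma enorm_orthogonal x (rho : 'M[R]_n) : rho *m rho^T = 1%:M ->
  enorm (x *m rho) = enorm x.
Proof.
move=> h; apply/eqP; rewrite -(@eqrXn2 _ 2)// ?enorm_ge0// -!dotvv.
have dE (y z : vec) : dotv y z = (y *m z^T) 0 0 by rewrite mulmx_tr_dotv mxE eqxx mulr1n.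
by rewrite !dE trmx_mul mulmxA -(mulmxA x) h mulmx1.
Qed.

(** A rotated cube lies in the cube n times as large about the rotated centre, so comparison on
    cubes bounds Lebesgue measure on bounded pieces by n^n times its image under [rho^T]. Null sets
    do not see the factor. *)
Lemma null_orthogonal (rho : 'M[R]_n) (N : set vec) :
  (0 < n)%N -> rho *m rho^T = 1%:M ->
  measurable N -> leb N = 0%E -> leb [set x | N (x *m rho)] = 0%E.
Proof.
move=> n0 rr mN N0.
have rr' := mulmx1C rr.
pose M := [set x | N (x *m rho)].
have mM : measurable M.
  by rewrite -[X in measurable X]setTI; exact: measurable_mulmx.
suff Hk (k : nat) : leb (M `&` cube 0 k%:R) = 0%E.
  apply/eqP; rewrite -measure_le0.
  have ME : M `<=` \bigcup_k (M `&` cube 0 k%:R).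
    move=> x Mx; exists (Num.truncn `|x|).+1 => //; split => //.
    rewrite /cube/= subr0; apply/ltW; exact: truncnS_gt.
  apply: (@le_trans _ _ (\sum_(0 <= k <oo) leb (M `&` cube 0 k%:R))%E).
    apply: measure_sigma_subadditive => // k; apply: measurableI => //.
    exact: measurable_cube.
  by rewrite eseries0.
(* A cube containing all the points z with |z - w rho| <= 1 for w in [cube 0 k%:R]; restricting to
   it makes the image measure finite. *)
have mC := @measurable_cube R n 0 (n%:R * k%:R + 1).
have mphi := measurable_mulmx rho^T.
have [|m mE] := @finite_measure_of _ _ _ (pushm (mrestr leb mC) mphi).
  by rewrite /= /pushforward /mrestr preimage_setT setTI leb_cube ?ltry// ltr_wpDl// mulr_ge0.
have nR : 0 < n%:R :> R by rewrite ltr0n.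
have H := @leb_le_cubes R n m (n%:R ^+ n) 1 (M `&` cube 0 k%:R).
apply/eqP; rewrite -measure_le0; apply: (le_trans (H _ _ _ _)) => //.
- by apply: measurableI => //; exact: measurable_cube.
- move=> w s [Mw wk] s0 s1.
  have sn : 0 < s / n%:R by rewrite divr_gt0.
  apply: (@le_trans _ _ ((n%:R ^+ n)%:E * leb (cube (w *m rho) (s / n%:R)))%E).
    rewrite !leb_cube// -EFinM lee_fin -exprMn.
    rewrite (_ : n%:R * (2 * (s / n%:R)) = 2 * s)//; field; exact: lt0r_neq0.
  apply: lee_wpmul2l => //; rewrite mE /= /pushforward /mrestr.
  apply: le_measure; rewrite ?inE.
  + exact: measurable_cube.
  + apply: measurableI => //; rewrite -[X in measurable X]setTI.
    by apply: measurable_mulmx => //; exact: measurable_cube.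
  + move=> z zw; split; rewrite /cube/=.
      have -> : z *m rho^T - w = (z - w *m rho) *m rho^T.
        by rewrite mulmxBl -mulmxA rr mulmx1.
      apply: (le_trans (supnorm_enorm _)).
      rewrite enorm_orthogonal ?trmxK//; apply: (le_trans (enorm_supnorm _)).
      by rewrite mulrC -ler_pdivlMr.
    rewrite subr0 -(subrK (w *m rho) z) addrC; apply: (le_trans (ler_normD _ _)).
    apply: lerD.
      apply: (le_trans (supnorm_enorm _)); rewrite enorm_orthogonal//.
      apply: (le_trans (enorm_supnorm _)); rewrite ler_pM2l//.
      by move: wk; rewrite /cube/= subr0.
    apply: (le_trans zw); rewrite ler_pdivrMr// mul1r (le_trans s1)// ler1n.
    exact: n0.
rewrite mE /= /pushforward /mrestr.
rewrite [X in (_ * X)%E](_ : _ = 0%E) ?mule0//.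
apply/eqP; rewrite -measure_le0 -N0; apply: le_measure; rewrite ?inE//.
  apply: measurableI => //; rewrite -[X in measurable X]setTI.
  by apply: measurable_mulmx => //; apply: measurableI => //; exact: measurable_cube.
by move=> z [[]]; rewrite /M/= -mulmxA rr' mulmx1.
Qed.

Lemma measurable_reflP u : measurable_fun setT (reflP u : vec -> vec).
Proof.
apply: measurable_fun_subv; apply: measurable_fun_scalev => //.
  by apply: measurable_funX; exact: measurable_enorm.
apply: measurable_funM => //; apply: measurable_sum => k.
by apply: measurable_funM => //; exact: measurable_entry.
Qed.

Lemma cube_basis_enorm i (c : R) a : n%:R * c <= 1 / 2 -> cube (basisv R i) c a ->
  [/\ enorm (a - basisv R i) <= n%:R * c, a != 0 & enorm a <= 2].
Proof.
move=> c2 ca.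
have h : enorm (a - basisv R i) <= n%:R * c.
  by apply: (le_trans (enorm_supnorm _)); exact: ler_wpM2l.
split => //.
  rewrite -enorm_gt0; have := ler_enormB (basisv R i) a; rewrite enorm_basis enormB; lra.
have := ler_enormB a (basisv R i); rewrite enorm_basis; lra.
Qed.

(** Every [w] of the cube is the value of [reflP us] at some [a] near e_i, and this map has
    Lipschitz constant 36 n for the sup norm. A cube about [w] thus contains the image of a cube
    about [a] smaller by that factor, and comparison on cubes bounds Lebesgue measure near [u] by
    (36 n)^n times the image measure. *)
Lemma cube_average_rotation (F : vec -> \bar R) u i (eta : R) :
  1 / 2 <= enorm u -> enorm u <= 3 -> enorm u <= n%:R * `|u 0 i| ->
  0 < eta -> eta <= (24 * n%:R ^+ 3)^-1 ->
  measurable_fun setT F -> (forall x, 0 <= F x)%E ->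
    (\int[leb]_(w in cube u eta) F w <=
   ((36 * n%:R) ^+ n)%:E * \int[leb]_(a in cube (basisv R i) (12 * n%:R ^+ 2 * eta)) F (reflP (u *m refl (basisv R i)) a))%E.
Proof.
move=> u12 u3 ui eta0 eta1 mF F0.
have n1 : 1 <= n%:R :> R.
  by rewrite ler1n (leq_ltn_trans _ (ltn_ord i)).
have nR : 0 < n%:R :> R by lra.
have hc : n%:R ^+ 3 * eta <= 1 / 24.
  move: eta1; rewrite -[X in _ <= X]mul1r ler_pdivlMr ?mulr_gt0 ?exprn_gt0//; lra.
(* Twice the bound (2 + 4 n) n eta <= 6 n^2 eta that [reflP_onto] gives for |a - e_i|; the other
   half leaves room for a cube about [a]. *)
set c := 12 * n%:R ^+ 2 * eta.
have nc : n%:R * c <= 1 / 2.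
  by rewrite /c (_ : n%:R * (12 * n%:R ^+ 2 * eta) = 12 * (n%:R ^+ 3 * eta)); [lra|ring].
have c0 : 0 < c by rewrite !mulr_gt0 ?exprn_gt0.
set us := u *m refl (basisv R i).
have nus : enorm us = enorm u by rewrite /us enorm_refl// basis_neq0.
have mC := @measurable_cube R n (basisv R i) c.
have mphi := measurable_reflP us.
have [|m mE] := @finite_measure_of _ _ _ (pushm (mrestr leb mC) mphi).
  by rewrite /= /pushforward /mrestr preimage_setT setTI leb_cube ?ltry.
set L := 36 * n%:R; have L0 : 0 < L by rewrite /L mulr_gt0.
have hK : 0 <= L ^+ n by rewrite exprn_ge0// ltW.
have mU := @measurable_cube R n u eta.
have dom A : measurable A -> (mrestr leb mU A <= mscale (NngNum hK) m A)%E.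
  move=> mA; apply: (@le_trans _ _ ((L ^+ n)%:E * m (A `&` cube u eta))%E); last first.
    apply: lee_wpmul2l => //; apply: le_measure; rewrite ?inE//.
    exact: measurableI.
  apply: (@leb_le_cubes _ _ _ _ eta) => //; first exact: measurableI.
  move=> w s [_ wu] s0 s1.
  have sL : 0 < s / L by rewrite divr_gt0.
  have [a Pa ae] : exists2 a, reflP us a = w & enorm (a - basisv R i) <= c / 2.
    have hd : n%:R * eta <= (8 * n%:R)^-1.
      rewrite -[X in _ <= X]mul1r ler_pdivlMr ?mulr_gt0//.
      rewrite (_ : n%:R * eta * (8 * n%:R) = 8 * (n%:R ^+ 2 * eta)); last by ring.
      have : n%:R ^+ 2 * eta <= n%:R ^+ 3 * eta.
        by apply: ler_wpM2r; [exact: ltW|exact: ler_weXn2l].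
      lra.
    have [|a Pa ae] := @reflP_onto R n u i w (n%:R * eta) u12 ui _ hd.
      by apply: (le_trans (enorm_supnorm _)); exact: ler_wpM2l.
    exists a => //; apply: (le_trans ae); rewrite /c.
    have : n%:R * eta <= n%:R ^+ 2 * eta.
      by apply: ler_wpM2r; [exact: ltW|rewrite -[leLHS]expr1; exact: ler_weXn2l].
    nra.
  have sub z : cube a (s / L) z -> cube (basisv R i) c z.
    move=> za; rewrite /cube/= -(subrK a z) -addrA; apply: (le_trans (ler_normD _ _)).
    have h1 : `|a - basisv R i| <= c / 2 by apply: le_trans ae; exact: supnorm_enorm.
    have h2 : s / L <= c / 2.
      rewrite ler_pdivrMr// (le_trans s1)// /c /L.
      rewrite (_ : 12 * n%:R ^+ 2 * eta / 2 * (36 * n%:R) = (216 * n%:R ^+ 3) * eta); last by field.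
      have h3 : 1 <= n%:R ^+ 3 :> R by exact: exprn_ege1.
      by apply: ler_peMl; [exact: ltW|lra].
    by move: za; rewrite /cube/=; lra.
  apply: (@le_trans _ _ ((L ^+ n)%:E * leb (cube a (s / L)))%E).
    rewrite !leb_cube// -EFinM lee_fin -exprMn.
    rewrite (_ : L * (2 * (s / L)) = 2 * s)//; field; exact: lt0r_neq0.
  apply: lee_wpmul2l => //; rewrite mE /= /pushforward /mrestr.
  apply: le_measure; rewrite ?inE.
  + exact: measurable_cube.
  + apply: measurableI => //; rewrite -[X in measurable X]setTI.
    by apply: measurable_reflP => //; exact: measurable_cube.
  + move=> z za; split; last exact: sub.
    have aa : cube a (s / L) a by rewrite /cube/= subrr normr0 ltW.
    have [_ _ z2] := cube_basis_enorm nc (sub _ za).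
    have [_ _ a2] := cube_basis_enorm nc (sub _ aa).
    rewrite /cube/= -Pa; apply: (le_trans (supnorm_enorm _)).
    have us3 : enorm us <= 3 by rewrite nus.
    apply: (le_trans (reflP_lipschitz us3 z2 a2)).
    apply: (@le_trans _ _ (36 * (n%:R * `|z - a|))); first by rewrite ler_pM2l// enorm_supnorm.
    by rewrite mulrA mulrC -ler_pdivlMr.
have := le_integral_measure dom F0.
rewrite ge0_integral_mrestr// ge0_integral_mscale//= => h; apply: (le_trans h).
apply: lee_wpmul2l => //.
rewrite (eq_measure_integral (pushm (mrestr leb mC) mphi)); last by move=> A mA _; exact: mE.
rewrite ge0_integral_pushforward// preimage_setT ge0_integral_mrestr//; last 2 first.
- exact: (measurableT_comp mF mphi).
- by move=> x; exact: F0.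
Qed.

End rotations_and_measure.

Lemma powR_dist_le (R : realType) (q a b c : R) : 0 <= q ->
  `|a - c| `^ q <= 2 `^ q * (`|a - b| `^ q + `|b - c| `^ q).
Proof.
move=> q0.
wlog h : a c / `|b - c| <= `|a - b|.
  move=> H; have [h|h] := leP `|b - c| `|a - b|; first exact: H.
  have := H c a; rewrite (distrC c a) (distrC c b) (distrC b a).
  by rewrite (addrC (`|b - c| `^ q)); apply; exact: ltW.
apply: (@le_trans _ _ ((2 * `|a - b|) `^ q)).
  apply: ge0_ler_powR; rewrite ?nnegrE ?mulr_ge0//.
  by apply: (le_trans (ler_distD b _ _)); lra.
by rewrite powRM// ler_wpM2l ?powR_ge0// lerDl powR_ge0.
Qed.

Section measurability.
Context d (T : measurableType d) (R : realType) (n : nat).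
Local Notation vec := 'rV[R]_n.

Lemma measurable_powR_comp (q : R) (f : T -> measurableTypeR R) :
  measurable_fun setT f -> measurable_fun setT (fun t => f t `^ q : measurableTypeR R).
Proof. by move=> mf; apply: (@measurableT_comp _ _ _ _ _ _ (@powR R ^~ q)). Qed.

Lemma measurable_powR_dist (q : R) (f g : T -> measurableTypeR R) :
  measurable_fun setT f -> measurable_fun setT g ->
  measurable_fun setT (fun t => (`|f t - g t| `^ q)%:E).
Proof.
move=> mf mg; apply/measurable_EFinP; apply: measurable_powR_comp.
by apply: measurableT_comp => //; exact: measurable_funB.
Qed.

Lemma measurable_fun_dotv (f g : T -> vec) :
  measurable_fun setT f -> measurable_fun setT g ->
  measurable_fun setT (fun t => dotv (f t) (g t) : measurableTypeR R).
Proof.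
move=> mf mg; apply: measurable_sum => k; apply: measurable_funM.
  by apply: (@measurableT_comp _ _ _ _ _ _ (fun v : vec => v 0 k : measurableTypeR R)) => //; exact: measurable_entry.
by apply: (@measurableT_comp _ _ _ _ _ _ (fun v : vec => v 0 k : measurableTypeR R)) => //; exact: measurable_entry.
Qed.

Lemma measurable_fun_reflP (f g : T -> vec) :
  measurable_fun setT f -> measurable_fun setT g ->
  measurable_fun setT (fun t => reflP (f t) (g t)).
Proof.
move=> mf mg; apply: measurable_fun_subv; apply: measurable_fun_scalev => //.
  apply: measurable_funX; apply: (@measurableT_comp _ _ _ _ _ _ (@enorm R n : vec -> measurableTypeR R)) => //.
  exact: measurable_enorm.
by apply: measurable_funM => //; exact: measurable_fun_dotv.
Qed.

End measurability.

Section tonelli.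
Context d1 d2 (T1 : measurableType d1) (T2 : measurableType d2) (R : realType).
Context (m1 : {sigma_finite_measure set T1 -> \bar R}).
Context (m2 : {sigma_finite_measure set T2 -> \bar R}).

Lemma integral_indicM d (T : measurableType d) (m : {measure set T -> \bar R})
    (A : set T) (f : T -> \bar R) :
  (\int[m]_(x in A) f x = \int[m]_x (f x * (\1_A x)%:E))%E.
Proof.
rewrite integral_mkcond; apply: eq_integral => x _.
by rewrite epatch_indic.
Qed.

Lemma tonelli_in (A : set T1) (B : set T2) (f : T1 * T2 -> \bar R) :
  measurable A -> measurable B -> measurable_fun setT f ->
  (forall x, 0 <= f x)%E ->
  (\int[m1]_(x in A) \int[m2]_(y in B) f (x, y) =
   \int[m2]_(y in B) \int[m1]_(x in A) f (x, y))%E.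
Proof.
move=> mA mB mf f0.
have mI : measurable (A `*` B) by exact: measurableX.
have H := @fubini_tonelli _ _ _ _ R m1 m2 (f \_ (A `*` B)).
have E1 : (\int[m1]_x \int[m2]_y (f \_ (A `*` B)) (x, y) =
  \int[m1]_(x in A) \int[m2]_(y in B) f (x, y))%E.
  rewrite [RHS]integral_mkcond; apply: eq_integral => x _.
  rewrite /patch; case: ifPn => [/set_mem Ax|/negP nA].
    rewrite [RHS]integral_mkcond; apply: eq_integral => y _; rewrite /patch.
    by have [/set_mem By|/negP nB] := ifPn (y \in B); [rewrite mem_set|rewrite memNset// => -[_ /mem_set]].
  apply: integral0_eq => y _; rewrite memNset// => -[/= Ax _]; apply: nA; exact: mem_set.
have E2 : (\int[m2]_y \int[m1]_x (f \_ (A `*` B)) (x, y) =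
  \int[m2]_(y in B) \int[m1]_(x in A) f (x, y))%E.
  rewrite [RHS]integral_mkcond; apply: eq_integral => y _.
  rewrite /patch; case: ifPn => [/set_mem By|/negP nB].
    rewrite [RHS]integral_mkcond; apply: eq_integral => x _; rewrite /patch.
    by have [/set_mem Ax|/negP nA] := ifPn (x \in A); [rewrite mem_set|rewrite memNset// => -[/mem_set]].
  apply: integral0_eq => x _; rewrite memNset// => -[_ /= By]; apply: nB; exact: mem_set.
rewrite -E1 -E2; apply: H.
  apply/(measurable_restrictT _ _).1; first by [].
  exact: (measurable_funS measurableT (@subsetT _ _) mf).
by move=> x; apply: erestrict_ge0.
Qed.

Lemma measurable_integral_in (B : set (T1 * T2)) (f : T1 * T2 -> \bar R) :
  measurable B -> measurable_fun setT f -> (forall x, 0 <= f x)%E ->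
  measurable_fun setT (fun x => \int[m2]_(y in [set y | B (x, y)]) f (x, y))%E.
Proof.
move=> mB mf f0.
rewrite (_ : (fun _ => _) = (fun x => \int[m2]_y (f \_ B) (x, y))%E); last first.
  apply/funext => x; rewrite integral_mkcond; apply: eq_integral => y _.
  rewrite /patch (_ : (y \in [set y | B (x, y)]) = ((x, y) \in B))//.
apply: (@measurable_fun_fubini_tonelli_F _ _ _ _ _ m2 (f \_ B)).
  apply/(measurable_restrictT _ _).1; first by [].
  exact: (measurable_funS measurableT (@subsetT _ _) mf).
by move=> x; apply: erestrict_ge0.
Qed.

End tonelli.

Section homogeneous_integrals.
Context (R : realType) (n : nat).
Local Notation vec := 'rV[R]_n.
Local Notation leb := (lebesgue_rV R n).

Lemma integral_scale_in (t : R) (D : set vec) (F : vec -> \bar R) : 0 < t ->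
  measurable D -> measurable_fun setT F -> (forall x, 0 <= F x)%E ->
  (\int[leb]_(x in [set x | D (t *: x)%R]) F (t *: x)%R =
   (t ^- n)%:E * \int[leb]_(x in D) F x)%E.
Proof.
move=> t0 mD mF F0; rewrite [X in (_ * X)%E]integral_mkcond -integral_leb_scale//.
- rewrite integral_mkcond; apply: eq_integral => x _; rewrite /patch.
  by rewrite [x \in _](_ : _ = (t *: x \in D)).
- by apply/(measurable_restrictT _ _).1 => //; exact: measurable_funS mF.
- by move=> x; apply: erestrict_ge0.
Qed.

Lemma integral_homogeneous_ball (F : vec -> \bar R) (d : R) : 0 < d ->
  measurable_fun setT F -> (forall x, 0 <= F x)%E ->
  (forall t x, 0 < t -> F (t *: x) = F x) ->
  (\int[leb]_(x in ecball 0%R d) F x =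
   (d ^+ n)%:E * \int[leb]_(x in ecball 0%R 1%R) F x)%E.
Proof.
move=> d0 mF F0 Fh.
have := @integral_scale_in d^-1 (ecball 0 1) F _ (@measurable_ecball R n _ _) mF F0.
rewrite invr_gt0 exprVn invrK => <-//.
rewrite (_ : [set x | _] = ecball 0 d); last first.
  apply/seteqP; split => x; rewrite /ecball/= !subr0 enormZ gtr0_norm ?invr_gt0//.
    by rewrite mulrC ler_pdivrMr// mul1r.
  by rewrite mulrC ler_pdivrMr// mul1r.
by apply: eq_integral => x _; rewrite Fh ?invr_gt0.
Qed.

End homogeneous_integrals.

(** * From rotations to translations of the homogeneous function W *)

Section translation_modulus.
Context (R : realType) (n : nat).
Local Notation vec := 'rV[R]_n.
Local Notation leb := (lebesgue_rV R n).
Variables (W : vec -> R) (q : R).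
Hypothesis mW : measurable_fun setT (W : vec -> measurableTypeR R).
Hypothesis hW : homogeneous0 W.
Hypothesis q0 : 0 <= q.
Local Notation D x y := (`|W x - W y| `^ q)%:E.

Let D0 x y : (0 <= D x y)%E. Proof. by rewrite lee_fin powR_ge0. Qed.

Let mD d (T : measurableType d) (f g : T -> vec) : measurable_fun setT f ->
  measurable_fun setT g -> measurable_fun setT (fun t => D (f t) (g t)).
Proof.
by move=> mf mg; apply: measurable_powR_dist; exact: (measurableT_comp mW).
Qed.

Lemma dominant_coordinate (u : vec) : u != 0 ->
  exists i, enorm u <= n%:R * `|u 0 i|.
Proof.
move=> u0; have : mx_norm u != 0 by rewrite -[mx_norm u]/(`|u|) normr_eq0.
move=> /mx_norm_neq0[[i j] /= h]; exists j.
by apply: (le_trans (enorm_supnorm u)); rewrite [`|u|]h ord1.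
Qed.

(** The difference W(x - y) - W(x) passes through [W w] for all [w] of the cube of size eta about
    [x], which lies in the cube of size 2 eta about x - y. With [Q u] the integral of |W u - W w|^q
    over [w] near [u], the preceding comparison turns [Q u] into an integral over near rotations of
    [u]; integrating in [u] first, each rotation costs a multiple of [S]. *)
Lemma translation_modulus (S eta : R) :
  (0 < n)%N -> 0 < eta -> eta <= (48 * n%:R ^+ 3)^-1 ->
  (forall rho : 'M[R]_n, rotation rho ->
     (rotation_size rho <= (384 * n%:R ^+ 3 * eta)%:E)%E ->
     (\int[leb]_(x in ecball 0%R 1%R) D (x *m rho)%R x <= S%:E)%E) ->
  forall y : vec, `|y| <= eta ->
  (\int[leb]_(x in [set x | (1 < enorm x <= 2)%R]) D (x - y)%R x <=
   (2 * 2 `^ q * n%:R * (36 * n%:R) ^+ n * (24 * n%:R ^+ 2) ^+ n * 3 ^+ n * S)%:E)%E.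
Proof.
move=> n0 eta0 eta1 hS y yeta.
have n1 : 1 <= n%:R :> R by rewrite ler1n.
have nR : 0 < n%:R :> R by lra.
have hc3 : n%:R ^+ 3 * eta <= 1 / 48.
  move: eta1; rewrite -[X in _ <= X]mul1r ler_pdivlMr ?mulr_gt0 ?exprn_gt0//; lra.
have neta : n%:R * eta <= 1 / 48.
  apply: le_trans hc3; apply: ler_wpM2r; first exact: ltW.
  by rewrite -[leLHS]expr1; exact: ler_weXn2l.
(* The size that [cube_average_rotation] requires for cubes of size 2 eta; the near rotations then
   have size at most 16 n c = 384 n^3 eta. *)
pose c := 12 * n%:R ^+ 2 * (2 * eta).
have c0 : 0 < c by rewrite !mulr_gt0 ?exprn_gt0.
have nc : n%:R * c <= 1 / 2.
  by rewrite /c (_ : n%:R * (12 * n%:R ^+ 2 * (2 * eta)) = 24 * (n%:R ^+ 3 * eta)); [lra|ring].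
pose A' := [set u : vec | 1 / 2 <= enorm u <= 3].
have mA' : measurable A'.
  have := @measurable_enorm_set R n `[1/2, 3]%classic (measurable_itv _).
  by congr measurable; apply/seteqP; split => x /=; rewrite in_itv.
pose A1 := [set x : vec | 1 < enorm x <= 2].
have mA1 : measurable A1.
  have := @measurable_enorm_set R n `]1, 2]%classic (measurable_itv _).
  by congr measurable; apply/seteqP; split => x /=; rewrite in_itv.
pose Q (u : vec) := (\int[leb]_(w in cube u (2 * eta)) D u w)%E.
have Q0 u : (0 <= Q u)%E by apply: integral_ge0.
have mQ : measurable_fun setT Q.
  pose B := [set uw : vec * vec | `|uw.2 - uw.1| <= 2 * eta].
  have mB : measurable B.
    have mf : measurable_fun setT (fun wz : vec * vec => `|wz.2 - wz.1| : measurableTypeR R).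
      apply: (@measurableT_comp _ _ _ _ _ _ (fun z : vec => `|z| : measurableTypeR R)).
        exact: measurable_supnorm.
      by apply: measurable_fun_subv; [exact: measurable_snd|exact: measurable_fst].
    have := mf measurableT `]-oo, (2 * eta)]%classic (measurable_itv _).
    by rewrite setTI; congr measurable; apply/seteqP; split => z /=; rewrite in_itv.
  have := @measurable_integral_in _ _ _ _ R leb B (fun uw => D uw.1 uw.2) mB.
  by apply => //; apply: mD; [exact: measurable_fst|exact: measurable_snd].
have step1 x : A1 x ->
  (((2 * eta) ^+ n)%:E * D (x - y)%R x <= (2 `^ q)%:E * (Q (x - y)%R + Q x))%E.
  move=> A1x.
  have mC := @measurable_cube R n x eta.
  rewrite -(leb_cube x eta0) muleC -integral_cst//.
  have mf1 : measurable_fun (cube x eta) (fun w => D (x - y) w).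
    by apply: measurable_funTS; apply: mD.
  have mf2 : measurable_fun (cube x eta) (fun w => D x w).
    by apply: measurable_funTS; apply: mD.
  apply: (@le_trans _ _ (\int[leb]_(w in cube x eta)
     ((2 `^ q)%:E * (D (x - y)%R w + D x w)))%E).
    apply: le_lower_integral => w _; first exact: D0.
    rewrite /cst -EFinD -EFinM lee_fin (distrC (W x) (W w)); exact: powR_dist_le.
  rewrite ge0_integralZl_EFin//; last 2 first.
  - by move=> w _; exact: adde_ge0.
  - exact: emeasurable_funD.
  rewrite ge0_integralD//; apply: lee_wpmul2l; first by rewrite lee_fin powR_ge0.
  apply: leeD.
    rewrite /Q [leLHS]integral_mkcond [leRHS]integral_mkcond.
    apply: le_lower_integral => w _; first by apply: erestrict_ge0.
    rewrite /patch; case: ifPn => [/set_mem h|_]; last by case: ifPn.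
    rewrite mem_set// /cube/= opprB addrA addrAC; apply: (le_trans (ler_normD _ _)).
    by move: h; rewrite /cube/= mulr2n mulrDl mul1r => h; exact: lerD.
  rewrite /Q [leLHS]integral_mkcond [leRHS]integral_mkcond.
  apply: le_lower_integral => w _; first by apply: erestrict_ge0.
  rewrite /patch; case: ifPn => [/set_mem h|_]; last by case: ifPn.
  rewrite mem_set//; apply: (le_trans h); lra.
pose G i (u : vec) := (((36 * n%:R) ^+ n)%:E * \int[leb]_(a in cube (basisv R i) c)
   D u (reflP (u *m refl (basisv R i)) a))%E.
have mF2 i : measurable_fun setT (fun ua : vec * vec =>
    D ua.1 (reflP (ua.1 *m refl (basisv R i)) ua.2)).
  apply: mD; first exact: measurable_fst.
  apply: measurable_fun_reflP; last exact: measurable_snd.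
  by apply: (measurableT_comp (measurable_mulmx _)); exact: measurable_fst.
have G0 i u : (0 <= G i u)%E.
  by apply: mule_ge0; [rewrite lee_fin exprn_ge0// mulr_ge0|apply: integral_ge0].
have mI i : measurable_fun setT (fun u : vec => \int[leb]_(a in cube (basisv R i) c)
   D u (reflP (u *m refl (basisv R i)) a))%E.
  have := @measurable_integral_in _ _ _ _ R leb (setT `*` cube (basisv R i) c) _ _ (mF2 i).
  rewrite (_ : (fun x => _) = (fun x : vec => \int[leb]_(a in cube (basisv R i) c) D x (reflP (x *m refl (basisv R i)) a))%E).
    by apply => //; apply: measurableX => //; exact: measurable_cube.
  by apply/funext => x; congr (integral _ _ _); apply/seteqP; split => a //= -[].
have mG i : measurable_fun setT (G i) by apply: measurable_funeM; exact: mI.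
(* The dominant coordinate depends on [u]; summing over all of them avoids a measurable choice and
   costs the factor n. *)
have step2 u : A' u -> (Q u <= \sum_(i < n) G i u)%E.
  move=> /andP[u12 u3].
  have u0 : u != 0 by rewrite -enorm_gt0; lra.
  have [i ui] := dominant_coordinate u0.
  apply: (@le_trans _ _ (G i u)); last first.
    by rewrite (bigD1 i)//= leeDl// sume_ge0.
  apply: cube_average_rotation => //; rewrite ?mulr_gt0//.
  rewrite -[X in _ <= X]mul1r ler_pdivlMr ?mulr_gt0 ?exprn_gt0//; lra.
  exact: mD.
have step3 i : (\int[leb]_(u in A') G i u <=
   ((36 * n%:R) ^+ n * (2 * c) ^+ n * 3 ^+ n * S)%:E)%E.
  have mC := @measurable_cube R n (basisv R i) c.
  rewrite /G ge0_integralZl_EFin//; last 2 first.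
  - by move=> u _; apply: integral_ge0.
  - apply: measurable_funTS; exact: mI.
  have -> := @tonelli_in _ _ _ _ R leb leb A' (cube (basisv R i) c) _ mA' mC (mF2 i) (fun x => D0 _ _).
  rewrite -!mulrA EFinM; apply: lee_wpmul2l; first by rewrite lee_fin exprn_ge0// mulr_ge0.
  rewrite mulrC EFinM -(leb_cube (basisv R i) c0) -integral_cst//.
  apply: le_lower_integral => a; first by move=> _; apply: integral_ge0.
  move=> /(cube_basis_enorm nc)[ae a0 _] /=.
  pose rho := near_rotation i a.
  have Wr u : W (reflP (u *m refl (basisv R i)) a) = W (u *m rho).
    by rewrite reflPE// hW ?exprn_gt0 ?enorm_gt0// -mulmxA.
  have rot : rotation rho by apply: rotation_refl => //; exact: basis_neq0.
  apply: (@le_trans _ _ (\int[leb]_(u in ecball 0%R 3%R) D (u *m rho)%R u)%E).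
    rewrite [leLHS]integral_mkcond [leRHS]integral_mkcond.
    apply: le_lower_integral => u _; first by apply: erestrict_ge0.
    rewrite /patch; case: ifPn => [/set_mem/andP[_ u3]|_]; last by case: ifPn.
    by rewrite mem_set /ecball/= ?subr0// Wr distrC.
  rewrite integral_homogeneous_ball//; last 2 first.
  - by apply: mD => //; exact: measurable_mulmx.
  - by move=> t x t0; rewrite -scalemxAl !hW.
  rewrite EFinM; apply: lee_wpmul2l => //; apply: hS => //.
  apply: (le_trans (near_rotation_size ae nc)).
  rewrite lee_fin /c; rewrite le_eqVlt; apply/orP; left; apply/eqP; ring.
clearbody Q G.
have e2 : 0 < (2 * eta) ^+ n by rewrite exprn_gt0// mulr_gt0.
(* The annulus 1/2 <= |u| <= 3 is wide enough to contain the translates of 1 < |x| <= 2 by [v],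
   which has Euclidean length at most n eta. *)
have step4 (v : vec) : `|v| <= eta ->
    (\int[leb]_(x in A1) Q (x - v)%R <= \int[leb]_(u in A') Q u)%E.
  move=> veta; rewrite [leRHS]integral_mkcond -[leRHS](integral_leb_shift (- v)).
  - rewrite [leLHS]integral_mkcond; apply: le_lower_integral => x _.
      by apply: erestrict_ge0.
    rewrite /patch; case: ifPn => [/set_mem/andP[x1 x2]|_]; last by case: ifPn.
    rewrite mem_set// /A'/=.
    have ve : enorm v <= 1 / 48.
      by apply: (le_trans (enorm_supnorm v)); apply: le_trans neta; rewrite ler_pM2l.
    have := ler_enormB x v; have := ler_enormD x (- v); rewrite enormN; lra.
  - apply/(measurable_restrictT _ _).1; first exact: mA'.
    exact: (measurable_funS measurableT (@subsetT _ _) mQ).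
  - by move=> x; apply: erestrict_ge0.
have mQy : measurable_fun setT (fun x : vec => Q (x - y)).
  by apply: (measurableT_comp mQ); exact: measurable_fun_subv.
rewrite -(@lee_pmul2l _ ((2 * eta) ^+ n)%:E)//.
rewrite -ge0_integralZl_EFin//; last 2 first.
- by apply: measurable_funTS; apply: mD => //; exact: measurable_fun_subv.
- exact: ltW.
apply: (@le_trans _ _ (\int[leb]_(x in A1) ((2 `^ q)%:E * (Q (x - y)%R + Q x)))%E).
  apply: le_lower_integral => x A1x; first by apply: mule_ge0 => //; rewrite lee_fin ltW.
  exact: step1.
rewrite ge0_integralZl_EFin//; last 2 first.
- by move=> x _; exact: adde_ge0.
- by apply: measurable_funTS; exact: emeasurable_funD.
rewrite ge0_integralD//; try exact: measurable_funTS.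
have h0 : (\int[leb]_(x in A1) Q x <= \int[leb]_(u in A') Q u)%E.
  by have := @step4 0; rewrite normr0 => /(_ (ltW eta0)); under eq_integral do rewrite subr0.
have hQ : (\int[leb]_(u in A') Q u <= (n%:R * ((36 * n%:R) ^+ n * (2 * c) ^+ n * 3 ^+ n * S))%:E)%E.
  apply: (@le_trans _ _ (\int[leb]_(u in A') (\sum_(i < n) G i u))%E).
    by apply: le_lower_integral => // u Au; exact: step2.
  rewrite ge0_integral_sum//; last by move=> i; exact: measurable_funTS.
  apply: (@le_trans _ _ (\sum_(i < n) ((36 * n%:R) ^+ n * (2 * c) ^+ n * 3 ^+ n * S)%:E)%E).
    by apply: lee_sum => i _; exact: step3.
  by set Z := (_ * S); rewrite sumEFin lee_fin sumr_const card_ord mulr_natl.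
apply: (@le_trans _ _ ((2 `^ q)%:E * (2 * (n%:R * ((36 * n%:R) ^+ n * (2 * c) ^+ n * 3 ^+ n * S)))%:E)%E).
  apply: lee_wpmul2l; first by rewrite lee_fin powR_ge0.
  rewrite mulr2n mulrDl mul1r EFinD; apply: leeD; last exact: le_trans h0 hQ.
  exact: (le_trans (step4 y yeta) hQ).
rewrite -!EFinM lee_fin /c.
have -> : (2 * (12 * n%:R ^+ 2 * (2 * eta))) ^+ n = (2 * eta) ^+ n * (24 * n%:R ^+ 2) ^+ n :> R.
  by rewrite -exprMn; congr (_ ^+ n); ring.
by rewrite le_eqVlt; apply/orP; left; apply/eqP; ring.
Qed.

End translation_modulus.

(** * Dyadic annuli, geometric sums and powers *)

Section annuli.
Context (R : realType) (n : nat).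
Local Notation vec := 'rV[R]_n.
Local Notation leb := (lebesgue_rV R n).

Definition annulus : set vec := [set x | 1 < enorm x <= 2].

Lemma measurable_annulus : measurable annulus.
Proof.
have := @measurable_enorm_set R n `]1, 2]%classic (measurable_itv _).
by congr measurable; apply/seteqP; split => x /=; rewrite in_itv.
Qed.

Lemma integral_annuli_le (D : set vec) (r : R^nat) (F : vec -> \bar R) :
  (forall i, 0 < r i) -> (forall x, D x -> exists i, r i < enorm x <= 2 * r i) ->
  measurable_fun setT F -> (forall x, 0 <= F x)%E ->
  (\int[leb]_(x in D) F x <=
   \sum_(0 <= i <oo) ((r i ^+ n)%:E * \int[leb]_(x in annulus) F (r i *: x)%R))%E.
Proof.
move=> r0 Dr mF F0.
pose A i := [set x : vec | annulus ((r i)^-1 *: x)].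
have mA i : measurable (A i).
  rewrite -[X in measurable X]setTI.
  apply: measurable_fun_scalev => //; exact: measurable_annulus.
have mFA i : measurable_fun setT (F \_ (A i)).
  apply/(measurable_restrictT _ _).1; first by [].
  exact: (measurable_funS measurableT (@subsetT _ _) mF).
have FA0 i x : (0 <= (F \_ (A i)) x)%E by apply: erestrict_ge0.
have AiE i : (\int[leb]_x (F \_ (A i)) x =
   (r i ^+ n)%:E * \int[leb]_(x in annulus) F (r i *: x)%R)%E.
  have mFr : measurable_fun setT (fun x : vec => F (r i *: x)).
    by apply: (measurableT_comp mF); exact: measurable_fun_scalev.
  have ri : 0 < (r i)^-1 by rewrite invr_gt0.
  have := @integral_scale_in R n (r i)^-1 annulus (fun x => F (r i *: x)) ri measurable_annulus mFr (fun x => F0 _).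
  rewrite exprVn invrK => <-; rewrite -integral_mkcond.
  by apply: eq_integral => x _; rewrite scalerA divff ?scale1r// gt_eqF.
rewrite [leRHS](_ : _ = \int[leb]_x \sum_(0 <= i <oo) (F \_ (A i)) x)%E; last first.
  by rewrite integral_nneseries//; apply: eq_eseriesr => i _; rewrite AiE.
rewrite integral_mkcond; apply: le_lower_integral => x _; first exact: erestrict_ge0.
rewrite {1}/patch; case: ifPn => [/set_mem Dx|_]; last by apply: nneseries_ge0.
have [i /andP[ri1 ri2]] := Dr x Dx.
apply: (@le_trans _ _ ((F \_ (A i)) x)).
  rewrite /patch mem_set// /A/= /annulus/= enormZ normfV gtr0_norm//.
  by rewrite ltr_pdivlMl// mulr1 ri1 ler_pdivrMl// mulrC.
have := @nneseries_lim_ge R (fun i => (F \_ (A i)) x) xpredT 0 i.+1 (fun _ _ _ => FA0 _ _).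
apply: le_trans; rewrite big_nat_recr//= leeDr// sume_ge0// => k _; exact: FA0.
Qed.

End annuli.

Section geometric.
Context (R : realType).

Lemma geometric_eseries_le (a rho : R) : 0 <= a -> 0 <= rho -> rho < 1 ->
  (\sum_(0 <= i <oo) (a * rho ^+ i)%:E <= (a / (1 - rho))%:E)%E.
Proof.
move=> a0 r0 r1; apply: lime_le.
  by apply: is_cvg_nneseries => i _ _; rewrite lee_fin mulr_ge0// exprn_ge0.
apply: nearW => N; rewrite sumEFin lee_fin -mulr_sumr ler_wpM2l//.
rewrite big_mkord -(@ler_pM2l _ (1 - rho)) ?subr_gt0// mulfV ?gt_eqF ?subr_gt0//.
by rewrite -[X in X * _]opprB mulNr -subrX1 opprB lerBlDr lerDl exprn_ge0.
Qed.

Lemma geometric_cut_le (a v : R) (N : nat) : 0 < a -> 0 < v ->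
  \sum_(i < N) (2 `^ (i%:R * a) * ((2 ^+ i < v)%R%:R)) <= (2 * v) `^ a / (2 `^ a - 1).
Proof.
move=> a0 v0.
have c0 : 0 < 2 `^ a - 1 :> R.
  by rewrite subr_gt0 -[ltLHS](congr1 (@^~ a) (powR1 R)); apply: gt0_ltr_powR; rewrite ?nnegrE ?ltr1n.
(* The second bound, for the sum without cut, carries the induction: as long as 2^N < v it implies
   the first, and afterwards the new terms vanish. *)
suff : \sum_(i < N) (2 `^ (i%:R * a) * ((2 ^+ i < v)%R%:R)) <= (2 * v) `^ a / (2 `^ a - 1)
  /\ \sum_(i < N) (2 `^ (i%:R * a) * ((2 ^+ i < v)%R%:R)) <= 2 `^ (N%:R * a) / (2 `^ a - 1).
  by case.
elim: N => [|N [IH1 IH2]].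
  by rewrite big_ord0; split; rewrite divr_ge0 ?powR_ge0 ?ltW.
have e2 : 2 `^ (N.+1%:R * a) = 2 `^ (N%:R * a) * 2 `^ a :> R.
  by rewrite -[N.+1%:R]natr1 mulrDl mul1r powRD// pnatr_eq0 implybT.
have IH : \sum_(i < N.+1) (2 `^ (i%:R * a) * ((2 ^+ i < v)%R%:R)) <= 2 `^ (N.+1%:R * a) / (2 `^ a - 1).
  rewrite big_ord_recr/=; apply: (@le_trans _ _ (2 `^ (N%:R * a) / (2 `^ a - 1) + 2 `^ (N%:R * a))).
    by apply: lerD => //; rewrite ler_piMr ?powR_ge0//; case: (_ < _).
  by rewrite e2 le_eqVlt; apply/orP; left; apply/eqP; field; exact: lt0r_neq0.
split => //; have [h|h] := ltP (2 ^+ N) v.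
  apply: (le_trans IH); apply: ler_wpM2r; first by rewrite invr_ge0 ltW.
  rewrite powRrM powR_mulrn//; apply: ge0_ler_powR; rewrite ?nnegrE ?exprn_ge0 ?mulr_ge0 ?(ltW v0)//.
    exact: ltW.
  by rewrite exprS ler_pM2l// ltW.
by rewrite big_ord_recr/= ltNge h/= mulr0 addr0.
Qed.

(** Whether [u] is above or below 1, u^g lies between 1 and the integer power u^m, and u^m - 1
    factors as u - 1 times a sum of m powers, each at most 2^m. *)
Lemma powR_sub_le (u : R) (g : R) (m : nat) : 0 < u -> u <= 2 -> 0 <= g -> g <= m%:R ->
  `|u `^ g - 1| <= m%:R * 2 ^+ m * `|u - 1|.
Proof.
move=> u0 u2 g0 gm.
apply: (@le_trans _ _ `|u ^+ m - 1|).
  rewrite -(powR_mulrn _ (ltW u0)).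
  have [u1|u1] := leP 1 u.
    have h1 : 1 <= u `^ g by rewrite -[X in X <= _](powRr0 u) ler_powR.
    have h2 : u `^ g <= u `^ m%:R by exact: ler_powR.
    rewrite !ger0_norm; lra.
  have h : u `^ m%:R <= u `^ g.
    by apply: ger_powR => //; rewrite u0 ltW.
  have h1 : u `^ g <= 1.
    by rewrite -[X in _ <= X](powRr0 u); apply: ger_powR => //; rewrite u0 ltW.
  rewrite !ler0_norm; lra.
rewrite subrX1 normrM mulrC; apply: ler_wpM2r; first by [].
apply: (le_trans (ler_norm_sum _ _ _)).
apply: (@le_trans _ _ (\sum_(i < m) (2 ^+ m : R))); last first.
  by rewrite sumr_const card_ord mulr_natl.
apply: ler_sum => i _; rewrite ger0_norm ?exprn_ge0 ?(ltW u0)//.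
apply: (@le_trans _ _ (2 ^+ i)); first by rewrite lerXn2r ?nnegrE// ltW.
by rewrite ler_weXn2l ?ler1n// ltnW.
Qed.

Lemma powRN_sub_le (s t g : R) (m : nat) : 0 < t -> t <= 2 * s -> 0 <= g -> g <= m%:R ->
  `|s `^ (- g) - t `^ (- g)| <= m%:R * 2 ^+ m.+1 * `|s - t| * t `^ (- g - 1).
Proof.
move=> t0 ts g0 gm.
have s0 : 0 < s by lra.
have u0 : 0 < t / s by rewrite divr_gt0.
have u2 : t / s <= 2 by rewrite ler_pdivrMr.
have -> : s `^ (- g) - t `^ (- g) = t `^ (- g) * ((t / s) `^ g - 1).
  rewrite mulrBr mulr1 powRM ?invr_ge0 ?(ltW s0) ?(ltW t0)// mulrA -powRD; last first.
    by rewrite (gt_eqF t0) implybT.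
  by rewrite addNr powRr0 mul1r -powR_inv1 ?(ltW s0)// -powRrM mulN1r.
rewrite normrM ger0_norm ?powR_ge0//.
apply: (@le_trans _ _ (t `^ (- g) * (m%:R * 2 ^+ m * `|t / s - 1|))).
  by rewrite ler_wpM2l ?powR_ge0//; exact: powR_sub_le.
have -> : t `^ (- g - 1) = t `^ (- g) / t.
  by rewrite powRD ?(gt_eqF t0) ?implybT// powR_inv1 ?(ltW t0).
have -> : `|t / s - 1| = `|s - t| / s.
  rewrite -[X in _ - X](divff (lt0r_neq0 s0)) -mulrBl normrM distrC.
  by rewrite [X in _ * X]gtr0_norm ?invr_gt0.
set Z := t `^ (- g); have Z0 : 0 <= Z by exact: powR_ge0.
have -> : Z * (m%:R * 2 ^+ m * (`|s - t| / s)) = (m%:R * 2 ^+ m * `|s - t| * Z) * s^-1.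
  by ring.
have -> : m%:R * 2 ^+ m.+1 * `|s - t| * (Z / t) = (m%:R * 2 ^+ m * `|s - t| * Z) * (2 / t).
  by rewrite exprS; ring.
apply: ler_wpM2l; first by rewrite !mulr_ge0 ?exprn_ge0.
by rewrite ler_pdivlMr// mulrC ler_pdivrMr.
Qed.

End geometric.

Section dyadic.
Context (R : realType).

Lemma dyadic_ge1 (t : R) : 1 < t -> exists i, 2 ^+ i < t <= 2 * 2 ^+ i.
Proof.
move=> t1.
have ex : exists k, t <= 2 ^+ k.
  exists (Num.truncn t).+1; apply/ltW; apply: (lt_le_trans (truncnS_gt t)).
  by rewrite -natrX ler_nat ltnW// ltn_expl.
case: (ex_minnP ex) => -[|k] hk hmin.
  by move: hk; rewrite expr0 leNgt t1.
exists k; rewrite -exprS hk andbT ltNge; apply/negP => h.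
by have := hmin k h; rewrite ltnn.
Qed.

Lemma dyadic_le1 (t : R) : 0 < t -> t <= 1 ->
  exists i, 2^-1 ^+ i.+1 < t <= 2 * 2^-1 ^+ i.+1.
Proof.
move=> t0 t1.
have ex : exists k, t^-1 < 2 ^+ k.
  exists (Num.truncn t^-1).+1; apply: (lt_le_trans (truncnS_gt _)).
  by rewrite -natrX ler_nat ltnW// ltn_expl.
case: (ex_minnP ex) => -[|k] hk hmin.
  by move: hk; rewrite expr0 ltNge -[X in X <= _]invr1 lef_pV2 ?posrE// t1.
exists k; rewrite exprS mulrA mulfV// mul1r -exprS exprVn invf_plt ?posrE ?exprn_gt0// hk/=.
rewrite exprVn -[X in X <= _]invrK lef_pV2 ?posrE ?exprn_gt0 ?invr_gt0//.
by rewrite leNgt; apply/negP => h; have := hmin k h; rewrite ltnn.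
Qed.

Lemma powR_expr (a b : R) (i : nat) : 0 <= a -> (a ^+ i) `^ b = (a `^ b) ^+ i.
Proof. by move=> a0; rewrite -(powR_mulrn i a0) -(powR_mulrn i (powR_ge0 a b)) powRAC. Qed.

Lemma powR_lt1 (b : R) : 0 < b -> 0 <= (2^-1 : R) `^ b < 1.
Proof.
move=> b0; rewrite powR_ge0 -[X in _ < X](congr1 (@^~ b) (powR1 R)).
by apply: gt0_ltr_powR => //; rewrite ?nnegrE ?invr_ge0// invf_lt1// ltr1n.
Qed.

End dyadic.

(** * Size, smoothness and weak-type bounds for the rough kernel *)

Section kernel.
Context (R : realType) (n : nat).
Local Notation vec := 'rV[R]_n.
Local Notation leb := (lebesgue_rV R n).
Variables (W : vec -> R) (alpha beta q IW : R).
Hypothesis n0 : (0 < n)%N.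
Hypothesis alpha0 : 0 < alpha.
Hypothesis beta0 : 0 < beta.
Hypothesis beta1 : beta < 1.
Hypothesis alphabeta : alpha + beta < n%:R.
Hypothesis qE : q = n%:R / (n%:R - alpha).
Hypothesis mW : measurable_fun setT (W : vec -> measurableTypeR R).
Hypothesis hW : homogeneous0 W.
Hypothesis IW0 : 0 <= IW.
Hypothesis hIW : (\int[leb]_(x in ecball 0%R 1%R) (`|W x| `^ q)%:E <= IW%:E)%E.

Local Notation g := (n%:R - alpha).
Let g0 : 0 < g. Proof. by move: beta0 alphabeta; lra. Qed.
Let nR : 0 < n%:R :> R. Proof. by rewrite ltr0n. Qed.
Lemma kernel_q_gt1 : 1 < q.
Proof. by rewrite qE ltr_pdivlMr ?g0// mul1r; move: alpha0; lra. Qed.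
Let q1 := kernel_q_gt1.
Let q0 : 0 < q. Proof. by move: q1; lra. Qed.
Let gq : g * q = n%:R. Proof. by rewrite qE mulrC divfK// gt_eqF// g0. Qed.

Definition kern (z : vec) : R := W z / enorm z `^ g.

Lemma kernE z : kern z = W z * enorm z `^ (- g).
Proof. by rewrite /kern powRN. Qed.

Lemma measurable_kern : measurable_fun setT (kern : vec -> measurableTypeR R).
Proof.
rewrite (_ : (kern : _ -> _) = fun z => W z * enorm z `^ (- g)); last first.
  by apply/funext => z; exact: kernE.
apply: measurable_funM => //; apply: measurable_powR_comp; exact: measurable_enorm.
Qed.

Lemma kernZ s z : 0 < s -> kern (s *: z) = s `^ (- g) * kern z.
Proof.
move=> s0; rewrite !kernE hW// enormZ gtr0_norm// powRM ?enorm_ge0 ?ltW//.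
by ring.
Qed.

Lemma kern0 : kern 0 = 0.
Proof.
have -> : kern 0 = W 0 / 0 `^ g by rewrite /kern (_ : enorm 0 = 0)//; apply/eqP; rewrite enorm_eq0.
by rewrite powR0 ?invr0 ?mulr0// gt_eqF.
Qed.

(** Because g q = n, the volume factor r^n cancels the q-th power of the size r^(-g) of the kernel,
    and an annulus of radius r contributes only r^(beta q). *)
Let rpow (r : R) : 0 < r -> r ^+ n * (r `^ (beta - g)) `^ q = r `^ (beta * q).
Proof.
move=> r0; rewrite -powR_mulrn ?ltW// -powRrM -powRD ?(gt_eqF r0) ?implybT//.
by congr (_ `^ _); rewrite mulrBl gq; ring.
Qed.

Lemma measurable_absW_pow (v : vec) : measurable_fun setT (fun x : vec => (`|W (x - v)| `^ q)%:E).
Proof.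
apply/measurable_EFinP; apply: measurable_powR_comp; apply: measurableT_comp => //.
by apply: (measurableT_comp mW); exact: measurable_fun_subv.
Qed.

Lemma integral_annulus_W (v : vec) : enorm v <= 1 ->
  (\int[leb]_(x in @annulus R n) (`|W (x - v)| `^ q)%:E <= (3 ^+ n * IW)%:E)%E.
Proof.
move=> v1.
have mF := measurable_absW_pow 0.
have mF0 : measurable_fun setT (fun x : vec => (`|W x| `^ q)%:E).
  by move: mF; under eq_fun do rewrite subr0.
apply: (@le_trans _ _ (\int[leb]_(x in ecball 0%R 3%R) (`|W x| `^ q)%:E)%E).
  rewrite [leRHS]integral_mkcond -[leRHS](integral_leb_shift (- v)).
  - rewrite integral_mkcond; apply: le_lower_integral => x _.
      by apply: erestrict_ge0 => z _; rewrite lee_fin powR_ge0.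
    rewrite /patch; case: ifPn => [/set_mem/andP[_ x2]|_]; last first.
      by case: ifPn => // _; rewrite lee_fin powR_ge0.
    rewrite mem_set// /ecball/= subr0; apply: (le_trans (ler_enormD _ _)); rewrite enormN; lra.
  - apply/(measurable_restrictT _ _).1; first exact: measurable_ecball.
    exact: (measurable_funS measurableT (@subsetT _ _) mF0).
  - by move=> x; apply: erestrict_ge0 => z _; rewrite lee_fin powR_ge0.
rewrite integral_homogeneous_ball//; last by move=> t x t0; rewrite hW.
by rewrite EFinM; apply: lee_wpmul2l.
Qed.

Lemma annulus_powN_le1 (x : vec) e : annulus x -> 0 <= e -> enorm x `^ (- e) <= 1.
Proof.
move=> /andP[x1 _] e0; rewrite -[leRHS](powRr0 (enorm x)).
by apply: ler_powR; [exact: ltW|rewrite oppr_le0].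
Qed.

(** The contributions r^(beta q) of the dyadic annuli form a convergent series as beta > 0. The
    radius 3 d is the one reached by x - y when |x - x0| <= 2 d and |y - x0| <= d. *)
Lemma kern_ball_bound : exists2 A, 0 <= A & forall d, 0 < d ->
  (\int[leb]_(x in ecball 0%R (3 * d)%R) ((`|kern x| * enorm x `^ beta) `^ q)%:E <=
   (A * d `^ (beta * q))%:E)%E.
Proof.
have mann := @measurable_annulus R n.
have bq : 0 < beta * q by rewrite mulr_gt0.
have /andP[rho0 rho1] := powR_lt1 bq.
set rho := 2^-1 `^ (beta * q) in rho0 rho1.
have A0 : 0 <= 2 `^ (beta * q) * (3 ^+ n * IW) / (1 - rho).
  by rewrite divr_ge0 ?subr_ge0 ?(ltW rho1)// mulr_ge0 ?powR_ge0// mulr_ge0 ?exprn_ge0.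
exists (2 `^ (beta * q) * (3 ^+ n * IW) / (1 - rho)) => // d d0.
pose F (x : vec) := ((`|kern x| * enorm x `^ beta) `^ q)%:E.
have mF : measurable_fun setT F.
  apply/measurable_EFinP; apply: measurable_powR_comp; apply: measurable_funM.
    by apply: measurableT_comp => //; exact: measurable_kern.
  by apply: measurable_powR_comp; exact: measurable_enorm.
have F0 x : (0 <= F x)%E by rewrite lee_fin powR_ge0.
pose D := [set x : vec | 0 < enorm x <= 4 * d].
apply: (@le_trans _ _ (\int[leb]_(x in D) F x)%E).
  rewrite integral_mkcond [leRHS]integral_mkcond; apply: le_lower_integral => x _.
    by apply: erestrict_ge0 => z _; exact: F0.
  rewrite /patch; case: ifPn => [/set_mem|_]; last by case: ifPn.
  rewrite /ecball/= subr0 => x3; have [->|x0] := eqVneq x 0.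
    rewrite kern0 normr0 mul0r powR0 ?gt_eqF//; by case: ifPn.
  rewrite mem_set// /D/= enorm_gt0 x0/=; lra.
pose r i := 4 * d * 2^-1 ^+ i.+1.
have r0 i : 0 < r i by rewrite !mulr_gt0// exprn_gt0// invr_gt0.
have cov x : D x -> exists i, r i < enorm x <= 2 * r i.
  move=> /andP[x0 x4].
  have [||i /andP[h1 h2]] := @dyadic_le1 _ (enorm x / (4 * d)).
  - by rewrite divr_gt0// mulr_gt0.
  - by rewrite ler_pdivrMr ?mulr_gt0// mul1r.
  have d4 : 0 < 4 * d by rewrite mulr_gt0.
  move: h1 h2; rewrite ltr_pdivlMr// ler_pdivrMr// => h1 h2.
  by exists i; rewrite /r mulrC h1/= mulrCA mulrC -mulrA (mulrC (4 * d)) mulrA.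
apply: (le_trans (integral_annuli_le r0 cov mF F0)).
apply: (@le_trans _ _ (\sum_(0 <= i <oo) ((4 * d) `^ (beta * q) * rho * (3 ^+ n * IW) * rho ^+ i)%:E)%E).
  apply: lee_nneseries => i _.
    by move=> _; apply: mule_ge0; [rewrite lee_fin exprn_ge0// ltW|apply: integral_ge0].
  apply: (@le_trans _ _ ((r i ^+ n)%:E * \int[leb]_(x in @annulus R n)
      (((r i `^ (beta - g)) `^ q)%:E * (`|W (x - 0)| `^ q)%:E))%E).
    apply: lee_wpmul2l; first by rewrite lee_fin exprn_ge0// ltW.
    apply: le_lower_integral => x // ax; rewrite subr0 -EFinM lee_fin.
    rewrite -powRM ?powR_ge0//; apply: ge0_ler_powR; rewrite ?nnegrE ?mulr_ge0 ?powR_ge0 ?(ltW q0)//.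
    rewrite kernZ// normrM (ger0_norm (powR_ge0 _ _)) enormZ (gtr0_norm (r0 i)).
    rewrite (powRM _ (ltW (r0 i)) (enorm_ge0 x)).
    have -> : r i `^ (beta - g) = r i `^ (- g) * r i `^ beta.
      by rewrite -powRD ?(gt_eqF (r0 i)) ?implybT// addrC.
    rewrite kernE normrM (ger0_norm (powR_ge0 _ _)).
    have -> : r i `^ (- g) * (`|W x| * enorm x `^ (- g)) * (r i `^ beta * enorm x `^ beta) =
       (r i `^ (- g) * r i `^ beta * `|W x|) * (enorm x `^ (- g) * enorm x `^ beta) by ring.
    have x0 : 0 < enorm x by case/andP: ax => x1 _; exact: lt_trans x1.
    have -> : enorm x `^ (- g) * enorm x `^ beta = enorm x `^ (- (g - beta)).
      by rewrite -powRD ?(gt_eqF x0) ?implybT//; congr (_ `^ _); ring.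
    rewrite -[leRHS]mulr1; apply: ler_wpM2l; first by rewrite !mulr_ge0 ?powR_ge0.
    apply: annulus_powN_le1 => //; move: alphabeta; lra.
  rewrite ge0_integralZl_EFin//; last 2 first.
  - by apply: measurable_funTS; exact: measurable_absW_pow.
  - exact: powR_ge0.
  rewrite muleA -EFinM rpow//.
  apply: (@le_trans _ _ ((r i `^ (beta * q))%:E * (3 ^+ n * IW)%:E)%E).
    apply: lee_wpmul2l; first by rewrite lee_fin powR_ge0.
    apply: integral_annulus_W; rewrite (_ : enorm 0 = 0)//; by apply/eqP; rewrite enorm_eq0.
  rewrite -EFinM lee_fin /r powRM ?mulr_ge0 ?exprn_ge0 ?invr_ge0 ?(ltW d0)//.
  rewrite powR_expr ?invr_ge0// -/rho exprS le_eqVlt; apply/orP; left; apply/eqP; ring.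
have B0 : 0 <= (4 * d) `^ (beta * q) * rho * (3 ^+ n * IW).
  by rewrite !mulr_ge0 ?powR_ge0 ?exprn_ge0.
apply: (le_trans (geometric_eseries_le B0 rho0 rho1)).
rewrite lee_fin (_ : 4 = 2 * 2)//; last by ring.
rewrite !powRM ?mulr_ge0 ?(ltW d0)//.
have h2 : 2 `^ (beta * q) * rho = 1.
  by rewrite /rho -powRM ?invr_ge0// mulfV// powR1.
rewrite le_eqVlt; apply/orP; left; apply/eqP.
transitivity ((2 `^ (beta * q) * rho) * (2 `^ (beta * q) * (3 ^+ n * IW) / (1 - rho) * d `^ (beta * q))).
  by ring.
by rewrite h2 mul1r.
Qed.

(** Rescaled to the annulus of radius r = 2 d 2^i, the vector [y] has length at most 2^-(i+1). The
    difference of kernels splits into the change of the power of |x|, of size 2^-(i+1), and the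
    change of W, measured by [tau i.+1]. With the weight r^(beta q) the first part is dominated by a
    geometric series of ratio 2^(-(1-beta) q), which is where beta < 1 enters; the second is the
    given series in [tau]. *)
Lemma kern_diff_bound (tau : R^nat) (Ktau : R) :
  (forall j, 0 <= tau j) ->
  (forall j (y : vec), enorm y <= 2^-1 ^+ j ->
     (\int[leb]_(x in @annulus R n) (`|W (x - y) - W x| `^ q)%:E <= (tau j)%:E)%E) ->
  (\sum_(0 <= j <oo) ((2 ^+ j) `^ (beta * q) * tau j)%:E <= Ktau%:E)%E ->
  exists2 A, 0 <= A & forall d (y : vec), 0 < d -> enorm y <= d ->
  (\int[leb]_(x in [set x | (2 * d < enorm x)%R])
     ((`|kern (x - y) - kern x| * enorm x `^ beta) `^ q)%:E <=
   (A * d `^ (beta * q))%:E)%E.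
Proof.
move=> tau0 htau hK.
have mann := @measurable_annulus R n.
have Ktau0 : 0 <= Ktau.
  rewrite -lee_fin; apply: le_trans hK; apply: nneseries_ge0 => i _ _.
  by rewrite lee_fin mulr_ge0 ?powR_ge0.
have b1q : 0 < (1 - beta) * q by rewrite mulr_gt0// subr_gt0.
have /andP[rho0 rho1] := powR_lt1 b1q.
set rho := 2^-1 `^ ((1 - beta) * q) in rho0 rho1.
(* [C1] is the constant of [powRN_sub_le] with m = n. In [c4], one factor 2^q comes from |x|^beta <=
   2 on the annulus, the other from splitting the q-th power of a sum. *)
pose C1 : R := n%:R * 2 ^+ n.+1.
have C10 : 0 <= C1 by rewrite mulr_ge0// exprn_ge0.
pose c4 : R := 2 `^ q * 2 `^ q.
have c40 : 0 <= c4 by rewrite mulr_ge0 ?powR_ge0.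
pose B := 2 `^ (beta * q) * c4.
have B0 : 0 <= B by rewrite mulr_ge0 ?powR_ge0.
have I0 : 0 <= 3 ^+ n * IW by rewrite mulr_ge0// exprn_ge0.
pose A := B * (C1 `^ q * (3 ^+ n * IW) / (1 - rho) + Ktau).
have A0 : 0 <= A.
  rewrite mulr_ge0// addr_ge0// divr_ge0 ?mulr_ge0 ?powR_ge0// ?exprn_ge0// subr_ge0 ltW//.
exists A => // d y d0 yd.
pose F (x : vec) := ((`|kern (x - y) - kern x| * enorm x `^ beta) `^ q)%:E.
have mk := measurable_kern.
have mF : measurable_fun setT F.
  apply/measurable_EFinP; apply: measurable_powR_comp; apply: measurable_funM.
    have md : measurable_fun setT (fun x : vec => kern (x - y) - kern x : measurableTypeR R).
      apply: measurable_funB; last exact: mk.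
      by apply: (measurableT_comp mk); exact: measurable_fun_subv.
    exact: (measurableT_comp (@normr_measurable R setT) md).
  by apply: measurable_powR_comp; exact: measurable_enorm.
have F0 x : (0 <= F x)%E by rewrite lee_fin powR_ge0.
have d2 : 0 < 2 * d by rewrite mulr_gt0.
pose r i := 2 * d * 2 ^+ i.
have r0 i : 0 < r i by rewrite /r mulr_gt0// exprn_gt0.
have cov (x : vec) : [set x : vec | 2 * d < enorm x] x -> exists i, r i < enorm x <= 2 * r i.
  move=> /= xd; have [|i /andP[h1 h2]] := @dyadic_ge1 _ (enorm x / (2 * d)).
    by rewrite ltr_pdivlMr// mul1r.
  move: h1 h2; rewrite ltr_pdivlMr// ler_pdivrMr// => h1 h2.
  by exists i; rewrite /r (mulrC (2 * d)) h1/= mulrA.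
apply: (le_trans (integral_annuli_le r0 cov mF F0)).
pose E1 i := B * d `^ (beta * q) * (C1 `^ q * (3 ^+ n * IW)) * rho ^+ i.
pose E2 i := B * d `^ (beta * q) * ((2 ^+ i.+1) `^ (beta * q) * tau i.+1).
have E10 i : 0 <= E1 i by rewrite !mulr_ge0 ?powR_ge0 ?exprn_ge0.
have E20 i : 0 <= E2 i by rewrite !mulr_ge0 ?powR_ge0 ?exprn_ge0.
apply: (@le_trans _ _ (\sum_(0 <= i <oo) ((E1 i)%:E + (E2 i)%:E))%E).
  apply: lee_nneseries => i _.
    by move=> _; apply: mule_ge0; [rewrite lee_fin exprn_ge0// ltW|apply: integral_ge0].
  set y' := (r i)^-1 *: y.
  have ey' : enorm y' <= 2^-1 ^+ i.+1.
    rewrite /y' enormZ normfV (gtr0_norm (r0 i)) ler_pdivrMl//.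
    have -> : r i * 2^-1 ^+ i.+1 = d.
      have e0 : 2 ^+ i != 0 :> R by rewrite expf_neq0.
      by rewrite /r exprVn exprS; field.
    exact: yd.
  have y12 : enorm y' <= 2^-1.
    apply: (le_trans ey'); rewrite -[leRHS]expr1; apply: ler_wiXn2l => //.
    by rewrite invf_le1// ler1n.
  have y'1 : enorm y' <= 1 by apply: (le_trans y12); rewrite invf_le1// ler1n.
  have hb := integral_annulus_W y'1.
  have ht : (\int[leb]_(x in @annulus R n) (`|W (x - y') - W x| `^ q)%:E <= (tau i.+1)%:E)%E.
    exact: htau.
  pose a := (C1 * 2^-1 ^+ i.+1) `^ q.
  have mH1 : measurable_fun (@annulus R n) (fun x : vec => (`|W (x - y')| `^ q)%:E).
    by apply: measurable_funTS; exact: measurable_absW_pow.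
  have mH2 : measurable_fun (@annulus R n) (fun x : vec => (`|W (x - y') - W x| `^ q)%:E).
    apply: measurable_funTS; apply: measurable_powR_dist => //.
    by apply: (measurableT_comp mW); exact: measurable_fun_subv.
  apply: (@le_trans _ _ ((r i ^+ n)%:E * \int[leb]_(x in @annulus R n)
      (((r i `^ (beta - g)) `^ q * c4)%:E *
        (a%:E * (`|W (x - y')| `^ q)%:E + (`|W (x - y') - W x| `^ q)%:E)))%E).
    apply: lee_wpmul2l; first by rewrite lee_fin exprn_ge0// ltW.
    apply: le_lower_integral => x // ax; rewrite -!EFinM lee_fin.
    have x1 : 1 < enorm x by case/andP: ax.
    have x2 : enorm x <= 2 by case/andP: ax.
    have x0 : 0 < enorm x by lra.
    have -> : r i *: x - y = r i *: (x - y').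
      by rewrite scalerBr /y' scalerA mulfV ?scale1r// gt_eqF.
    rewrite !kernZ// -mulrBr normrM (ger0_norm (powR_ge0 _ _)) enormZ (gtr0_norm (r0 i)).
    rewrite (powRM _ (ltW (r0 i)) (enorm_ge0 x)).
    have -> : r i `^ (beta - g) = r i `^ (- g) * r i `^ beta.
      by rewrite -powRD ?(gt_eqF (r0 i)) ?implybT// addrC.
    set u := `|W (x - y')|; set w := `|W (x - y') - W x|.
    have u0 : 0 <= u by exact: normr_ge0.
    have w0 : 0 <= w by exact: normr_ge0.
    have hk : `|kern (x - y') - kern x| <= u * (C1 * 2^-1 ^+ i.+1) + w.
      have xy : enorm x <= 2 * enorm (x - y').
        by have := ler_enormB x y'; lra.
      have -> : kern (x - y') - kern x =
          W (x - y') * (enorm (x - y') `^ (- g) - enorm x `^ (- g)) +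
          (W (x - y') - W x) * enorm x `^ (- g) by rewrite !kernE; ring.
      apply: (le_trans (ler_normD _ _)); rewrite !normrM -/u -/w; apply: lerD.
        apply: ler_wpM2l => //.
        have gn : g <= n%:R by rewrite lerBlDr lerDl ltW.
        apply: (le_trans (powRN_sub_le x0 xy (ltW g0) gn)); rewrite -/C1 -mulrA.
        apply: ler_wpM2l => //; rewrite -[leRHS]mulr1; apply: ler_pM; rewrite ?powR_ge0//.
          apply: le_trans ey'; apply: (le_trans (ler_dist_enorm _ _)).
          by rewrite addrAC subrr sub0r enormN.
        rewrite -opprD; apply: annulus_powN_le1 => //; have := g0; lra.
      rewrite -[leRHS]mulr1; apply: ler_wpM2l => //.
      rewrite (ger0_norm (powR_ge0 _ _)); apply: annulus_powN_le1 => //; exact: ltW.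
    have xb : enorm x `^ beta <= 2.
      apply: le_trans x2; rewrite -[leRHS](powRr1 (ltW x0)).
      by apply: (ler_powR (ltW x1)); exact: ltW.
    apply: (@le_trans _ _ ((r i `^ (- g) * r i `^ beta * (2 * (u * (C1 * 2^-1 ^+ i.+1) + w))) `^ q)).
      apply: ge0_ler_powR; rewrite ?nnegrE ?mulr_ge0 ?addr_ge0 ?powR_ge0 ?mulr_ge0 ?exprn_ge0 ?invr_ge0 ?(ltW q0)//.
      rewrite mulrACA; apply: ler_wpM2l; first by rewrite mulr_ge0 ?powR_ge0.
      by rewrite mulrC; apply: ler_pM; rewrite ?powR_ge0.
    have pp : 0 <= C1 * 2^-1 ^+ i.+1 by rewrite mulr_ge0 ?exprn_ge0 ?invr_ge0.
    rewrite powRM ?mulr_ge0 ?powR_ge0 ?addr_ge0 ?mulr_ge0//.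
    rewrite -[leRHS]mulrA; apply: ler_wpM2l; first by rewrite powR_ge0.
    rewrite powRM ?addr_ge0 ?mulr_ge0// /c4 -[leRHS]mulrA; apply: ler_wpM2l; first by rewrite powR_ge0.
    (* Taken between the first summand and the opposite of the second, by way of 0, this bounds the
       q-th power of their sum. *)
    have := @powR_dist_le R q (u * (C1 * 2^-1 ^+ i.+1)) 0 (- w) (ltW q0).
    rewrite !opprK subr0 add0r !ger0_norm ?addr_ge0 ?mulr_ge0// => h.
    by apply: (le_trans h); rewrite powRM// (mulrC _ a).
  rewrite ge0_integralZl_EFin//; last 3 first.
  - by move=> x _; apply: adde_ge0; rewrite -?EFinM lee_fin ?mulr_ge0 ?powR_ge0.
  - by apply: emeasurable_funD => //; exact: measurable_funeM.
  - by rewrite mulr_ge0 ?powR_ge0.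
  rewrite ge0_integralD//; last 2 first.
  - by move=> x _; rewrite -EFinM lee_fin mulr_ge0 ?powR_ge0.
  - exact: measurable_funeM.
  rewrite ge0_integralZl_EFin ?powR_ge0//.
  rewrite muleA -EFinM mulrA rpow//.
  apply: (@le_trans _ _ ((r i `^ (beta * q) * c4)%:E * (a%:E * (3 ^+ n * IW)%:E + (tau i.+1)%:E))%E).
    apply: lee_wpmul2l; first by rewrite lee_fin mulr_ge0 ?powR_ge0.
    by apply: leeD => //; apply: lee_wpmul2l => //; rewrite lee_fin powR_ge0.
  rewrite -(EFinM a) -(EFinD _ (tau _)) -EFinM -EFinD lee_fin.
  have rE : r i `^ (beta * q) = 2 `^ (beta * q) * d `^ (beta * q) * (2 `^ (beta * q)) ^+ i.
    rewrite /r powRM ?exprn_ge0 ?mulr_ge0 ?(ltW d0)// powRM ?(ltW d0)//.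
    by rewrite powR_expr.
  rewrite mulrDr; apply: lerD.
    rewrite rE /E1 /B /a powRM ?exprn_ge0 ?invr_ge0// powR_expr ?invr_ge0//.
    have hrho : (2 `^ (beta * q)) ^+ i * (2^-1 `^ q) ^+ i = rho ^+ i.
      rewrite -exprMn; congr (_ ^+ i).
      have p2 : 2^-1 `^ q = 2 `^ (- q) :> R by rewrite powRN -powR_inv1// -powRrM mulN1r powRN.
      have p3 : rho = 2 `^ (- ((1 - beta) * q)).
        by rewrite /rho -(@powR_inv1 _ 2)// -powRrM mulN1r.
      rewrite p2 p3 -powRD ?pnatr_eq0 ?implybT//; congr (_ `^ _); ring.
    rewrite -hrho exprS.
    have h21 : 2^-1 `^ q <= 1 by have /andP[_ /ltW] := powR_lt1 q0.
    set X := 2 `^ (beta * q); set Y := d `^ _; set Z := C1 `^ q; set V := 3 ^+ n * IW.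
    have -> : X * Y * X ^+ i * c4 * (Z * (2^-1 `^ q * (2^-1 `^ q) ^+ i) * V) =
      (X * c4 * Y * (Z * V) * (X ^+ i * (2^-1 `^ q) ^+ i)) * 2^-1 `^ q by ring.
    rewrite ler_piMr// !mulr_ge0 ?exprn_ge0 ?powR_ge0//.
  rewrite rE /E2 /B.
  have -> : (2 ^+ i.+1) `^ (beta * q) = (2 `^ (beta * q)) ^+ i * 2 `^ (beta * q) :> R.
    by rewrite powR_expr// exprSr.
  set X := 2 `^ (beta * q); set Y := d `^ _.
  have -> : X * c4 * Y * (X ^+ i * X * tau i.+1) = X * Y * X ^+ i * c4 * tau i.+1 * X by ring.
  rewrite ler_peMr// ?mulr_ge0 ?exprn_ge0 ?powR_ge0//.
  rewrite -[leLHS](powRr0 2); apply: ler_powR; rewrite ?ler1n//.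
  by rewrite mulr_ge0 ?ltW.
rewrite nneseriesD//; last 2 first.
- by move=> i _ _; rewrite lee_fin.
- by move=> i _ _; rewrite lee_fin.
have -> : A * d `^ (beta * q) = B * d `^ (beta * q) * (C1 `^ q * (3 ^+ n * IW)) / (1 - rho)
    + B * d `^ (beta * q) * Ktau by rewrite /A; ring.
rewrite EFinD; apply: leeD.
  by apply: geometric_eseries_le => //; rewrite !mulr_ge0 ?powR_ge0.
under eq_eseriesr do rewrite EFinM.
rewrite nneseriesZl; last by move=> i _; rewrite lee_fin mulr_ge0 ?powR_ge0.
rewrite [leRHS]EFinM; apply: lee_wpmul2l; first by rewrite lee_fin mulr_ge0 ?powR_ge0.
apply: le_trans hK.
pose u j := ((2 ^+ j) `^ (beta * q) * tau j)%:E.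
have u0 j : (0 <= u j)%E by rewrite lee_fin mulr_ge0 ?powR_ge0.
rewrite (nneseries_recl (f := u))// -(@nneseries_addn _ u 1)//.
rewrite (eq_eseriesr (g := fun i => u (i + 1)%N)); last by move=> i _; rewrite addn1.
by rewrite leeDr.
Qed.

Lemma indic_bool (T : Type) (P : T -> bool) :
  (fun x => (P x)%:R) = (\1_[set x | P x] : T -> R).
Proof.
apply/funext => x; rewrite indicE; have [h|/negP h] := boolP (P x); first by rewrite mem_set.
by rewrite memNset.
Qed.

Definition kern_cut t (x : vec) := (`|kern x| * ((t < `|kern x|)%R%:R))%:E.

Lemma measurable_kern_cut t : measurable_fun setT (kern_cut t).
Proof.
have mk := measurable_kern.
have mn : measurable_fun setT (fun x : vec => `|kern x| : measurableTypeR R).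
  exact: (measurableT_comp (@normr_measurable R setT) mk).
apply/measurable_EFinP; apply: measurable_funM; first exact: mn.
rewrite (_ : (fun x => _) = (\1_[set x : vec | t < `|kern x|] : vec -> R)).
  apply: measurable_indic; have := mn measurableT `]t, +oo[%classic (measurable_itv _).
  by rewrite setTI; congr measurable; apply/seteqP; split => x /=; rewrite in_itv/= andbT.
exact: indic_bool.
Qed.

(** Since the kernel is homogeneous of degree -g and g q = n, dilation reduces everything to t = 1.
    In the unit ball |k| is integrable because alpha > 0. On the annulus of radius 2^i outside it,
    |k| > 1 forces 2^(i g) < |W|, and the masses 2^(i alpha) |W| over these i add up to a multiple
    of |W|^(1 + alpha/g) = |W|^q. *)
Lemma kern_weak_bound : exists2 A, 0 <= A & forall t, 0 < t ->
  (\int[leb]_x kern_cut t x <= (A * t `^ (1 - q))%:E)%E.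
Proof.
have mann := @measurable_annulus R n.
have cut0 t x : (0 <= kern_cut t x)%E by rewrite lee_fin mulr_ge0.
have I0 : 0 <= 3 ^+ n * IW by rewrite mulr_ge0// exprn_ge0.
have mWq : measurable_fun (@annulus R n) (fun x : vec => (`|W x| `^ q)%:E).
  by apply: measurable_funTS; have := measurable_absW_pow 0; under eq_fun do rewrite subr0.
have hb : (\int[leb]_(x in @annulus R n) (`|W x| `^ q)%:E <= (3 ^+ n * IW)%:E)%E.
  have e0 : enorm (0 : vec) <= 1 by rewrite (_ : enorm 0 = 0)//; apply/eqP; rewrite enorm_eq0.
  by have := integral_annulus_W e0; under eq_integral do rewrite subr0.
have kW x : annulus x -> `|kern x| <= `|W x|.
  move=> ax; rewrite kernE normrM (ger0_norm (powR_ge0 _ _)) -[leRHS]mulr1.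
  by apply: ler_wpM2l => //; apply: annulus_powN_le1 => //; exact: ltW.
have rg (r : R) : 0 < r -> r ^+ n * r `^ (- g) = r `^ alpha.
  move=> r0; rewrite -powR_mulrn ?ltW// -powRD ?(gt_eqF r0) ?implybT//.
  by congr (_ `^ _); ring.
have [M M0 hM] : exists2 M, 0 <= M & (\int[leb]_x kern_cut 1%R x <= M%:E)%E.
  pose D := [set x : vec | 0 < enorm x <= 1].
  pose D' := [set x : vec | 1 < enorm x].
  have mD : measurable D.
    have := @measurable_enorm_set R n `]0, 1]%classic (measurable_itv _).
    by congr measurable; apply/seteqP; split => x /=; rewrite in_itv.
  have mD' : measurable D'.
    have := @measurable_enorm_set R n `]1, +oo[%classic (measurable_itv _).
    by congr measurable; apply/seteqP; split => x /=; rewrite in_itv/= andbT.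
  have mcut := measurable_kern_cut 1.
  have mcD (E : set vec) : measurable E -> measurable_fun setT (kern_cut 1%R \_ E).
    move=> mE; apply/(measurable_restrictT _ _).1; first exact: mE.
    exact: (measurable_funS measurableT (@subsetT _ _) mcut).
  have /andP[rho0 rho1] := powR_lt1 alpha0.
  set rho := 2^-1 `^ alpha in rho0 rho1.
  pose V := 2 ^+ n * ballvol R n + 3 ^+ n * IW.
  have V0 : 0 <= V by rewrite addr_ge0// mulr_ge0 ?exprn_ge0// ltW// ballvol_gt0.
  pose C2 : R := 2 `^ (alpha / g) / (2 `^ (alpha / g) - 1).
  have hin : (\int[leb]_(x in D) kern_cut 1%R x <= (V / (1 - rho))%:E)%E.
    pose r i : R := 2^-1 ^+ i.+1.
    have r0 i : 0 < r i by rewrite exprn_gt0// invr_gt0.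
    have cov x : D x -> exists i, r i < enorm x <= 2 * r i.
      by move=> /andP[x0 x1]; exact: dyadic_le1.
    apply: (le_trans (integral_annuli_le r0 cov mcut (cut0 1))).
    apply: (@le_trans _ _ (\sum_(0 <= i <oo) (V * rho ^+ i)%:E)%E); last exact: geometric_eseries_le.
    apply: lee_nneseries => i _.
      by move=> _; apply: mule_ge0; [rewrite lee_fin exprn_ge0// ltW|apply: integral_ge0].
    apply: (@le_trans _ _ ((r i ^+ n)%:E * \int[leb]_(x in @annulus R n)
        ((r i `^ (- g))%:E * (1 + (`|W x| `^ q)%:E)))%E).
      apply: lee_wpmul2l; first by rewrite lee_fin exprn_ge0// ltW.
      apply: le_lower_integral => x // ax; rewrite -EFinD -EFinM lee_fin.
      apply: (@le_trans _ _ `|kern (r i *: x)|); first by rewrite ler_piMr//; case: (_ < _)%R.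
      rewrite kernZ// normrM (ger0_norm (powR_ge0 _ _)); apply: ler_wpM2l; first exact: powR_ge0.
      apply: (le_trans (kW x ax)); have [w1|w1] := leP `|W x| 1.
        by rewrite (le_trans w1)// lerDl powR_ge0.
      apply: (@le_trans _ _ (`|W x| `^ q)); last by rewrite lerDr.
      by apply: le1r_powR; exact: ltW.
    rewrite ge0_integralZl_EFin//; last 3 first.
    - by move=> x _; rewrite -EFinD lee_fin addr_ge0 ?powR_ge0.
    - exact: emeasurable_funD.
    - exact: powR_ge0.
    rewrite ge0_integralD// muleA -EFinM rg// integral_cst// mul1e.
    apply: (@le_trans _ _ ((r i `^ alpha)%:E * V%:E)%E).
      apply: lee_wpmul2l; first by rewrite lee_fin powR_ge0.
      rewrite EFinD; apply: leeD => //; rewrite -(leb_ecball (0 : vec))//; apply: le_measure; rewrite ?inE//.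
        exact: measurable_ecball.
      by move=> x /andP[_ x2]; rewrite /ecball/= subr0.
    rewrite -EFinM lee_fin mulrC; apply: ler_wpM2l => //.
    rewrite /r powR_expr ?invr_ge0// -/rho exprS ler_piMl ?exprn_ge0// ltW//.
  have ag : 0 < alpha / g by rewrite divr_gt0.
  have hout : (\int[leb]_(x in D') kern_cut 1%R x <= ((2 `^ alpha / (2 `^ alpha - 1)) * (3 ^+ n * IW))%:E)%E.
    pose r i : R := 2 ^+ i.
    have r0 i : 0 < r i by rewrite exprn_gt0.
    have cov x : D' x -> exists i, r i < enorm x <= 2 * r i by exact: dyadic_ge1.
    apply: (le_trans (integral_annuli_le r0 cov mcut (cut0 1))).
    (* The condition 2^i < v x is 2^(i g) < |W x|, in the form that [geometric_cut_le] sums. *)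
    pose v (x : vec) := `|W x| `^ g^-1.
    pose h i (x : vec) := (`|W x| * (2 `^ (i%:R * alpha) * (2 ^+ i < v x)%R%:R))%:E.
    have h0 i x : (0 <= h i x)%E by rewrite lee_fin !mulr_ge0 ?powR_ge0.
    have mnW : measurable_fun setT (fun x : vec => `|W x| : measurableTypeR R).
      exact: (measurableT_comp (@normr_measurable R setT) mW).
    have mv : measurable_fun setT (v : vec -> measurableTypeR R).
      by apply: measurable_powR_comp.
    have mh i : measurable_fun (@annulus R n) (h i).
      apply: measurable_funTS; apply/measurable_EFinP; apply: measurable_funM; first exact: mnW.
      apply: measurable_funM; first by [].
      rewrite (_ : (fun x => _) = (\1_[set x : vec | 2 ^+ i < v x] : vec -> R)).
        apply: measurable_indic; have := mv measurableT `]2 ^+ i, +oo[%classic (measurable_itv _).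
        by rewrite setTI; congr measurable; apply/seteqP; split => x /=; rewrite in_itv/= andbT.
      exact: indic_bool.
    apply: (@le_trans _ _ (\sum_(0 <= i <oo) \int[leb]_(x in @annulus R n) h i x)%E).
      apply: lee_nneseries => i _.
        by move=> _; apply: mule_ge0; [rewrite lee_fin exprn_ge0// ltW|apply: integral_ge0].
      rewrite -ge0_integralZl_EFin//; last 2 first.
      - apply: measurable_funTS; apply: (measurableT_comp mcut).
        exact: measurable_fun_scalev.
      - by rewrite exprn_ge0// ltW.
      apply: le_lower_integral => x; first by move=> _; apply: mule_ge0 => //; rewrite lee_fin exprn_ge0// ltW.
      move=> ax; rewrite /kern_cut -EFinM lee_fin kernZ// normrM (ger0_norm (powR_ge0 _ _)).
      rewrite mulrA mulrA rg//.
      have -> : r i `^ alpha = 2 `^ (i%:R * alpha).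
        by rewrite /r powRrM powR_mulrn.
      rewrite -mulrA [leRHS]mulrCA; apply: ler_wpM2l; first exact: powR_ge0.
      apply: ler_pM => //; first exact: kW.
      case: ltP => [lt1|_]; last by case: (_ < _).
      rewrite (_ : (2 ^+ i < v x) = true)//.
      have w0 : r i `^ g < `|W x|.
        apply: (lt_le_trans _ (kW x ax)).
        by rewrite -[ltLHS]mulr1 -ltr_pdivlMl ?powR_gt0// -powRN; move: lt1.
      have hr : r i = (r i `^ g) `^ g^-1.
        by rewrite -powRrM mulfV ?gt_eqF// powRr1// ltW.
      rewrite /v -/(r i) [X in (X < _)%R]hr.
      by apply: gt0_ltr_powR => //; rewrite ?invr_gt0// nnegrE ?powR_ge0.
    rewrite -integral_nneseries//.
    apply: (@le_trans _ _ (\int[leb]_(x in @annulus R n) ((2 `^ alpha / (2 `^ alpha - 1))%:E * (`|W x| `^ q)%:E))%E).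
      apply: le_lower_integral => x _; first by apply: nneseries_ge0.
      have [W0|W0] := eqVneq (`|W x|) 0.
        rewrite eseries0 ?W0//; last by move=> i _ _; rewrite /h W0 mul0r.
        by rewrite -EFinM lee_fin mulr_ge0 ?powR_ge0 ?divr_ge0 ?powR_ge0// subr_ge0 -[leLHS](powRr0 2) ler_powR ?ler1n// ltW.
      have wp : 0 < `|W x| by rewrite lt_def W0/=.
      have vp : 0 < v x by rewrite powR_gt0.
      apply: lime_le; first by apply: is_cvg_nneseries.
      apply: nearW => N; rewrite big_mkord sumEFin lee_fin -mulr_sumr.
      apply: (@le_trans _ _ (`|W x| * ((2 * v x) `^ alpha / (2 `^ alpha - 1)))).
        by apply: ler_wpM2l => //; exact: geometric_cut_le.
      rewrite powRM ?powR_ge0// -powRrM -[X in X * (_ / _)](powRr1 (ltW wp)).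
      have -> : q = 1 + g^-1 * alpha by rewrite qE; field; rewrite gt_eqF.
      rewrite [in leRHS]powRD ?(gt_eqF wp) ?implybT//.
      by rewrite le_eqVlt; apply/orP; left; apply/eqP; ring.
    have c0 : 0 <= 2 `^ alpha / (2 `^ alpha - 1) :> R.
      by rewrite divr_ge0 ?powR_ge0// subr_ge0 -[leLHS](powRr0 2) ler_powR ?ler1n// ltW.
    rewrite ge0_integralZl_EFin// [leRHS]EFinM; apply: lee_wpmul2l => //.
  exists (V / (1 - rho) + 2 `^ alpha / (2 `^ alpha - 1) * (3 ^+ n * IW)).
    rewrite addr_ge0//; first by rewrite divr_ge0// subr_ge0 ltW.
    rewrite mulr_ge0// divr_ge0 ?powR_ge0// subr_ge0 -[leLHS](powRr0 2) ler_powR ?ler1n// ltW//.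
  apply: (@le_trans _ _ (\int[leb]_x ((kern_cut 1%R \_ D) x + (kern_cut 1%R \_ D') x))%E).
    apply: le_lower_integral => x // _.
    rewrite /patch; have [->|x0] := eqVneq x 0.
      by rewrite [leLHS](_ : _ = 0%E); [apply: adde_ge0; case: ifPn|rewrite /kern_cut kern0 normr0 mul0r].
    have xp : 0 < enorm x by rewrite enorm_gt0.
    have [x1|x1] := leP (enorm x) 1.
      by rewrite [x \in D]mem_set ?leeDl//; [case: ifPn|rewrite /D/= xp].
    by rewrite [x \in D']mem_set ?leeDr//; case: ifPn.
  rewrite ge0_integralD//; last 4 first.
  - by move=> x _; apply: erestrict_ge0.
  - exact: mcD.
  - by move=> x _; apply: erestrict_ge0.
  - exact: mcD.
  by rewrite -!integral_mkcond EFinD; exact: leeD.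
exists M => // t t0.
(* The dilation by t^(-1/g) brings the level [t] to 1. *)
pose s := t `^ (- g^-1).
have s0 : 0 < s by exact: powR_gt0.
have sg : s `^ (- g) = t.
  by rewrite /s -powRrM mulrNN mulVf ?gt_eqF// powRr1// ltW.
have sn : s ^+ n * t = t `^ (1 - q).
  rewrite /s -powR_mulrn ?powR_ge0// -powRrM -[X in _ * X](powRr1 (ltW t0)) -powRD ?(gt_eqF t0) ?implybT//.
  congr (_ `^ _); rewrite qE; ring.
have mcut := measurable_kern_cut t.
have := integral_leb_affine (t := s) 0 (lt0r_neq0 s0) mcut (cut0 t).
rewrite (gtr0_norm s0) => <-.
have -> : (\int[leb]_x kern_cut t (s *: x + 0)%R = t%:E * \int[leb]_x kern_cut 1%R x)%E.
  rewrite -ge0_integralZl_EFin//; last 2 first.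
  - exact: measurable_kern_cut.
  - exact: ltW.
  apply: eq_integral => x _; rewrite addr0 /kern_cut kernZ// sg normrM (gtr0_norm t0).
  by rewrite -EFinM mulrA -[X in (X < _)%R]mulr1 ltr_pM2l.
rewrite muleA -EFinM sn [leRHS]EFinM [in leRHS]muleC.
by apply: lee_wpmul2l => //; rewrite lee_fin powR_ge0.
Qed.

End kernel.

(** * The Dini integral as a dyadic sum *)

Section dini.
Context (R : realType).

(** As [w] is nondecreasing, the integrand on ]2^-(i+1), 2^-i[ is at least w(2^-(i+1)) 2^(i
    (1+beta)); multiplied by the length of the interval, this is the i-th term divided by
    2^(1+beta). An infinite value of [w] at one of these points would make the sum infinite. *)
Lemma dini_sum (w : R -> \bar R) (beta : R) : 0 < beta ->
  (forall d, 0 <= w d)%E -> (forall d d', d <= d' -> (w d <= w d')%E) ->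
  (\int[lebesgue_measure]_(d in `]0%R, 1%R[) (w d * ((d `^ (1 + beta))^-1)%:E) < +oo)%E ->
  exists2 D, 0 <= D &
    (forall i, w (2^-1 ^+ i.+1) \is a fin_num) /\
    (\sum_(0 <= i <oo) ((2 ^+ i.+1) `^ beta * fine (w (2^-1 ^+ i.+1)))%:E <= D%:E)%E.
Proof.
move=> b0 w0 wnd hint.
pose I i : set R := `](2^-1 ^+ i.+1), (2^-1 ^+ i)[%classic.
pose c i := (w (2^-1 ^+ i.+1)%R * ((2 ^+ i) `^ (1 + beta))%:E)%E.
have c0 i : (0 <= c i)%E by apply: mule_ge0 => //; rewrite lee_fin powR_ge0.
pose h (d : R) := (\sum_(0 <= i <oo) (c i * (\1_(I i) d)%:E))%E.
have p2 i : 0 < 2^-1 ^+ i :> R by rewrite exprn_gt0// invr_gt0.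
have hh d : (0 <= h d)%E.
  by apply: nneseries_ge0 => i _ _; apply: mule_ge0 => //; rewrite lee_fin.
have Iuniq d i k : I i d -> I k d -> i = k.
  rewrite /I /= !in_itv/= => /andP[i1 i2] /andP[k1 k2].
  have anti : forall a b : nat, 2^-1 ^+ a.+1 < d -> d < 2^-1 ^+ b -> (b <= a)%N.
    move=> a b h1 h2; rewrite leqNgt; apply/negP => ab.
    have : 2^-1 ^+ b <= 2^-1 ^+ a.+1 :> R.
      by apply: ler_wiXn2l => //; rewrite invf_le1// ler1n.
    by rewrite leNgt (lt_trans h1 h2).
  by apply/eqP; rewrite eqn_leq !anti.
have hle d : d \in `]0, 1[ -> (h d <= w d * ((d `^ (1 + beta))^-1)%:E)%E.
  rewrite in_itv/= => /andP[d0 d1].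
  have f0 : (0 <= w d * ((d `^ (1 + beta))^-1)%:E)%E.
    by apply: mule_ge0 => //; rewrite lee_fin invr_ge0 powR_ge0.
  have [[k Ik]|nI] := pselect (exists k, I k d); last first.
    rewrite /h eseries0// => i _ _.
    by rewrite indicE memNset ?mule0// => Ii; apply: nI; exists i.
  apply: lime_le.
    by apply: is_cvg_nneseries => i _ _; apply: mule_ge0 => //; rewrite lee_fin.
  apply: nearW => N; rewrite (eq_bigr (fun i => if i == k then c i else 0%E)); last first.
    move=> i _; rewrite indicE; case: eqP => [->|ik]; first by rewrite mem_set// mule1.
    by rewrite memNset ?mule0// => Ii; apply: ik; exact: Iuniq Ii Ik.
  rewrite -big_mkcond big_nat1_eq /=; case: ifP => // _.
  move: Ik; rewrite /I/= in_itv/= => /andP[k1 k2]; rewrite /c; apply: lee_pmul => //.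
    exact/wnd/ltW.
  rewrite lee_fin -(invrK (2 ^+ k)) -exprVn.
  rewrite -powR_inv1 ?(ltW (p2 _))// -powRrM mulN1r powRN lef_pV2 ?posrE ?powR_gt0//.
  by apply: ge0_ler_powR; rewrite ?nnegrE ?ltW// addr_gt0.
have mI i : measurable (I i) by exact: measurable_itv.
have hsum : (\int[lebesgue_measure]_(d in `]0%R, 1%R[) h d =
    \sum_(0 <= i <oo) (c i * (2^-1 ^+ i.+1)%:E))%E.
  rewrite integral_nneseries//; last 2 first.
  - move=> i; apply: measurable_funeM. apply: measurable_funTS. apply/measurable_EFinP. apply: measurable_indic. exact: mI.
  - by move=> i x _; apply: mule_ge0 => //; rewrite lee_fin.
  apply: eq_eseriesr => i _; rewrite ge0_integralZl//; last first.
    by apply: measurable_funTS; apply/measurable_EFinP; apply: measurable_indic; exact: mI.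
  rewrite integral_indic//; last exact: mI. congr (_ * _)%E.
  rewrite setIidl; last first.
    move=> x; rewrite /I/= !in_itv/= => /andP[x1 x2]; rewrite (lt_trans (p2 _) x1)/=.
    by apply: (lt_le_trans x2); apply: exprn_ile1; rewrite ?invr_ge0// invf_le1// ler1n.
  rewrite -[LHS]/(@lebesgue_measure R (I i)) /I lebesgue_measure_itv/= lte_fin ifT; last first.
    by rewrite exprS gtr_pMl ?p2// invf_lt1// ltr1n.
  by rewrite -EFinD; congr EFin; rewrite exprS; field.
have fin : (\sum_(0 <= i <oo) (c i * (2^-1 ^+ i.+1)%:E) < +oo)%E.
  rewrite -hsum; apply: le_lt_trans hint; apply: le_lower_integral => d // hd.
  by apply: hle.
have ci0 i : (0 <= c i * (2^-1 ^+ i.+1)%:E)%E by apply: mule_ge0.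
have wfin i : w (2^-1 ^+ i.+1) \is a fin_num.
  rewrite ge0_fin_numE// ltey; apply/eqP => wi.
  have := @nneseries_lim_ge R (fun i => c i * (2^-1 ^+ i.+1)%:E)%E xpredT 0 i.+1 (fun _ _ _ => ci0 _).
  rewrite big_nat_recr//= {2}/c wi gt0_mulye ?lte_fin ?powR_gt0 ?exprn_gt0// gt0_mulye ?lte_fin//.
  rewrite addey; last by rewrite gt_eqF// (lt_le_trans (ltNyr 0))// sume_ge0.
  by rewrite leye_eq => /eqP h1; move: fin; rewrite h1 ltxx.
pose S := (\sum_(0 <= i <oo) (c i * (2^-1 ^+ i.+1)%:E))%E.
have S0 : (0 <= S)%E by apply: nneseries_ge0.
have Sfin : S \is a fin_num by rewrite ge0_fin_numE.
exists (2 `^ (1 + beta) * fine S); first by rewrite mulr_ge0 ?powR_ge0 ?fine_ge0.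
split => //.
rewrite EFinM fineK// /S -nneseriesZl//; apply: lee_nneseries => i _.
  by move=> _; rewrite lee_fin mulr_ge0 ?powR_ge0// fine_ge0.
rewrite /c; have [f f0 ->] : exists2 f, 0 <= f & w (2^-1 ^+ i.+1) = f%:E.
  by exists (fine (w (2^-1 ^+ i.+1))); rewrite ?fine_ge0 ?fineK.
rewrite /= -!EFinM lee_fin.
have e1 : (2 ^+ i.+1) `^ beta = 2 `^ (1 + beta) * (2 ^+ i) `^ (1 + beta) * 2^-1 ^+ i.+1.
  rewrite -powRM ?exprn_ge0// -exprS powRD ?addr_eq0 ?expf_neq0 ?implybT//.
  by rewrite powRr1 ?exprn_ge0// exprVn mulrAC mulfV ?mul1r// expf_neq0.
by rewrite e1; rewrite le_eqVlt; apply/orP; left; apply/eqP; ring.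
Qed.

(** Inclusion of l^1 in l^q: every term is at most [T], so t^q <= T^(q-1) t. *)
Lemma eseries_powR_le (t : R^nat) (q T : R) : 1 <= q -> (forall i, 0 <= t i) ->
  (\sum_(0 <= i <oo) (t i)%:E <= T%:E)%E ->
  (\sum_(0 <= i <oo) (t i `^ q)%:E <= (T `^ q)%:E)%E.
Proof.
move=> q1 t0 hT.
have tT i : t i <= T.
  rewrite -lee_fin; apply: le_trans hT.
  have := @nneseries_lim_ge R (fun i => (t i)%:E) xpredT 0 i.+1 (fun _ _ _ => t0 _).
  move=> hi; apply: le_trans hi; rewrite big_nat_recr//=; apply: leeDr.
  by apply: sume_ge0 => k _; rewrite lee_fin.
have T0 : 0 <= T by apply: le_trans (tT 0%N).
have pw x : 0 <= x -> x `^ q = x * x `^ (q - 1).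
  move=> x0; have [->|xn] := eqVneq x 0; first by rewrite mul0r powR0// gt_eqF//; lra.
  by rewrite -[X in X * _](powRr1 x0) -powRD ?xn ?implybT//; congr (_ `^ _); ring.
apply: (@le_trans _ _ (\sum_(0 <= i <oo) ((T `^ (q - 1))%:E * (t i)%:E))%E).
  apply: lee_nneseries => i _; first by rewrite lee_fin powR_ge0.
  rewrite -EFinM lee_fin pw// mulrC ler_wpM2r//.
  by apply: ge0_ler_powR; rewrite ?nnegrE ?subr_ge0.
rewrite nneseriesZl; last by move=> i _; rewrite lee_fin.
rewrite (pw _ T0) mulrC EFinM; apply: lee_wpmul2l => //.
by rewrite lee_fin powR_ge0.
Qed.

End dini.

(** * Borel version of Omega and its modulus of continuity *)

Section symbol.
Context (R : realType) (n : nat).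
Local Notation vec := 'rV[R]_n.
Local Notation leb := (lebesgue_rV R n).
Hypothesis n0 : (0 < n)%N.

Lemma measurable_leb_set1 (v : vec) : measurable [set v] /\ leb [set v] = 0%E.
Proof.
have mcube s := @measurable_cube R n v s.
have m1 : measurable [set v].
  rewrite (_ : [set v] = \bigcap_(k in setT) cube v k.+1%:R^-1).
    by apply: bigcap_measurable.
  apply/seteqP; split => [x -> k _|x hx]; first by rewrite /cube/= subrr normr0 invr_ge0.
  apply/eqP; rewrite -subr_eq0 -normr_eq0; apply/eqP/le_anti; rewrite normr_ge0 andbT.
  apply/ler_addgt0Pl => e e0; rewrite addr0.
  have [N _ hN] := near_infty_natSinv_lt (PosNum e0).
  apply: (@le_trans _ _ (N.+1%:R^-1)); first exact: hx.
  by apply/ltW; have := hN N (leqnn _); rewrite /=.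
split=> //; apply/eqP; rewrite -measure_le0; apply/lee_addgt0Pr => e e0; rewrite add0e.
have e10 : 0 < Num.min e 1 by rewrite lt_min e0 ltr01.
apply: (@le_trans _ _ (leb (cube v (2^-1 * Num.min e 1)))).
  apply: le_measure; rewrite ?inE//.
  by move=> x ->; rewrite /cube/= subrr normr0 mulr_ge0// ltW.
rewrite leb_cube ?mulr_gt0//.
rewrite lee_fin mulrA mulfV// mul1r; apply: (@le_trans _ _ (Num.min e 1)); last first.
  by rewrite ge_min lexx.
by rewrite -[leRHS]expr1; apply: ler_wiXn2l => //; rewrite ?(ltW e10)// ge_min lexx orbT.
Qed.

Lemma edirZ (t : R) (x : vec) : 0 < t -> edir (t *: x) = edir x.
Proof.
move=> t0; rewrite /edir enormZ gtr0_norm// scalerA invfM mulrAC mulVf ?mul1r//.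
exact: lt0r_neq0.
Qed.

Lemma enorm_edir (x : vec) : x != 0 -> enorm (edir x) = 1.
Proof.
move=> x0; rewrite /edir enormZ gtr0_norm ?invr_gt0 ?enorm_gt0// mulVf//.
by rewrite gt_eqF// enorm_gt0.
Qed.

Lemma edir_mulmx (rho : 'M[R]_n) (x : vec) : rho *m rho^T = 1%:M ->
  edir (x *m rho) = edir x *m rho.
Proof. by move=> rr; rewrite /edir enorm_orthogonal// scalemxAl. Qed.

Lemma measurable_preimage_edir (A : set vec) : measurable A ->
  measurable (@edir R n @^-1` A).
Proof. by move=> mA; rewrite -[X in measurable X]setTI; exact: measurable_edir. Qed.

Lemma null_cone (A : set vec) : measurable A ->
  @sphere_measure R n A = 0%E -> leb (@edir R n @^-1` A) = 0%E.
Proof.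
move=> mA; rewrite /sphere_measure -/(ballvol R n) => /eqP.
rewrite mule_eq0 eqe invr_eq0 gt_eqF ?ballvol_gt0//= => /eqP A0.
have mE := measurable_preimage_edir mA.
apply/eqP; rewrite -measure_le0.
apply: (@le_trans _ _ (\sum_(0 <= k <oo) leb (@edir R n @^-1` A `&` ecball 0 k.+1%:R))%E).
  apply: measure_sigma_subadditive => //.
    by move=> k; apply: measurableI => //; exact: measurable_ecball.
  move=> x Ax; exists (Num.truncn (enorm x)).+1 => //; split => //.
  by rewrite /ecball/= subr0; apply/ltW/(lt_trans (truncnS_gt _)); rewrite ltr_nat.
rewrite eseries0// => k _ _.
have mI : measurable (@edir R n @^-1` A `&` ecball 0 1).
  by apply: measurableI => //; exact: measurable_ecball.
have k0 : (k.+1%:R : R)^-1 != 0 by rewrite invr_eq0 pnatr_eq0.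
have := leb_affine 0 k0 mI; rewrite A0 => /eqP; rewrite mule_eq0 eqe expf_eq0 normr_eq0.
rewrite (negPf k0) andbF/= => /eqP <-; congr (leb _); apply/seteqP; split => x /=.
  move=> [h1 h2]; rewrite addr0 edirZ ?invr_gt0//; split => //.
  move: h2; rewrite /ecball/= !subr0 enormZ gtr0_norm ?invr_gt0// => h2.
  by rewrite mulrC ler_pdivrMr// mul1r.
rewrite addr0 edirZ ?invr_gt0// => -[h1 h2]; split => //.
move: h2; rewrite /ecball/= !subr0 enormZ gtr0_norm ?invr_gt0//.
by rewrite mulrC ler_pdivrMr// mul1r.
Qed.

Lemma measurable_sphere : measurable (@sphere R n).
Proof.
have := @measurable_enorm R n measurableT [set 1]; rewrite setTI; apply.
exact: measurable_set1.
Qed.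

(** Only the origin has its direction off the sphere. *)
Lemma sphere_measure_sphereC : @sphere_measure R n (~` @sphere R n) = 0%E.
Proof.
rewrite /sphere_measure; set A := (X in (_ * leb X)%E).
suff -> : leb A = 0%E by rewrite mule0.
apply/eqP; rewrite -measure_le0 -(measurable_leb_set1 0).2; apply: le_measure; rewrite ?inE//.
- rewrite /A; apply: measurableI; last exact: measurable_ecball0.
  apply: measurable_preimage_edir; apply: measurableC.
  exact: measurable_sphere.
- exact: (measurable_leb_set1 0).1.
move=> x [/= h _]; apply: contrapT => x0; apply: h; rewrite /sphere/=.
by apply: enorm_edir; apply/eqP.
Qed.

Variables (Omega : vec -> R) (r : R).
Hypotheses (hom : homogeneous0 Omega) (r1 : 1 <= r).
Hypothesis hO : inLp (@sphere_measure R n) r Omega.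

(** Extending a Borel representative along rays makes it homogeneous everywhere. [N] is the cone
    over the exceptional set together with the origin, whose direction is the zero vector. *)
Lemma borel_symbol : exists (W : vec -> measurableTypeR R) (N : set vec) (I : R),
  [/\ measurable_fun setT W, homogeneous0 W,
      [/\ measurable N, leb N = 0%E, (forall t x, 0 < t -> N (t *: x) -> N x) &
          forall x, ~ N x -> Omega x = W x],
      0 <= I & (\int[leb]_(x in ecball 0 1) (`|W x| `^ r)%:E <= I%:E)%E].
Proof.
have [g gL [N0 [mN0 N00 hN0]]] := hO.
have mg : measurable_fun setT g by move: gL; rewrite inE => /andP[/[!inE]/=].
pose W : vec -> measurableTypeR R := fun x => g (edir x).
have mW : measurable_fun setT W by apply: measurableT_comp mg _; exact: measurable_edir.
have /integrableP[mgr gi] := Lfun_integrable r1 gL.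
have gi2 : (\int[leb]_(x in ecball 0 1) (`|W x| `^ r)%:E < +oo)%E.
  move: gi; under eq_integral do rewrite gee0_abs ?lee_fin ?powR_ge0//.
  rewrite (@integral_sphere_measure R n (fun x => (`|g x| `^ r)%:E))//.
  move=> h; have b0 := @ballvol_gt0 R n.
  have : ((ballvol R n)%:E * ((ballvol R n)^-1%:E *
     \int[leb]_(x in ecball 0 1) (`|g (edir x)| `^ r)%:E) < +oo)%E.
    by rewrite lte_mul_pinfty// lee_fin ltW.
  by rewrite muleA -EFinM mulfV ?gt_eqF// mul1e.
exists W, (@edir R n @^-1` N0 `|` [set 0]),
  (fine (\int[leb]_(x in ecball 0 1) (`|W x| `^ r)%:E)); split => //.
- by move=> t x t0; rewrite /W edirZ.
- have mE := measurable_preimage_edir mN0.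
  have m1 : measurable [set (0 : vec)].
    exact: (measurable_leb_set1 0).1.
  split; first exact: measurableU.
    apply/eqP; rewrite -measure_le0; apply: le_trans (measureU2 _ _ _) _ => //.
    have e1 : (leb (@edir R n @^-1` N0) <= 0)%E by rewrite null_cone.
    have e2 : (leb [set (0%R : vec)] <= 0)%E by rewrite (measurable_leb_set1 0).2.
    by rewrite -[leRHS]adde0; exact: leeD e1 e2.
    move=> t x t0 [h|/eqP]; first by left; move: h; rewrite /preimage/= edirZ.
    by rewrite scaler_eq0 gt_eqF//= => /eqP; right.
  move=> x /not_orP[xN /eqP x0]; rewrite /W.
  have -> : Omega x = Omega (edir x) by rewrite /edir hom// invr_gt0 enorm_gt0.
  apply: contrapT => h; apply: xN; apply: hN0 => /= e; exact: h (e I).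
- by apply/fine_ge0/integral_ge0 => x _; rewrite lee_fin powR_ge0.
- by rewrite fineK// ge0_fin_numE//; apply: integral_ge0 => x _; rewrite lee_fin powR_ge0.
Qed.

End symbol.

Section symbol_modulus.
Context (R : realType) (n : nat).
Local Notation vec := 'rV[R]_n.
Local Notation leb := (lebesgue_rV R n).
Hypothesis n0 : (0 < n)%N.
Variables (Omega : vec -> R) (W : vec -> measurableTypeR R) (N : set vec) (r : R).
Hypotheses (r1 : 1 <= r) (mW : measurable_fun setT W) (hW : homogeneous0 W).
Hypotheses (mN : measurable N) (N0 : leb N = 0%E).
Hypotheses (Ncone : forall t x, 0 < t -> N (t *: x) -> N x)
  (OW : forall x, ~ N x -> Omega x = W x).

Lemma preimage_edir_cone : @edir R n @^-1` N `<=` N.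
Proof.
move=> x; rewrite /preimage/=; have [->|x0] := eqVneq x 0.
  by rewrite /edir scaler0.
by apply: Ncone; rewrite invr_gt0 enorm_gt0.
Qed.

Lemma measurable_rotated_diff (rho : 'M[R]_n) q :
  measurable_fun setT (fun x : vec => (`|W (x *m rho) - W x| `^ q)%:E).
Proof.
apply: measurable_powR_dist => //.
by apply: measurableT_comp => //; exact: measurable_mulmx.
Qed.

(** [Omega (z *m rho)] is controlled only where [z *m rho] avoids [N], so the rotated exceptional
    set has to be null too. Homogeneity then turns the integral over the sphere into one over the
    ball. *)
Lemma rotation_integral_le (rho : 'M[R]_n) (s : R) : rotation rho -> 0 <= s ->
  ((\int[@sphere_measure R n]_(z in @sphere R n)
     (`|Omega (z *m rho) - Omega z| `^ r)%:E) `^ r^-1 <= s%:E)%E ->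
  (\int[leb]_(x in ecball 0 1) (`|W (x *m rho) - W x| `^ r)%:E <=
     (ballvol R n * s `^ r)%:E)%E.
Proof.
move=> [rr _] s0; have mF := measurable_rotated_diff rho r.
have mB : measurable [set x | N (x *m rho)].
  by rewrite -[X in measurable X]setTI; exact: measurable_mulmx.
have B0 : leb [set x | N (x *m rho)] = 0%E by exact: null_orthogonal.
have mS := @measurable_sphere R n.
rewrite (@ge0_lower_integral_ae _ _ _ _ _ _ (fun z => (`|W (z *m rho) - W z| `^ r)%:E))//; first last.
- exists (N `|` [set x | N (x *m rho)]); split.
  + exact: measurableU.
  + change (@sphere_measure R n (N `|` [set x | N (x *m rho)]) = 0%E).
    rewrite /sphere_measure; set A := (X in (_ * leb X)%E).
    suff A0 : leb A = 0%E by rewrite A0 mule0.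
    apply/eqP; rewrite -measure_le0.
    apply: (@le_trans _ _ (leb (N `|` [set x | N (x *m rho)]))).
      apply: le_measure; rewrite ?inE.
      * apply: measurableI; last exact: measurable_ecball0.
        by apply: measurable_preimage_edir; exact: measurableU.
      * exact: measurableU.
      * move=> x [[/= h|/= h] _]; [left; exact: preimage_edir_cone|right => /=].
        by apply: preimage_edir_cone => /=; rewrite edir_mulmx.
    apply: le_trans (measureU2 _ _ _) _ => //.
    have e1 : (leb N <= 0)%E by rewrite N0.
    have e2 : (leb [set x | N (x *m rho)] <= 0)%E by rewrite B0.
    by rewrite -[leRHS]adde0; exact: leeD e1 e2.
  + move=> z /= h; apply: contrapT => /not_orP[nz nzr]; apply: h => _.
    by rewrite !OW.
- by apply: measurable_funTS.
have -> : (\int[@sphere_measure R n]_(z in @sphere R n) (`|W (z *m rho) - W z| `^ r)%:E =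
    \int[@sphere_measure R n]_z (`|W (z *m rho) - W z| `^ r)%:E)%E.
  rewrite -(setUv (@sphere R n)) ge0_integral_setU//; last 3 first.
  - exact: measurableC.
  - by rewrite setUv.
  - by rewrite disj_set2E setICr.
  rewrite [X in (_ + X)%E](_ : _ = 0%E) ?adde0//.
  apply: null_set_integral; [exact: measurableC|exact: measurable_funTS|].
  exact: sphere_measure_sphereC.
rewrite (@integral_sphere_measure R n (fun z => (`|W (z *m rho) - W z| `^ r)%:E))//.
have -> : (\int[leb]_(x in ecball 0 1) (`|W (edir x *m rho) - W (edir x)| `^ r)%:E =
  \int[leb]_(x in ecball 0 1) (`|W (x *m rho) - W x| `^ r)%:E)%E.
  apply: eq_integral => x _; have [->|x0] := eqVneq x 0; first by rewrite /edir scaler0.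
  by rewrite -edir_mulmx// /edir !hW// ?invr_gt0 ?enorm_orthogonal ?enorm_gt0.
set I := integral _ _ _ => h.
have I0 : (0 <= I)%E by apply: integral_ge0.
have b0 := @ballvol_gt0 R n.
have r0 : 0 < r by apply: lt_le_trans r1.
have h2 : ((ballvol R n)^-1%:E * I <= (s `^ r)%:E)%E.
  have := h; have J0 : (0 <= (ballvol R n)^-1%:E * I)%E.
    by apply: mule_ge0 => //; rewrite lee_fin invr_ge0 ltW.
  move/(@gt0_ler_poweR _ _ (ltW r0)); rewrite -poweRrM mulVf ?gt_eqF// poweRe1// poweR_EFin.
  by apply; rewrite in_itv/= ?leey ?andbT ?lee_fin// poweR_ge0.
rewrite EFinM -[leLHS]mul1e -(@mulfV _ (ballvol R n)) ?gt_eqF// EFinM -muleA.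
by apply: lee_wpmul2l => //; rewrite lee_fin ltW.
Qed.

Lemma rotation_integral_le_power (rho : 'M[R]_n) (s q : R) : rotation rho -> 0 < s ->
  0 < q -> q <= r ->
  ((\int[@sphere_measure R n]_(z in @sphere R n)
     (`|Omega (z *m rho) - Omega z| `^ r)%:E) `^ r^-1 <= s%:E)%E ->
  (\int[leb]_(x in ecball 0 1) (`|W (x *m rho) - W x| `^ q)%:E <=
     (2 * ballvol R n * s `^ q)%:E)%E.
Proof.
move=> hrho s0 q0 qr /(rotation_integral_le hrho (ltW s0)) h.
have mF := measurable_rotated_diff rho r.
have mB := @measurable_ecball0 R n 1.
(* The first term suffices for H <= s and the second for H > s, as q <= r. With this in place of
   Hoelder's inequality, the two terms account for the factor 2 in the conclusion. *)
have pw (H : R) : 0 <= H -> H `^ q <= s `^ q + s `^ (q - r) * H `^ r.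
  move=> H0; have [Hs|sH] := leP H s.
    apply: (@le_trans _ _ (s `^ q)); last by rewrite lerDl mulr_ge0 ?powR_ge0.
    by apply: ge0_ler_powR; rewrite ?nnegrE// ltW.
  have Hp := lt_trans s0 sH.
  apply: (@le_trans _ _ (s `^ (q - r) * H `^ r)); last by rewrite lerDr powR_ge0.
  have -> : H `^ q = H `^ (q - r) * H `^ r.
    by rewrite -powRD ?(gt_eqF Hp) ?implybT// subrK.
  rewrite ler_wpM2r ?powR_ge0//.
  rewrite -[q - r]opprB !powRN lef_pV2 ?posrE ?powR_gt0//.
  by apply: ge0_ler_powR; rewrite ?nnegrE ?subr_ge0// ltW.
apply: (@le_trans _ _ (\int[leb]_(x in ecball 0 1)
   ((s `^ q)%:E + (s `^ (q - r))%:E * (`|W (x *m rho) - W x| `^ r)%:E))%E).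
  apply: le_lower_integral => x _; first by rewrite lee_fin powR_ge0.
  by rewrite -EFinM -EFinD lee_fin pw.
rewrite ge0_integralD//; last 3 first.
- by move=> x _; rewrite lee_fin powR_ge0.
- by move=> x _; rewrite -EFinM lee_fin mulr_ge0 ?powR_ge0.
- by apply: measurable_funTS; apply: measurable_funeM.
rewrite ge0_integralZl//; last 2 first.
- by apply: measurable_funTS.
- by rewrite lee_fin powR_ge0.
rewrite (_ : \int[leb]_(_ in ecball 0 1) _ = (s `^ q)%:E * (ballvol R n)%:E)%E; last first.
  rewrite integral_cst//; congr (_ * _)%E; rewrite -[LHS]/(leb _).
  by rewrite leb_ecball// expr1n mul1r.
apply: (@le_trans _ _ ((s `^ q)%:E * (ballvol R n)%:E +
  (s `^ (q - r))%:E * (ballvol R n * s `^ r)%:E)%E).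
  by apply: leeD2l; apply: lee_wpmul2l => //; rewrite lee_fin powR_ge0.
rewrite -!EFinM -EFinD lee_fin mulrCA -powRD ?(gt_eqF s0) ?implybT// subrK.
by rewrite le_eqVlt; apply/orP; left; apply/eqP; ring.
Qed.

End symbol_modulus.

Lemma integral_modulus_ge0 (R : realType) n (Omega : 'rV[R]_n -> R) (r d : R) : 0 < d ->
  (0 <= integral_modulus Omega r d)%E.
Proof.
move=> d0; apply: (@le_trans _ _ ((\int[@sphere_measure R n]_(z in @sphere R n)
   (`|Omega (z *m 1%:M) - Omega z| `^ r)%:E) `^ r^-1)%E); first exact: poweR_ge0.
apply: ereal_sup_ubound => /=; exists 1%:M => //; split.
  by split; [rewrite trmx1 mulmx1|rewrite det1].
apply: (@le_lt_trans _ _ 0%E); last by rewrite lte_fin.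
by apply: ge_ereal_sup => _ [z _ <-]; rewrite mulmx1 subrr lee_fin (_ : enorm 0 = 0)//;
  apply/eqP; rewrite enorm_eq0.
Qed.

Lemma le_integral_modulus (R : realType) n (Omega : 'rV[R]_n -> R) (r d d' : R) : d <= d' ->
  (integral_modulus Omega r d <= integral_modulus Omega r d')%E.
Proof.
move=> dd; apply: le_ereal_sup => _ [rho [h1 h2] <-]; exists rho => //; split => //.
by apply: lt_le_trans h2 _; rewrite lee_fin.
Qed.

Section annulus_modulus.
Context (R : realType) (n : nat).
Local Notation vec := 'rV[R]_n.
Local Notation leb := (lebesgue_rV R n).
Hypothesis n0 : (0 < n)%N.
Variables (Omega : vec -> R) (W : vec -> measurableTypeR R) (N : set vec) (r q beta IW : R).
Hypotheses (beta0 : 0 < beta) (q1 : 1 <= q) (qr : q <= r).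
Hypotheses (mW : measurable_fun setT W) (hW : homogeneous0 W).
Hypotheses (mN : measurable N) (N0 : leb N = 0%E).
Hypotheses (Ncone : forall t x, 0 < t -> N (t *: x) -> N x)
  (OW : forall x, ~ N x -> Omega x = W x).
Hypotheses (IW0 : 0 <= IW) (hIW : (\int[leb]_(x in ecball 0 1) (`|W x| `^ q)%:E <= IW%:E)%E).
Hypothesis hdini : (\int[lebesgue_measure]_(delta in `]0%R, 1%R[)
  (integral_modulus Omega r delta * ((delta `^ (1 + beta))^-1)%:E) < +oo)%E.

(** A translation of length 2^-j calls for rotations of size 384 n^3 2^-j, hence for the modulus at
    2^-(j - K0) once 2^K0 > 384 n^3. For the finitely many j <= K0 the triangle inequality for q-th
    powers is enough. *)
Lemma annulus_modulus : exists (tau : R^nat) (K : R),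
  [/\ forall j, 0 <= tau j,
      forall j y, enorm y <= 2^-1 ^+ j ->
        (\int[leb]_(x in annulus (n:=n)) (`|W (x - y) - W x| `^ q)%:E <= (tau j)%:E)%E &
      (\sum_(0 <= j <oo) ((2 ^+ j) `^ (beta * q) * tau j)%:E <= K%:E)%E].
Proof.
have q0 : 0 < q by apply: lt_le_trans q1.
have r1 : 1 <= r by apply: le_trans qr.
have nR : 0 < n%:R :> R by rewrite ltr0n.
have b0 := @ballvol_gt0 R n.
(* For d <= 0 no rotation is small enough and the supremum is -oo; the maximum with 0 makes [w]
   nonnegative and nondecreasing on the whole line. *)
pose w d := maxe 0%E (integral_modulus Omega r d).
have wE d : 0 < d -> w d = integral_modulus Omega r d.
  by move=> d0; rewrite /w; apply/max_idPr; exact: integral_modulus_ge0.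
have [D D0 [wfin hD]] : exists2 D, 0 <= D &
    (forall i, w (2^-1 ^+ i.+1) \is a fin_num) /\
    (\sum_(0 <= i <oo) ((2 ^+ i.+1) `^ beta * fine (w (2^-1 ^+ i.+1)))%:E <= D%:E)%E.
  apply: dini_sum => //.
  - by move=> d; rewrite /w le_max lexx.
  - move=> d d' dd; rewrite /w ge_max le_max lexx/=.
    by rewrite le_max le_integral_modulus// orbT.
  - apply: le_lt_trans hdini; apply: le_lower_integral => d /=; rewrite in_itv/= => /andP[d0 _].
      by apply: mule_ge0; rewrite ?lee_fin ?invr_ge0 ?powR_ge0// wE// integral_modulus_ge0.
    by rewrite wE.
have [K0 hK0] : exists K0, 384 * n%:R ^+ 3 < 2 ^+ K0 :> R.
  exists (Num.truncn (384 * n%:R ^+ 3 : R)).+1; apply: lt_trans (truncnS_gt _) _.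
  by rewrite -[ltRHS]natrX ltr_nat ltn_expl.
(* The second summand makes [s i] positive, as [rotation_integral_le_power] requires; with the
   weights (2^(i+1))^beta these summands add up to 1. *)
pose s i := fine (w (2^-1 ^+ i.+1)) + (2^-1 ^+ i.+1) / (2 ^+ i.+1) `^ beta.
have p2 i : 0 < 2^-1 ^+ i :> R by rewrite exprn_gt0// invr_gt0.
have pp2 i : 0 < (2 ^+ i) `^ beta :> R by rewrite powR_gt0// exprn_gt0.
have fw0 i : 0 <= fine (w (2^-1 ^+ i.+1)) by apply: fine_ge0; rewrite /w le_max lexx.
have s0 i : 0 < s i by rewrite /s ltr_wpDl// divr_gt0.
pose C0 : R := 2 * 2 `^ q * n%:R * (36 * n%:R) ^+ n * (24 * n%:R ^+ 2) ^+ n * 3 ^+ n.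
have C00 : 0 <= C0 by rewrite /C0 !mulr_ge0 ?powR_ge0 ?exprn_ge0 ?mulr_ge0// ?exprn_ge0.
pose T0 := 2 `^ q * (2 * (3 ^+ n * IW)).
have T00 : 0 <= T0 by rewrite /T0 !mulr_ge0 ?powR_ge0// exprn_ge0.
pose T1 i := C0 * (2 * ballvol R n * s i `^ q).
have T10 i : 0 <= T1 i by rewrite /T1 !mulr_ge0 ?powR_ge0// ltW.
pose tau j := if (j <= K0)%N then T0 else T1 (j - K0.+1)%N.
have tau0 j : 0 <= tau j by rewrite /tau; case: ifP.
have hsum1 : (\sum_(0 <= i <oo) ((2 ^+ i.+1) `^ beta * s i)%:E <= (D + 1)%:E)%E.
  have -> : (\sum_(0 <= i <oo) ((2 ^+ i.+1) `^ beta * s i)%:E =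
     \sum_(0 <= i <oo) (((2 ^+ i.+1) `^ beta * fine (w (2^-1 ^+ i.+1)))%:E + (2^-1 ^+ i.+1)%:E))%E.
    apply: eq_eseriesr => i _; rewrite -EFinD; congr EFin.
    by rewrite /s mulrDr; congr (_ + _); rewrite mulrCA mulfV ?mulr1// gt_eqF.
  rewrite nneseriesD; last 2 first.
  - by move=> i _; rewrite lee_fin mulr_ge0// ltW.
  - by move=> i _; rewrite lee_fin ltW.
  rewrite EFinD; apply: leeD => //.
  have h2 : 2^-1 < 1 :> R by rewrite invf_lt1// ltr1n.
  have := @geometric_eseries_le R 2^-1 2^-1 (ltW (p2 1%N)) (ltW (p2 1%N)) h2.
  rewrite (_ : 2^-1 / (1 - 2^-1) = 1); last by field.
  by under eq_eseriesr do rewrite -exprS.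
have hsumq := @eseries_powR_le R (fun i => (2 ^+ i.+1) `^ beta * s i) q _ q1
  (fun i => mulr_ge0 (ltW (pp2 _)) (ltW (s0 _))) hsum1.
exists tau, (\sum_(0 <= j < K0.+1) ((2 ^+ j) `^ (beta * q) * tau j) +
  (2 ^+ K0) `^ (beta * q) * (C0 * (2 * ballvol R n)) * (D + 1) `^ q); split => //.
- move=> j y hy; rewrite /tau; case: leqP => jK.
    have y1 : enorm y <= 1.
      by apply: le_trans hy _; apply: exprn_ile1; rewrite ?invr_ge0// invf_le1// ler1n.
    have mA := @measurable_annulus R n.
    have mWy v : measurable_fun (annulus (n:=n)) (fun x => (`|W (x - v)| `^ q)%:E).
      apply: measurable_funTS; apply/measurable_EFinP; apply: measurable_powR_comp.
      apply: measurableT_comp => //; apply: measurableT_comp => //.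
      exact: measurable_fun_subv.
    apply: (@le_trans _ _ (\int[leb]_(x in annulus (n:=n))
      ((2 `^ q)%:E * ((`|W (x - y)| `^ q)%:E + (`|W (x - 0)| `^ q)%:E)))%E).
      apply: le_lower_integral => x _; first by rewrite lee_fin powR_ge0.
      have := @powR_dist_le R q (W (x - y)) 0 (W x) (ltW q0).
      by rewrite !subr0 sub0r normrN -EFinD -EFinM lee_fin.
    rewrite ge0_integralZl//; last 2 first.
    + exact: emeasurable_funD.
    + by move=> x _; rewrite -EFinD lee_fin addr_ge0 ?powR_ge0.
    rewrite ge0_integralD//.
    rewrite /T0 EFinM; apply: lee_wpmul2l; first by rewrite lee_fin powR_ge0.
    rewrite mulr_natl mulr2n EFinD; apply: leeD; apply: integral_annulus_W => //.
    by rewrite (_ : enorm 0 = 0)//; apply/eqP; rewrite enorm_eq0.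
  have jE : j = (K0 + (j - K0.+1).+1)%N by rewrite -subSn// subSS subnKC// ltnW.
  move: jE; set i := (j - K0.+1)%N => jE.
  have e1 : 384 * n%:R ^+ 3 * 2^-1 ^+ j < 2^-1 ^+ i.+1 :> R.
    rewrite jE exprD mulrA -[ltRHS]mul1r ltr_pM2r//.
    by rewrite exprVn ltr_pdivrMr ?exprn_gt0// mul1r.
  have n30 : 0 < n%:R ^+ 3 :> R by rewrite exprn_gt0.
  have mf := @measurable_rotated_diff R n W mW.
  have := @translation_modulus R n W q mW hW (ltW q0) (2 * ballvol R n * s i `^ q) (2^-1 ^+ j) n0 (p2 _).
  rewrite /T1 /C0; apply.
  - rewrite -[leRHS]mul1r ler_pdivlMr ?mulr_gt0//.
    apply: (@le_trans _ _ (2^-1 ^+ i.+1)).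
      apply: le_trans (ltW e1); rewrite mulrC ler_pM2r// ler_pM2r// ler_nat//.
    by apply: exprn_ile1; rewrite ?invr_ge0// invf_le1// ler1n.
  - move=> rho hrho hsize.
    apply: (@rotation_integral_le_power R n n0 Omega W N r) => //.
    apply: (@le_trans _ _ (integral_modulus Omega r (2^-1 ^+ i.+1))).
      apply: ereal_sup_ubound; exists rho => //; split => //.
      by apply: le_lt_trans hsize _; rewrite lte_fin.
    rewrite -wE// -(fineK (wfin i)) lee_fin /s lerDl.
    by apply/ltW/divr_gt0.
  - by apply: le_trans (supnorm_enorm _) hy.
- have t0 j : (0 <= ((2 ^+ j) `^ (beta * q) * tau j)%:E)%E.
    by rewrite lee_fin mulr_ge0// powR_ge0.
  rewrite (nneseries_split 0 K0.+1)// add0n EFinD sumEFin.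
  apply: leeD => //.
  rewrite -[K0.+1]add0n -nneseries_addn//.
  apply: (@le_trans _ _ (((2 ^+ K0) `^ (beta * q) * (C0 * (2 * ballvol R n)))%:E *
     \sum_(0 <= i <oo) (((2 ^+ i.+1) `^ beta * s i) `^ q)%:E)%E); last first.
    rewrite [leRHS]EFinM; apply: lee_wpmul2l => //.
    by rewrite lee_fin !mulr_ge0 ?powR_ge0// ltW.
  rewrite -nneseriesZl//; last by move=> i _; rewrite lee_fin powR_ge0.
  apply: lee_nneseries => i _ //; rewrite -EFinM lee_fin /tau leqNgt addnC ltnS leq_addr/=.
  rewrite addSn subSS addnC addnK /T1 -addSn exprD.
  rewrite powRM ?exprn_ge0// powRM ?powR_ge0 ?(ltW (s0 _))//.
  rewrite -[((2 ^+ i.+1) `^ beta) `^ q]powRrM le_eqVlt; apply/orP; left; apply/eqP; ring.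
Qed.

End annulus_modulus.

(** * Weak-type bounds for superpositions *)

Section cut.
Context (R : realType).

Definition cut (t u : R) : \bar R := (u * (t < u)%R%:R)%:E.

Lemma cut_ge0 t u : 0 <= u -> (0 <= cut t u)%E.
Proof. by move=> u0; rewrite lee_fin mulr_ge0. Qed.

Lemma le_cut_add (t u : R) : 0 <= t -> (u%:E <= t%:E + cut t u)%E.
Proof.
move=> t0; rewrite /cut -EFinD lee_fin; case: ltP => h.
  by rewrite mulr1 lerDr.
by rewrite mulr0 addr0.
Qed.

Lemma cut_le_powR (t u q : R) : 1 <= q -> 0 < t -> 0 <= u ->
  (cut t u <= (t `^ (1 - q) * u `^ q)%:E)%E.
Proof.
move=> q1 t0 u0; rewrite /cut lee_fin; case: ltP => h; last first.
  by rewrite mulr0 mulr_ge0 ?powR_ge0.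
have u00 := lt_trans t0 h; rewrite mulr1.
have -> : t `^ (1 - q) = (t `^ (q - 1))^-1 by rewrite -powRN opprB.
rewrite ler_pdivlMl ?powR_gt0//.
have -> : u `^ q = u `^ (q - 1) * u.
  by rewrite -[X in _ * X]powRr1// -powRD ?(gt_eqF u00) ?implybT// subrK.
rewrite ler_pM2r//; apply: ge0_ler_powR; rewrite ?nnegrE ?subr_ge0 ?(ltW t0)//.
exact: ltW.
Qed.

(** If the sum exceeds 3 t, its largest term exceeds t and is at least a third of the sum. *)
Lemma cut_add3 (t u v w : R) : 0 <= u -> 0 <= v -> 0 <= w ->
  (cut (3 * t) (u + v + w) <= 3%:E * (cut t u + cut t v + cut t w))%E.
Proof.
move=> u0 v0 w0; rewrite /cut -!EFinD -EFinM lee_fin.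
have c0 x : 0 <= x -> 0 <= x * (t < x)%R%:R :> R by move=> ?; rewrite mulr_ge0.
case: (ltP (3 * t)) => h; last by rewrite mulr0 mulr_ge0// !addr_ge0// c0.
have mx (x y z : R) : 0 <= x -> 0 <= y -> 0 <= z -> y <= x -> z <= x -> 3 * t < x + y + z ->
    x + y + z <= 3 * (x * (t < x)%R%:R).
  move=> x0 y0 z0 yx zx hx; rewrite (_ : (t < x) = true) ?mulr1; first by lra.
  by apply: contraTT hx; rewrite -!leNgt; lra.
have := c0 _ u0; have := c0 _ v0; have := c0 _ w0.
rewrite mulr1; have [uv|/ltW vu] := leP u v.
  have [vw|/ltW wv] := leP v w.
    by have := mx w v u w0 v0 u0 vw (le_trans uv vw); lra.
  by have := mx v u w v0 u0 w0 uv wv; lra.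
have [uw|/ltW wu] := leP u w.
  by have := mx w u v w0 u0 v0 uw (le_trans vu uw); lra.
by have := mx u v w u0 v0 w0 vu wu; lra.
Qed.

Lemma measurable_cut d (T : measurableType d) (t : R) (u : T -> measurableTypeR R) :
  measurable_fun setT u -> measurable_fun setT (fun x => cut t (u x)).
Proof.
move=> mu; apply/measurable_EFinP; apply: measurable_funM; first exact: mu.
rewrite (_ : (fun x => _) = (\1_[set x | t < u x] : T -> R)).
  apply: measurable_indic; have := mu measurableT `]t, +oo[%classic (measurable_itv _).
  by rewrite setTI; congr measurable; apply/seteqP; split => x /=; rewrite in_itv/= andbT.
exact: indic_bool.
Qed.

End cut.

Section weak_sum.
Context (R : realType) (n : nat).
Local Notation vec := 'rV[R]_n.
Local Notation leb := (lebesgue_rV R n).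
Variables (m : nat -> vec -> measurableTypeR R)
  (F : nat -> vec * vec -> measurableTypeR R) (q A M : R).
Hypotheses (mm : forall j, measurable_fun setT (m j)) (m0 : forall j y, 0 <= m j y).
Hypotheses (mF : forall j, measurable_fun setT (F j)) (F0 : forall j z, 0 <= F j z).
Hypotheses (A0 : 0 <= A)
  (weakF : forall j y t, m j y != 0 -> 0 < t ->
     (\int[leb]_x cut t (F j (x, y)) <= (A * t `^ (1 - q))%:E)%E).
Hypothesis M0 : 0 < M.
Hypothesis massM : (\sum_(0 <= j <oo) \int[leb]_y (m j y)%:E <= M%:E)%E.

Definition weighted_sum (x : vec) : \bar R :=
  (\sum_(0 <= j <oo) \int[leb]_y (m j y * F j (x, y))%:E)%E.

Let mass_ge0 j : (0 <= \int[leb]_y (m j y)%:E)%E.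
Proof. by apply: integral_ge0 => y _; rewrite lee_fin. Qed.

Let measurable_m2 j : measurable_fun setT (fun z : vec * vec => m j z.2).
Proof. by apply: measurableT_comp => //; exact: measurable_snd. Qed.

Lemma measurable_weighted_term j :
  measurable_fun setT (fun x => \int[leb]_y (m j y * F j (x, y))%:E)%E.
Proof.
apply: (@measurable_fun_fubini_tonelli_F _ _ _ _ _ leb
  (fun z : vec * vec => (m j z.2 * F j z)%:E)).
  by apply/measurable_EFinP; exact: (measurable_funM (measurable_m2 j) (mF j)).
by move=> z; rewrite lee_fin mulr_ge0.
Qed.

Let term_ge0 j x : (0 <= \int[leb]_y (m j y * F j (x, y))%:E)%E.
Proof. by apply: integral_ge0 => y _; rewrite lee_fin mulr_ge0. Qed.

Lemma weighted_sum_ge0 x : (0 <= weighted_sum x)%E.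
Proof. by apply: nneseries_ge0. Qed.

Lemma measurable_weighted_sum : measurable_fun setT weighted_sum.
Proof.
by apply: ge0_emeasurable_sum => [j x _ _//|j _]; exact: measurable_weighted_term.
Qed.

Definition high_sum (t : R) (x : vec) : \bar R :=
  (\sum_(0 <= j <oo) \int[leb]_y ((m j y)%:E * cut t (F j (x, y))))%E.

Let mcutm t j : measurable_fun setT (fun z : vec * vec => (m j z.2)%:E * cut t (F j z))%E.
Proof.
apply: emeasurable_funM; first by apply/measurable_EFinP; exact: (measurable_m2 j).
by apply: measurable_cut.
Qed.

Let cutm_ge0 t j z : (0 <= (m j z.2)%:E * cut t (F j z))%E.
Proof. by apply: mule_ge0; rewrite ?cut_ge0 ?lee_fin. Qed.

Lemma high_term_ge0 t j x : (0 <= \int[leb]_y ((m j y)%:E * cut t (F j (x, y))))%E.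
Proof. by apply: integral_ge0 => y _; exact: (cutm_ge0 t j (x, y)). Qed.

Lemma measurable_high_term t j :
  measurable_fun setT (fun x => \int[leb]_y ((m j y)%:E * cut t (F j (x, y))))%E.
Proof. exact: (@measurable_fun_fubini_tonelli_F _ _ _ _ _ leb _ (mcutm t j) (cutm_ge0 t j)). Qed.

Lemma integral_high_sum t : 0 < t ->
  (\int[leb]_x high_sum t x <= (M * (A * t `^ (1 - q)))%:E)%E.
Proof.
move=> t0; rewrite integral_nneseries//; last 2 first.
- by move=> j; exact: measurable_high_term.
- by move=> j x _; exact: high_term_ge0.
apply: (@le_trans _ _ (\sum_(0 <= j <oo) (\int[leb]_y (m j y)%:E * (A * t `^ (1 - q))%:E))%E); last first.
  under eq_eseriesr do rewrite muleC.
  rewrite nneseriesZl// [M * _]mulrC [leRHS]EFinM; apply: lee_wpmul2l => //.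
  by rewrite lee_fin mulr_ge0// powR_ge0.
apply: lee_nneseries => j _; first by move=> _; apply: integral_ge0 => x _; exact: high_term_ge0.
rewrite (@fubini_tonelli _ _ _ _ _ leb leb _ (mcutm t j) (cutm_ge0 t j)).
rewrite -ge0_integralZr//; last 3 first.
- by apply/measurable_EFinP; exact: mm.
- by move=> y _; rewrite lee_fin.
- by rewrite lee_fin mulr_ge0// powR_ge0.
apply: le_lower_integral => y _.
  by apply: integral_ge0 => x _; exact: (cutm_ge0 t j (x, y)).
rewrite [leLHS](_ : _ = (m j y)%:E * \int[leb]_x cut t (F j (x, y)))%E; last first.
  rewrite -ge0_integralZl ?lee_fin//; last by move=> x _; exact: cut_ge0.
  apply: measurable_cut; exact: (measurableT_comp (mF j) (@measurable_pair2 _ _ vec vec y)).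
have [->|mj] := eqVneq (m j y) 0; first by rewrite !mul0e.
by apply: lee_wpmul2l; [rewrite lee_fin|exact: weakF].
Qed.

Lemma weighted_sum_le_high t x : 0 < t -> (weighted_sum x <= (t * M)%:E + high_sum t x)%E.
Proof.
move=> t0.
apply: (@le_trans _ _ (\sum_(0 <= j <oo) (t%:E * \int[leb]_y (m j y)%:E +
    \int[leb]_y ((m j y)%:E * cut t (F j (x, y)))))%E).
  apply: lee_nneseries => j _ //.
  rewrite -ge0_integralZl//; last 3 first.
  - by apply/measurable_EFinP; exact: mm.
  - by move=> y _; rewrite lee_fin.
  - by rewrite lee_fin ltW.
  have mc : measurable_fun setT (fun y => (m j y)%:E * cut t (F j (x, y)))%E.
    exact: (measurableT_comp (mcutm t j) (@measurable_pair1 _ _ vec vec x)).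
  rewrite -ge0_integralD//; last 3 first.
  - by move=> y _; rewrite -EFinM lee_fin mulr_ge0// ltW.
  - by apply: measurable_funeM; by apply/measurable_EFinP; exact: mm.
  - by move=> y _; exact: (cutm_ge0 t j (x, y)).
  apply: le_lower_integral => y _; first by rewrite lee_fin mulr_ge0.
  have := le_cut_add (F j (x, y)) (ltW t0).
  rewrite /cut -!EFinM -!EFinD !lee_fin => h.
  by rewrite [t * _]mulrC -mulrDr ler_wpM2l.
rewrite nneseriesD; last 2 first.
- by move=> j _ _; apply: mule_ge0 => //; rewrite lee_fin ltW.
- by move=> j _ _; exact: high_term_ge0.
apply: leeD => //; rewrite nneseriesZl//.
by rewrite EFinM; apply: lee_wpmul2l => //; rewrite lee_fin ltW.
Qed.

Let measurable_high t : measurable_fun setT (high_sum t).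
Proof.
by apply: ge0_emeasurable_sum => [j x _ _|j _]; [exact: high_term_ge0|exact: measurable_high_term].
Qed.

Let high_ge0 t x : (0 <= high_sum t x)%E.
Proof. by apply: nneseries_ge0 => j _ _; exact: high_term_ge0. Qed.

(** The level t = 1 splits the superposition into a part bounded by [M] and an integrable one. The
    resulting local integrability is what allows sums of commutators to be tested against
    cut-offs. *)
Lemma integral_weighted_sum (E : set vec) : measurable E ->
  (\int[leb]_(x in E) weighted_sum x <= M%:E * (leb E + A%:E))%E.
Proof.
move=> mE; apply: (@le_trans _ _ (\int[leb]_(x in E) (M%:E + high_sum 1%R x))%E).
  apply: le_lower_integral => x _; first exact: weighted_sum_ge0.
  by have := @weighted_sum_le_high 1 x ltr01; rewrite mul1r.
rewrite ge0_integralD//; last 2 first.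
- by move=> x _; rewrite lee_fin ltW.
- exact: measurable_funTS.
rewrite integral_cst// ge0_muleDr//; apply: leeD => //.
apply: (@le_trans _ _ (\int[leb]_x high_sum 1%R x)%E).
  by apply: ge0_subset_integral => //; exact: measurable_high.
by have := @integral_high_sum 1 ltr01; rewrite powR1 mulr1.
Qed.

Lemma weighted_sum_weak (lambda : R) : 0 < lambda ->
  (leb [set x | (lambda%:E < weighted_sum x)%E] <= (A * (2 * M / lambda) `^ q)%:E)%E.
Proof.
(* At this level the low part is at most t M = lambda / 2, so the high part exceeds lambda / 2 on
   the set; Chebyshev's inequality then gives A t^(-q). *)
move=> l0; pose t := lambda / (2 * M).
have t0 : 0 < t by rewrite divr_gt0// mulr_gt0.
pose E := [set x | (lambda%:E < weighted_sum x)%E].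
have mE : measurable E.
  by rewrite -[E]setTI; apply: emeasurable_fun_o_infty => //; exact: measurable_weighted_sum.
have h1 : ((lambda / 2)%:E * leb E <= (M * (A * t `^ (1 - q)))%:E)%E.
  apply: le_trans (integral_high_sum t0).
  apply: (@le_trans _ _ (\int[leb]_(x in E) high_sum t x)%E).
    rewrite -integral_cst//; apply: le_lower_integral => x Ex /=.
      by rewrite lee_fin divr_ge0// ltW.
    have := weighted_sum_le_high x t0.
    rewrite (_ : t * M = lambda / 2); last first.
      by rewrite /t invfM mulrA mulfVK// gt_eqF.
    move=> h; have := lt_le_trans Ex h; case: (high_sum t x) (high_ge0 t x) => [r|_ _|//].
      by rewrite -EFinD lte_fin !lee_fin => _ h1; lra.
    by rewrite leey.
  by apply: ge0_subset_integral => //; exact: measurable_high.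
have l20 : 0 < lambda / 2 by rewrite divr_gt0.
rewrite -(@lee_pmul2l _ (lambda / 2)%:E)// ?lte_fin//.
apply: le_trans h1 _; rewrite -EFinM lee_fin le_eqVlt; apply/orP; left; apply/eqP.
have ti : 2 * M / lambda = t^-1 by rewrite /t invf_div.
have -> : lambda / 2 = t * M by rewrite /t invfM mulrA mulfVK// gt_eqF.
rewrite ti -powR_inv1 ?ltW// -powRrM mulN1r powRD ?(gt_eqF t0) ?implybT// powRr1 ?ltW//.
ring.
Qed.

End weak_sum.

(** * The kernel that dominates the commutator of an atom *)

Section atom_kernel.
Context (R : realType) (n : nat).
Local Notation vec := 'rV[R]_n.
Local Notation leb := (lebesgue_rV R n).
Variables (k : vec -> measurableTypeR R) (beta q A1 A2 A3 : R).
Hypotheses (beta0 : 0 < beta) (q1 : 1 <= q) (mk : measurable_fun setT k).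
Hypotheses (A10 : 0 <= A1) (A20 : 0 <= A2) (A30 : 0 <= A3).
Hypothesis k_near : forall d, 0 < d ->
  (\int[leb]_(x in ecball 0 (3 * d)) ((`|k x| * enorm x `^ beta) `^ q)%:E
     <= (A1 * d `^ (beta * q))%:E)%E.
Hypothesis k_far : forall d y, 0 < d -> enorm y <= d ->
  (\int[leb]_(x in [set x | (2 * d < enorm x)%R])
     ((`|k (x - y) - k x| * enorm x `^ beta) `^ q)%:E <= (A2 * d `^ (beta * q))%:E)%E.
Hypothesis k_weak : forall t, 0 < t -> (\int[leb]_x cut t `|k x| <= (A3 * t `^ (1 - q))%:E)%E.

(** Against the mass |a y| d^beta, up to the constant of [b]: the near part is the bound |k(x-y)|
    |x-y|^beta. The far part bounds the change of the kernel, its factor 2 coming from |x-y| <= 2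
    |x-x0|. The term |k(x-x0)| added in [atom_kernel] pays for b x0 - b y. *)
Definition near_part (x0 : vec) (d : R) (x y : vec) : R :=
  `|k (x - y)| * enorm (x - y) `^ beta / d `^ beta * (enorm (x - x0) <= 2 * d)%R%:R.
Definition far_part (x0 : vec) (d : R) (x y : vec) : R :=
  `|k (x - y) - k (x - x0)| * enorm (x - x0) `^ beta * 2 / d `^ beta
    * (2 * d < enorm (x - x0))%R%:R.
Definition atom_kernel (x0 : vec) (d : R) (z : vec * vec) : R :=
  near_part x0 d z.1 z.2 + far_part x0 d z.1 z.2 + `|k (z.1 - x0)|.

Lemma near_part_ge0 x0 d x y : 0 <= near_part x0 d x y.
Proof. by rewrite !mulr_ge0 ?invr_ge0 ?powR_ge0. Qed.

Lemma far_part_ge0 x0 d x y : 0 <= far_part x0 d x y.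
Proof. by rewrite !mulr_ge0 ?invr_ge0 ?powR_ge0. Qed.

Lemma atom_kernel_ge0 x0 d z : 0 <= atom_kernel x0 d z.
Proof. by rewrite !addr_ge0 ?near_part_ge0 ?far_part_ge0. Qed.

Let mnorm d (T : measurableType d) (f : T -> measurableTypeR R) : measurable_fun setT f ->
  measurable_fun setT (fun t => `|f t| : measurableTypeR R).
Proof. by move=> mf; exact: (measurableT_comp (@normr_measurable R setT) mf). Qed.

Let mbool (P : R -> bool) d (T : measurableType d) (f : T -> measurableTypeR R) :
  measurable [set u | P u] -> measurable_fun setT f ->
  measurable_fun setT (fun t => (P (f t))%:R : measurableTypeR R).
Proof.
move=> mP mf; rewrite (_ : (fun t => _) = (\1_[set t | P (f t)] : T -> R)).
  by apply: measurable_indic; have := mf measurableT _ mP; rewrite setTI.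
exact: indic_bool.
Qed.

Let mle (t : R) : measurable [set u : R | u <= t].
Proof. by have := @measurable_itv R `]-oo, t]; congr measurable. Qed.

Let mlt (t : R) : measurable [set u : R | t < u].
Proof.
have := @measurable_itv R `]t, +oo[; congr measurable.
by apply/seteqP; split => x /=; rewrite in_itv/= andbT.
Qed.

Let mnear d (T : measurableType d) x0 r (f g : T -> vec) : measurable_fun setT f ->
  measurable_fun setT g ->
  measurable_fun setT (fun t => near_part x0 r (f t) (g t) : measurableTypeR R).
Proof.
move=> mf mg; have ms := measurable_fun_subv mf mg.
have ms0 := measurable_fun_subv mf (@measurable_cst _ _ _ _ setT x0).
apply: measurable_funM; last first.
  apply: (@mbool (fun u => u <= 2 * r) _ _ (fun t => enorm (f t - x0))) => //.
  by apply: measurableT_comp ms0; exact: measurable_enorm.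
apply: measurable_funM => //; apply: measurable_funM.
  by apply: mnorm; exact: measurableT_comp mk ms.
by apply: measurable_powR_comp; apply: measurableT_comp ms; exact: measurable_enorm.
Qed.

Let mfar d (T : measurableType d) x0 r (f g : T -> vec) : measurable_fun setT f ->
  measurable_fun setT g ->
  measurable_fun setT (fun t => far_part x0 r (f t) (g t) : measurableTypeR R).
Proof.
move=> mf mg; have ms := measurable_fun_subv mf mg.
have ms0 := measurable_fun_subv mf (@measurable_cst _ _ _ _ setT x0).
have me : measurable_fun setT (fun t => enorm (f t - x0) : measurableTypeR R).
  by apply: measurableT_comp ms0; exact: measurable_enorm.
apply: measurable_funM; last first.
  exact: (@mbool (fun u => 2 * r < u) _ _ (fun t => enorm (f t - x0))).
do 2 (apply: measurable_funM => //); apply: measurable_funM; last exact: measurable_powR_comp.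
apply: mnorm; apply: measurable_funB; [exact: measurableT_comp mk ms|exact: measurableT_comp mk ms0].
Qed.

Let mtail d (T : measurableType d) (x0 : vec) (f : T -> vec) : measurable_fun setT f ->
  measurable_fun setT (fun t => `|k (f t - x0)| : measurableTypeR R).
Proof.
move=> mf; have ms0 := measurable_fun_subv mf (@measurable_cst _ _ _ _ setT x0).
by apply: mnorm; exact: measurableT_comp mk ms0.
Qed.

Lemma measurable_atom_kernel x0 r :
  measurable_fun setT (atom_kernel x0 r : _ -> measurableTypeR R).
Proof.
apply: measurable_funD; first apply: measurable_funD.
- by apply: mnear; [exact: measurable_fst|exact: measurable_snd].
- by apply: mfar; [exact: measurable_fst|exact: measurable_snd].
- by apply: mtail; exact: measurable_fst.
Qed.

(** For the near and far parts [cut_le_powR] reduces the claim to the q-th power integrals of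
    [k_near] and [k_far], in which d^(beta q) cancels; the tail is a translate of [k]. Each part is
    cut at a third of the level. *)
Lemma atom_kernel_weak : exists2 A, 0 <= A &
  forall x0 d y t, 0 < d -> enorm (y - x0) <= d -> 0 < t ->
    (\int[leb]_x cut t (atom_kernel x0 d (x, y)) <= (A * t `^ (1 - q))%:E)%E.
Proof.
have q0 : 0 < q by apply: lt_le_trans q1.
pose B := A1 + 2 `^ q * A2 + A3.
have B0 : 0 <= B by rewrite !addr_ge0// mulr_ge0// powR_ge0.
exists (3 * B * 3 `^ (q - 1)); first by rewrite !mulr_ge0// powR_ge0.
move=> x0 d y t' d0 yd t'0; pose t := t' / 3.
have t0 : 0 < t by rewrite divr_gt0.
have tE : t' = 3 * t by rewrite /t mulrCA mulfV ?mulr1.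
have db0 : 0 < d `^ beta by rewrite powR_gt0.
have dbq (u : R) : 0 <= u -> (u / d `^ beta) `^ q = u `^ q / d `^ (beta * q).
  by move=> u0; rewrite powRM ?invr_ge0 ?(ltW db0)// -powRN -powRrM mulNr powRN.
have hnear : (\int[leb]_x cut t (near_part x0 d x y) <= (t `^ (1 - q) * A1)%:E)%E.
  pose h z := ((t `^ (1 - q) / d `^ (beta * q))%:E *
     (((`|k z| * enorm z `^ beta) `^ q)%:E * (\1_(ecball 0 (3 * d)) z)%:E))%E.
  have h0 z : (0 <= h z)%E.
    by rewrite /h -!EFinM lee_fin !mulr_ge0 ?invr_ge0 ?powR_ge0.
  have mh : measurable_fun setT h.
    apply: measurable_funeM; apply: emeasurable_funM.
      apply/measurable_EFinP; apply: measurable_powR_comp; apply: measurable_funM.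
        exact: mnorm.
      by apply: measurable_powR_comp; exact: measurable_enorm.
    by apply/measurable_EFinP; apply: measurable_indic; exact: measurable_ecball.
  apply: (@le_trans _ _ (\int[leb]_x h (x + - y)%R)%E).
    apply: le_lower_integral => x _; first by rewrite cut_ge0 ?near_part_ge0.
    apply: le_trans (cut_le_powR q1 t0 (near_part_ge0 _ _ _ _)) _.
    rewrite /h /near_part -!EFinM lee_fin.
    case: (leP (enorm (x - x0)) (2 * d)) => hx; last first.
      by rewrite mulr0 powR0 ?gt_eqF// mulr0 !mulr_ge0 ?invr_ge0 ?powR_ge0.
    rewrite mulr1 indicE mem_set ?mulr1; last first.
      rewrite /ecball/= subr0 (_ : x - y = (x - x0) - (y - x0)); last first.
        by rewrite opprB addrA subrK.
      by apply: le_trans (ler_enormD _ _) _; rewrite enormN; lra.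
    rewrite dbq ?mulr_ge0 ?powR_ge0//.
    by rewrite le_eqVlt; apply/orP; left; apply/eqP; ring.
  rewrite integral_leb_shift// /h ge0_integralZl//; last 3 first.
  - apply: emeasurable_funM.
      apply/measurable_EFinP; apply: measurable_powR_comp; apply: measurable_funM.
        exact: mnorm.
      by apply: measurable_powR_comp; exact: measurable_enorm.
    by apply/measurable_EFinP; apply: measurable_indic; exact: measurable_ecball.
  - by move=> x _; rewrite -EFinM lee_fin mulr_ge0 ?powR_ge0.
  - by rewrite lee_fin mulr_ge0 ?invr_ge0 ?powR_ge0.
  rewrite -integral_indicM.
  apply: (@le_trans _ _ ((t `^ (1 - q) / d `^ (beta * q))%:E * (A1 * d `^ (beta * q))%:E)%E).
    by apply: lee_wpmul2l (k_near d0); rewrite lee_fin mulr_ge0 ?invr_ge0 ?powR_ge0.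
  rewrite -EFinM lee_fin le_eqVlt; apply/orP; left; apply/eqP; field.
  by rewrite gt_eqF// powR_gt0.
have hfar : (\int[leb]_x cut t (far_part x0 d x y) <= (t `^ (1 - q) * (2 `^ q * A2))%:E)%E.
  pose D := [set z : vec | 2 * d < enorm z].
  have mD : measurable D by exact: (@measurable_enorm_set R n _ (mlt (2 * d))).
  pose h0 z := ((`|k (z - (y - x0)) - k z| * enorm z `^ beta) `^ q)%:E.
  have mh0 : measurable_fun setT h0.
    apply/measurable_EFinP; apply: measurable_powR_comp; apply: measurable_funM.
      apply: mnorm; apply: measurable_funB => //.
      by apply: measurableT_comp mk _; apply: measurable_fun_subv => //; exact: measurable_cst.
    by apply: measurable_powR_comp; exact: measurable_enorm.
  pose c := (t `^ (1 - q) * 2 `^ q / d `^ (beta * q)).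
  have c0 : 0 <= c by rewrite /c !mulr_ge0 ?invr_ge0 ?powR_ge0.
  have mhD : measurable_fun setT (fun z => h0 z * (\1_D z)%:E)%E.
    by apply: emeasurable_funM => //; apply/measurable_EFinP; exact: measurable_indic.
  have hD0 z : (0 <= h0 z * (\1_D z)%:E)%E by rewrite -EFinM lee_fin mulr_ge0 ?powR_ge0.
  apply: (@le_trans _ _ (\int[leb]_x (c%:E * (h0 (x + - x0)%R * (\1_D (x + - x0)%R)%:E)))%E).
    apply: le_lower_integral => x _; first by rewrite cut_ge0 ?far_part_ge0.
    apply: le_trans (cut_le_powR q1 t0 (far_part_ge0 _ _ _ _)) _.
    rewrite /h0 /far_part -!EFinM lee_fin.
    case: (ltP (2 * d) (enorm (x - x0))) => hx; last first.
      rewrite mulr0 powR0 ?gt_eqF// mulr0; apply: mulr_ge0 => //.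
      by apply: mulr_ge0; rewrite ?powR_ge0.
    rewrite mulr1 indicE mem_set// ?mulr1 dbq ?mulr_ge0 ?powR_ge0//.
    rewrite (_ : x - x0 - (y - x0) = x - y); last by rewrite opprB addrA subrK.
    rewrite [X in X / _]powRM ?mulr_ge0 ?powR_ge0//.
    by rewrite /c le_eqVlt; apply/orP; left; apply/eqP; ring.
  rewrite (@integral_leb_shift R n (- x0) (fun z => c%:E * (h0 z * (\1_D z)%:E))%E)//; last first.
  - by move=> z; apply: mule_ge0 => //; rewrite lee_fin.
  - exact: measurable_funeM.
  rewrite ge0_integralZl// -integral_indicM.
  apply: (@le_trans _ _ (c%:E * (A2 * d `^ (beta * q))%:E)%E).
    by apply: lee_wpmul2l (k_far d0 yd); rewrite lee_fin.
  rewrite -EFinM lee_fin le_eqVlt; apply/orP; left; apply/eqP; rewrite /c; field.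
  by rewrite gt_eqF// powR_gt0.
have htail : (\int[leb]_x cut t `|k (x - x0)| <= (A3 * t `^ (1 - q))%:E)%E.
  rewrite (@integral_leb_shift R n (- x0) (fun z => cut t `|k z|)); first exact: k_weak.
    by apply: measurable_cut; exact: mnorm.
  by move=> z; exact: cut_ge0.
have mc (f : vec -> measurableTypeR R) : measurable_fun setT f ->
    measurable_fun setT (fun x => cut t (f x)) by exact: measurable_cut.
have mn : measurable_fun setT (fun x => cut t (near_part x0 d x y)).
  by apply: mc; apply: mnear => //; exact: measurable_cst.
have mf : measurable_fun setT (fun x => cut t (far_part x0 d x y)).
  by apply: mc; apply: mfar => //; exact: measurable_cst.
have mt : measurable_fun setT (fun x : vec => cut t `|k (x - x0)|).
  by apply: mc; apply: mtail.
have n0 x : (0 <= cut t (near_part x0 d x y))%E by rewrite cut_ge0 ?near_part_ge0.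
have f0 x : (0 <= cut t (far_part x0 d x y))%E by rewrite cut_ge0 ?far_part_ge0.
have l0 x : (0 <= cut t `|k (x - x0)|)%E by exact: cut_ge0.
apply: (@le_trans _ _ (\int[leb]_x (3%:E * (cut t (near_part x0 d x y) +
    cut t (far_part x0 d x y) + cut t `|k (x - x0)|)))%E).
  apply: le_lower_integral => x _; first by rewrite cut_ge0 ?atom_kernel_ge0.
  by rewrite tE; apply: cut_add3; rewrite ?near_part_ge0 ?far_part_ge0.
rewrite ge0_integralZl//; last 2 first.
- by apply: emeasurable_funD => //; exact: emeasurable_funD.
- by move=> x _; rewrite !adde_ge0.
rewrite ge0_integralD//; last 2 first.
- by move=> x _; rewrite adde_ge0.
- exact: emeasurable_funD.
rewrite ge0_integralD//.
apply: (@le_trans _ _ (3%:E * ((t `^ (1 - q) * A1)%:E + (t `^ (1 - q) * (2 `^ q * A2))%:E +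
    (A3 * t `^ (1 - q))%:E))%E).
  by apply: lee_wpmul2l => //; apply: leeD => //; apply: leeD.
have -> : t' `^ (1 - q) = 3 `^ (1 - q) * t `^ (1 - q) by rewrite tE powRM// ltW.
rewrite -!EFinD -EFinM lee_fin /B.
have -> : 3 * (A1 + 2 `^ q * A2 + A3) * 3 `^ (q - 1) * (3 `^ (1 - q) * t `^ (1 - q)) =
   3 * (A1 + 2 `^ q * A2 + A3) * (3 `^ (q - 1) * 3 `^ (1 - q)) * t `^ (1 - q) by ring.
rewrite -powRD ?pnatr_eq0 ?implybT// (_ : q - 1 + (1 - q) = 0) ?powRr0; last by ring.
by rewrite le_eqVlt; apply/orP; left; apply/eqP; ring.
Qed.

End atom_kernel.

Section integrable_bound.
Context d (T : measurableType d) (R : realType) (mu : {measure set T -> \bar R}).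
Implicit Types f g : T -> measurableTypeR R.

Lemma integrable_of_le f (u : T -> \bar R) : measurable_fun setT f ->
  measurable_fun setT u ->
  (forall x, `|f x|%:E <= u x)%E -> (\int[mu]_x u x < +oo)%E ->
  mu.-integrable setT (EFin \o f).
Proof.
move=> mf mu_ fu uoo; apply/integrableP; split; first exact/measurable_EFinP.
apply: le_lt_trans uoo; apply: le_lower_integral => x _ //.
exact: fu.
Qed.

Lemma Rintegral_le_bound f (u : T -> \bar R) : mu.-integrable setT (EFin \o f) ->
  (forall x, `|f x|%:E <= u x)%E ->
  (`|(\int[mu]_x f x)%R|%:E <= \int[mu]_x u x)%E.
Proof.
move=> fi fu; rewrite EFin_normr_Rintegral//.
apply: (@le_trans _ _ (\int[mu]_x `|(f x)%:E|)%E).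
  by apply: le_abse_integral => //; case/integrableP : fi.
by apply: le_lower_integral => x _ //; exact: fu.
Qed.

End integrable_bound.

(** * Atoms and the commutator of one atom *)

Section atom_data.
Context (R : realType) (n : nat).
Local Notation vec := 'rV[R]_n.
Local Notation leb := (lebesgue_rV R n).
Hypothesis n0 : (0 < n)%N.
Variables (beta p l : R) (s : nat).
Hypotheses (beta0 : 0 < beta) (hp : p = n%:R / (n%:R + beta)) (l1 : 1 < l).

(** An atom has L^1 norm of the order |B(x0,d)|^(1 - 1/p) = |B(x0,d)|^(-beta/n), from which
    d^(-beta) is taken out; the factor 2 arises because a splitting at a level replaces Hoelder's
    inequality. *)
Definition atom_const : R := 2 * ballvol R n `^ (- beta / n%:R).

Lemma atom_const_ge0 : 0 <= atom_const.
Proof. by rewrite mulr_ge0 ?powR_ge0. Qed.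

(* an atom up to a null set, with the moment of order 0 only *)
Definition borel_atom (x0 : vec) (d : R) (a : vec -> measurableTypeR R) : Prop :=
  [/\ 0 < d, measurable_fun setT a, (forall x, d < enorm (x - x0) -> a x = 0),
      (\int[leb]_x `|a x|%:E <= (atom_const / d `^ beta)%:E)%E &
      \int[leb]_x a x = 0].

Lemma atom_borel a : atom p l s a -> exists x0 d a0,
  borel_atom x0 d a0 /\ {ae leb, forall x, a x = a0 x}.
Proof.
move=> [x0 [d [d0 [g gL ag] asupp anorm amom]]].
have nR : 0 < n%:R :> R by rewrite ltr0n.
have nb : 0 < n%:R + beta by rewrite addr_gt0.
have l0 : 0 < l by apply: lt_trans l1.
have mg : measurable_fun setT g by move: gL; rewrite inE => /andP[/[!inE]/=].
have mB := @measurable_ecball R n x0 d.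
pose a0 : vec -> measurableTypeR R := fun x => g x * \1_(ecball x0 d) x.
have ma0 : measurable_fun setT a0.
  by apply: measurable_funM => //; exact: measurable_indic.
have aa0 : {ae leb, forall x, a x = a0 x}.
  apply: filterS2 ag asupp => x h1 h2; rewrite /a0 indicE.
  have [xB|xB] := pselect (ecball x0 d x).
    by rewrite mem_set// mulr1; apply: h1.
  by rewrite memNset// mulr0; exact: h2.
exists x0, d, a0; split => //.
have a0out x : d < enorm (x - x0) -> a0 x = 0.
  by move=> h; rewrite /a0 indicE memNset ?mulr0// /ecball/= leNgt h.
have bv := @ballvol_gt0 R n.
pose V : R := d ^+ n * ballvol R n.
have V0 : 0 < V by rewrite mulr_gt0// exprn_gt0.
have VE : leb (ecball x0 d) = V%:E by rewrite leb_ecball.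
have mal : measurable_fun setT (fun x => (`|a0 x| `^ l)%:E).
  apply/measurable_EFinP; apply: measurable_powR_comp.
  exact: (measurableT_comp (@normr_measurable R setT) ma0).
have hl : (\int[leb]_x (`|a0 x| `^ l)%:E <= (V `^ (1 - l / p))%:E)%E.
  have e1 : (\int[leb]_x `|(EFin \o a) x| `^ l)%E = (\int[leb]_x (`|a0 x| `^ l)%:E)%E.
    apply: lower_integral_ae => //; apply: filterS aa0 => x h.
    by rewrite (_ : (EFin \o a) x = (a0 x)%:E) ?abse_EFin ?poweR_EFin//= h.
  rewrite -e1 -powR_Lnorm ?gt_eqF//.
  apply: (@le_trans _ _ ((leb (ecball x0 d) `^ (l^-1 - p^-1)) `^ l)%E).
    apply: (gt0_ler_poweR (ltW l0)) => //; rewrite in_itv/= leey andbT.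
      exact: Lnorm_ge0.
    exact: poweR_ge0.
  rewrite VE -poweRrM poweR_EFin lee_fin le_eqVlt; apply/orP; left; apply/eqP.
  by congr (_ `^ _); rewrite mulrBl mulVf ?gt_eqF// [_^-1 * l]mulrC.
(* The natural height |B|^(-1/p) of an atom: below this level and above it, the integral of |a| is
   at most |B|^(1 - 1/p). *)
pose tau := V `^ (- p^-1).
have tau0 : 0 < tau by rewrite powR_gt0.
have ptw x : `|a0 x| <= tau * \1_(ecball x0 d) x + tau `^ (1 - l) * `|a0 x| `^ l.
  have [xB|xB] := pselect (ecball x0 d x); last first.
    rewrite a0out; last by rewrite ltNge; apply/negP.
    by rewrite normr0; apply: addr_ge0; apply: mulr_ge0; rewrite ?powR_ge0// ltW.
  rewrite indicE mem_set// mulr1.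
  have := le_cut_add `|a0 x| (ltW tau0).
  have := cut_le_powR (ltW l1) tau0 (normr_ge0 (a0 x)).
  by rewrite /cut -EFinD !lee_fin; lra.
have Vexp : V `^ (1 - p^-1) = ballvol R n `^ (- beta / n%:R) / d `^ beta.
  rewrite (_ : 1 - p^-1 = - beta / n%:R); last first.
    by rewrite hp invf_div; field; rewrite gt_eqF.
  rewrite /V powRM ?exprn_ge0 ?(ltW d0) ?(ltW bv)// mulrC; congr (_ * _).
  rewrite -powR_mulrn ?(ltW d0)// -powRrM (_ : n%:R * _ = - beta) ?powRN//.
  by field; rewrite gt_eqF.
have L1 : (\int[leb]_x `|a0 x|%:E <= (atom_const / d `^ beta)%:E)%E.
  apply: (@le_trans _ _ (\int[leb]_x (tau%:E * (\1_(ecball x0 d) x)%:E +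
     (tau `^ (1 - l))%:E * (`|a0 x| `^ l)%:E))%E).
    by apply: le_lower_integral => x _ //; rewrite -!EFinM -EFinD lee_fin ptw.
  rewrite ge0_integralD//; last 4 first.
  - by move=> x _; rewrite -EFinM lee_fin mulr_ge0// ltW.
  - by apply: measurable_funeM; apply/measurable_EFinP; exact: measurable_indic.
  - by move=> x _; rewrite -EFinM lee_fin mulr_ge0 ?powR_ge0.
  - exact: measurable_funeM.
  rewrite ge0_integralZl//; last 2 first.
  - by apply/measurable_EFinP; exact: measurable_indic.
  - by rewrite lee_fin ltW.
  rewrite ge0_integralZl//; last by rewrite lee_fin powR_ge0.
  apply: (@le_trans _ _ (tau%:E * V%:E + (tau `^ (1 - l))%:E * (V `^ (1 - l / p))%:E)%E).
    apply: leeD; last by apply: lee_wpmul2l => //; rewrite lee_fin powR_ge0.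
    have -> : (\int[leb]_x (\1_(ecball x0 d) x)%:E = V%:E)%E.
      by rewrite integral_indic// setIT -VE.
    by [].
  rewrite -!EFinM -EFinD lee_fin /tau -powRrM -powRD ?(gt_eqF V0) ?implybT//.
  rewrite -[X in _ * X + _ <= _](powRr1 (ltW V0)) -powRD ?(gt_eqF V0) ?implybT//.
  rewrite (_ : - p^-1 * (1 - l) + (1 - l / p) = 1 - p^-1); last by ring.
  rewrite (_ : - p^-1 + 1 = 1 - p^-1) 1?addrC// Vexp /atom_const.
  by rewrite le_eqVlt; apply/orP; left; apply/eqP; ring.
have a0i : leb.-integrable setT (EFin \o a0).
  apply: (@integrable_of_le _ _ _ _ _ (fun x => `|a0 x|%:E)) => //.
    apply/measurable_EFinP; exact: (measurableT_comp (@normr_measurable R setT) ma0).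
  exact: le_lt_trans L1 (ltry _).
have I0 : \int[leb]_x a0 x = 0.
  rewrite -(amom (fun=> 0%N)); last by rewrite big1.
  rewrite /Rintegral; congr fine; apply/esym/lower_integral_ae; first exact/measurable_EFinP.
  by apply: filterS aa0 => x ->; rewrite big1 ?mulr1// => i _; rewrite expr0.
by [].
Qed.

End atom_data.

Section commutator_bound.
Context (R : realType) (n : nat).
Local Notation vec := 'rV[R]_n.
Local Notation leb := (lebesgue_rV R n).
Variables (k b : vec -> measurableTypeR R) (beta L : R).
Hypotheses (n0 : (0 < n)%N) (beta0 : 0 < beta) (beta1 : beta < 1).
Hypotheses (mk : measurable_fun setT k) (mb : measurable_fun setT b) (L0 : 0 <= L).
Hypothesis bL : forall x y, `|b x - b y| <= L * enorm (x - y) `^ beta.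

Definition comm (x y : vec) : measurableTypeR R := k (x - y) * (b x - b y).

Lemma measurable_comm_pair :
  measurable_fun setT (fun z : vec * vec => comm z.1 z.2).
Proof.
apply: measurable_funM.
  apply: measurableT_comp mk _; apply: measurable_fun_subv; [exact: measurable_fst|exact: measurable_snd].
apply: measurable_funB; apply: measurableT_comp mb _; [exact: measurable_fst|exact: measurable_snd].
Qed.

Lemma measurable_comm (x : vec) : measurable_fun setT (comm x).
Proof. exact: (measurableT_comp measurable_comm_pair (@measurable_pair1 _ _ vec vec x)). Qed.

Definition atom_mass (d : R) (a : vec -> R) (y : vec) : measurableTypeR R := `|a y| * d `^ beta.

Lemma atom_mass_ge0 d a y : 0 <= atom_mass d a y.
Proof. by rewrite mulr_ge0 ?powR_ge0. Qed.

Lemma measurable_atom_mass d (a : vec -> measurableTypeR R) : measurable_fun setT a ->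
  measurable_fun setT (atom_mass d a).
Proof.
move=> ma; apply: measurable_funM => //.
exact: (measurableT_comp (@normr_measurable R setT) ma).
Qed.

(* beyond 2d subtracting the constant k (x - x0) (b x - b x0) from the kernel
   does not change the integral against the atom and makes it small *)
Lemma comm_atom_pointwise x0 d (a : vec -> measurableTypeR R) x :
  borel_atom beta x0 d a ->
  exists c : R, forall y, `|comm x y * a y - c * a y| <=
    L * (atom_mass d a y * atom_kernel k beta x0 d (x, y)).
Proof.
move=> [d0 ma asupp _ _].
have db0 : 0 < d `^ beta by rewrite powR_gt0.
have m0 := atom_mass_ge0 d a.
exists (if enorm (x - x0) <= 2 * d then 0 else k (x - x0) * (b x - b x0)) => y.
have [xd|dx] := leP (enorm (x - x0)) (2 * d).
  rewrite mul0r subr0 !normrM.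
  apply: (@le_trans _ _ (L * (atom_mass d a y * near_part k beta x0 d x y))); last first.
    apply: ler_wpM2l => //; apply: ler_wpM2l => //.
    by rewrite /atom_kernel/= -addrA lerDl addr_ge0 ?far_part_ge0.
  rewrite /near_part xd mulr1 /atom_mass.
  have -> : L * (`|a y| * d `^ beta * (`|k (x - y)| * enorm (x - y) `^ beta / d `^ beta)) =
     `|k (x - y)| * (L * enorm (x - y) `^ beta) * `|a y|.
    by field; rewrite gt_eqF.
  by apply: ler_wpM2r => //; apply: ler_wpM2l.
have [yd|dy] := leP (enorm (y - x0)) d; last first.
  by rewrite asupp// !mulr0 subrr normr0; apply: mulr_ge0 => //; apply: mulr_ge0 => //;
    exact: atom_kernel_ge0.
rewrite -mulrBl normrM.
have -> : comm x y - k (x - x0) * (b x - b x0) =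
    (k (x - y) - k (x - x0)) * (b x - b y) + k (x - x0) * (b x0 - b y).
  by rewrite /comm; ring.
apply: (@le_trans _ _ (L * (atom_mass d a y * (far_part k beta x0 d x y + `|k (x - x0)|)))); last first.
  apply: ler_wpM2l => //; apply: ler_wpM2l => //.
  by rewrite /atom_kernel/= -addrA lerDr near_part_ge0.
rewrite /far_part dx mulr1 /atom_mass.
set D := `|k (x - y) - k (x - x0)|.
have D0 : 0 <= D by exact: normr_ge0.
have -> : L * (`|a y| * d `^ beta * (D * enorm (x - x0) `^ beta * 2 / d `^ beta + `|k (x - x0)|)) =
   (D * (L * (2 * enorm (x - x0) `^ beta)) + `|k (x - x0)| * (L * d `^ beta)) * `|a y|.
  by field; rewrite gt_eqF.
apply: ler_wpM2r => //; apply: le_trans (ler_normD _ _) _; rewrite !normrM -/D.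
apply: lerD; apply: ler_wpM2l => //; apply: le_trans (bL _ _) _; apply: ler_wpM2l => //.
  apply: (@le_trans _ _ ((2 * enorm (x - x0)) `^ beta)).
    apply: ge0_ler_powR; rewrite ?nnegrE ?(ltW beta0) ?enorm_ge0 ?mulr_ge0 ?enorm_ge0//.
    rewrite (_ : x - y = (x - x0) + (x0 - y)); last by rewrite addrA subrK.
    by apply: le_trans (ler_enormD _ _) _; rewrite (enormB x0 y); lra.
  rewrite powRM ?enorm_ge0//; apply: ler_wpM2r; rewrite ?powR_ge0//.
  rewrite -[leRHS]powRr1//; by apply: ler_powR; [rewrite ler1n|exact: ltW].
by apply: ge0_ler_powR; rewrite ?nnegrE ?(ltW beta0) ?enorm_ge0 ?(ltW d0)// enormB.
Qed.

Lemma borel_atom_integrable x0 d (a : vec -> measurableTypeR R) : borel_atom beta x0 d a ->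
  leb.-integrable setT (EFin \o a).
Proof.
move=> [d0 ma _ L1 _]; apply: (@integrable_of_le _ _ _ _ _ (fun x => `|a x|%:E)) => //.
  apply/measurable_EFinP; exact: (measurableT_comp (@normr_measurable R setT) ma).
exact: le_lt_trans L1 (ltry _).
Qed.

Lemma measurable_mass_kernel x0 d (a : vec -> measurableTypeR R) x : measurable_fun setT a ->
  measurable_fun setT (fun y => (atom_mass d a y * atom_kernel k beta x0 d (x, y))%:E).
Proof.
move=> ma; apply/measurable_EFinP.
apply: (@measurable_funM _ _ _ _ _ (fun y => atom_kernel k beta x0 d (x, y) : measurableTypeR R)).
  exact: measurable_atom_mass.
exact: (measurableT_comp (measurable_atom_kernel beta mk x0 d) (@measurable_pair1 _ _ vec vec x)).
Qed.

Lemma comm_atom_bound x0 d (a : vec -> measurableTypeR R) x :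
  borel_atom beta x0 d a ->
  (\int[leb]_y (atom_mass d a y * atom_kernel k beta x0 d (x, y))%:E < +oo)%E ->
  leb.-integrable setT (EFin \o (fun y => comm x y * a y)) /\
  (`|(\int[leb]_y (comm x y * a y))%R|%:E <=
     L%:E * \int[leb]_y (atom_mass d a y * atom_kernel k beta x0 d (x, y))%:E)%E.
Proof.
move=> ha Goo; have [c hc] := comm_atom_pointwise x ha.
have [d0 ma asupp L1 I0] := ha.
have ai := borel_atom_integrable ha.
have mu_ := @measurable_mass_kernel x0 d a x ma.
pose u y := (L%:E * (atom_mass d a y * atom_kernel k beta x0 d (x, y))%:E)%E.
have uE : (\int[leb]_y u y = L%:E *
    \int[leb]_y (atom_mass d a y * atom_kernel k beta x0 d (x, y))%:E)%E.
  by rewrite ge0_integralZl// => y _; rewrite lee_fin mulr_ge0 ?atom_mass_ge0 ?atom_kernel_ge0.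
have mcomm : measurable_fun setT (fun y => comm x y * a y).
  by apply: measurable_funM => //; exact: measurable_comm.
have mca : measurable_fun setT (fun y => c * a y) by exact: measurable_funM.
have hi : leb.-integrable setT (EFin \o (fun y => comm x y * a y - c * a y)).
  apply: (@integrable_of_le _ _ _ _ _ u).
  - exact: measurable_funB.
  - exact: measurable_funeM.
  - by move=> y; rewrite /u -EFinM lee_fin; exact: hc.
  - by rewrite uE lte_mul_pinfty.
have hci : leb.-integrable setT (EFin \o (fun y => c * a y)).
  by apply: eq_integrable (integrableZl measurableT c ai).
have hK : leb.-integrable setT (EFin \o (fun y => comm x y * a y)).
  apply: eq_integrable (integrableD measurableT hi hci) => // y _.
  by rewrite /= -EFinD subrK.
split => //; rewrite -uE.
have -> : \int[leb]_y (comm x y * a y) = \int[leb]_y (comm x y * a y - c * a y).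
  by rewrite RintegralB// RintegralZl// I0 mulr0 subr0.
by apply: Rintegral_le_bound => // y; rewrite /u -EFinM lee_fin; exact: hc.
Qed.

End commutator_bound.

Section commutator_borel.
Context (R : realType) (n : nat).
Local Notation vec := 'rV[R]_n.
Local Notation leb := (lebesgue_rV R n).
Variables (Omega : vec -> R) (W b : vec -> measurableTypeR R) (N : set vec) (alpha : R).
Hypotheses (mN : measurable N) (N0 : leb N = 0%E) (OW : forall x, ~ N x -> Omega x = W x).

Lemma commutator_kernel_ae (a a0 : vec -> R) x : {ae leb, forall y, a y = a0 y} ->
  {ae leb, forall y, commutator_kernel Omega alpha b x y * a y =
                     comm (kern W alpha) b x y * a0 y}.
Proof.
move=> aa0; have mx : measurable [set y | N (x - y)].
  rewrite -[X in measurable X]setTI.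
  exact: (measurable_fun_subv (@measurable_cst _ _ _ _ setT x) (@measurable_id _ _ _)).
have N0' : leb [set y | N (x - y)] = 0%E.
  have m1 : (-1 : R) != 0 by rewrite oppr_eq0 oner_eq0.
  have := leb_affine x m1 mN; rewrite N0 normrN normr1 expr1n mul1e => h.
  by rewrite -[RHS]h; congr (leb _); apply/seteqP; split => y /=; rewrite scaleN1r addrC.
have hN : {ae leb, forall y, ~ N (x - y)}.
  by exists [set y | N (x - y)]; split => // y /=; apply: contra_notP.
apply: filterS2 aa0 hN => y -> hy.
by rewrite /commutator_kernel /comm /kern OW.
Qed.

End commutator_borel.

(** * Smooth compactly supported test functions *)

Section bump.
Context (R : realType).
Local Notation bs t := ((t * (1 - t))^-1).

(* p(t) s^m e^(-s), s = 1/(t(1-t)), on ]0,1[, and 0 outside; this class of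
   functions is closed under derivation *)
Definition bump (p : {poly R}) (m : nat) (t : R) : R :=
  if 0 < t < 1 then p.[t] * bs t ^+ m * expR (- bs t) else 0.

(** With s' = -(1 - 2t) s^2, the factor s^(m+2) e^(-s) is taken out of the derivative; the remaining
    powers of 1/s = t(1 - t) are polynomial. *)
Definition bump_deriv (p : {poly R}) (m : nat) : {poly R} :=
  p^`() * ('X * (1 - 'X)) ^+ 2 - (1 - 2%:P * 'X) * p * (m%:R%:P * ('X * (1 - 'X)) - 1).

Lemma poly_bounded01 (p : {poly R}) : exists2 B, 0 <= B & forall t, 0 <= t <= 1 -> `|p.[t]| <= B.
Proof.
exists (\sum_(i < size p) `|p`_i|); first exact: sumr_ge0.
move=> t /andP[t0 t1]; rewrite horner_coef; apply: le_trans (ler_norm_sum _ _ _) _.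
apply: ler_sum => i _; rewrite normrM -[leRHS]mulr1 ler_wpM2l// normrX ger0_norm//.
exact: exprn_ile1.
Qed.

(** From s^(m+2) <= (m+2)! e^s. Vanishing to second order at the end points gives derivative 0
    there. *)
Lemma bump_sqr_le p m : exists2 B, 0 <= B & forall t, 0 < t < 1 ->
  `|bump p m t| <= B * (t * (1 - t)) ^+ 2.
Proof.
have [B B0 hB] := poly_bounded01 p.
exists (B * (m.+2)`!%:R); first by rewrite mulr_ge0.
move=> t t01; have /andP[t0 t1] := t01; rewrite /bump t01.
have u0 : 0 < t * (1 - t) by rewrite mulr_gt0// subr_gt0.
set s := (_)^-1; have s0 : 0 < s by rewrite invr_gt0.
rewrite !normrM (ger0_norm (expR_ge0 _)) (ger0_norm (exprn_ge0 _ (ltW s0))) -!mulrA.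
apply: ler_pM => //; first by rewrite mulr_ge0 ?expR_ge0 ?exprn_ge0// ltW.
  by apply: hB; rewrite !ltW.
have -> : (t * (1 - t)) ^+ 2 = s ^- 2 by rewrite /s exprVn invrK.
have h : s ^+ m.+2 / m.+2`!%:R <= expR s.
  by apply: le_trans (expR_ge1Dxn m.+1 (ltW s0)); rewrite lerDr.
rewrite expRN ler_pdivrMr ?expR_gt0//.
rewrite ler_pdivrMr ?ltr0n ?fact_gt0// in h.
rewrite mulrAC ler_pdivlMr ?exprn_gt0// -exprD addn2 mulrC; apply: le_trans h _.
by rewrite mulrC.
Qed.

Lemma is_derive0_of_sqr (f : R -> R) (a B : R) :
  (forall t, `|f t| <= B * (t - a) ^+ 2) -> is_derive a 1 f 0.
Proof.
move=> hf; have fa : f a = 0.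
  by have := hf a; rewrite subrr expr0n mulr0 normr_le0 => /eqP.
have B0 : 0 <= B.
  by have := hf (a + 1); rewrite addrAC subrr add0r expr1n mulr1; apply: le_trans.
have h : (fun h => h^-1 *: ((f \o shift a) (h *: (1 : R)) - f a)) @ 0^' --> (0 : R).
  apply/cvgrPdist_le => e e0.
  have eB : 0 < e / (B + 1) by rewrite divr_gt0// ltr_wpDl.
  near=> h; rewrite sub0r normrN fa subr0 /= scaler1.
  have hn0 : h != 0 by near: h; exact: nbhs_dnbhs_neq.
  have hle : `|h| <= e / (B + 1).
    by near: h; apply: dnbhs0_le.
  have := hf (h + a); rewrite addrK => h1.
  rewrite normrM normfV ler_pdivrMl ?normr_gt0//; apply: le_trans h1 _.
  rewrite -real_normK ?num_real// expr2 mulrA [leRHS]mulrC ler_wpM2r//.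
  apply: (@le_trans _ _ ((B + 1) * (e / (B + 1)))).
    by apply: ler_pM => //; rewrite lerDl.
  by rewrite mulrC divfK// gt_eqF// ltr_wpDl.
apply: DeriveDef; first by apply/cvg_ex; exists 0.
by apply/cvg_lim.
Unshelve. all: by end_near.
Qed.

Lemma is_derive_bump p m (t : R) : is_derive t (1 : R) (bump p m) (bump (bump_deriv p m) m.+2 t).
Proof.
have [t01|t01] := boolP (0 < t < 1); last first.
  have [B B0 hB] := bump_sqr_le p m.
  rewrite {2}/bump (negPf t01); apply: (@is_derive0_of_sqr _ _ B) => u.
  have [u01|u01] := boolP (0 < u < 1); last first.
    by rewrite /bump (negPf u01) normr0 mulr_ge0// sqr_ge0.
  apply: le_trans (hB _ u01) _; apply: ler_wpM2l => //.
  (* A point [t] outside ]0,1[ is at distance at least [u] or [1 - u] from [u], according to its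
     side; the other factor is at most 1. *)
  move: u01 t01 => /andP[u0 u1]; rewrite negb_and -!leNgt => /orP[t0|t1].
    rewrite exprMn -[leRHS]mulr1; apply: ler_pM; rewrite ?sqr_ge0//.
      by rewrite ler_sqr ?nnegrE; lra.
    by apply: exprn_ile1; lra.
  rewrite exprMn -[leRHS]mul1r -[(u - t) ^+ 2]sqrrN opprB; apply: ler_pM; rewrite ?sqr_ge0//.
    by apply: exprn_ile1; lra.
  by rewrite ler_sqr ?nnegrE; lra.
have /andP[t0 t1] := t01.
have u0 : t * (1 - t) != 0 by rewrite mulf_neq0 ?gt_eqF ?subr_gt0.
apply: (@near_eq_is_derive _ _ _ (fun t => p.[t] * bs t ^+ m * expR (- bs t))).
  near=> y; rewrite /bump ifT//.
  have : y \in `]0, 1[ by near: y; apply: near_in_itvoo; rewrite in_itv/= t0.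
  by rewrite in_itv.
have hs : is_derive t 1 (fun t : R => bs t) (- (1 - 2 * t) * bs t ^+ 2).
  have hu : is_derive t 1 (fun t : R => t * (1 - t)) (1 - 2 * t).
    apply: is_derive_eq; rewrite /GRing.scale/=; ring.
  apply: is_derive_eq (@is_deriveV R (fun t => t * (1 - t)) t _ 1 u0 hu) _.
  by rewrite /GRing.scale/= -exprVn; ring.
have he : is_derive t 1 (fun t : R => expR (- bs t)) (- (- (1 - 2 * t) * bs t ^+ 2) * expR (- bs t)).
  have hN := is_deriveN hs.
  by apply: is_derive_eq (@is_derive1_comp R expR (fun t => - bs t) t _ _ (is_derive_expR _) hN) _; rewrite mulrC.
have hm : is_derive t 1 (fun t : R => bs t ^+ m) (m%:R * bs t ^+ m.-1 * (- (1 - 2 * t) * bs t ^+ 2)).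
  have := @is_deriveX R _ (fun t : R => bs t) m t (1 : R) _ hs.
  by rewrite exprfctE /GRing.scale.
have hpm := @is_deriveM _ _ (horner p) (fun t => bs t ^+ m) t 1 _ _ (is_derive_poly p t) hm.
have hpe := is_deriveM hpm he.
suff <- : (horner p * (fun t : R => bs t ^+ m)) t *: (- (- (1 - 2 * t) * bs t ^+ 2) * expR (- bs t)) +
    expR (- bs t) *: (p.[t] *: (m%:R * bs t ^+ m.-1 * (- (1 - 2 * t) * bs t ^+ 2)) +
       bs t ^+ m *: p^`().[t]) = bump (bump_deriv p m) m.+2 t by exact: hpe.
rewrite mulrfctE /bump t01.
have -> : (bump_deriv p m).[t] = p^`().[t] * (t * (1 - t)) ^+ 2
    - (1 - 2 * t) * p.[t] * (m%:R * (t * (1 - t)) - 1).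
  by rewrite /bump_deriv !hornerE.
clear hs he hm hpm hpe; set S := bs t; have S0 : S != 0 by rewrite invr_eq0.
have -> : t * (1 - t) = S^-1 by rewrite invrK.
have -> : m%:R * S ^+ m.-1 = m%:R * S ^+ m / S.
  by case: (m) => [|m']; rewrite ?mul0r ?mul0r// exprS; field.
rewrite /GRing.scale/= [S ^+ m.+2]exprS [S ^+ m.+1]exprS; clearbody S.
set E := expR _; set X := S ^+ m; clearbody E X; field.
by [].
Unshelve. all: by end_near.
Qed.

End bump.

Section test_functions.
Context (R : realType) (n : nat).
Local Notation vec := 'rV[R]_n.

(** Each derivative of a rescaled bump brings out a factor [r], hence the scalar [c] in the
    class. *)
Definition bump1 (u : R -> R) : Prop :=
  exists (c r v : R) (p : {poly R}) (m : nat), u = fun t => c * bump p m (r * t + v).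

Lemma bump1_is_derive u : bump1 u -> exists2 w, bump1 w & forall t : R, is_derive t (1 : R) u (w t).
Proof.
move=> [c [r [v [p [m ->]]]]].
exists (fun t => (c * r) * bump (bump_deriv p m) m.+2 (r * t + v)).
  by exists (c * r), r, v, (bump_deriv p m), m.+2.
move=> t; have h1 : is_derive t (1 : R) (fun t => r * t + v) r.
  by apply: is_derive_eq; rewrite /GRing.scale/=; ring.
have h2 := @is_derive1_comp R (bump p m) (fun t => r * t + v) t _ _ (is_derive_bump _ _ _) h1.
have h3 := is_deriveZ c h2.
suff <- : c *: (bump (bump_deriv p m) m.+2 (r * t + v) * r) =
  (c * r) * bump (bump_deriv p m) m.+2 (r * t + v) by exact: h3.
by rewrite /GRing.scale/=; ring.
Qed.

Definition tensor (u : 'I_n -> R -> R) (x : vec) : R := \prod_i u i (x 0 i).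

Lemma is_derive_tensor (u : 'I_n -> R -> R) (w : R -> R) (i : 'I_n) (x : vec) : is_derive (x 0 i) (1 : R) (u i) (w (x 0 i)) ->
  is_derive x (delta_mx 0 i) (tensor u) (tensor (fun j => if j == i then w else u j) x).
Proof.
move=> [dd dE]; pose C := \prod_(j | j != i) u j (x 0 j).
have qE (h : R) : (tensor u \o shift x) (h *: delta_mx 0 i) - tensor u x =
    C * ((u i \o shift (x 0 i)) (h *: (1 : R)) - u i (x 0 i)).
  rewrite /tensor /= (bigD1 i)//= [X in _ - X](bigD1 i)//= -/C.
  rewrite (eq_bigr (fun j => u j (x 0 j))); last first.
    by move=> j ji; rewrite !mxE (negPf ji) andbF mulr0 add0r.
  by rewrite -/C !mxE !eqxx mulr1 /GRing.scale/= mulr1; ring.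
have hcvg : (fun h : R => h^-1 *: ((tensor u \o shift x) (h *: delta_mx 0 i) - tensor u x)) @ 0^' -->
    C * w (x 0 i).
  rewrite (_ : (fun h : R => _) = (fun h : R => C * (h^-1 *:
      ((u i \o shift (x 0 i)) (h *: (1 : R)) - u i (x 0 i))))); last first.
    by apply/funext => h; rewrite qE /GRing.scale/= mulrCA.
  apply: cvgMr; rewrite -dE; exact: dd.
have -> : tensor (fun j => if j == i then w else u j) x = C * w (x 0 i).
  rewrite /tensor (bigD1 i)//= eqxx mulrC; congr (_ * _).
  by apply: eq_bigr => j /negPf ->.
by apply: DeriveDef; [apply/cvg_ex; exists (C * w (x 0 i))|exact/cvg_lim].
Qed.

Lemma partial_tensor (u : 'I_n -> R -> R) (k : seq 'I_n) : (forall i, bump1 (u i)) ->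
  exists2 w, (forall i, bump1 (w i)) & partial k (tensor u) = tensor w.
Proof.
move=> hu; elim: k => [|i k [w hw e]]; first by exists u.
have [wi hwi di] := bump1_is_derive (hw i).
exists (fun j => if j == i then wi else w j); first by move=> j; case: ifP.
rewrite /= /partial -/(partial k (tensor u)) e; apply/funext => x.
by have [_ ->] := @is_derive_tensor w wi i x (di _).
Qed.

Lemma bump1_continuous u : bump1 u -> continuous u.
Proof.
move=> /bump1_is_derive[w _ dw] t; apply: differentiable_continuous.
by apply/derivable1_diffP; have [] := dw t.
Qed.

Lemma tensor_continuous (u : 'I_n -> R -> R) : (forall i, bump1 (u i)) -> continuous (tensor u).
Proof.
move=> hu x; rewrite /tensor.
have h (s : seq 'I_n) : continuous (fun y : vec => \prod_(i <- s) u i (y 0 i)).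
  elim: s => [|i s ih].
    have -> : (fun y : vec => \prod_(i <- [::]) u i (y 0 i)) = (fun=> 1).
      by apply/funext => y; rewrite big_nil.
    exact: cst_continuous.
  have -> : (fun y : vec => \prod_(j <- i :: s) u j (y 0 j)) =
      (fun y => u i (y 0 i) * \prod_(j <- s) u j (y 0 j)).
    by apply/funext => y; rewrite big_cons.
  have h1 : continuous (u i \o (fun y : vec => y 0 i)).
    move=> y; apply: continuous_comp; [exact: coord_continuous|exact: bump1_continuous].
  by move=> y; exact: (continuousM (h1 y) (ih y)).
exact: h.
Qed.

Lemma tensor_smooth (u : 'I_n -> R -> R) : (forall i, bump1 (u i)) -> smooth (tensor u).
Proof.
move=> hu k; have [w hw ->] := partial_tensor k hu; split.
  exact: tensor_continuous.
move=> i x; have [wi _ di] := bump1_is_derive (hw i).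
by have [] := @is_derive_tensor w wi i x (di _).
Qed.

(** Supported in the cube with corner [y], not centre [y], and side 1/r, because the bump lives on
    [0,1]. *)
Definition mollifier (r : R) (y x : vec) : R := tensor (fun=> bump 1 0) (r *: (x - y)).

Lemma mollifier_test r y : 0 < r -> test_function (mollifier r y).
Proof.
move=> r0; have e : mollifier r y = tensor (fun i t => 1 * bump 1 0 (r * t + - (r * y 0 i))).
  apply/funext => x; rewrite /mollifier /tensor; apply: eq_bigr => i _.
  by rewrite !mxE mul1r mulrBr.
split.
  by rewrite e; apply: tensor_smooth => i; exists 1, r, (- (r * y 0 i)), 1, 0%N.
exists [set x : vec | forall i, `[y 0 i, y 0 i + r^-1]%classic (x 0 i)].
  apply: (@rV_compact R n (fun i => `[y 0 i, y 0 i + r^-1]%classic)) => i.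
  exact: segment_compact.
move=> x /= hx; rewrite /mollifier /tensor.
have [i hi] : exists i, ~ `[y 0 i, y 0 i + r^-1]%classic (x 0 i) by exact/existsNP.
rewrite (bigD1 i)//= !mxE /bump ifF ?mul0r//.
apply/negP => /andP[h1 h2]; apply: hi; rewrite /= in_itv/=.
rewrite pmulr_rgt0// subr_gt0 in h1; rewrite (ltW h1)/= -lerBlDl.
by rewrite -[leRHS]mul1r ler_pdivlMr// mulrC ltW.
Qed.

End test_functions.

(** * Limit theorems for series and real integrals *)

Section tannery.
Context (R : realType).

Lemma series_tail_le (u w : R^nat) (S : R) N : (forall j, `|u j| <= w j) ->
  series u @ \oo --> S ->
  (`|S - series u N|%:E <= \sum_(N <= j <oo) (w j)%:E)%E.
Proof.
move=> uw uS; have w0 j : 0 <= w j by apply: le_trans (uw j).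
have W0 : (0 <= \sum_(N <= j <oo) (w j)%:E)%E by apply: nneseries_ge0 => j _ _; rewrite lee_fin.
case: (eqVneq (\sum_(N <= j <oo) (w j)%:E)%E +oo%E) => [->|Wfin]; first by rewrite leey.
have Wf : (\sum_(N <= j <oo) (w j)%:E)%E \is a fin_num by rewrite ge0_fin_numE// ltey.
rewrite -(fineK Wf) lee_fin.
have hc : (fun M => `|series u M - series u N|) @ \oo --> `|S - series u N|.
  by apply: cvg_norm; apply: cvgB => //; exact: cvg_cst.
rewrite -(cvg_lim _ hc)//; apply: limr_le; first by apply/cvg_ex; exists `|S - series u N|.
exists N => // M /= NM; rewrite sub_series_geq//.
apply: le_trans (ler_norm_sum _ _ _) _.
apply: (@le_trans _ _ (\sum_(N <= j < M) w j)); first by apply: ler_sum => j _; exact: uw.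
rewrite -lee_fin fineK// -sumEFin.
by apply: (@nneseries_lim_ge R (fun j => (w j)%:E) xpredT N M) => j _ _; rewrite lee_fin.
Qed.

Lemma tannery (t : nat -> R^nat) (v w S : R^nat) (V : R) :
  (\sum_(0 <= j <oo) (w j)%:E < +oo)%E -> (forall m j, `|t m j| <= w j) ->
  (forall j, (fun m => t m j) @ \oo --> v j) ->
  (forall m, series (t m) @ \oo --> S m) -> series v @ \oo --> V ->
  S @ \oo --> V.
Proof.
move=> Woo tw tv tS vV.
have w0 j : 0 <= w j by apply: le_trans (tw 0%N j).
have vw j : `|v j| <= w j.
  have hc : (fun m => `|t m j|) @ \oo --> `|v j| by apply: cvg_norm; exact: tv.
  rewrite -(cvg_lim _ hc)//; apply: limr_le; first by apply/cvg_ex; exists `|v j|.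
  by apply: nearW => m; exact: tw.
apply/cvgrPdist_le => e e0; have e40 : 0 < e / 4 by rewrite divr_gt0.
have tail := @nneseries_tail_cvg R (fun j => (w j)%:E) xpredT Woo (fun j _ => w0 j).
have [N hN] : exists N, (\sum_(N <= j <oo) (w j)%:E <= (e / 4)%:E)%E.
  have e4E : (0 < (e / 4)%:E)%E by rewrite lte_fin.
  have [N _ hN] := cvg_near_lt tail e4E; exists N.
  by apply: ltW; apply: hN => /=.
have fin : (fun m => series (t m) N) @ \oo --> series v N.
  rewrite /series/=; elim: (N) => [|K ih].
    by rewrite big_nil; under eq_fun do rewrite big_nil; exact: cvg_cst.
  rewrite big_nat_recr//=; under eq_fun do rewrite big_nat_recr//=.
  by apply: cvgD.
move/cvgrPdist_le : fin => /(_ _ e40); apply: filterS => m hm.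
have h1 := le_trans (series_tail_le N vw vV) hN.
have h2 := le_trans (series_tail_le N (tw m) (tS m)) hN.
rewrite !lee_fin in h1 h2.
have -> : V - S m = (V - series v N) + ((series v N - series (t m) N) - (S m - series (t m) N)).
  by ring.
apply: le_trans (ler_normD _ _) _; have := ler_normB (series v N - series (t m) N) (S m - series (t m) N).
lra.
Qed.

End tannery.

Section real_integrals.
Context d1 d2 (T1 : measurableType d1) (T2 : measurableType d2) (R : realType).
Variables (m1 : {sigma_finite_measure set T1 -> \bar R})
  (m2 : {sigma_finite_measure set T2 -> \bar R}).
Variable f : T1 * T2 -> measurableTypeR R.
Hypothesis mf : measurable_fun setT f.

(** The integral of a section is the difference of the integrals of its positive and negative parts,
    measurable by Tonelli, and [fine] sends infinite values to 0; sections that are not integrable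
    are thus included. *)
Lemma measurable_Rintegral2 :
  measurable_fun setT (fun x => \int[m2]_y f (x, y) : measurableTypeR R).
Proof.
apply: (@measurableT_comp _ _ _ _ _ _ fine _ (fun x => \int[m2]_y (f (x, y))%:E)%E).
  exact: fine_measurable.
pose g : T1 * T2 -> \bar R := fun z => (f z)%:E.
have mg : measurable_fun setT g by exact/measurable_EFinP.
have mp := @measurable_fun_fubini_tonelli_F _ _ _ _ R m2 _ (measurable_funepos mg) (funepos_ge0 g).
have mn := @measurable_fun_fubini_tonelli_F _ _ _ _ R m2 _ (measurable_funeneg mg) (funeneg_ge0 g).
have := emeasurable_funB mp mn; congr measurable_fun; apply/funext => x.
rewrite integralE; congr (_ - _)%E; apply: eq_integral => y _.
  by rewrite !funeposE.
by rewrite !funenegE.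
Qed.

Hypothesis foo : (\int[m1]_x \int[m2]_y `|f (x, y)|%:E < +oo)%E.

Lemma Fubini_Rintegral :
  \int[m1]_x (\int[m2]_y f (x, y))%R = \int[m2]_y (\int[m1]_x f (x, y))%R.
Proof.
have mE : measurable_fun setT (EFin \o f) by exact/measurable_EFinP.
have fi : (m1 \x m2)%E.-integrable setT (EFin \o f) by apply/integrable12ltyP.
have e1 : (\int[m1]_x (\int[m2]_y f (x, y))%R%:E = \int[m1]_x \int[m2]_y (f (x, y))%:E)%E.
  apply: lower_integral_ae; first exact: (measurable_fubini_F fi).
  apply: filterS (ae_integrable1 fi) => x fx.
  by rewrite fineK//; exact: integrable_fin_num.
have e2 : (\int[m2]_y (\int[m1]_x f (x, y))%R%:E = \int[m2]_y \int[m1]_x (f (x, y))%:E)%E.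
  apply: lower_integral_ae; first exact: (measurable_fubini_G fi).
  apply: filterS (ae_integrable2 fi) => y fy.
  by rewrite fineK//; exact: integrable_fin_num.
by rewrite /Rintegral e1 e2; congr fine; exact: (Fubini fi).
Qed.

End real_integrals.

Lemma Rintegral_dominated d (T : measurableType d) (R : realType)
  (mu : {measure set T -> \bar R}) (u : nat -> T -> measurableTypeR R)
  (h : T -> measurableTypeR R) (G : T -> \bar R) :
  (forall m, measurable_fun setT (u m)) -> measurable_fun setT h ->
  measurable_fun setT G -> (forall x, 0 <= G x)%E -> (\int[mu]_x G x < +oo)%E ->
  {ae mu, forall x, (u ^~ x) @ \oo --> h x} ->
  (forall m x, `|u m x|%:E <= G x)%E ->
  (fun m => \int[mu]_x u m x) @ \oo --> \int[mu]_x h x.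
Proof.
move=> mu_ mh mG G0 Goo uh uG.
have Gi : mu.-integrable setT G.
  apply/integrableP; split => //.
  by under eq_integral do rewrite gee0_abs//.
have [] := @dominated_convergence _ _ _ mu setT measurableT
  (fun m x => (u m x)%:E) (fun x => (h x)%:E) G.
- by move=> m; apply/measurable_EFinP; exact: mu_.
- by apply/measurable_EFinP.
- by apply: filterS uh => x hx _; apply: cvg_EFin => //; exact: nearW.
- exact: Gi.
- by apply: aeW => x m _; exact: uG.
move=> hi _ hc.
have hfin : (\int[mu]_x (h x)%:E)%E \is a fin_num by exact: integrable_fin_num hi.
by apply: fine_cvg; rewrite /Rintegral fineK.
Qed.

Section hoelder_measurable.
Context (R : realType) (n : nat).
Local Notation vec := 'rV[R]_n.
Variables (f : vec -> R) (H beta : R).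
Hypotheses (n0 : (0 < n)%N) (beta0 : 0 < beta) (H0 : 0 <= H).
Hypothesis fH : forall x y, `|f x - f y| <= H * enorm (x - y) `^ beta.

(** Measurable sets are generated by the coordinates, so the set where f > t is written as a
    countable union of cubes: those of the grids of mesh 1/(k+1) that it contains, enumerated by
    [unpickle]. *)
Lemma hoelder_measurable : measurable_fun setT (f : vec -> measurableTypeR R).
Proof.
have nR : 0 < n%:R :> R by rewrite ltr0n.
apply: (@measurability _ _ _ _ setT f (@RGenOInfty.G R)); first exact: RGenOInfty.measurableE.
move=> _ [_ [t ->] <-]; rewrite setTI; set U := (_ @^-1` _).
have UE x : U x = (t < f x) by rewrite /U/preimage/= in_itv/= andbT.
pose r k : R := k.+1%:R^-1.
have r0 k : 0 < r k by rewrite invr_gt0.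
pose C (z : 'rV[int]_n) k := cube (\row_j ((z 0 j)%:~R * r k) : vec) (r k).
pose F i : set vec := if @unpickle ('rV[int]_n * nat)%type i is Some (z, k) then
  (if `[< C z k `<=` U >] then C z k else set0) else set0.
have -> : U = \bigcup_i F i.
  apply/seteqP; split => [x Ux|x [i _]]; last first.
    rewrite /F; case: unpickle => [[z k]|//]; case: asboolP => // CU; exact: CU.
  have fx : 0 < f x - t by rewrite subr_gt0 -UE.
  pose e := ((f x - t) / (H + 1)) `^ beta^-1.
  have H1 : 0 < H + 1 by rewrite ltr_wpDl.
  have e0 : 0 < e by rewrite powR_gt0// divr_gt0.
  have eU y : enorm (y - x) < e -> U y.
    move=> hy; rewrite UE.
    have h1 : H * enorm (x - y) `^ beta < f x - t.
      apply: (@le_lt_trans _ _ ((H + 1) * enorm (x - y) `^ beta)).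
        by rewrite ler_wpM2r ?powR_ge0// lerDl.
      rewrite -ltr_pdivlMl// mulrC.
      have -> : (f x - t) / (H + 1) = e `^ beta.
        by rewrite -powRrM mulVf ?gt_eqF// powRr1// divr_ge0 ?ltW.
      by apply: gt0_ltr_powR; rewrite ?nnegrE ?enorm_ge0 ?(ltW e0)// enormB.
    have := le_lt_trans (fH x y) h1; rewrite ltr_norml => /andP[_]; lra.
  (* Two points of a cube of this grid are at Euclidean distance at most 2 n / (k + 1) < e. *)
  pose k := Num.truncn (2 * n%:R / e).
  have rk : n%:R * (2 * r k) < e.
    rewrite /r mulrA [n%:R * 2]mulrC ltr_pdivrMr// [e * _]mulrC -ltr_pdivrMr//.
    exact: truncnS_gt.
  pose z := \row_j (Num.floor (x 0 j / r k)) : 'rV[int]_n.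
  have xC : C z k x.
    rewrite /C /cube/=; apply/supnorm_leP; first exact: ltW.
    move=> j; rewrite !mxE.
    have /andP[f1 f2] := floor_itv (x 0 j / r k).
    rewrite ler_norml; move: f1 f2; rewrite intrD1 ler_pdivlMr// ltr_pdivrMr// mulrDl mul1r.
    by have := r0 k; lra.
  exists (pickle (z, k)) => //; rewrite /F pickleK; case: asboolP => //.
  move=> nC; exfalso; apply: nC => y Cy; apply: eU.
  apply: le_lt_trans (enorm_supnorm _) _; apply: le_lt_trans rk.
  rewrite ler_pM2l//.
  have -> : y - x = (y - \row_j ((z 0 j)%:~R * r k)) - (x - \row_j ((z 0 j)%:~R * r k)).
    by rewrite opprB addrA subrK.
  apply: le_trans (ler_normB _ _) _; move: xC Cy; rewrite /C /cube/=; lra.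
apply: bigcupT_measurable => i; rewrite /F; case: unpickle => [[z k]|//].
by case: ifP => // _; exact: measurable_cube.
Qed.

End hoelder_measurable.

(** * The commutator tested against a cut-off *)

Section dual_function.
Context (R : realType) (n : nat).
Local Notation vec := 'rV[R]_n.
Local Notation leb := (lebesgue_rV R n).
Variables (k b psi : vec -> measurableTypeR R) (beta A3 L B H V : R) (E : set vec).
Hypotheses (n0 : (0 < n)%N) (beta0 : 0 < beta).
Hypotheses (mk : measurable_fun setT k) (mb : measurable_fun setT b) (mpsi : measurable_fun setT psi).
Hypotheses (L0 : 0 <= L) (B0 : 0 <= B) (H0 : 0 <= H) (A30 : 0 <= A3) (V0 : 0 <= V).
Hypothesis bL : forall x y, `|b x - b y| <= L * enorm (x - y) `^ beta.
Hypothesis bB : forall x, `|b x| <= B.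
Hypothesis psi01 : forall x, 0 <= psi x <= 1.
Hypothesis psiH : forall x y, `|psi x - psi y| <= H * enorm (x - y) `^ beta.
Hypotheses (mE : measurable E) (EV : leb E = V%:E) (psiE : forall x, ~ E x -> psi x = 0).
Hypothesis k1 : (\int[leb]_x cut 1 `|k x| <= A3%:E)%E.

Let mnk : measurable_fun setT (fun z => `|k z| : measurableTypeR R).
Proof. exact: (measurableT_comp (@normr_measurable R setT) mk). Qed.

(** The transposed commutator applied to [psi]. *)
Definition dual (y : vec) : R := \int[leb]_x (comm k b x y * psi x).

(** |k| is at most 1 plus its part above level 1; the constant 1 is integrated over a translate of
    [E], of measure [V]. *)
Lemma kernel_translate_le y : (\int[leb]_z (`|k z| * \1_E (z + y))%:E <= (V + A3)%:E)%E.
Proof.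
apply: (@le_trans _ _ (\int[leb]_z ((\1_E (z + y))%:E + cut 1%R `|k z|))%E).
  apply: le_lower_integral => z _ //; rewrite /cut -EFinD lee_fin indicE.
  case: (z + y \in E); rewrite ?mulr0 ?mulr1; last by rewrite add0r mulr_ge0.
  by have := le_cut_add `|k z| ler01; rewrite /cut -EFinD lee_fin.
have mi : measurable_fun setT (fun z => (\1_E z)%:E : \bar R).
  by apply/measurable_EFinP; exact: measurable_indic.
rewrite ge0_integralD//; last 3 first.
- have ma : measurable_fun setT (fun z : vec => z + y).
    by apply: measurable_fun_addv => //; exact: measurable_cst.
  exact: (measurableT_comp mi ma).
- by move=> x _; exact: cut_ge0.
- by apply: measurable_cut.
rewrite EFinD; apply: leeD => //.
rewrite (@integral_leb_shift R n y (fun z => (\1_E z)%:E))//.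
by rewrite integral_indic// setIT -EV.
Qed.

(** In the variable z = x - y the singular factor is independent of [y], and the dependence on [y]
    is left to [b] and [psi], whose regularity passes to [dual]. *)
Lemma dual_shift y : dual y = \int[leb]_z (k z * ((b (z + y) - b y) * psi (z + y))).
Proof.
rewrite /dual /Rintegral; congr fine.
have mc : measurable_fun setT (fun z : vec => z + y).
  by apply: measurable_fun_addv => //; exact: measurable_cst.
pose F z := (k z * ((b (z + y) - b y) * psi (z + y)))%:E.
have mF : measurable_fun setT F.
  apply/measurable_EFinP; apply: measurable_funM => //; apply: measurable_funM.
    by apply: measurable_funB => //; exact: measurableT_comp mb mc.
  exact: measurableT_comp mpsi mc.
have FE x : (comm k b x y * psi x)%:E = F (x + - y).
  by rewrite /F /comm subrK mulrA.
rewrite integralE [RHS]integralE; congr (_ - _)%E.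
  transitivity (\int[leb]_x (F^\+ (x + - y)%R))%E.
    by apply: eq_integral => x _; rewrite !funeposE FE.
  rewrite (@integral_leb_shift R n (- y) (F^\+)%E)//; exact: measurable_funepos.
transitivity (\int[leb]_x (F^\- (x + - y)%R))%E.
  by apply: eq_integral => x _; rewrite !funenegE FE.
rewrite (@integral_leb_shift R n (- y) (F^\-)%E)//; exact: measurable_funeneg.
Qed.

Let u y z : measurableTypeR R := k z * ((b (z + y) - b y) * psi (z + y)).

Let mu_ y : measurable_fun setT (u y).
Proof.
have mc : measurable_fun setT (fun z : vec => z + y).
  by apply: measurable_fun_addv => //; exact: measurable_cst.
apply: measurable_funM => //; apply: measurable_funM.
  by apply: measurable_funB => //; exact: measurableT_comp mb mc.
exact: measurableT_comp mpsi mc.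
Qed.

Let mE_ y : measurable_fun setT (fun z => (`|k z| * \1_E (z + y))%:E).
Proof.
have ma : measurable_fun setT (fun z : vec => z + y).
  by apply: measurable_fun_addv => //; exact: measurable_cst.
apply/measurable_EFinP; apply: measurable_funM => //.
have mi : measurable_fun setT (\1_E : vec -> measurableTypeR R) by exact: measurable_indic.
exact: (measurableT_comp mi ma).
Qed.

Let E0 y z : (0 <= (`|k z| * \1_E (z + y))%:E)%E.
Proof. by rewrite lee_fin mulr_ge0. Qed.

Let psi_le x : psi x <= \1_E x.
Proof.
rewrite indicE; have [xE|xE] := pselect (E x); first by rewrite mem_set//; case/andP: (psi01 x).
by rewrite memNset// psiE.
Qed.

Let psi0 x : 0 <= psi x. Proof. by case/andP: (psi01 x). Qed.

Let u_le y z : `|u y z| <= 2 * B * (`|k z| * \1_E (z + y)).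
Proof.
rewrite /u !normrM (ger0_norm (psi0 _)) [leRHS]mulrCA; apply: ler_wpM2l => //.
apply: ler_pM => //; apply: le_trans (ler_normB _ _) _.
by have := bB (z + y); have := bB y; lra.
Qed.

Let ui y : leb.-integrable setT (EFin \o u y).
Proof.
apply: (@integrable_of_le _ _ _ _ _ (fun z => (2 * B)%:E * (`|k z| * \1_E (z + y))%:E)%E) => //.
- exact: measurable_funeM.
- by move=> z; rewrite -EFinM lee_fin; exact: u_le.
rewrite ge0_integralZl//; last by rewrite lee_fin mulr_ge0.
apply: lte_mul_pinfty; rewrite ?lee_fin ?mulr_ge0//.
exact: le_lt_trans (kernel_translate_le y) (ltry _).
Qed.

Lemma dual_bounded y : `|dual y| <= 2 * B * (V + A3).
Proof.
rewrite dual_shift -lee_fin.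
apply: le_trans (@Rintegral_le_bound _ _ _ _ (u y) (fun z => (2 * B)%:E * (`|k z| * \1_E (z + y))%:E)%E (ui y) _) _.
  by move=> z; rewrite -EFinM lee_fin; exact: u_le.
rewrite ge0_integralZl//; last by rewrite lee_fin mulr_ge0.
rewrite [leRHS]EFinM; apply: lee_wpmul2l; first by rewrite lee_fin mulr_ge0.
exact: kernel_translate_le.
Qed.

Definition dual_const : R := (2 * L + 2 * B * H) * (2 * (V + A3)).

Lemma dual_const_ge0 : 0 <= dual_const.
Proof. by rewrite !mulr_ge0 ?addr_ge0 ?mulr_ge0. Qed.

(** The four values of [b] are grouped into two differences over x - y, which gives 2 L; the
    difference of the values of [psi] is multiplied by an increment of [b], bounded by 2 B. This is
    where [b] has to be bounded. *)
Lemma dual_hoelder x y : `|dual x - dual y| <= dual_const * enorm (x - y) `^ beta.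
Proof.
set D := enorm (x - y) `^ beta; have D0 : 0 <= D by rewrite powR_ge0.
have c0 : 0 <= (2 * L + 2 * B * H) * D by rewrite mulr_ge0 ?addr_ge0 ?mulr_ge0.
rewrite !dual_shift -RintegralB//; [|exact: ui|exact: ui].
have ptw z : `|u x z - u y z| <= (2 * L + 2 * B * H) * D *
    (`|k z| * \1_E (z + x) + `|k z| * \1_E (z + y)).
  rewrite -mulrDr /u -mulrBr normrM [leRHS]mulrCA; apply: ler_wpM2l => //.
  have zxy : z + x - (z + y) = x - y by rewrite opprD addrACA subrr add0r.
  have -> : (b (z + x) - b x) * psi (z + x) - (b (z + y) - b y) * psi (z + y) =
    ((b (z + x) - b (z + y)) - (b x - b y)) * psi (z + x) +
    (b (z + y) - b y) * (psi (z + x) - psi (z + y)) by ring.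
  have h1 : `|((b (z + x) - b (z + y)) - (b x - b y)) * psi (z + x)| <= 2 * L * D * \1_E (z + x).
    rewrite normrM (ger0_norm (psi0 _)); apply: ler_pM => //.
    apply: le_trans (ler_normB _ _) _.
    by have := bL (z + x) (z + y); have := bL x y; rewrite zxy -/D; lra.
  have i1 := psi_le (z + x); have i2 := psi_le (z + y).
  have h2 : `|(b (z + y) - b y) * (psi (z + x) - psi (z + y))| <=
      2 * B * H * D * (\1_E (z + x) + \1_E (z + y)).
    rewrite normrM -!mulrA (mulrA 2 B).
    apply: ler_pM => //.
      by apply: le_trans (ler_normB _ _) _; have := bB (z + y); have := bB y; lra.
    rewrite mulrA; have := psiH (z + x) (z + y); rewrite zxy -/D => hp.
    have HD : 0 <= H * D by rewrite mulr_ge0.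
    have [xE|xE] := pselect (E (z + x)).
      apply: le_trans hp _; rewrite -[leLHS]mulr1; apply: ler_wpM2l => //.
      by rewrite indicE mem_set// lerDl.
    have [yE|yE] := pselect (E (z + y)).
      apply: le_trans hp _; rewrite -[leLHS]mulr1; apply: ler_wpM2l => //.
      by rewrite [X in _ + X]indicE mem_set// lerDr.
    by rewrite !psiE// subrr normr0 mulr_ge0.
  apply: le_trans (ler_normD _ _) _; apply: (le_trans (lerD h1 h2)).
  rewrite [(_ + _) * D]mulrDl [leRHS]mulrDl lerD2r; apply: ler_wpM2l; first by rewrite !mulr_ge0.
  by rewrite lerDl.
rewrite -lee_fin.
apply: le_trans (@Rintegral_le_bound _ _ _ _ (fun z => u x z - u y z)
  (fun z => ((2 * L + 2 * B * H) * D)%:E *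
   ((`|k z| * \1_E (z + x))%:E + (`|k z| * \1_E (z + y))%:E))%E _ _) _.
- by apply: eq_integrable (integrableB measurableT (ui x) (ui y)).
- by move=> z; rewrite -EFinD -EFinM lee_fin; exact: ptw.
rewrite ge0_integralZl//; last 2 first.
- exact: emeasurable_funD.
- by move=> z _; rewrite adde_ge0.
rewrite ge0_integralD//.
apply: (@le_trans _ _ (((2 * L + 2 * B * H) * D)%:E * ((V + A3)%:E + (V + A3)%:E))%E).
  by apply: lee_wpmul2l; [rewrite lee_fin|apply: leeD; exact: kernel_translate_le].
rewrite -EFinD -EFinM lee_fin /dual_const le_eqVlt; apply/orP; left; apply/eqP; ring.
Qed.

(* the commutator is tested against psi by testing the atom against the dual function *)
Lemma commutator_duality x0 d (a : vec -> measurableTypeR R) : borel_atom beta x0 d a ->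
  \int[leb]_x ((\int[leb]_y (comm k b x y * a y)) * psi x) = \int[leb]_y (a y * dual y).
Proof.
move=> ha; have [d0 ma _ aL1 _] := ha.
pose f (z : vec * vec) : measurableTypeR R := comm k b z.1 z.2 * a z.2 * psi z.1.
have mf : measurable_fun setT f.
  apply: measurable_funM; last by apply: measurableT_comp mpsi _; exact: measurable_fst.
  apply: measurable_funM; first exact: measurable_comm_pair.
  by apply: measurableT_comp ma _; exact: measurable_snd.
have foo : (\int[leb]_x \int[leb]_y `|f (x, y)|%:E < +oo)%E.
  have mnf : measurable_fun setT (fun z => `|f z|%:E).
    apply/measurable_EFinP; exact: (measurableT_comp (@normr_measurable R setT) mf).
  rewrite (@fubini_tonelli _ _ _ _ _ leb leb (fun z => `|f z|%:E))//.
  apply: (@le_lt_trans _ _ (\int[leb]_y (`|a y|%:E * (2 * B * (V + A3))%:E))%E).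
    apply: le_lower_integral => y _; first by apply: integral_ge0.
    apply: (@le_trans _ _ (\int[leb]_x (`|a y|%:E * ((2 * B)%:E * (`|k (x + - y)| * \1_E (x + - y + y))%:E)))%E).
      apply: le_lower_integral => x _ //; rewrite -!EFinM lee_fin /f /comm !normrM/=.
      rewrite subrK (ger0_norm (psi0 _)).
      have hb : `|b x - b y| <= 2 * B.
        by apply: le_trans (ler_normB _ _) _; have := bB x; have := bB y; lra.
      have -> : `|k (x - y)| * `|b x - b y| * `|a y| * psi x =
         `|a y| * `|k (x - y)| * (`|b x - b y| * psi x) by ring.
      have -> : `|a y| * (2 * B * (`|k (x - y)| * \1_E x)) =
         `|a y| * `|k (x - y)| * (2 * B * \1_E x) by ring.
      by apply: ler_wpM2l; [rewrite mulr_ge0|apply: ler_pM].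
    rewrite (@integral_leb_shift R n (- y) (fun z => `|a y|%:E * ((2 * B)%:E * (`|k z| * \1_E (z + y))%:E))%E); last 2 first.
    - by apply: measurable_funeM; exact: measurable_funeM.
    - by move=> z; rewrite -!EFinM lee_fin !mulr_ge0.
    rewrite ge0_integralZl//; last 2 first.
    - exact: measurable_funeM.
    - by move=> z _; rewrite -EFinM lee_fin !mulr_ge0.
    apply: lee_wpmul2l => //; rewrite ge0_integralZl//; last by rewrite lee_fin mulr_ge0.
    rewrite [leRHS]EFinM; apply: lee_wpmul2l; first by rewrite lee_fin mulr_ge0.
    exact: kernel_translate_le.
  have c0 : 0 <= 2 * B * (V + A3) by rewrite !mulr_ge0// addr_ge0.
  rewrite ge0_integralZr//; last first.
    apply/measurable_EFinP; exact: (measurableT_comp (@normr_measurable R setT) ma).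
  by rewrite muleC lte_mul_pinfty// (le_lt_trans aL1)// ltry.
have := Fubini_Rintegral mf foo.
have -> : \int[leb]_x (\int[leb]_y f (x, y))%R =
    \int[leb]_x ((\int[leb]_y (comm k b x y * a y)) * psi x).
  have fi := (integrable12ltyP leb leb ((measurable_EFinP _ _).2 mf)).2 foo.
  rewrite /Rintegral; congr fine.
  have mg := measurable_Rintegral2 leb mf.
  apply/esym/lower_integral_ae; first by apply/measurable_EFinP; exact: mg.
  apply: filterS (ae_integrable1 fi) => x fx; congr EFin.
  (* Where [psi] vanishes both sides are 0 whether or not the inner integral converges; elsewhere
     its integrability is recovered by dividing by [psi x]. *)
  have [p0|p0] := eqVneq (psi x) 0.
    rewrite p0 mulr0 /Rintegral (eq_integral (cst 0%E)) ?integral0// => y _.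
    by rewrite /f/= p0 mulr0.
  have hi : leb.-integrable setT (fun y => (comm k b x y * a y)%:E).
    have := integrableZl measurableT (psi x)^-1 fx; apply: eq_integrable => // y _.
    by rewrite /= /f/= -EFinM mulrC mulfK.
  have e : (\int[leb]_y (comm k b x y * a y))%R * psi x =
      (\int[leb]_y (comm k b x y * a y * psi x))%R.
    by rewrite RintegralZr.
  exact: e.
move=> ->; apply: eq_Rintegral => y _; rewrite /dual.
rewrite -RintegralZl//; last first.
  have := ui y => /integrableP[_ uoo]; apply/integrableP; split.
    apply/measurable_EFinP; apply: measurable_funM => //.
    exact: (measurableT_comp (measurable_comm_pair mk mb) (@measurable_pair2 _ _ vec vec y)).
  apply: le_lt_trans uoo; rewrite -(@integral_leb_shift R n (- y) (fun z => `|(EFin \o u y) z|%E)).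
  - by apply: le_lower_integral => x _ //; rewrite /= /u /comm subrK mulrA.
  - by apply: measurableT_comp => //; apply/measurable_EFinP; exact: mu_.
  - by [].
by apply: eq_Rintegral => x _; rewrite /f /=; ring.
Qed.

End dual_function.

Section density.
Context d (T : measurableType d) (R : realType) (mu : {measure set T -> \bar R}).
Variables (f : T -> \bar R) (mf : measurable_fun setT f) (f0 : forall x, (0 <= f x)%E).

Definition density_measure (A : set T) : \bar R := (\int[mu]_(x in A) f x)%E.

Let density0 : density_measure set0 = 0%E.
Proof. exact: integral_set0. Qed.

Let density_ge0 A : (0 <= density_measure A)%E.
Proof. by apply: integral_ge0. Qed.

Let density_sigma_additive : semi_sigma_additive density_measure.
Proof.
move=> F mF tF mUF; rewrite /density_measure ge0_integral_bigcup//; last first.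
  exact: measurable_funTS.
by apply: is_cvg_nneseries => i _ _; exact: density_ge0.
Qed.

HB.instance Definition _ := isMeasure.Build _ _ _ density_measure
  density0 density_ge0 density_sigma_additive.

Definition density_m : {measure set T -> \bar R} := density_measure.

End density.

Lemma near_cvg_cst_eq (R : realType) (u : R^nat) (l : R) :
  (\forall k \near \oo, u k = l) -> u @ \oo --> l.
Proof.
move=> hu; apply/cvgrPdist_le => e e0; apply: filterS hu => k ->.
by rewrite subrr normr0 ltW.
Qed.

(** * Functions orthogonal to all Lipschitz cut-offs *)

Section cutoff.
Context (R : realType) (n : nat).
Local Notation vec := 'rV[R]_n.
Local Notation leb := (lebesgue_rV R n).
Hypothesis n0 : (0 < n)%N.

Definition cutoff (psi : vec -> R) : Prop :=
  [/\ forall x, 0 <= psi x <= 1,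
      exists2 H, 0 <= H & forall x y, `|psi x - psi y| <= H * enorm (x - y) &
      exists r, forall x, r < enorm x -> psi x = 0].

Lemma min_dist_le (a b c e : R) : `|Num.min a b - Num.min c e| <= `|a - c| + `|b - e|.
Proof.
have h1 := ler_norm (a - c); have h2 := ler_norm (c - a).
have h3 := ler_norm (b - e); have h4 := ler_norm (e - b).
rewrite (distrC c a) in h2; rewrite (distrC e b) in h4.
rewrite ler_norml; apply/andP; split.
  by case: (leP a b) => _; case: (leP c e) => ?; lra.
by case: (leP a b) => ?; case: (leP c e) => _; lra.
Qed.

Lemma cutoff_min psi phi : cutoff psi -> cutoff phi -> cutoff (fun x => Num.min (psi x) (phi x)).
Proof.
move=> [p01 [H H0 hH] [r hr]] [q01 [K K0 hK] _]; split.
- move=> x; have /andP[a1 a2] := p01 x; have /andP[b1 b2] := q01 x.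
  by rewrite le_min a1 b1 ge_min a2.
- exists (H + K); first exact: addr_ge0.
  move=> x y; apply: le_trans (min_dist_le _ _ _ _) _.
  by rewrite mulrDl; apply: lerD.
- exists r => x rx; rewrite hr//; apply/min_idPl; by have /andP[] := q01 x.
Qed.

Lemma cutoff_clip (c : R) psi : 0 <= c -> cutoff psi -> cutoff (fun x => Num.min 1 (c * psi x)).
Proof.
move=> c0 [p01 [H H0 hH] [r hr]]; split.
- move=> x; have /andP[a1 a2] := p01 x.
  by rewrite le_min ler01 mulr_ge0//= ge_min lexx.
- exists (c * H); first exact: mulr_ge0.
  move=> x y; apply: le_trans (min_dist_le _ _ _ _) _.
  by rewrite subrr normr0 add0r -mulrBr normrM ger0_norm// -mulrA ler_wpM2l.
- by exists r => x rx; rewrite hr// mulr0; apply/min_idPr.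
Qed.

(** The function is the positive part of min (u, N - |x|), capped at 1. The maximum with 0 is
    written through minima so that [min_dist_le] alone gives the Lipschitz bound. *)
Lemma cutoff_ramp (u : vec -> R) (N : R) :
  (forall x y, `|u x - u y| <= enorm (x - y)) ->
  cutoff (fun x => Num.min 1 (- Num.min 0 (- Num.min (u x) (N - enorm x)))).
Proof.
move=> uL; split.
- by move=> x; rewrite le_min ler01 ge_min lexx andbT/= oppr_ge0 ge_min lexx.
- exists 2 => // x y; apply: le_trans (min_dist_le _ _ _ _) _.
  rewrite subrr normr0 add0r -opprD normrN.
  apply: le_trans (min_dist_le _ _ _ _) _; rewrite subrr normr0 add0r -opprD normrN.
  apply: le_trans (min_dist_le _ _ _ _) _.
  have e1 : `|N - enorm x - (N - enorm y)| <= enorm (x - y).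
    rewrite (_ : N - enorm x - (N - enorm y) = - (enorm x - enorm y)); last by ring.
    by rewrite normrN ler_dist_enorm.
  by have := uL x y; lra.
- exists N => x Nx.
  have h : Num.min (u x) (N - enorm x) <= 0 by rewrite ge_min subr_le0 (ltW Nx) orbT.
  have -> : Num.min 0 (- Num.min (u x) (N - enorm x)) = 0 by apply/min_idPl; rewrite oppr_ge0.
  by rewrite oppr0; apply/min_idPr.
Qed.

Lemma cutoff_ramp_gt0 (u : vec -> R) (N : R) x :
  (0 < Num.min 1 (- Num.min 0 (- Num.min (u x) (N - enorm x)))) = (0 < u x) && (enorm x < N).
Proof.
rewrite lt_min ltr01/= oppr_gt0 gt_min ltxx/= oppr_lt0 lt_min subr_gt0.
by [].
Qed.

Lemma cutoff_measurable psi : cutoff psi -> measurable_fun setT (psi : vec -> measurableTypeR R).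
Proof.
move=> [_ [H H0 hH] _]; apply: (@hoelder_measurable R n psi H 1) => // x y.
by rewrite powRr1 ?enorm_ge0.
Qed.

(** A pi-system generating the Borel sets, on which two measures can be compared by means of
    cut-offs. *)
Definition cutoff_sets : set (set vec) :=
  [set U | exists2 psi, cutoff psi & U = [set x | 0 < psi x]].

Lemma cutoff_sets_ball N : cutoff_sets [set x | enorm x < N].
Proof.
have uL : forall x y : vec, `|(1 : R) - 1| <= enorm (x - y).
  by move=> x y; rewrite subrr normr0 enorm_ge0.
exists (fun x => Num.min 1 (- Num.min 0 (- Num.min 1 (N - enorm x)))).
  exact: (@cutoff_ramp (fun=> 1)).
by apply/seteqP; split => x /=; rewrite (cutoff_ramp_gt0 (fun=> 1)) ltr01.
Qed.

Lemma cutoff_sets_ray (j : 'I_n) (t N : R) : cutoff_sets [set x : vec | t < x 0 j /\ enorm x < N].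
Proof.
have uL (x y : vec) : `|(x 0 j - t) - (y 0 j - t)| <= enorm (x - y).
  rewrite (_ : x 0 j - t - (y 0 j - t) = (x - y) 0 j); last by rewrite !mxE; ring.
  by apply: le_trans (supnorm_ge _ _) (supnorm_enorm _).
exists (fun x : vec => Num.min 1 (- Num.min 0 (- Num.min (x 0 j - t) (N - enorm x)))).
  exact: (@cutoff_ramp (fun x : vec => x 0 j - t)).
apply/seteqP; split => x /=; rewrite (cutoff_ramp_gt0 (fun x : vec => x 0 j - t)) subr_gt0.
  by move=> [-> ->].
by move=> /andP[].
Qed.

Lemma cutoff_sets_setI : setI_closed cutoff_sets.
Proof.
move=> _ _ [psi hpsi ->] [phi hphi ->].
exists (fun x => Num.min (psi x) (phi x)); first exact: cutoff_min.
by apply/seteqP; split => x /=; rewrite lt_min => /andP.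
Qed.

Lemma measurable_cutoff_sets : (@measurable _ vec) = <<s cutoff_sets >>.
Proof.
have saG : sigma_algebra setT <<s cutoff_sets >> by exact: smallest_sigma_algebra.
apply/seteqP; split; last first.
  apply: smallest_sub; first exact: sigma_algebra_measurable.
  move=> _ [psi hpsi ->].
  have := cutoff_measurable hpsi measurableT (measurable_itv `]0, +oo[).
  by rewrite setTI; congr measurable; apply/seteqP; split => x /=; rewrite in_itv/= andbT.
apply: smallest_sub => // _ [[i j] _ [Y mY <-]] /=; rewrite setTI ord1 {i}.
have saY : sigma_algebra setT [set Y : set R | <<s cutoff_sets >> [set x : vec | Y (x 0 j)]].
  case: saG => r0 rC rU; split => //=.
  - by move=> A /rC; congr (_ _); apply/seteqP; split.
  - by move=> A /rU.
move: mY; rewrite RGenOInfty.measurableE => mY.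
apply: (smallest_sub saY _ mY) => _ [t ->] /=.
have -> : [set x : vec | `]t, +oo[%classic (x 0 j)] =
    \bigcup_N [set x : vec | t < x 0 j /\ enorm x < N.+1%:R].
  apply/seteqP; split => x /=; rewrite in_itv/= andbT.
    by move=> tx; exists (Num.truncn (enorm x)) => //; split => //; exact: truncnS_gt.
  by move=> [N _ []].
by apply: sigma_algebra_bigcup => N; apply: sub_sigma_algebra; exact: cutoff_sets_ray.
Qed.

Variable h : vec -> measurableTypeR R.
Hypothesis mh : measurable_fun setT h.
Hypothesis hloc : forall r, (\int[leb]_(x in ecball 0 r) `|h x|%:E < +oo)%E.
Hypothesis hcut : forall psi, cutoff psi -> \int[leb]_x (h x * psi x) = 0.

Let mabs : measurable_fun setT (fun x => `|h x|%:E).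
Proof. by apply/measurable_EFinP; exact: (measurableT_comp (@normr_measurable R setT) mh). Qed.

Lemma cutoff_sets_null U : cutoff_sets U -> \int[leb]_x (h x * \1_U x) = 0.
Proof.
move=> [psi hpsi UE]; have [p01 _ [r hr]] := hpsi.
have mball := @measurable_ecball0 R n r.
have mU : measurable U.
  by rewrite measurable_cutoff_sets; apply: sub_sigma_algebra; exists psi.
(* These cut-offs increase to the indicator of the set where psi > 0, each value being stationary in
   [k]. *)
pose psik (k : nat) x := Num.min 1 (k%:R * psi x).
have ck k : cutoff (psik k) by exact: cutoff_clip.
have hlim : (fun k => \int[leb]_x (h x * psik k x)) @ \oo --> \int[leb]_x (h x * \1_U x).
  apply: (@Rintegral_dominated _ _ _ leb (fun k x => h x * psik k x) (fun x => h x * \1_U x)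
    (fun x => (`|h x|%:E * (\1_(ecball 0 r) x)%:E)%E)).
  - by move=> k; apply: measurable_funM => //; exact: cutoff_measurable.
  - by apply: measurable_funM => //; exact: measurable_indic.
  - apply: emeasurable_funM => //; apply/measurable_EFinP; exact: measurable_indic.
  - by move=> x; rewrite -EFinM lee_fin mulr_ge0.
  - by rewrite -integral_indicM.
  - apply: aeW => x; have [p0|p0] := eqVneq (psi x) 0.
      have xU : \1_U x = 0 :> R by rewrite indicE memNset// UE/= p0 ltxx.
      rewrite xU mulr0 (_ : (fun k => _) = (fun=> 0)); first exact: cvg_cst.
      by apply/funext => k; rewrite /psik p0 mulr0 (min_idPr ler01) mulr0.
    have pp : 0 < psi x by rewrite lt_neqAle eq_sym p0; case/andP: (p01 x).
    have xU : \1_U x = 1 :> R by rewrite indicE mem_set// UE.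
    rewrite xU mulr1; apply: near_cvg_cst_eq.
    exists (Num.truncn (psi x)^-1).+1 => // k /= hk.
    rewrite /psik (min_idPl _) ?mulr1// -ler_pdivrMr// mul1r.
    by apply: le_trans (ltW (truncnS_gt _)) _; rewrite ler_nat.
  - move=> k x; rewrite -EFinM lee_fin normrM; apply: ler_wpM2l => //.
    have [k01 _ _] := ck k; have /andP[k0 k1] := k01 x; rewrite ger0_norm//.
    rewrite indicE; have [xr|rx] := leP (enorm x) r.
      by rewrite mem_set// /ecball/= subr0.
    by rewrite /psik hr// mulr0 (min_idPr ler01).
have h0 : (fun k => \int[leb]_x (h x * psik k x)) = (fun=> 0).
  by apply/funext => k; exact: hcut.
rewrite h0 in hlim; rewrite -(cvg_lim _ hlim)//; apply: cvg_lim => //; exact: cvg_cst.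
Qed.

(** The measures with densities h^+ and h^- agree on [cutoff_sets], hence on all Borel sets. On the
    set where h > 0 the second vanishes, so h^+ is 0 almost everywhere there; the other sign is
    symmetric. *)
Lemma cutoff_orthogonal_ae0 : {ae leb, forall x, h x = 0}.
Proof.
pose g : vec -> \bar R := fun x => (h x)%:E.
have mg : measurable_fun setT g by exact/measurable_EFinP.
have mgp := measurable_funepos mg; have mgn := measurable_funeneg mg.
pose mp := density_m leb mgp (funepos_ge0 g).
pose mn := density_m leb mgn (funeneg_ge0 g).
pose gk (k : nat) : set vec := [set x | enorm x < k.+1%:R].
have mgk k : measurable (gk k).
  by rewrite measurable_cutoff_sets; apply: sub_sigma_algebra; exact: cutoff_sets_ball.
have gabs x : (g^\+ x <= `|h x|%:E)%E.
  by rewrite funeposE /g ge_max !lee_fin ler_norm normr_ge0.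
have gabsn x : (g^\- x <= `|h x|%:E)%E.
  by rewrite funenegE /g -EFinN ge_max !lee_fin -normrN ler_norm normr_ge0.
have fin U (w : vec -> \bar R) r : (forall x, 0 <= w x)%E -> (forall x, w x <= `|h x|%:E)%E ->
    measurable U -> measurable_fun setT w -> U `<=` ecball 0 r ->
    (\int[leb]_(x in U) w x < +oo)%E.
  move=> w0 wh mU mw Ur; apply: le_lt_trans (hloc r).
  apply: (@le_trans _ _ (\int[leb]_(x in ecball 0 r) w x)%E).
    apply: ge0_subset_integral => //; first exact: measurable_ecball0.
    exact: measurable_funTS.
  by apply: le_lower_integral => x _.
have agree U : cutoff_sets U -> mp U = mn U.
  move=> hU; have h0 := cutoff_sets_null hU; have [psi hpsi UE] := hU.
  have [_ _ [r hr]] := hpsi.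
  have mU : measurable U by rewrite measurable_cutoff_sets; apply: sub_sigma_algebra.
  have Ur : U `<=` ecball 0 r.
    move=> x; rewrite UE/= /ecball/= subr0 => px; rewrite leNgt; apply/negP => rx.
    by move: px; rewrite hr// ltxx.
  have f1 := fin U _ r (funepos_ge0 g) gabs mU mgp Ur.
  have f2 := fin U _ r (funeneg_ge0 g) gabsn mU mgn Ur.
  have e1 : (\int[leb]_x (h x * \1_U x)%:E = mp U - mn U)%E.
    rewrite -[RHS]/(\int[leb]_(x in U) g^\+ x - \int[leb]_(x in U) g^\- x)%E.
    rewrite -integralE integral_indicM.
    by apply: eq_integral => x _; rewrite EFinM.
  have f1' : mp U \is a fin_num by rewrite ge0_fin_numE.
  have f2' : mn U \is a fin_num by rewrite ge0_fin_numE.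
  move: h0; rewrite /Rintegral e1 -(fineK f1') -(fineK f2') -EFinB/= => /eqP.
  by rewrite subr_eq0 => /eqP ->.
have all A : measurable A -> mp A = mn A.
  apply: (@measure_unique _ _ _ cutoff_sets gk measurable_cutoff_sets cutoff_sets_setI) => //.
  - by move=> k; exact: cutoff_sets_ball.
  - apply/seteqP; split => // x _; exists (Num.truncn (enorm x)) => //.
    exact: truncnS_gt.
  - move=> k; apply: (fin (gk k) _ k.+1%:R (funepos_ge0 g) gabs (mgk k) mgp).
    by move=> x; rewrite /gk/ecball/= subr0 => /ltW.
have nullA (A : set vec) (w w' : vec -> \bar R) : measurable A -> measurable_fun setT w ->
    (\int[leb]_(x in A) w x = \int[leb]_(x in A) w' x)%E ->
    (forall x, 0 <= w x)%E -> (forall x, A x -> w' x = 0%E) ->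
    {ae leb, forall x, A x -> w x = 0%E}.
  move=> mA mw e1 w0 w'0.
  have e2 : (\int[leb]_(x in A) w x = 0)%E.
    by rewrite e1; apply: integral0_eq.
  have := (@ae_eq_integral_abs _ _ _ leb A mA w (measurable_funTS mw)).1; apply.
  by under eq_integral do rewrite gee0_abs//.
pose Ap : set vec := [set x | 0 < h x]; pose An : set vec := [set x | h x < 0].
have mAp : measurable Ap.
  have := mh measurableT (measurable_itv `]0, +oo[); rewrite setTI; congr measurable.
  by apply/seteqP; split => x /=; rewrite in_itv/= andbT.
have mAn : measurable An.
  have := mh measurableT (measurable_itv `]-oo, 0[); rewrite setTI; congr measurable.
have n1 : {ae leb, forall x, Ap x -> (g^\+ x = 0)%E}.
  apply: (nullA Ap _ g^\-%E) => //; first exact: all.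
  by move=> x hx; rewrite funenegE /g -EFinN -EFin_max; congr EFin; apply/max_idPr; rewrite oppr_le0 ltW.
have n2 : {ae leb, forall x, An x -> (g^\- x = 0)%E}.
  apply: (nullA An _ g^\+%E) => //; first by apply/esym; exact: all.
  by move=> x hx; rewrite funeposE /g -EFin_max; congr EFin; apply/max_idPr; rewrite ltW.
apply: filterS2 n1 n2 => x p1 p2; case: (ltgtP (h x) 0) => // hx.
  have := p2 hx; rewrite funenegE /g -EFinN -EFin_max => -[] /eqP.
  by rewrite gt_eqF// lt_max oppr_gt0 hx.
have := p1 hx; rewrite funeposE /g -EFin_max => -[] /eqP.
by rewrite gt_eqF// lt_max hx.
Qed.

End cutoff.

(** * Mollification and pairings with Hoelder functions *)

Section mollify.
Context (R : realType) (n : nat).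
Local Notation vec := 'rV[R]_n.
Local Notation leb := (lebesgue_rV R n).
Variable beta : R.
Hypotheses (n0 : (0 < n)%N) (beta0 : 0 < beta) (beta1 : beta < 1).
Local Notation Ca := (atom_const (R := R) n beta).

Definition holder (H M : R) (phi : vec -> measurableTypeR R) : Prop :=
  (forall x y, `|phi x - phi y| <= H * enorm (x - y) `^ beta) /\ (forall x, `|phi x| <= M).

Lemma holder_measurable H M phi : 0 <= H -> holder H M phi -> measurable_fun setT phi.
Proof. by move=> H0 [hH _]; exact: (@hoelder_measurable R n phi H beta). Qed.

Let mnorm (a : vec -> measurableTypeR R) : measurable_fun setT a ->
  measurable_fun setT (fun x => `|a x|%:E).
Proof.
by move=> ma; apply/measurable_EFinP; exact: (measurableT_comp (@normr_measurable R setT) ma).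
Qed.

Lemma bounded_mul_integrable (a phi : vec -> measurableTypeR R) M :
  leb.-integrable setT (EFin \o a) -> measurable_fun setT phi ->
  (forall x, `|phi x| <= M) -> leb.-integrable setT (EFin \o (fun x => a x * phi x)).
Proof.
move=> /integrableP[ma aoo] mphi phiM.
have ma' : measurable_fun setT a by exact/measurable_EFinP.
have M0 : 0 <= M by apply: le_trans (phiM 0).
apply: (@integrable_of_le _ _ _ _ _ (fun x => M%:E * `|a x|%:E)%E).
- exact: measurable_funM.
- by apply: measurable_funeM; exact: mnorm.
- by move=> x; rewrite -EFinM lee_fin normrM mulrC ler_wpM2r.
- rewrite ge0_integralZl//; last exact: mnorm.
  by rewrite lte_mul_pinfty.
Qed.

(** The mean of the atom being 0, phi(x0) may be subtracted; on the support |phi - phi(x0)| <= H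
    d^beta, which the L^1 norm of the atom compensates. The bound depends neither on the atom nor on
    [M], so pairings with summable coefficients converge absolutely. *)
Lemma atom_holder_le x0 d (a phi : vec -> measurableTypeR R) H M : 0 <= H ->
  borel_atom beta x0 d a -> holder H M phi -> `|\int[leb]_x (a x * phi x)| <= H * Ca.
Proof.
move=> H0 ha hphi; have [d0 ma asupp aL1 a0] := ha; have [hH hM] := hphi.
have mphi := holder_measurable H0 hphi.
have ai := borel_atom_integrable ha.
have db0 : 0 < d `^ beta by rewrite powR_gt0.
have i1 := bounded_mul_integrable ai mphi hM.
have i2 : leb.-integrable setT (EFin \o (fun x => a x * phi x0)).
  by apply: (bounded_mul_integrable ai (measurable_cst _) (M := M)) => x; exact: hM.
have -> : \int[leb]_x (a x * phi x) = \int[leb]_x (a x * phi x - a x * phi x0).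
  by rewrite RintegralB// RintegralZr// a0 mul0r subr0.
have i3 : leb.-integrable setT (EFin \o (fun x => a x * phi x - a x * phi x0)).
  by apply: eq_integrable (integrableB measurableT i1 i2).
rewrite -lee_fin.
apply: le_trans (@Rintegral_le_bound _ _ _ _ _ (fun x => (H * d `^ beta)%:E * `|a x|%:E)%E i3 _) _.
  move=> x; rewrite -EFinM lee_fin -mulrBr normrM mulrC.
  have [xd|dx] := leP (enorm (x - x0)) d; last by rewrite asupp// normr0 !mulr0.
  apply: ler_wpM2r => //; apply: le_trans (hH _ _) _; apply: ler_wpM2l => //.
  by apply: ge0_ler_powR; rewrite ?nnegrE ?enorm_ge0 ?(ltW beta0) ?(ltW d0).
rewrite ge0_integralZl//; last 2 first.
- exact: mnorm.
- by rewrite lee_fin mulr_ge0// ltW.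
apply: (@le_trans _ _ ((H * d `^ beta)%:E * (Ca / d `^ beta)%:E)%E).
  by apply: lee_wpmul2l => //; rewrite lee_fin mulr_ge0// ltW.
by rewrite -EFinM lee_fin mulrACA mulfV ?gt_eqF// mulr1.
Qed.

Local Notation eta := (@bump R 1 0).

Lemma eta01 t : 0 <= eta t <= 1.
Proof.
rewrite /bump; case: ifP => [/andP[t0 t1]|_]; last by rewrite lexx ler01.
rewrite hornerC mul1r expr0 mul1r expR_ge0/= -[X in _ <= X]expR0 ler_expR oppr_le0 invr_ge0 ltW//.
by rewrite mulr_gt0// subr_gt0.
Qed.

Lemma eta_lipschitz : exists2 C, 0 <= C & forall s t, `|eta s - eta t| <= C * `|s - t|.
Proof.
have [B B0 hB] := @bump_sqr_le R (bump_deriv 1 0) 2.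
have hB1 t : `|bump (bump_deriv 1 0) 2 t| <= B.
  have [t01|t01] := boolP (0 < t < 1); last by rewrite /bump (negPf t01) normr0.
  apply: le_trans (hB _ t01) _; rewrite -[leRHS]mulr1; apply: ler_wpM2l => //.
  by move: t01 => /andP[t0 t1]; apply: exprn_ile1; [rewrite mulr_ge0//|apply: mulr_ile1]; lra.
exists B => // s t.
wlog st : s t / s <= t.
  move=> hw; have [st|/ltW ts] := leP s t; first exact: hw.
  by rewrite distrC (distrC s); exact: hw.
have [||c _ e] := @MVT_segment R eta (bump (bump_deriv 1 0) 2) s t st.
- by move=> x _; exact: is_derive_bump.
- apply: continuous_subspaceT => x; apply: differentiable_continuous.
  by apply/derivable1_diffP; have [] := @is_derive_bump R 1 0 x.
by rewrite distrC e normrM (distrC s) ler_wpM2r.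
Qed.

Lemma prod_dist_le (I : Type) (q : seq I) (f g : I -> R) :
  (forall i, 0 <= f i <= 1) -> (forall i, 0 <= g i <= 1) ->
  `|\prod_(i <- q) f i - \prod_(i <- q) g i| <= \sum_(i <- q) `|f i - g i|.
Proof.
move=> hf hg; elim: q => [|i q ih]; first by rewrite !big_nil subrr normr0.
rewrite !big_cons; set P := \prod_(j <- q) f j; set Q := \prod_(j <- q) g j.
have -> : f i * P - g i * Q = f i * (P - Q) + (f i - g i) * Q by ring.
apply: le_trans (ler_normD _ _) _; rewrite !normrM addrC; apply: lerD.
  rewrite -[leRHS]mulr1; apply: ler_wpM2l => //.
  rewrite ger0_norm; last by apply: prodr_ge0 => j _; case/andP: (hg j).
  by apply: prodr_ile1 => j _; exact: hg.
have /andP[f0 f1] := hf i; rewrite ger0_norm//.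
by apply: le_trans ih; rewrite -[leRHS]mul1r ler_wpM2r.
Qed.

(** The profile of the mollifiers, not normalized: its integral [I0] is carried along and divided
    out at the end. *)
Definition kap (x : vec) : measurableTypeR R := tensor (fun=> eta) x.

Lemma kap01 x : 0 <= kap x <= 1.
Proof.
rewrite /kap /tensor prodr_ge0/=; last by move=> i _; case/andP: (eta01 (x 0 i)).
by apply: prodr_ile1 => i _; exact: eta01.
Qed.

Lemma kap_holder : exists2 H, 0 <= H & holder H 1 kap.
Proof.
have [C C0 hC] := eta_lipschitz; exists (1 + n%:R * C).
  by rewrite addr_ge0// mulr_ge0.
split=> [x y|x]; last by have /andP[k0 k1] := kap01 x; rewrite ger0_norm.
have /andP[x0 x1] := kap01 x; have /andP[y0 y1] := kap01 y.
have [xy|xy] := leP (enorm (x - y)) 1; last first.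
  apply: (@le_trans _ _ 1); first by rewrite ler_norml; apply/andP; split; lra.
  rewrite -[leLHS]mulr1; apply: ler_pM => //; first by rewrite lerDl mulr_ge0.
  have := @ge0_ler_powR R beta (ltW beta0) 1 (enorm (x - y)); rewrite powR1.
  by apply; rewrite ?nnegrE ?enorm_ge0 ?(ltW xy).
apply: le_trans (prod_dist_le _ _ _) _; [by move=> i; exact: eta01|by move=> i; exact: eta01|].
apply: (@le_trans _ _ (\sum_(i < n) C * enorm (x - y))).
  apply: ler_sum => i _; apply: le_trans (hC _ _) _; apply: ler_wpM2l => //.
  rewrite (_ : x 0 i - y 0 i = (x - y) 0 i); last by rewrite !mxE.
  by apply: le_trans (supnorm_ge _ _) (supnorm_enorm _).
rewrite sumr_const card_ord -[leLHS]mulr_natl mulrA.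
apply: ler_pM; rewrite ?mulr_ge0 ?enorm_ge0//; first by rewrite lerDr.
have [->|e0] := eqVneq (enorm (x - y)) 0; first exact: powR_ge0.
have e00 : 0 < enorm (x - y) by rewrite lt_neqAle eq_sym e0 enorm_ge0.
by rewrite -[leLHS]powRr1 ?(ltW e00)//; apply: ger_powR; rewrite ?e00 ?xy// ltW.
Qed.

Lemma measurable_kap : measurable_fun setT kap.
Proof. by have [H H0 /(holder_measurable H0)] := kap_holder. Qed.

Lemma kap_supp x : kap x != 0 -> enorm x <= n%:R.
Proof.
move=> kx; apply: le_trans (enorm_supnorm _) _; rewrite -[leRHS]mulr1 ler_wpM2l//.
apply/supnorm_leP => // i; rewrite leNgt; apply/negP => xi.
move/negP: kx; apply; rewrite /kap /tensor (bigD1 i)//= /bump ifF ?mul0r//.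
apply/negP => /andP[x0 x1]; move: xi; rewrite gtr0_norm// ltNge => /negP; apply; exact: ltW.
Qed.

Lemma integral_kap : exists2 I0, 0 < I0 & (\int[leb]_x (kap x)%:E = I0%:E)%E.
Proof.
have mk : measurable_fun setT (fun x => (kap x)%:E) by apply/measurable_EFinP; exact: measurable_kap.
have k0 x : (0 <= (kap x)%:E)%E by rewrite lee_fin; case/andP: (kap01 x).
have up : (\int[leb]_x (kap x)%:E < +oo)%E.
  have nR : 0 < n%:R :> R by rewrite ltr0n.
  apply: (@le_lt_trans _ _ (\int[leb]_x (\1_(ecball 0 n%:R) x)%:E)%E); last first.
    rewrite integral_indic//; last exact: measurable_ecball0.
    by rewrite setIT -[X in (X < _)%E]/(leb (ecball 0 n%:R)) leb_ecball// ltry.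
  apply: le_lower_integral => x _ //; rewrite lee_fin indicE.
  have [->|kx] := eqVneq (kap x) 0; first by [].
  by rewrite mem_set ?(andP (kap01 x)).2// /ecball/= subr0; exact: kap_supp.
have low : (0 < \int[leb]_x (kap x)%:E)%E.
  (* On the cube of points with coordinates in [1/4, 3/4], both t and 1 - t are at least 1/4, so
     each factor of [kap] is at least [c0]. *)
  pose c0 : R := expR (- (4^-1 * 4^-1)^-1).
  pose w : vec := const_mx 2^-1.
  have cw x : cube w 4^-1 x -> c0 ^+ n <= kap x.
    move=> xw; rewrite /kap /tensor -[X in c0 ^+ X](card_ord n) -prodr_const.
    apply: ler_prod => i _; rewrite expR_ge0/=.
    have : `|x 0 i - 2^-1| <= 4^-1.
      by apply: le_trans xw; have := supnorm_ge (x - w) i; rewrite !mxE.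
    rewrite ler_norml => /andP[x1 x2].
    have h1 : 4^-1 <= x 0 i by lra.
    have h2 : 4^-1 <= 1 - x 0 i by lra.
    have g1 : 0 < x 0 i by lra.
    have g2 : 0 < 1 - x 0 i by lra.
    rewrite /bump g1 -subr_gt0 g2 /= hornerC mul1r expr0 mul1r ler_expR lerN2.
    by rewrite lef_pV2 ?posrE ?mulr_gt0//; apply: ler_pM.
  apply: (@lt_le_trans _ _ ((c0 ^+ n)%:E * leb (cube w 4^-1))%E).
    by rewrite leb_cube// -EFinM lte_fin mulr_gt0 ?exprn_gt0 ?expR_gt0.
  have mc := @measurable_cube R n w 4^-1.
  rewrite -integral_cst//.
  apply: (@le_trans _ _ (\int[leb]_(x in cube w 4^-1) (kap x)%:E)%E).
    apply: le_lower_integral => x xw; first by rewrite lee_fin exprn_ge0 ?expR_ge0.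
    by rewrite lee_fin; exact: cw.
  by apply: ge0_subset_integral.
have f : (\int[leb]_x (kap x)%:E)%E \is a fin_num by rewrite ge0_fin_numE// ltW.
exists (fine (\int[leb]_x (kap x)%:E)%E); last by rewrite fineK.
by rewrite -lte_fin fineK.
Qed.

Lemma mollifier_kap r y (x : vec) : mollifier r y x = kap (r *: (x - y)).
Proof. by []. Qed.

Opaque kap.

Variable I0 : R.
Hypotheses (I00 : 0 < I0) (I0E : (\int[leb]_x (kap x)%:E = I0%:E)%E).

Let kap_ge0 x : 0 <= kap x. Proof. by case/andP: (kap01 x). Qed.

Lemma kap_integrable : leb.-integrable setT (EFin \o kap).
Proof.
apply: (@integrable_of_le _ _ _ _ _ (fun x => (kap x)%:E)); rewrite ?I0E ?ltry//.
- exact: measurable_kap.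
- by apply/measurable_EFinP; exact: measurable_kap.
- by move=> x; rewrite ger0_norm.
Qed.

Lemma kap_average_le (f : vec -> measurableTypeR R) M c : measurable_fun setT f ->
  (forall z, `|f z| <= M) -> 0 <= c -> (forall z, kap z != 0 -> `|f z| <= c) ->
  `|\int[leb]_z (kap z * f z)| <= c * I0.
Proof.
move=> mf fM c0 fc; have fi := bounded_mul_integrable kap_integrable mf fM.
rewrite -lee_fin.
apply: le_trans (@Rintegral_le_bound _ _ _ _ _ (fun z => c%:E * (kap z)%:E)%E fi _) _.
  move=> z; rewrite -EFinM lee_fin normrM (ger0_norm (kap_ge0 z)) mulrC.
  have [->|kz] := eqVneq (kap z) 0; first by rewrite !mulr0.
  by rewrite ler_wpM2r// fc.
rewrite ge0_integralZl ?I0E ?EFinM//; first by apply/measurable_EFinP; exact: measurable_kap.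
by move=> z _; rewrite lee_fin.
Qed.

Variables (Phi : vec -> measurableTypeR R) (H M : R).
Hypotheses (H0 : 0 <= H) (hPhi : holder H M Phi).

(** [I0] times a weighted mean of [Phi] at scale 1/r. Written with the scale inside [Phi], it has
    Hoelder bounds independent of [r]. *)
Definition moll (r : R) (x : vec) : measurableTypeR R :=
  \int[leb]_z (kap z * Phi (x - r^-1 *: z)).

Let mPhi : measurable_fun setT Phi. Proof. exact: holder_measurable H0 hPhi. Qed.

Let mPhi_shift r x : measurable_fun setT (fun z : vec => Phi (x - r^-1 *: z)).
Proof.
apply: measurableT_comp mPhi _; apply: measurable_fun_subv; first exact: measurable_cst.
by apply: measurable_fun_scalev.
Qed.

Let M0 : 0 <= M. Proof. exact: le_trans (hPhi.2 0). Qed.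

Let moll_i r x : leb.-integrable setT (EFin \o (fun z => kap z * Phi (x - r^-1 *: z))).
Proof.
by apply: (bounded_mul_integrable kap_integrable (mPhi_shift r x) (M := M)) => z; exact: hPhi.2.
Qed.

Lemma moll_holder r : holder (H * I0) (M * I0) (moll r).
Proof.
split=> [x y|x]; last first.
  rewrite /moll; apply: (@kap_average_le (fun z => Phi (x - r^-1 *: z)) M M (mPhi_shift r x)) => // z *; exact: hPhi.2.
rewrite /moll -RintegralB//.
have -> : \int[leb]_z (kap z * Phi (x - r^-1 *: z) - kap z * Phi (y - r^-1 *: z)) =
    \int[leb]_z (kap z * (Phi (x - r^-1 *: z) - Phi (y - r^-1 *: z))).
  by apply: eq_Rintegral => z _; rewrite mulrBr.
rewrite -mulrA [I0 * _]mulrC mulrA.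
apply: (@kap_average_le _ (M + M)).
- by apply: measurable_funB; exact: mPhi_shift.
- by move=> z; apply: le_trans (ler_normB _ _) _; apply: lerD; exact: hPhi.2.
- by rewrite mulr_ge0 ?powR_ge0.
move=> z _; apply: le_trans (hPhi.1 _ _) _.
by rewrite (_ : x - r^-1 *: z - (y - r^-1 *: z) = x - y)// opprB addrA subrK.
Qed.

(** The profile lives in |z| <= n, so [Phi] is evaluated at distance at most n/r from [x]. *)
Lemma moll_close r x : 0 < r -> `|moll r x - I0 * Phi x| <= H * (n%:R / r) `^ beta * I0.
Proof.
move=> r0.
have i1 : leb.-integrable setT (EFin \o (fun z => kap z * Phi x)).
  by apply: (bounded_mul_integrable kap_integrable (measurable_cst _) (M := M)) => z; exact: hPhi.2.
have -> : moll r x - I0 * Phi x = \int[leb]_z (kap z * (Phi (x - r^-1 *: z) - Phi x)).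
  have e : I0 * Phi x = \int[leb]_z (kap z * Phi x).
    by rewrite RintegralZr ?kap_integrable// /Rintegral I0E.
  rewrite e /moll -RintegralB//.
  by apply: eq_Rintegral => z _; rewrite mulrBr.
apply: (@kap_average_le _ (M + M)).
- by apply: measurable_funB => //; exact: mPhi_shift.
- by move=> z; apply: le_trans (ler_normB _ _) _; apply: lerD; exact: hPhi.2.
- by rewrite mulr_ge0 ?powR_ge0.
move=> z kz; apply: le_trans (hPhi.1 _ _) _; apply: ler_wpM2l => //.
rewrite (_ : x - r^-1 *: z - x = - (r^-1 *: z)); last by rewrite addrAC subrr add0r.
rewrite enormN enormZ gtr0_norm ?invr_gt0//.
apply: ge0_ler_powR; rewrite ?nnegrE ?(ltW beta0) ?divr_ge0 ?mulr_ge0 ?invr_ge0 ?enorm_ge0 ?(ltW r0)//.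
by rewrite mulrC ler_wpM2r ?invr_ge0 ?(ltW r0)//; exact: kap_supp.
Qed.

Hypothesis Phi0 : forall x, 0 <= Phi x.

Let mkap2 r : measurable_fun setT (fun z : vec * vec => kap (r *: (z.1 - z.2))).
Proof.
apply: measurableT_comp measurable_kap _.
have h := measurable_fun_subv (@measurable_fst _ _ vec vec) (@measurable_snd _ _ vec vec).
exact: (measurable_fun_scalev (@measurable_cst _ _ _ _ setT r) h).
Qed.

Lemma moll_convolution r x : 0 < r ->
  moll r x = r ^+ n * \int[leb]_y (Phi y * kap (r *: (x - y))).
Proof.
move=> r0; pose F y := (Phi y * kap (r *: (x - y)))%:E.
have mF : measurable_fun setT F.
  apply/measurable_EFinP; apply: measurable_funM => //.
  exact: (measurableT_comp (mkap2 r) (@measurable_pair1 _ _ vec vec x)).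
have F0 y : (0 <= F y)%E by rewrite lee_fin mulr_ge0.
have tn : - r^-1 != 0 by rewrite oppr_eq0 invr_eq0 gt_eqF.
have h := integral_leb_affine x tn mF F0.
have FE z : F (- r^-1 *: z + x) = (kap z * Phi (x - r^-1 *: z))%:E.
  rewrite /F addrC scaleNr opprB addrCA subrr addr0 scalerA mulfV ?gt_eqF// scale1r.
  by rewrite mulrC.
rewrite /moll /Rintegral -/F.
have -> : (\int[leb]_y (Phi y * kap (r *: (x - y)))%:E = \int[leb]_y F y)%E by [].
rewrite -h; under [in RHS]eq_integral do rewrite FE.
have f := integrable_fin_num measurableT (moll_i r x).
rewrite normrN gtr0_norm ?invr_gt0// -(fineK f) -EFinM/= mulrA.
by rewrite exprVn mulfV ?mul1r// expf_neq0// gt_eqF.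
Qed.

Hypothesis Phi_i : leb.-integrable setT (EFin \o Phi).

(** Pairing of [a] with [mollifier r y]; summed over an atomic decomposition, it is the value of the
    distribution at a test function. *)
Definition kap_pairing (r : R) (a : vec -> R) (y : vec) : measurableTypeR R :=
  \int[leb]_x (a x * kap (r *: (x - y))).

Lemma kap_pairingE r a y : kap_pairing r a y = \int[leb]_x (a x * kap (r *: (x - y))).
Proof. by []. Qed.

(** At fixed [r] the rescaled profile is Hoelder with constant proportional to r^beta, and
    [atom_holder_le] then bounds the pairings with all atoms and all [y] at once. *)
Lemma kap_pairing_le r : 0 < r -> exists2 K, 0 <= K &
  forall x0 d a y, borel_atom beta x0 d a -> `|kap_pairing r a y| <= K.
Proof.
move=> r0; have [Hk Hk0 [hk1 hk2]] := kap_holder.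
exists (Hk * r `^ beta * Ca).
  by rewrite !mulr_ge0 ?powR_ge0 ?atom_const_ge0.
move=> x0 d a y ha; have h0 : 0 <= Hk * r `^ beta by rewrite mulr_ge0 ?powR_ge0.
have hh : holder (Hk * r `^ beta) 1 (fun x => kap (r *: (x - y))); last exact: (atom_holder_le h0 ha hh).
split=> [u v|u]; last exact: hk2.
apply: le_trans (hk1 _ _) _; rewrite -mulrA; apply: ler_wpM2l => //.
rewrite -scalerBr (_ : u - y - (v - y) = u - v); last by rewrite opprB addrA subrK.
by rewrite enormZ gtr0_norm// powRM ?enorm_ge0// ltW.
Qed.

Let matom2 r (a : vec -> measurableTypeR R) : measurable_fun setT a ->
  measurable_fun setT (fun z : vec * vec => a z.1 * (Phi z.2 * kap (r *: (z.1 - z.2)))).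
Proof.
move=> ma; apply: measurable_funM; first by apply: measurableT_comp ma _; exact: measurable_fst.
apply: measurable_funM; last exact: mkap2.
by apply: measurableT_comp mPhi _; exact: measurable_snd.
Qed.

Let measurable_pairing r (a : vec -> measurableTypeR R) : measurable_fun setT a ->
  measurable_fun setT (kap_pairing r a).
Proof.
move=> ma.
have mf : measurable_fun setT (fun z : vec * vec => a z.2 * kap (r *: (z.2 - z.1)) : measurableTypeR R).
  apply: measurable_funM; first by apply: measurableT_comp ma _; exact: measurable_snd.
  apply: measurableT_comp measurable_kap _.
  have h := measurable_fun_subv (@measurable_snd _ _ vec vec) (@measurable_fst _ _ vec vec).
  exact: (measurable_fun_scalev (@measurable_cst _ _ _ _ setT r) h).
exact: (measurable_Rintegral2 leb mf).
Qed.

Lemma moll_pairing r x0 d a : 0 < r -> borel_atom beta x0 d a ->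
  \int[leb]_x (a x * moll r x) = r ^+ n * \int[leb]_y (Phi y * kap_pairing r a y).
Proof.
move=> r0 ha; have [d0 ma _ aL1 _] := ha; have ai := borel_atom_integrable ha.
have /integrableP[_ Phioo] := Phi_i.
have mf := matom2 r ma.
have foo : (\int[leb]_x \int[leb]_y `|a x * (Phi y * kap (r *: (x - y)))|%:E < +oo)%E.
  apply: (@le_lt_trans _ _ (\int[leb]_x (`|a x|%:E * \int[leb]_y `|(Phi y)%:E|))%E).
    apply: le_lower_integral => x _; first exact: integral_ge0.
    rewrite -ge0_integralZl//; last by apply: measurableT_comp => //; exact/measurable_EFinP.
    apply: le_lower_integral => y _ //; rewrite -EFinM lee_fin normrM ler_wpM2l// normrM.
    by rewrite -[leRHS]mulr1 ler_wpM2l// (ger0_norm (kap_ge0 _)) (andP (kap01 _)).2.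
  rewrite ge0_integralZr//; last 2 first.
  - by move=> //; apply: mnorm.
  - exact: integral_ge0.
  rewrite muleC lte_mul_pinfty//; first exact: integral_ge0.
    by rewrite ge0_fin_numE//; exact: integral_ge0.
  exact: le_lt_trans aL1 (ltry _).
have := Fubini_Rintegral mf foo => /= hF.
have mc (x : vec) : measurable_fun setT (fun y : vec => kap (r *: (x - y))).
  exact: (measurableT_comp (mkap2 r) (@measurable_pair1 _ _ vec vec x)).
have mc2 (y : vec) : measurable_fun setT (fun x : vec => kap (r *: (x - y))).
  exact: (measurableT_comp (mkap2 r) (@measurable_pair2 _ _ vec vec y)).
have kb u : `|kap u| <= 1 by rewrite (ger0_norm (kap_ge0 u)) (andP (kap01 u)).2.
have i1 x : leb.-integrable setT (EFin \o (fun y => Phi y * kap (r *: (x - y)))).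
  by apply: (bounded_mul_integrable Phi_i (mc x) (M := 1)).
have i2 y : leb.-integrable setT (EFin \o (fun x => a x * kap (r *: (x - y)))).
  by apply: (bounded_mul_integrable ai (mc2 y) (M := 1)).
have e1 : \int[leb]_x (a x * moll r x) =
    \int[leb]_x (r ^+ n * \int[leb]_y (a x * (Phi y * kap (r *: (x - y))))).
  apply: eq_Rintegral => x _; rewrite (moll_convolution x r0) mulrCA; congr (_ * _).
  by rewrite (RintegralZl _ _ (i1 x)).
have e2 : \int[leb]_y (Phi y * kap_pairing r a y) =
    \int[leb]_y \int[leb]_x (a x * (Phi y * kap (r *: (x - y)))).
  apply: eq_Rintegral => y _; rewrite /kap_pairing -(RintegralZl _ _ (i2 y)); last exact: measurableT.
  by apply: eq_Rintegral => x _; rewrite mulrCA.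
have hi2 : leb.-integrable setT (EFin \o (fun x => \int[leb]_y (a x * (Phi y * kap (r *: (x - y)))))).
  have fi := (integrable12ltyP leb leb ((measurable_EFinP _ _).2 mf)).2 foo.
  have hi := integrable_fubini_F fi.
  apply/integrableP; split.
    by apply/measurable_EFinP; exact: (measurable_Rintegral2 leb mf).
  apply: le_lt_trans foo; apply: le_lower_integral => x _; first exact: abse_ge0.
  have ix : leb.-integrable setT (EFin \o (fun y => a x * (Phi y * kap (r *: (x - y))))).
    by apply: eq_integrable (integrableZl measurableT (a x) (i1 x)).
  by apply: (@Rintegral_le_bound _ _ _ _ _ (fun y => `|a x * (Phi y * kap (r *: (x - y)))|%:E) ix).
by rewrite e1 e2 -hF (RintegralZl _ _ hi2).
Qed.

Opaque moll kap_pairing.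

Variables (c : R^nat) (X : nat -> vec) (D : R^nat) (a : nat -> vec -> measurableTypeR R).
Hypotheses (ha : forall j, borel_atom beta (X j) (D j) (a j))
  (coo : (\sum_(0 <= j <oo) `|c j|%:E < +oo)%E).

(** Pairing with the mollified [Phi] is an integral over [y], with weight [Phi y], of pairings with
    test functions; sum and integral commute by domination. The limit depends on the decomposition
    only through [F]. *)
Lemma moll_series r (F : vec -> R) : 0 < r ->
  (forall y, series (fun j => c j * kap_pairing r (a j) y) @ \oo --> F y) ->
  series (fun j => c j * \int[leb]_x (a j x * moll r x)) @ \oo -->
    r ^+ n * \int[leb]_y (Phi y * F y).
Proof.
move=> r0 hF; have [K K0 hK] := kap_pairing_le r0.
have ma j : measurable_fun setT (a j) by have [] := ha j.
have mp j := measurable_pairing r (ma j).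
pose S := (\sum_(0 <= j <oo) `|c j|%:E)%E.
have Sf : S \is a fin_num by rewrite ge0_fin_numE//; apply: nneseries_ge0.
have partial_le N : \sum_(0 <= j < N) `|c j| <= fine S.
  rewrite -lee_fin fineK// -sumEFin.
  exact: (@nneseries_lim_ge R (fun j => `|c j|%:E) xpredT 0 N).
have ms N : measurable_fun setT (fun y => series (fun j => c j * kap_pairing r (a j) y) N : measurableTypeR R).
  by apply: measurable_sum => j; apply: measurable_funM => //; exact: mp.
have mFF : measurable_fun setT (F : vec -> measurableTypeR R).
  apply: (@measurable_fun_cvg _ _ _ setT (fun N y => series (fun j => c j * kap_pairing r (a j) y) N)).
    exact: ms.
  by move=> y _; exact: hF.
have pi j : leb.-integrable setT (EFin \o (fun y => Phi y * kap_pairing r (a j) y)).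
  by apply: (bounded_mul_integrable Phi_i (mp j) (M := K)) => y; exact: hK (ha j).
have sumE N : \int[leb]_y (Phi y * series (fun j => c j * kap_pairing r (a j) y) N) =
    \sum_(0 <= j < N) c j * \int[leb]_y (Phi y * kap_pairing r (a j) y) /\
    leb.-integrable setT (EFin \o (fun y => Phi y * series (fun j => c j * kap_pairing r (a j) y) N)).
  elim: N => [|N [ih1 ih2]].
    split.
      rewrite big_nil /Rintegral integral0_eq// => y _.
      by rewrite /series/= big_nil mulr0.
    apply: eq_integrable (integrable0 leb setT) => // y _.
    by rewrite /series/= big_nil mulr0.
  have iN : leb.-integrable setT (EFin \o (fun y => c N * (Phi y * kap_pairing r (a N) y))).
    by apply: eq_integrable (integrableZl measurableT (c N) (pi N)).
  have eN y : Phi y * series (fun j => c j * kap_pairing r (a j) y) N.+1 =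
     Phi y * series (fun j => c j * kap_pairing r (a j) y) N + c N * (Phi y * kap_pairing r (a N) y).
    by rewrite /series/= big_nat_recr//= mulrDr [c N * (_ * _)]mulrCA.
  split.
    rewrite big_nat_recr//= -ih1 -RintegralZl// -RintegralD//.
    by apply: eq_Rintegral => y _; exact: eN.
  by apply: eq_integrable (integrableD measurableT ih2 iN) => // y _; rewrite /= -EFinD -eN.
have -> : series (fun j => c j * \int[leb]_x (a j x * moll r x)) =
    (fun N => r ^+ n * \int[leb]_y (Phi y * series (fun j => c j * kap_pairing r (a j) y) N)).
  apply/funext => N; rewrite (sumE N).1 /series/= mulr_sumr; apply: eq_bigr => j _.
  by rewrite (moll_pairing r0 (ha j)) mulrCA.
apply: cvgMr.
have /integrableP[_ Phioo] := Phi_i.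
apply: (@Rintegral_dominated _ _ _ leb
  (fun N y => Phi y * series (fun j => c j * kap_pairing r (a j) y) N) (fun y => Phi y * F y)
  (fun y => (K * fine S)%:E * `|(Phi y)%:E|)%E).
- by move=> N; exact: (measurable_funM mPhi (ms N)).
- exact: measurable_funM.
- by apply: measurable_funeM; exact: mnorm.
- by move=> y; apply: mule_ge0 => //; rewrite lee_fin mulr_ge0// fine_ge0//; apply: nneseries_ge0.
- rewrite ge0_integralZl//; first by rewrite lte_mul_pinfty// lee_fin mulr_ge0// fine_ge0//; apply: nneseries_ge0.
    exact: mnorm.
  by rewrite lee_fin mulr_ge0// fine_ge0//; apply: nneseries_ge0.
- by apply: aeW => y; apply: cvgMr; exact: hF.
move=> N y; rewrite -EFinM lee_fin normrM mulrC ler_wpM2r// /series/=.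
apply: le_trans (ler_norm_sum _ _ _) _.
apply: (@le_trans _ _ (\sum_(0 <= j < N) `|c j| * K)).
  by apply: ler_sum => j _; rewrite normrM ler_wpM2l//; exact: hK (ha j).
by rewrite -mulr_suml mulrC ler_wpM2l.
Qed.

Lemma inv_powR_cvg0 : (fun m : nat => (n%:R / m.+1%:R : R) `^ beta) @ \oo --> (0 : R).
Proof.
apply/cvgrPdist_le => e e0.
have nR : 0 < n%:R :> R by rewrite ltr0n.
pose t := e `^ beta^-1 / n%:R; have t0 : 0 < t by rewrite divr_gt0// powR_gt0.
have [N _ hN] := near_infty_natSinv_lt (PosNum t0).
exists N => // m /= Nm; rewrite sub0r normrN ger0_norm ?powR_ge0//.
have -> : e = (e `^ beta^-1) `^ beta by rewrite -powRrM mulVf ?gt_eqF// powRr1// ltW.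
apply: ge0_ler_powR; rewrite ?nnegrE ?(ltW beta0) ?divr_ge0 ?powR_ge0//.
by have := hN m Nm => /= /ltW; rewrite /t ler_pdivlMr// mulrC.
Qed.

(** The Hoelder constant H I0 of the mollified functions is independent of the scale, so the
    pairings with the atoms are dominated uniformly and Tannery's theorem applies. *)
Lemma moll_series_limit (S : R^nat) (V : R) :
  (forall m, series (fun j => c j * \int[leb]_x (a j x * moll m.+1%:R x)) @ \oo --> S m) ->
  series (fun j => c j * \int[leb]_x (a j x * Phi x)) @ \oo --> V ->
  S @ \oo --> I0 * V.
Proof.
move=> hS hV.
have Coo : (\sum_(0 <= j <oo) (`|c j| * (H * I0 * Ca))%:E < +oo)%E.
  under eq_eseriesr do rewrite EFinM muleC.
  have C0 : 0 <= H * I0 * Ca by apply: mulr_ge0; [apply: mulr_ge0 => //; exact: ltW|exact: atom_const_ge0].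
  by rewrite nneseriesZl// lte_mul_pinfty.
apply: (@tannery R (fun m j => c j * \int[leb]_x (a j x * moll m.+1%:R x))
  (fun j => I0 * (c j * \int[leb]_x (a j x * Phi x))) (fun j => `|c j| * (H * I0 * Ca)) S) => //.
- move=> m j; rewrite normrM ler_wpM2l//; apply: (atom_holder_le _ (ha j) (moll_holder _)).
  by rewrite mulr_ge0// ltW.
- move=> j; rewrite mulrCA; apply: cvgMr.
  have [d0 ma _ aL1 _] := ha j; have ai := borel_atom_integrable (ha j).
  have mm m : measurable_fun setT (moll m.+1%:R).
    by apply: (holder_measurable _ (moll_holder m.+1%:R)); rewrite mulr_ge0// ltW.
  have -> : I0 * \int[leb]_x (a j x * Phi x) = \int[leb]_x (a j x * (I0 * Phi x)).
    rewrite -RintegralZl//; last by apply: (bounded_mul_integrable ai mPhi (M := M)); exact: hPhi.2.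
    by apply: eq_Rintegral => x _; rewrite mulrCA.
  apply: (@Rintegral_dominated _ _ _ leb (fun m x => a j x * moll m.+1%:R x)
    (fun x => a j x * (I0 * Phi x)) (fun x => (M * I0)%:E * `|a j x|%:E)%E).
  + by move=> m; exact: (measurable_funM ma (mm m)).
  + by apply: measurable_funM => //; exact: measurable_funM.
  + by apply: measurable_funeM; exact: mnorm.
  + by move=> x; rewrite -EFinM lee_fin !mulr_ge0// ltW.
  + rewrite ge0_integralZl//; first by rewrite lte_mul_pinfty ?lee_fin ?mulr_ge0 ?(ltW I00)// (le_lt_trans aL1)// ltry.
      exact: mnorm.
    by rewrite lee_fin mulr_ge0// ltW.
  + apply: aeW => x; apply: cvgMr; apply/cvgrPdist_le => e e0.
    have K0 : 0 < H * I0 + 1 by rewrite ltr_wpDl// mulr_ge0// ltW.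
    have eK : 0 < e / (H * I0 + 1) by rewrite divr_gt0.
    have /cvgrPdist_le/(_ _ eK) := inv_powR_cvg0; apply: filterS => m.
    rewrite sub0r normrN ger0_norm ?powR_ge0// => hm; rewrite distrC.
    apply: le_trans (moll_close x (ltr0Sn _ _)) _.
    rewrite mulrAC; apply: (@le_trans _ _ ((H * I0 + 1) * (e / (H * I0 + 1)))).
      by apply: ler_pM; rewrite ?mulr_ge0 ?powR_ge0 ?(ltW I00)// lerDl.
    by rewrite mulrC divfK// gt_eqF.
  + move=> m x; rewrite -EFinM lee_fin normrM mulrC ler_wpM2r//.
    exact: (moll_holder _).2.
- rewrite (_ : (fun j => I0 * _) = I0 *: (fun j => c j * \int[leb]_x (a j x * Phi x)))//.
  have -> : series (I0 *: (fun j => c j * \int[leb]_x (a j x * Phi x))) =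
     (fun N => I0 * series (fun j => c j * \int[leb]_x (a j x * Phi x)) N).
    by apply/funext => N; rewrite /series/= mulr_sumr.
  by apply: cvgMr.
Qed.

Lemma moll_value (F : nat -> vec -> R) (V : R) :
  (forall m y, series (fun j => c j * kap_pairing m.+1%:R (a j) y) @ \oo --> F m y) ->
  series (fun j => c j * \int[leb]_x (a j x * Phi x)) @ \oo --> V ->
  (fun m : nat => m.+1%:R ^+ n * \int[leb]_y (Phi y * F m y)) @ \oo --> I0 * V.
Proof.
move=> hF hV; apply: moll_series_limit hV => m.
by apply: moll_series.
Qed.

Lemma holder_pairing_cvg : cvgn (series (fun j => c j * \int[leb]_x (a j x * Phi x))).
Proof.
apply: normed_cvg; apply: (@series_le_cvg _ _ (fun j => `|c j| * (H * Ca))).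
- by move=> j; exact: normr_ge0.
- by move=> j; apply: mulr_ge0 => //; apply: mulr_ge0 => //; exact: atom_const_ge0.
- by move=> j; rewrite /= normrM ler_wpM2l//; exact: (atom_holder_le H0 (ha j) hPhi).
have C0 : 0 <= H * Ca by apply: mulr_ge0 => //; exact: atom_const_ge0.
apply: nondecreasing_is_cvgn.
  by apply: nondecreasing_series => j _ _; apply: mulr_ge0.
pose S := (\sum_(0 <= j <oo) `|c j|%:E)%E.
have Sf : S \is a fin_num by rewrite ge0_fin_numE//; apply: nneseries_ge0.
exists (fine S * (H * Ca)) => _ [N _ <-]; rewrite /series/= -mulr_suml ler_wpM2r//.
rewrite -lee_fin fineK// -sumEFin.
exact: (@nneseries_lim_ge R (fun j => `|c j|%:E) xpredT 0 N).
Qed.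

End mollify.

Section pairing_unique.
Context (R : realType) (n : nat).
Local Notation vec := 'rV[R]_n.
Local Notation leb := (lebesgue_rV R n).
Variable beta : R.
Hypotheses (n0 : (0 < n)%N) (beta0 : 0 < beta) (beta1 : beta < 1).
Variables (c : R^nat) (X : nat -> vec) (D : R^nat) (a : nat -> vec -> measurableTypeR R).
Hypotheses (ha : forall j, borel_atom beta (X j) (D j) (a j))
  (coo : (\sum_(0 <= j <oo) `|c j|%:E < +oo)%E).
Variables (c' : R^nat) (X' : nat -> vec) (D' : R^nat) (a' : nat -> vec -> measurableTypeR R).
Hypotheses (ha' : forall j, borel_atom beta (X' j) (D' j) (a' j))
  (coo' : (\sum_(0 <= j <oo) `|c' j|%:E < +oo)%E).
Variable F : nat -> vec -> R.
Hypotheses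
  (hF : forall m y, series (fun j => c j * kap_pairing m.+1%:R (a j) y) @ \oo --> F m y)
  (hF' : forall m y, series (fun j => c' j * kap_pairing m.+1%:R (a' j) y) @ \oo --> F m y).

(** Both I0 V and I0 V' are limits of one sequence, built from [Phi] and [F] alone. *)
Lemma pairing_unique_integrable (Phi : vec -> measurableTypeR R) (H M V V' : R) : 0 <= H ->
  holder beta H M Phi -> (forall x, 0 <= Phi x) -> leb.-integrable setT (EFin \o Phi) ->
  series (fun j => c j * \int[leb]_x (a j x * Phi x)) @ \oo --> V ->
  series (fun j => c' j * \int[leb]_x (a' j x * Phi x)) @ \oo --> V' -> V = V'.
Proof.
move=> H0 hPhi Phi0 Phi_i hV hV'.
have [I0 I00 I0E] : exists2 I0, 0 < I0 & (\int[leb]_x (kap x)%:E = I0%:E)%E.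
  by eapply integral_kap; eauto.
have e1 : (fun m : nat => m.+1%:R ^+ n * \int[leb]_y (Phi y * F m y)) @ \oo --> I0 * V.
  by eapply moll_value with (beta := beta) (c := c) (a := a); eauto.
have e2 : (fun m : nat => m.+1%:R ^+ n * \int[leb]_y (Phi y * F m y)) @ \oo --> I0 * V'.
  by eapply moll_value with (beta := beta) (c := c') (a := a'); eauto.
have e3 : I0 * V = I0 * V' by rewrite -(cvg_lim _ e1)// -(cvg_lim _ e2).
by apply: (mulfI _ e3); rewrite gt_eqF.
Qed.

(** Adding [M] makes [Phi] nonnegative and the cut-off [chi N] makes it integrable. On the support
    of a given atom [chi N] is eventually 1, and the mean zero of the atom then removes the constant
    [M]. The Hoelder constants do not grow with [N], so the limit can be taken inside the series. *)
Lemma pairing_unique (Phi : vec -> measurableTypeR R) (H M V V' : R) : 0 <= H ->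
  holder beta H M Phi ->
  series (fun j => c j * \int[leb]_x (a j x * Phi x)) @ \oo --> V ->
  series (fun j => c' j * \int[leb]_x (a' j x * Phi x)) @ \oo --> V' -> V = V'.
Proof.
move=> H0 hPhi hV hV'; have [hH hM] := hPhi.
have M0 : 0 <= M by apply: le_trans (hM 0).
have mPhi := holder_measurable n0 beta0 H0 hPhi.
pose chi (N : nat) (x : vec) : R := Num.min 1 (- Num.min 0 (- Num.min 1 (N%:R - enorm x))).
have hchi N : cutoff (chi N).
  by apply: (@cutoff_ramp R n (fun=> 1)) => x y; rewrite subrr normr0 enorm_ge0.
have chi01 N x : 0 <= chi N x <= 1 by have [] := hchi N.
have chiL N x y : `|chi N x - chi N y| <= 2 * enorm (x - y).
  have e1 : `|N%:R - enorm x - (N%:R - enorm y)| <= enorm (x - y).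
    rewrite (_ : N%:R - enorm x - (N%:R - enorm y) = - (enorm x - enorm y)); last by ring.
    by rewrite normrN ler_dist_enorm.
  apply: (@le_trans _ _ (enorm (x - y))); last by rewrite ler_peMl ?enorm_ge0// ler1n.
  rewrite /chi; apply: le_trans (min_dist_le _ _ _ _) _.
  rewrite subrr normr0 add0r -opprD normrN.
  apply: le_trans (min_dist_le _ _ _ _) _; rewrite subrr normr0 add0r -opprD normrN.
  by apply: le_trans (min_dist_le _ _ _ _) _; rewrite subrr normr0 add0r.
have chiH N x y : `|chi N x - chi N y| <= 2 * enorm (x - y) `^ beta.
  have e0 := enorm_ge0 (x - y).
  have [xy|xy] := leP (enorm (x - y)) 1.
    apply: le_trans (chiL N x y) _; rewrite ler_wpM2l//.
    have [->|ez] := eqVneq (enorm (x - y)) 0; first exact: powR_ge0.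
    have e00 : 0 < enorm (x - y) by rewrite lt_neqAle eq_sym ez.
    by rewrite -[leLHS]powRr1 ?(ltW e00)//; apply: ger_powR; rewrite ?e00 ?xy// ltW.
  have := @ge0_ler_powR R beta (ltW beta0) 1 (enorm (x - y)); rewrite powR1 => h.
  have {}h : 1 <= enorm (x - y) `^ beta by apply: h; rewrite ?nnegrE ?(ltW xy).
  have /andP[a1 a2] := chi01 N x; have /andP[b1 b2] := chi01 N y.
  by rewrite ler_norml; apply/andP; split; lra.
have chi1 N x : enorm x + 1 <= N%:R -> chi N x = 1.
  move=> h; rewrite /chi (min_idPl (_ : 1 <= N%:R - enorm x)); last by lra.
  by rewrite (min_idPr (_ : - 1 <= 0)) ?opprK ?minxx//; lra.
have chi0 N x : N%:R < enorm x -> chi N x = 0.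
  move=> h; have g : Num.min 1 (N%:R - enorm x) <= 0 :> R by rewrite ge_min subr_le0 (ltW h) orbT.
  rewrite /chi (min_idPl (_ : 0 <= - Num.min 1 (N%:R - enorm x))) ?oppr_ge0//.
  by rewrite oppr0 (min_idPr ler01).
pose P N : vec -> measurableTypeR R := fun x => (Phi x + M) * chi N x.
have PM x : 0 <= Phi x + M <= 2 * M.
  by have := hM x; rewrite ler_norml => /andP[h1 h2]; apply/andP; split; lra.
have PH N : holder beta (H + 2 * M * 2) (2 * M) (P N).
  split=> [x y|x]; rewrite /P.
    have -> : (Phi x + M) * chi N x - (Phi y + M) * chi N y =
      (Phi x - Phi y) * chi N x + (Phi y + M) * (chi N x - chi N y) by ring.
    apply: le_trans (ler_normD _ _) _; rewrite !normrM mulrDl; apply: lerD.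
      rewrite -[leRHS]mulr1; have /andP[z0 z1] := chi01 N x; apply: ler_pM => //.
      by rewrite ger0_norm.
    have hc := chiH N x y; have /andP[z0 z1] := PM y.
    by rewrite -(mulrA (2 * M)); apply: ler_pM => //; rewrite ger0_norm.
  have /andP[z0 z1] := PM x; have /andP[y0 y1] := chi01 N x.
  by rewrite normrM !ger0_norm// -[leRHS]mulr1; apply: ler_pM.
have C0 : 0 <= H + 2 * M * 2 by rewrite addr_ge0// !mulr_ge0.
have P0 N x : 0 <= P N x.
  by have /andP[z0 _] := PM x; have /andP[y0 _] := chi01 N x; rewrite mulr_ge0.
have mP N := holder_measurable n0 beta0 C0 (PH N).
have Pi N : leb.-integrable setT (EFin \o P N).
  have mb := @measurable_ecball0 R n N.+1%:R.
  apply: (@integrable_of_le _ _ _ _ _ (fun x => (2 * M)%:E * (\1_(ecball 0 N.+1%:R) x)%:E)%E) => //.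
  - by apply: measurable_funeM; apply/measurable_EFinP; exact: measurable_indic.
  - move=> x; rewrite -EFinM lee_fin indicE; have [xN|Nx] := leP (enorm x) N.+1%:R.
      by rewrite mem_set ?mulr1; [exact: (PH N).2|rewrite /ecball/= subr0].
    by rewrite /P chi0 ?mulr0 ?normr0 ?mulr_ge0// (lt_trans _ Nx)// ltr_nat.
  rewrite ge0_integralZl//; last 2 first.
  - by apply/measurable_EFinP; exact: measurable_indic.
  - by rewrite lee_fin mulr_ge0.
  rewrite lte_mul_pinfty ?lee_fin ?mulr_ge0// integral_indic// setIT.
  by rewrite -[X in (X < _)%E]/(leb (ecball 0 N.+1%:R)) leb_ecball// ltry.
have conv (cc : R^nat) XX DD (aa : nat -> vec -> measurableTypeR R) (VV : R) :
    (forall j, borel_atom beta (XX j) (DD j) (aa j)) ->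
    (\sum_(0 <= j <oo) `|cc j|%:E < +oo)%E ->
    series (fun j => cc j * \int[leb]_x (aa j x * Phi x)) @ \oo --> VV ->
    (fun N => limn (series (fun j => cc j * \int[leb]_x (aa j x * P N x)))) @ \oo --> VV.
  move=> haa hcc hVV; have CC0 : 0 <= (H + 2 * M * 2) * atom_const (R := R) n beta.
    by apply: mulr_ge0 => //; exact: atom_const_ge0.
  apply: (@tannery R (fun N j => cc j * \int[leb]_x (aa j x * P N x))
    (fun j => cc j * \int[leb]_x (aa j x * Phi x))
    (fun j => `|cc j| * ((H + 2 * M * 2) * atom_const (R := R) n beta))
    (fun N => limn (series (fun j => cc j * \int[leb]_x (aa j x * P N x)))) VV) => //.
  - under eq_eseriesr do rewrite EFinM muleC.
    by rewrite nneseriesZl// lte_mul_pinfty.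
  - move=> N j; rewrite normrM ler_wpM2l//.
    by eapply atom_holder_le; eauto.
  - move=> j; apply: near_cvg_cst_eq; exists (Num.truncn (enorm (XX j) + DD j + 1)).+1 => // N /= hN.
    have [d0 ma asupp _ a0] := haa j; have ai := borel_atom_integrable (haa j).
    congr (_ * _).
    have -> : \int[leb]_x (aa j x * P N x) = \int[leb]_x (aa j x * Phi x + aa j x * M).
      apply: eq_Rintegral => x _; have [xd|dx] := leP (enorm (x - XX j)) (DD j); last first.
        by rewrite asupp// !mul0r addr0.
      rewrite /P chi1 ?mulr1 ?mulrDr//.
      have h1 : enorm x <= enorm (x - XX j) + enorm (XX j).
        by rewrite -{1}(subrK (XX j) x) ler_enormD.
      apply: (@le_trans _ _ (enorm (XX j) + DD j + 1)); first by lra.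
      by apply: le_trans (ltW (truncnS_gt _)) _; rewrite ler_nat.
    have iM : leb.-integrable setT (EFin \o (fun x => aa j x * M)).
      by apply: (bounded_mul_integrable ai (measurable_cst _) (M := `|M|)).
    have iP : leb.-integrable setT (EFin \o (fun x => aa j x * Phi x)).
      by apply: (bounded_mul_integrable ai mPhi (M := M)).
    by rewrite RintegralD// RintegralZr// a0 mul0r addr0.
  - move=> N; have : cvgn (series (fun j => cc j * \int[leb]_x (aa j x * P N x))).
      exact: (holder_pairing_cvg n0 beta0 C0 (PH N) haa hcc).
    by [].
have h1 := conv _ _ _ _ _ ha coo hV; have h2 := conv _ _ _ _ _ ha' coo' hV'.
have e N : limn (series (fun j => c j * \int[leb]_x (a j x * P N x))) =
    limn (series (fun j => c' j * \int[leb]_x (a' j x * P N x))).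
  apply: (@pairing_unique_integrable (P N) (H + 2 * M * 2) (2 * M)) => //.
    have : cvgn (series (fun j => c j * \int[leb]_x (a j x * P N x))).
      exact: (holder_pairing_cvg n0 beta0 C0 (PH N) ha coo).
    by [].
  have : cvgn (series (fun j => c' j * \int[leb]_x (a' j x * P N x))).
    exact: (holder_pairing_cvg n0 beta0 C0 (PH N) ha' coo').
  by [].
have e0 : (fun N => limn (series (fun j => c j * \int[leb]_x (a j x * P N x)))) =
    (fun N => limn (series (fun j => c' j * \int[leb]_x (a' j x * P N x)))).
  by apply/funext => N; exact: e.
rewrite e0 in h1; exact: (cvg_unique (@Rhausdorff R) h1 h2).
Qed.

End pairing_unique.

(** * Sums of commutators of atoms *)

Section atomic_sums.
Context (R : realType) (n : nat).
Local Notation vec := 'rV[R]_n.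
Local Notation leb := (lebesgue_rV R n).
Variables (k : vec -> measurableTypeR R) (beta q A : R).
Hypotheses (n0 : (0 < n)%N) (beta0 : 0 < beta) (beta1 : beta < 1) (q0 : 0 < q) (A0 : 0 <= A).
Hypothesis mk : measurable_fun setT k.
Hypothesis hweak : forall x0 d y t, 0 < d -> enorm (y - x0) <= d -> 0 < t ->
  (\int[leb]_x cut t (atom_kernel k beta x0 d (x, y)) <= (A * t `^ (1 - q))%:E)%E.
Variables (X : nat -> vec) (D : R^nat) (a : nat -> vec -> measurableTypeR R).
Hypothesis ha : forall j, borel_atom beta (X j) (D j) (a j).
Local Notation Ca := (atom_const (R := R) n beta).

(** Majorant of the commutator of the j-th atom, up to the constant [L], that does not involve
    [b]. *)
Definition atom_gauge j (x : vec) : \bar R :=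
  (\int[leb]_y (atom_mass beta (D j) (a j) y * atom_kernel k beta (X j) (D j) (x, y))%:E)%E.

Definition gauge_sum (w : R^nat) (x : vec) : \bar R :=
  (\sum_(0 <= j <oo) (w j)%:E * atom_gauge j x)%E.

Lemma atom_gauge_ge0 j x : (0 <= atom_gauge j x)%E.
Proof.
by apply: integral_ge0 => y _; rewrite lee_fin mulr_ge0 ?atom_mass_ge0 ?atom_kernel_ge0.
Qed.

Section weights.
Variables (w : R^nat) (Mw : R).
Hypotheses (w0 : forall j, 0 <= w j) (hMw : (\sum_(0 <= j <oo) (w j)%:E <= Mw%:E)%E).

Let mw j (y : vec) : measurableTypeR R := w j * atom_mass beta (D j) (a j) y.
Let Fk j : vec * vec -> measurableTypeR R := atom_kernel k beta (X j) (D j).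

Let ma j : measurable_fun setT (a j). Proof. by have [] := ha j. Qed.

Let mmw j : measurable_fun setT (mw j).
Proof. by apply: measurable_funM => //; exact: measurable_atom_mass. Qed.

Let mw0 j y : 0 <= mw j y. Proof. by rewrite mulr_ge0 ?atom_mass_ge0. Qed.

Let mFk j : measurable_fun setT (Fk j). Proof. exact: measurable_atom_kernel. Qed.

Let Fk0 j z : 0 <= Fk j z. Proof. exact: atom_kernel_ge0. Qed.

Let weakFk j y t : mw j y != 0 -> 0 < t ->
  (\int[leb]_x cut t (Fk j (x, y)) <= (A * t `^ (1 - q))%:E)%E.
Proof.
move=> mj t0; have [d0 _ asupp _ _] := ha j; apply: hweak => //.
rewrite leNgt; apply/negP => dy; move/negP: mj; apply.
by rewrite /mw /atom_mass asupp// normr0 mul0r mulr0.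
Qed.

Lemma gauge_sumE x : gauge_sum w x = weighted_sum mw Fk x.
Proof.
apply: eq_eseriesr => j _; rewrite /atom_gauge -ge0_integralZl//.
- by apply: eq_integral => y _; rewrite -EFinM mulrA.
- exact: measurable_mass_kernel.
- by move=> y _; rewrite lee_fin mulr_ge0 ?atom_mass_ge0 ?atom_kernel_ge0.
- by rewrite lee_fin.
Qed.

Let mass_le : (\sum_(0 <= j <oo) \int[leb]_y (mw j y)%:E <= (Mw * Ca)%:E)%E.
Proof.
have Ca0 : 0 <= Ca by exact: atom_const_ge0.
apply: (@le_trans _ _ (\sum_(0 <= j <oo) (Ca%:E * (w j)%:E))%E); last first.
  rewrite nneseriesZl; last by move=> j _; rewrite lee_fin.
  rewrite (_ : (Mw * Ca)%:E = Ca%:E * Mw%:E)%E; last by rewrite -EFinM mulrC.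
  by apply: lee_wpmul2l => //; rewrite lee_fin.
apply: lee_nneseries => j _; first by move=> _; apply: integral_ge0 => y _; rewrite lee_fin.
have [d0 _ _ aL1 _] := ha j; have db : 0 < D j `^ beta by rewrite powR_gt0.
have mabs : measurable_fun setT (fun y => `|a j y|%:E).
  by apply/measurable_EFinP; exact: (measurableT_comp (@normr_measurable R setT) (ma j)).
have e (y : vec) : (mw j y)%:E = ((w j * D j `^ beta)%:E * `|a j y|%:E)%E.
  by rewrite -EFinM /mw /atom_mass; congr EFin; ring.
under eq_integral do rewrite e.
have c0 : 0 <= w j * D j `^ beta by rewrite mulr_ge0// ltW.
rewrite ge0_integralZl//.
apply: (@le_trans _ _ ((w j * D j `^ beta)%:E * (Ca / D j `^ beta)%:E)%E).
  by apply: lee_wpmul2l; rewrite ?lee_fin.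
rewrite -!EFinM lee_fin le_eqVlt; apply/orP; left; apply/eqP; field.
by rewrite gt_eqF.
Qed.

Lemma gauge_weak (M lambda : R) : Mw * Ca <= M -> 0 < M -> 0 < lambda ->
  (leb [set x | (lambda%:E < gauge_sum w x)%E] <= (A * (2 * M / lambda) `^ q)%:E)%E.
Proof.
move=> MM M0 l0.
have hm : (\sum_(0 <= j <oo) \int[leb]_y (mw j y)%:E <= M%:E)%E.
  by apply: le_trans mass_le _; rewrite lee_fin.
have := @weighted_sum_weak R n mw Fk q A M mmw mw0 mFk Fk0 A0 weakFk M0 hm lambda l0.
rewrite (_ : [set x | (lambda%:E < gauge_sum w x)%E] = [set x | (lambda%:E < weighted_sum mw Fk x)%E])//.
by apply/seteqP; split => x /=; rewrite gauge_sumE.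
Qed.

Lemma measurable_gauge_sum : measurable_fun setT (gauge_sum w).
Proof.
rewrite (_ : gauge_sum w = weighted_sum mw Fk); last by apply/funext => x; exact: gauge_sumE.
exact: measurable_weighted_sum.
Qed.

Lemma gauge_sum_ge0 x : (0 <= gauge_sum w x)%E.
Proof.
by apply: nneseries_ge0 => j _ _; apply: mule_ge0; rewrite ?lee_fin ?atom_gauge_ge0.
Qed.

Lemma gauge_local E : measurable E -> (leb E < +oo)%E ->
  (\int[leb]_(x in E) gauge_sum w x < +oo)%E.
Proof.
move=> mE Eoo; pose M := Num.max 1 (Mw * Ca).
have M0 : 0 < M by rewrite /M lt_max ltr01.
have hm : (\sum_(0 <= j <oo) \int[leb]_y (mw j y)%:E <= M%:E)%E.
  by apply: le_trans mass_le _; rewrite lee_fin /M le_max lexx orbT.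
have h := @integral_weighted_sum R n mw Fk q A M mmw mw0 mFk Fk0 A0 weakFk M0 hm E mE.
under eq_integral do rewrite gauge_sumE.
apply: le_lt_trans h _; apply: lte_mul_pinfty; rewrite ?lee_fin ?(ltW M0)//.
by rewrite lte_add_pinfty// ltry.
Qed.

Lemma gauge_finite_ae : {ae leb, forall x, (gauge_sum w x < +oo)%E}.
Proof.
have mN : measurable [set x | (+oo <= gauge_sum w x)%E].
  rewrite -[X in measurable X]setTI; apply: emeasurable_fun_c_infty => //.
  exact: measurable_gauge_sum.
exists [set x | (+oo <= gauge_sum w x)%E]; split => //; last first.
  by move=> x /= /negP; rewrite -leNgt.
apply/eqP; rewrite -measure_le0; apply/lee_addgt0Pr => e e0; rewrite add0e.
pose M := Num.max 1 (Mw * Ca).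
have M0 : 0 < M by rewrite /M lt_max ltr01.
have A1 : 0 < A + 1 by rewrite ltr_wpDl.
(* Chosen so that A r^q <= e; the level [lambda] is then the one at which the weak bound equals A
   r^q. *)
pose r := (e / (A + 1)) `^ q^-1.
have r0 : 0 < r by rewrite powR_gt0// divr_gt0.
pose lambda := 2 * M / r; have l0 : 0 < lambda by rewrite divr_gt0// mulr_gt0.
have MM : Mw * Ca <= M by rewrite /M le_max lexx orbT.
have h := gauge_weak MM M0 l0.
apply: (@le_trans _ _ (leb [set x | (lambda%:E < gauge_sum w x)%E])).
  apply: le_measure; rewrite ?inE//.
    rewrite -[X in measurable X]setTI; apply: emeasurable_fun_o_infty => //.
    exact: measurable_gauge_sum.
  by move=> x /= hx; apply: lt_le_trans hx; rewrite ltry.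
apply: le_trans h _; rewrite lee_fin.
have -> : 2 * M / lambda = r.
  by rewrite /lambda invf_div mulrCA mulfV ?mulr1// mulf_neq0// gt_eqF.
rewrite /r -powRrM mulVf ?gt_eqF// powRr1; last by rewrite divr_ge0// ltW.
rewrite mulrA ler_pdivrMr// mulrDr mulr1 mulrC lerDl; exact: ltW.
Qed.

End weights.

Variables (b : vec -> measurableTypeR R) (L : R).
Hypotheses (mb : measurable_fun setT b) (L0 : 0 <= L).
Hypothesis bL : forall x y, `|b x - b y| <= L * enorm (x - y) `^ beta.

Definition atom_comm j (x : vec) : measurableTypeR R := \int[leb]_y (comm k b x y * a j y).

Lemma measurable_atom_comm j : measurable_fun setT (atom_comm j).
Proof.
have [_ ma _ _ _] := ha j.
have mf : measurable_fun setT (fun z : vec * vec => comm k b z.1 z.2 * a j z.2 : measurableTypeR R).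
  apply: measurable_funM; first exact: measurable_comm_pair.
  by apply: measurableT_comp ma _; exact: measurable_snd.
exact: (measurable_Rintegral2 leb mf).
Qed.

Lemma atom_comm_bound j x : (atom_gauge j x < +oo)%E ->
  leb.-integrable setT (EFin \o (fun y => comm k b x y * a j y)) /\
  `|atom_comm j x| <= L * fine (atom_gauge j x).
Proof.
move=> goo; have gf : atom_gauge j x \is a fin_num by rewrite ge0_fin_numE ?atom_gauge_ge0.
have [h1 h2] := comm_atom_bound beta0 beta1 mk mb L0 bL (ha j) goo.
by split => //; rewrite -lee_fin EFinM fineK.
Qed.

Lemma atom_comm_series (c : R^nat) x : (forall j, atom_gauge j x < +oo)%E ->
  (gauge_sum (fun j => `|c j|%R) x < +oo)%E ->
  cvgn (series (fun j => c j * atom_comm j x)) /\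
  (forall N, (`|series (fun j => c j * atom_comm j x) N|%:E <=
     L%:E * gauge_sum (fun j => `|c j|%R) x)%E) /\
  (forall S : R, series (fun j => c j * atom_comm j x) @ \oo --> S ->
     (`|S|%:E <= L%:E * gauge_sum (fun j => `|c j|%R) x)%E).
Proof.
move=> goo Goo.
have gf j : atom_gauge j x \is a fin_num by rewrite ge0_fin_numE ?atom_gauge_ge0.
have gj0 j : 0 <= fine (atom_gauge j x) by rewrite fine_ge0 ?atom_gauge_ge0.
pose u j := `|c j| * (L * fine (atom_gauge j x)).
have u0 j : 0 <= u j by rewrite mulr_ge0 ?mulr_ge0.
have hu j : `|c j * atom_comm j x| <= u j.
  by rewrite normrM; apply: ler_wpM2l => //; have [_] := atom_comm_bound (goo j).
have uE : (\sum_(0 <= j <oo) (u j)%:E = L%:E * gauge_sum (fun j => `|c j|%R) x)%E.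
  rewrite /gauge_sum -nneseriesZl; last first.
    by move=> j _; apply: mule_ge0; rewrite ?lee_fin ?atom_gauge_ge0.
  by apply: eq_eseriesr => j _; rewrite /u !EFinM fineK// muleCA.
have uoo : (\sum_(0 <= j <oo) (u j)%:E < +oo)%E by rewrite uE lte_mul_pinfty ?lee_fin.
have uf : (\sum_(0 <= j <oo) (u j)%:E)%E \is a fin_num.
  by rewrite ge0_fin_numE//; apply: nneseries_ge0 => j _ _; rewrite lee_fin.
split.
  apply: normed_cvg; apply: (@series_le_cvg _ _ u) => //.
    by move=> j; exact: normr_ge0.
  apply: nondecreasing_is_cvgn; first by apply: nondecreasing_series.
  exists (fine (\sum_(0 <= j <oo) (u j)%:E)%E) => _ [N _ <-].
  rewrite /series/= -lee_fin fineK// -sumEFin.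
  by apply: (@nneseries_lim_ge R (fun j => (u j)%:E) xpredT 0 N) => j _ _; rewrite lee_fin.
split=> [N|S hS]; last first.
  by have := series_tail_le 0 hu hS; rewrite /series/= big_geq// subr0 uE.
rewrite -uE; apply: (@le_trans _ _ (\sum_(0 <= j < N) (u j)%:E)%E).
  rewrite sumEFin lee_fin; apply: le_trans (ler_norm_sum _ _ _) _.
  by apply: ler_sum => j _; exact: hu.
by apply: (@nneseries_lim_ge R (fun j => (u j)%:E) xpredT 0 N) => j _ _; rewrite lee_fin.
Qed.

(** Positive weights let one finite sum control the gauge of every atom, including those with
    coefficient 0, whose commutators must converge absolutely as well. *)
Lemma gauge_sum_good (c w : R^nat) x : (forall j, `|c j| <= w j) -> (forall j, 0 < w j) ->
  (gauge_sum w x < +oo)%E ->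
  [/\ forall j, (atom_gauge j x < +oo)%E,
      forall j, (atom_gauge j x <= (w j)^-1%:E * gauge_sum w x)%E &
      (gauge_sum (fun j => `|c j|%R) x <= gauge_sum w x)%E].
Proof.
move=> cw w0 Goo.
have hw j : ((w j)%:E * atom_gauge j x <= gauge_sum w x)%E.
  have h0 i : (0 <= (w i)%:E * atom_gauge i x)%E.
    by apply: mule_ge0; rewrite ?atom_gauge_ge0 ?lee_fin ?ltW.
  have := @nneseries_lim_ge R (fun i => (w i)%:E * atom_gauge i x)%E xpredT 0 j.+1 (fun i _ _ => h0 i).
  move=> hi; apply: le_trans hi; rewrite big_nat_recr//=; apply: leeDr.
  by apply: sume_ge0 => i _; exact: h0.
have hg j : (atom_gauge j x <= (w j)^-1%:E * gauge_sum w x)%E.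
  rewrite -[leLHS]mul1e -(@mulVf _ (w j)) ?gt_eqF// EFinM -muleA.
  by apply: lee_wpmul2l; [rewrite lee_fin invr_ge0 ltW|exact: hw].
split => //.
- move=> j; apply: le_lt_trans (hg j) _; apply: lte_mul_pinfty => //.
  by rewrite lee_fin invr_ge0 ltW.
apply: lee_nneseries => j _; first by move=> _; apply: mule_ge0; rewrite ?lee_fin ?atom_gauge_ge0.
by apply: lee_wpmul2r; rewrite ?atom_gauge_ge0 ?lee_fin.
Qed.

(* the constant L + 1 is positive, so that the bound also holds where the gauge is infinite *)
Lemma atom_comm_le_gauge j x : (`|atom_comm j x|%:E <= (L + 1)%:E * atom_gauge j x)%E.
Proof.
have L1 : 0 < L + 1 by rewrite ltr_wpDl.
have [goo|] := ltP (atom_gauge j x) +oo%E; last first.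
  by rewrite leye_eq => /eqP ->; rewrite gt0_muley ?lte_fin// leey.
have gf : atom_gauge j x \is a fin_num by rewrite ge0_fin_numE ?atom_gauge_ge0.
have [_ h] := atom_comm_bound goo; rewrite -(fineK gf) -EFinM lee_fin.
apply: le_trans h _; apply: ler_wpM2r; first by rewrite fine_ge0 ?atom_gauge_ge0.
by rewrite lerDl.
Qed.

End atomic_sums.

Lemma Rintegral_series d (T : measurableType d) (R : realType)
    (mu : {measure set T -> \bar R}) (c : R^nat) (f : nat -> T -> measurableTypeR R) N :
  (forall j, mu.-integrable setT (EFin \o f j)) ->
  \int[mu]_x series (fun j => c j * f j x) N = series (fun j => c j * \int[mu]_x f j x) N /\
  mu.-integrable setT (EFin \o (fun x => series (fun j => c j * f j x) N)).
Proof.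
move=> fi; elim: N => [|N [ih1 ih2]].
  split.
    rewrite /series/= big_nil /Rintegral integral0_eq// => y _.
    by rewrite big_nil.
  apply: eq_integrable (integrable0 mu setT) => // y _.
  by rewrite /series/= big_nil.
have iN : mu.-integrable setT (EFin \o (fun y => c N * f N y)).
  by apply: eq_integrable (integrableZl measurableT (c N) (fi N)).
have eN y : series (fun j => c j * f j y) N.+1 = series (fun j => c j * f j y) N + c N * f N y.
  by rewrite /series/= big_nat_recr.
split.
  rewrite [RHS]/series/= big_nat_recr//= -[X in X + _]/(series (fun j => c j * \int[mu]_x f j x) N).
  rewrite -ih1 -(RintegralZl _ _ (fi N))// -RintegralD//.
  by apply: eq_Rintegral => y _; exact: eN.
by apply: eq_integrable (integrableD measurableT ih2 iN) => // y _; rewrite /= -EFinD -eN.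
Qed.

Lemma summable_weight (R : realType) (c : R^nat) : (\sum_(0 <= j <oo) `|c j|%:E < +oo)%E ->
  exists w Mw, [/\ forall j, `|c j| <= w j, forall j, 0 < w j &
    (\sum_(0 <= j <oo) (w j)%:E <= Mw%:E)%E].
Proof.
move=> coo.
have p2 j : 0 < 2^-1 * 2^-1 ^+ j :> R by rewrite mulr_gt0// exprn_gt0.
exists (fun j => `|c j| + 2^-1 * 2^-1 ^+ j), (fine (\sum_(0 <= j <oo) `|c j|%:E)%E + 2^-1 / (1 - 2^-1)).
split=> [j|j|]; [by rewrite lerDl ltW|by rewrite ltr_wpDl|].
have -> : (\sum_(0 <= j <oo) (`|c j| + 2^-1 * 2^-1 ^+ j)%:E =
    \sum_(0 <= j <oo) (`|c j|%:E + (2^-1 * 2^-1 ^+ j)%:E))%E by [].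
rewrite nneseriesD; last 2 first.
- by move=> j _ _; rewrite lee_fin.
- by move=> j _ _; rewrite lee_fin ltW.
rewrite EFinD fineK; last by rewrite ge0_fin_numE//; apply: nneseries_ge0.
apply: leeD => //; apply: geometric_eseries_le => //.
by rewrite invf_lt1// ltr1n.
Qed.

(** * Truncation of the multiplier b *)

Section clamp.
Variable R : realType.
Implicit Types M s t : R.

(** For M >= 0, the projection onto [-M, M], with the maximum written through minima so that
    [min_dist_le] applies. *)
Definition clamp M t : R := - Num.min M (- Num.min M t).

Lemma clamp_lip M s t : `|clamp M s - clamp M t| <= `|s - t|.
Proof.
rewrite /clamp -opprD normrN; apply: le_trans (min_dist_le _ _ _ _) _.
rewrite subrr normr0 add0r -opprD normrN.
by apply: le_trans (min_dist_le _ _ _ _) _; rewrite subrr normr0 add0r.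
Qed.

Lemma clamp_le M t : 0 <= M -> `|clamp M t| <= M.
Proof.
move=> M0; rewrite ler_norml /clamp; apply/andP; split; first by rewrite lerN2 ge_min lexx.
by rewrite lerNl le_min lerN2 ge_min lexx andbT (le_trans _ M0)// oppr_le0.
Qed.

Lemma clamp_id M t : `|t| <= M -> clamp M t = t.
Proof.
rewrite ler_norml => /andP[h1 h2]; rewrite /clamp (min_idPr h2).
by rewrite (min_idPr (_ : - t <= M)) ?opprK// lerNl.
Qed.

End clamp.

Section comm_clamp.
Context (R : realType) (n : nat).
Local Notation vec := 'rV[R]_n.
Local Notation leb := (lebesgue_rV R n).
Variables (k : vec -> measurableTypeR R) (beta : R).
Hypotheses (n0 : (0 < n)%N) (beta0 : 0 < beta) (beta1 : beta < 1) (mk : measurable_fun setT k).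
Variables (c : R^nat) (X : nat -> vec) (D : R^nat) (a : nat -> vec -> measurableTypeR R).
Hypothesis ha : forall j, borel_atom beta (X j) (D j) (a j).
Variables (b : vec -> measurableTypeR R) (L : R).
Hypotheses (mb : measurable_fun setT b) (L0 : 0 <= L).
Hypothesis bL : forall x y, `|b x - b y| <= L * enorm (x - y) `^ beta.

Definition clampf (m : nat) (x : vec) : measurableTypeR R := clamp m%:R (b x).

Lemma clampf_hoelder m x y : `|clampf m x - clampf m y| <= L * enorm (x - y) `^ beta.
Proof. exact: le_trans (clamp_lip _ _ _) (bL x y). Qed.

Lemma measurable_clampf m : measurable_fun setT (clampf m).
Proof. exact: (hoelder_measurable n0 beta0 L0 (clampf_hoelder m)). Qed.

Lemma atom_comm_clamp_cvg x : (forall j, atom_gauge k beta X D a j x < +oo)%E ->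
  (gauge_sum k beta X D a (fun j => `|c j|%R) x < +oo)%E ->
  (fun m => limn (series (fun j => c j * atom_comm k a (clampf m) j x))) @ \oo -->
  limn (series (fun j => c j * atom_comm k a b j x)).
Proof.
move=> goo Goo.
have g0 j : (0 <= atom_gauge k beta X D a j x)%E by exact: atom_gauge_ge0.
have gf j : atom_gauge k beta X D a j x \is a fin_num by rewrite ge0_fin_numE.
have uE : (\sum_(0 <= j <oo) (`|c j| * (L * fine (atom_gauge k beta X D a j x)))%:E =
    L%:E * gauge_sum k beta X D a (fun j => `|c j|%R) x)%E.
  rewrite /gauge_sum -nneseriesZl; last by move=> j _; apply: mule_ge0; rewrite ?lee_fin.
  by apply: eq_eseriesr => j _; rewrite !EFinM fineK// muleCA.
apply: (@tannery R (fun m j => c j * atom_comm k a (clampf m) j x)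
  (fun j => c j * atom_comm k a b j x) (fun j => `|c j| * (L * fine (atom_gauge k beta X D a j x)))
  (fun m => limn (series (fun j => c j * atom_comm k a (clampf m) j x)))).
- by rewrite uE lte_mul_pinfty ?lee_fin.
- move=> m j; rewrite normrM; apply: ler_wpM2l => //.
  exact: (atom_comm_bound beta0 beta1 mk ha (measurable_clampf m) L0 (clampf_hoelder m) (goo j)).2.
- move=> j; have [d0 ma asupp _ _] := ha j.
  (* A bound for |b| at [x] and on the support of the j-th atom; once m exceeds it, the truncation
     is inactive in the j-th term. *)
  pose K := `|b x| + L * (enorm (x - X j) + D j) `^ beta.
  apply: near_cvg_cst_eq; exists (Num.truncn K).+1 => // m /= Km.
  have KM : K <= m%:R by apply: le_trans (ltW (truncnS_gt _)) _; rewrite ler_nat.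
  have hx : `|b x| <= m%:R by apply: le_trans KM; rewrite lerDl mulr_ge0 ?powR_ge0.
  congr (_ * _); apply: eq_Rintegral => y _.
  have [yd|dy] := leP (enorm (y - X j)) (D j); last by rewrite asupp// !mulr0.
  have hy : `|b y| <= m%:R.
    apply: le_trans KM; rewrite (_ : b y = b x + (b y - b x)); last by rewrite addrC subrK.
    apply: le_trans (ler_normD _ _) _.
    rewrite lerD2l; apply: le_trans (bL y x) _; apply: ler_wpM2l => //.
    apply: ge0_ler_powR; rewrite ?nnegrE ?(ltW beta0) ?enorm_ge0 ?addr_ge0 ?enorm_ge0 ?(ltW d0)//.
    rewrite (_ : y - x = (y - X j) + (X j - x)); last by rewrite addrA subrK.
    apply: le_trans (ler_enormD _ _) _; rewrite [leRHS]addrC; apply: lerD => //.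
    by rewrite -enormN opprB.
  by rewrite /comm /clampf !clamp_id.
- move=> m.
  exact: (atom_comm_series beta0 beta1 mk ha (measurable_clampf m) L0 (clampf_hoelder m) goo Goo).1.
exact: (atom_comm_series beta0 beta1 mk ha mb L0 bL goo Goo).1.
Qed.

End comm_clamp.

(** * Independence of the atomic decomposition *)

Section comm_unique.
Context (R : realType) (n : nat).
Local Notation vec := 'rV[R]_n.
Local Notation leb := (lebesgue_rV R n).
Variables (k : vec -> measurableTypeR R) (beta q A A3 : R).
Hypotheses (n0 : (0 < n)%N) (beta0 : 0 < beta) (beta1 : beta < 1) (q0 : 0 < q) (A0 : 0 <= A).
Hypotheses (mk : measurable_fun setT k) (A30 : 0 <= A3).
Hypothesis k1 : (\int[leb]_x cut 1 `|k x| <= A3%:E)%E.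
Hypothesis hweak : forall x0 d y t, 0 < d -> enorm (y - x0) <= d -> 0 < t ->
  (\int[leb]_x cut t (atom_kernel k beta x0 d (x, y)) <= (A * t `^ (1 - q))%:E)%E.
Variables (c : R^nat) (X : nat -> vec) (D : R^nat) (a : nat -> vec -> measurableTypeR R).
Hypotheses (ha : forall j, borel_atom beta (X j) (D j) (a j))
  (coo : (\sum_(0 <= j <oo) `|c j|%:E < +oo)%E).
Variables (c' : R^nat) (X' : nat -> vec) (D' : R^nat) (a' : nat -> vec -> measurableTypeR R).
Hypotheses (ha' : forall j, borel_atom beta (X' j) (D' j) (a' j))
  (coo' : (\sum_(0 <= j <oo) `|c' j|%:E < +oo)%E).
Hypothesis hpair : forall (Phi : vec -> measurableTypeR R) (H M V V' : R), 0 <= H ->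
  holder beta H M Phi ->
  series (fun j => c j * \int[leb]_x (a j x * Phi x)) @ \oo --> V ->
  series (fun j => c' j * \int[leb]_x (a' j x * Phi x)) @ \oo --> V' -> V = V'.
Variable L : R.
Hypothesis L0 : 0 <= L.

Local Ltac by_weak lem :=
  first [eapply lem with (q := q) (A := A) | eapply lem with (A := A) | eapply lem with (q := q) | eapply lem]; eauto.

(** [h] is the difference of the two sums where both gauges are finite. Against a cut-off, duality
    turns each sum into the pairing of its atoms with the dual function, bounded and Hoelder, so
    [hpair] makes the difference 0; a locally integrable function orthogonal to all cut-offs
    vanishes almost everywhere. *)
Lemma comm_unique_bounded (b : vec -> measurableTypeR R) B : 0 <= B ->
  measurable_fun setT b -> (forall x y, `|b x - b y| <= L * enorm (x - y) `^ beta) ->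
  (forall x, `|b x| <= B) ->
  {ae leb, forall x, limn (series (fun j => c j * atom_comm k a b j x)) =
     limn (series (fun j => c' j * atom_comm k a' b j x))}.
Proof.
move=> B0 mb bL bB.
have [w [Mw [cw w0 hMw]]] := summable_weight coo.
have [w' [Mw' [cw' w0' hMw']]] := summable_weight coo'.
have w00 j : 0 <= w j by exact: ltW.
have w00' j : 0 <= w' j by exact: ltW.
have [G GE] : exists G, G = gauge_sum k beta X D a w by eexists.
have [G' GE'] : exists G', G' = gauge_sum k beta X' D' a' w' by eexists.
have mG : measurable_fun setT G by rewrite GE; by_weak measurable_gauge_sum.
have mG' : measurable_fun setT G' by rewrite GE'; by_weak measurable_gauge_sum.
have G0 x : (0 <= G x)%E by rewrite GE; by_weak gauge_sum_ge0.
have G0' x : (0 <= G' x)%E by rewrite GE'; by_weak gauge_sum_ge0.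
have Gae : {ae leb, forall x, (G x < +oo)%E} by rewrite GE; by_weak gauge_finite_ae.
have Gae' : {ae leb, forall x, (G' x < +oo)%E} by rewrite GE'; by_weak gauge_finite_ae.
have Gloc r : (\int[leb]_(x in ecball 0 r) G x < +oo)%E.
  rewrite GE; by_weak gauge_local; first exact: measurable_ecball0.
  apply: (@le_lt_trans _ _ (leb (ecball 0 (Num.max 1 r)))).
    apply: le_measure; rewrite ?inE; [exact: measurable_ecball0|exact: measurable_ecball0|].
    by move=> x; rewrite /ecball/= => h; apply: le_trans h _; rewrite le_max lexx orbT.
  by rewrite leb_ecball ?ltry// lt_max ltr01.
have Gloc' r : (\int[leb]_(x in ecball 0 r) G' x < +oo)%E.
  rewrite GE'; by_weak gauge_local; first exact: measurable_ecball0.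
  apply: (@le_lt_trans _ _ (leb (ecball 0 (Num.max 1 r)))).
    apply: le_measure; rewrite ?inE; [exact: measurable_ecball0|exact: measurable_ecball0|].
    by move=> x; rewrite /ecball/= => h; apply: le_trans h _; rewrite le_max lexx orbT.
  by rewrite leb_ecball ?ltry// lt_max ltr01.
pose Gam : set vec := [set x | (G x < +oo)%E] `&` [set x | (G' x < +oo)%E].
have mGam : measurable Gam.
  by apply: measurableI; rewrite -[X in measurable X]setTI; apply: emeasurable_fun_infty_o.
have [T TE] : exists T, T = atom_comm k a b by eexists.
have [T' TE'] : exists T', T' = atom_comm k a' b by eexists.
have mT j : measurable_fun setT (T j) by rewrite TE; eapply measurable_atom_comm; eauto.
have mT' j : measurable_fun setT (T' j) by rewrite TE'; eapply measurable_atom_comm; eauto.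
pose s N x := series (fun j => c j * T j x) N; pose s' N x := series (fun j => c' j * T' j x) N.
(* Off [Gam] the partial sums may diverge; the indicator makes them converge everywhere and alters
   them only on a null set. *)
pose u N : vec -> measurableTypeR R := fun x => \1_Gam x * (s N x - s' N x).
pose h : vec -> measurableTypeR R := fun x =>
  \1_Gam x * (limn (series (fun j => c j * T j x)) - limn (series (fun j => c' j * T' j x))).
have ms N : measurable_fun setT (s N : vec -> measurableTypeR R).
  rewrite (_ : s N = fun x => \sum_(0 <= j < N) c j * T j x)//.
  by apply: measurable_sum => j; exact: (measurable_funM (measurable_cst _) (mT j)).
have ms' N : measurable_fun setT (s' N : vec -> measurableTypeR R).
  rewrite (_ : s' N = fun x => \sum_(0 <= j < N) c' j * T' j x)//.
  by apply: measurable_sum => j; exact: (measurable_funM (measurable_cst _) (mT' j)).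
have mu_ N : measurable_fun setT (u N).
  apply: measurable_funM; first exact: measurable_indic.
  exact: (measurable_funB (ms N) (ms' N)).
have good x : Gam x -> [/\ cvgn (series (fun j => c j * T j x)),
    (forall N, `|s N x|%:E <= L%:E * G x)%E & forall S : R, series (fun j => c j * T j x) @ \oo --> S ->
       (`|S|%:E <= L%:E * G x)%E].
  move=> [/= g1 _].
  have [k1_ k2_ k3_] : [/\ forall j, (atom_gauge k beta X D a j x < +oo)%E,
    forall j, (atom_gauge k beta X D a j x <= (w j)^-1%:E * G x)%E &
    (gauge_sum k beta X D a (fun j => `|c j|%R) x <= G x)%E]
    by move: (g1); rewrite GE => g2; eapply gauge_sum_good; [exact: cw|exact: w0|exact: g2].
  have koo : (gauge_sum k beta X D a (fun j => `|c j|%R) x < +oo)%E by apply: le_lt_trans g1.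
  have [h1 [h2 h3]] : cvgn (series (fun j => c j * T j x)) /\
    (forall N, `|s N x|%:E <= L%:E * gauge_sum k beta X D a (fun j => `|c j|%R) x)%E /\
    (forall S : R, series (fun j => c j * T j x) @ \oo --> S ->
       (`|S|%:E <= L%:E * gauge_sum k beta X D a (fun j => `|c j|%R) x)%E).
    by rewrite /s TE; eapply atom_comm_series; eauto.
  split=> //.
    by move=> N; apply: le_trans (h2 N) _; apply: lee_wpmul2l.
  by move=> S hS; apply: le_trans (h3 S hS) _; apply: lee_wpmul2l.
have good' x : Gam x -> [/\ cvgn (series (fun j => c' j * T' j x)),
    (forall N, `|s' N x|%:E <= L%:E * G' x)%E & forall S : R, series (fun j => c' j * T' j x) @ \oo --> S ->
       (`|S|%:E <= L%:E * G' x)%E].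
  move=> [/= _ g1].
  have [k1_ k2_ k3_] : [/\ forall j, (atom_gauge k beta X' D' a' j x < +oo)%E,
    forall j, (atom_gauge k beta X' D' a' j x <= (w' j)^-1%:E * G' x)%E &
    (gauge_sum k beta X' D' a' (fun j => `|c' j|%R) x <= G' x)%E]
    by move: (g1); rewrite GE' => g2; eapply gauge_sum_good; [exact: cw'|exact: w0'|exact: g2].
  have koo : (gauge_sum k beta X' D' a' (fun j => `|c' j|%R) x < +oo)%E by apply: le_lt_trans g1.
  have [h1 [h2 h3]] : cvgn (series (fun j => c' j * T' j x)) /\
    (forall N, `|s' N x|%:E <= L%:E * gauge_sum k beta X' D' a' (fun j => `|c' j|%R) x)%E /\
    (forall S : R, series (fun j => c' j * T' j x) @ \oo --> S ->
       (`|S|%:E <= L%:E * gauge_sum k beta X' D' a' (fun j => `|c' j|%R) x)%E).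
    by rewrite /s' TE'; eapply atom_comm_series; eauto.
  split=> //.
    by move=> N; apply: le_trans (h2 N) _; apply: lee_wpmul2l.
  by move=> S hS; apply: le_trans (h3 S hS) _; apply: lee_wpmul2l.
have uh x : (u ^~ x) @ \oo --> h x.
  have [xG|xG] := pselect (Gam x); last first.
    apply: near_cvg_cst_eq; apply: nearW => N.
    by rewrite /u /h indicE memNset// !mul0r.
  have [h1 _ _] := good x xG; have [h1' _ _] := good' x xG.
  by apply: cvgMr; exact: (cvgB h1 h1').
pose GG x := (L%:E * (G x + G' x))%E.
have GG0 x : (0 <= GG x)%E by apply: mule_ge0; rewrite ?adde_ge0.
have mGG : measurable_fun setT GG by apply: measurable_funeM; exact: emeasurable_funD.
have uG N x : (`|u N x|%:E <= GG x)%E.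
  have [xG|xG] := pselect (Gam x); last by rewrite /u indicE memNset// mul0r normr0.
  rewrite /u indicE mem_set// mul1r; have [_ h1 _] := good x xG; have [_ h1' _] := good' x xG.
  rewrite /GG ge0_muleDr//; apply: le_trans (leeD (h1 N) (h1' N)).
  by rewrite -EFinD lee_fin ler_normB.
have hG x : (`|h x|%:E <= GG x)%E.
  have [xG|xG] := pselect (Gam x); last by rewrite /h indicE memNset// mul0r normr0.
  rewrite /h indicE mem_set// mul1r; have [c1 _ h1] := good x xG; have [c1' _ h1'] := good' x xG.
  rewrite /GG ge0_muleDr//; apply: le_trans (leeD (h1 _ c1) (h1' _ c1')).
  by rewrite -EFinD lee_fin ler_normB.
have GGloc r : (\int[leb]_(x in ecball 0 r) GG x < +oo)%E.
  have mr := @measurable_ecball0 R n r.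
  rewrite ge0_integralZl//; last 2 first.
  - by apply: measurable_funTS; exact: emeasurable_funD.
  - by move=> x _; rewrite adde_ge0.
  rewrite ge0_integralD//; [|exact: measurable_funTS|exact: measurable_funTS].
  by rewrite lte_mul_pinfty ?lee_fin// lte_add_pinfty.
have mh : measurable_fun setT h.
  by apply: (@measurable_fun_cvg _ _ _ setT u) => // x _; exact: uh.
have Ti psi (j : nat) : cutoff psi -> leb.-integrable setT (EFin \o (fun x => T j x * psi x)).
  move=> hpsi; have mpsi := cutoff_measurable n0 hpsi; have [p01 _ [r hr]] := hpsi.
  have mr := @measurable_ecball0 R n r.
  have L1 : 0 < L + 1 by rewrite ltr_wpDl.
  have mGr : measurable_fun setT (fun x => G x * (\1_(ecball 0 r) x)%:E)%E.
    by apply: emeasurable_funM => //; apply/measurable_EFinP; exact: measurable_indic.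
  have G0r x : (0 <= G x * (\1_(ecball 0 r) x)%:E)%E by apply: mule_ge0; rewrite ?lee_fin.
  (* The gauge sum divided by its j-th weight dominates the gauge of the j-th atom, and it is
     locally integrable. *)
  apply: (@integrable_of_le _ _ _ _ _ (fun x => ((L + 1) * (w j)^-1)%:E * (G x * (\1_(ecball 0 r) x)%:E))%E).
  - exact: (measurable_funM (mT j) mpsi).
  - exact: measurable_funeM.
  - move=> x; have [xr|rx] := leP (enorm x) r; last first.
      rewrite hr// mulr0 normr0; apply: mule_ge0 => //.
      by rewrite lee_fin mulr_ge0 ?invr_ge0// ltW.
    rewrite indicE mem_set ?mule1; last by rewrite /ecball/= subr0.
    apply: (@le_trans _ _ (`|T j x|%:E)).
      by have /andP[p0 p1] := p01 x; rewrite lee_fin normrM -[leRHS]mulr1 ler_wpM2l// ger0_norm.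
    have h1 : (`|T j x|%:E <= (L + 1)%:E * atom_gauge k beta X D a j x)%E.
      by rewrite TE; eapply atom_comm_le_gauge; eauto.
    have [Goo|] := ltP (G x) +oo%E; last first.
      rewrite leye_eq => /eqP ->; rewrite gt0_muley ?leey// lte_fin.
      by rewrite mulr_gt0// invr_gt0.
    have [_ k2_ _] : [/\ forall j, (atom_gauge k beta X D a j x < +oo)%E,
      forall j, (atom_gauge k beta X D a j x <= (w j)^-1%:E * G x)%E &
      (gauge_sum k beta X D a (fun j => `|c j|%R) x <= G x)%E]
    by move: (Goo); rewrite GE => g2; eapply gauge_sum_good; [exact: cw|exact: w0|exact: g2].
    apply: le_trans h1 _; rewrite EFinM -muleA; apply: lee_wpmul2l => //.
    by rewrite lee_fin ltW.
  - rewrite ge0_integralZl//; last by rewrite lee_fin mulr_ge0 ?invr_ge0// ltW.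
    rewrite -integral_indicM lte_mul_pinfty// lee_fin mulr_ge0 ?invr_ge0//; exact: ltW.
have Ti' psi (j : nat) : cutoff psi -> leb.-integrable setT (EFin \o (fun x => T' j x * psi x)).
  move=> hpsi; have mpsi := cutoff_measurable n0 hpsi; have [p01 _ [r hr]] := hpsi.
  have mr := @measurable_ecball0 R n r.
  have L1 : 0 < L + 1 by rewrite ltr_wpDl.
  have mGr : measurable_fun setT (fun x => G' x * (\1_(ecball 0 r) x)%:E)%E.
    by apply: emeasurable_funM => //; apply/measurable_EFinP; exact: measurable_indic.
  have G0r x : (0 <= G' x * (\1_(ecball 0 r) x)%:E)%E by apply: mule_ge0; rewrite ?lee_fin.
  apply: (@integrable_of_le _ _ _ _ _ (fun x => ((L + 1) * (w' j)^-1)%:E * (G' x * (\1_(ecball 0 r) x)%:E))%E).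
  - exact: (measurable_funM (mT' j) mpsi).
  - exact: measurable_funeM.
  - move=> x; have [xr|rx] := leP (enorm x) r; last first.
      rewrite hr// mulr0 normr0; apply: mule_ge0 => //.
      by rewrite lee_fin mulr_ge0 ?invr_ge0// ltW.
    rewrite indicE mem_set ?mule1; last by rewrite /ecball/= subr0.
    apply: (@le_trans _ _ (`|T' j x|%:E)).
      by have /andP[p0 p1] := p01 x; rewrite lee_fin normrM -[leRHS]mulr1 ler_wpM2l// ger0_norm.
    have h1 : (`|T' j x|%:E <= (L + 1)%:E * atom_gauge k beta X' D' a' j x)%E.
      by rewrite TE'; eapply atom_comm_le_gauge; eauto.
    have [Goo|] := ltP (G' x) +oo%E; last first.
      rewrite leye_eq => /eqP ->; rewrite gt0_muley ?leey// lte_fin.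
      by rewrite mulr_gt0// invr_gt0.
    have [_ k2_ _] : [/\ forall j, (atom_gauge k beta X' D' a' j x < +oo)%E,
      forall j, (atom_gauge k beta X' D' a' j x <= (w' j)^-1%:E * G' x)%E &
      (gauge_sum k beta X' D' a' (fun j => `|c' j|%R) x <= G' x)%E]
    by move: (Goo); rewrite GE' => g2; eapply gauge_sum_good; [exact: cw'|exact: w0'|exact: g2].
    apply: le_trans h1 _; rewrite EFinM -muleA; apply: lee_wpmul2l => //.
    by rewrite lee_fin ltW.
  - rewrite ge0_integralZl//; last by rewrite lee_fin mulr_ge0 ?invr_ge0// ltW.
    rewrite -integral_indicM lte_mul_pinfty// lee_fin mulr_ge0 ?invr_ge0//; exact: ltW.
have hcut psi : cutoff psi -> \int[leb]_x (h x * psi x) = 0.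
  move=> hpsi; have mpsi := cutoff_measurable n0 hpsi; have [p01 [H H0 hH] [r hr]] := hpsi.
  have mr := @measurable_ecball0 R n r.
  have hlim : (fun N => \int[leb]_x (u N x * psi x)) @ \oo --> \int[leb]_x (h x * psi x).
    apply: (@Rintegral_dominated _ _ _ leb (fun N x => u N x * psi x) (fun x => h x * psi x)
      (fun x => GG x * (\1_(ecball 0 r) x)%:E)%E).
    - by move=> N; exact: (measurable_funM (mu_ N) mpsi).
    - exact: (measurable_funM mh mpsi).
    - by apply: emeasurable_funM => //; apply/measurable_EFinP; exact: measurable_indic.
    - by move=> x; apply: mule_ge0; rewrite ?lee_fin.
    - by rewrite -integral_indicM.
    - by apply: aeW => x; apply: cvgMl; exact: uh.
    move=> N x; have [xr|rx] := leP (enorm x) r; last first.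
      by rewrite hr// mulr0 normr0; apply: mule_ge0; rewrite ?lee_fin.
    rewrite indicE mem_set ?mule1; last by rewrite /ecball/= subr0.
    apply: le_trans (uG N x).
    by have /andP[p0 p1] := p01 x; rewrite lee_fin normrM -[leRHS]mulr1 ler_wpM2l// ger0_norm.
  have H10 : 0 <= 1 + H by rewrite addr_ge0.
  (* A Lipschitz function with values in [0,1] is Hoelder of order beta: distances up to 1 use the
     Lipschitz bound, larger ones the trivial bound 1. *)
  have psiH x y : `|psi x - psi y| <= (1 + H) * enorm (x - y) `^ beta.
    have e0 := enorm_ge0 (x - y).
    have [xy|xy] := leP (enorm (x - y)) 1.
      apply: le_trans (hH x y) _; apply: ler_pM; rewrite ?lerDr//.
      have [->|ez] := eqVneq (enorm (x - y)) 0; first exact: powR_ge0.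
      have e00 : 0 < enorm (x - y) by rewrite lt_neqAle eq_sym ez.
      by rewrite -[leLHS]powRr1 ?(ltW e00)//; apply: ger_powR; rewrite ?e00 ?xy// ltW.
    have := @ge0_ler_powR R beta (ltW beta0) 1 (enorm (x - y)); rewrite powR1 => hp.
    have {}hp : 1 <= enorm (x - y) `^ beta by apply: hp; rewrite ?nnegrE ?(ltW xy).
    apply: (@le_trans _ _ 1).
      have /andP[a1 a2] := p01 x; have /andP[b1 b2] := p01 y.
      by rewrite ler_norml; apply/andP; split; lra.
    by rewrite -[leLHS]mulr1; apply: ler_pM; rewrite ?lerDl.
  (* The radius beyond which [psi] vanishes may be negative; the maximum with 1 gives a genuine
     ball. *)
  pose r1 := Num.max 1 r; have r10 : 0 < r1 by rewrite lt_max ltr01.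
  pose V0 := r1 ^+ n * ballvol R n.
  have V00 : 0 <= V0 by rewrite mulr_ge0 ?exprn_ge0 ?(ltW r10)// ltW// ballvol_gt0.
  have EV : leb (ecball 0 r1) = V0%:E by rewrite leb_ecball.
  have mr1 := @measurable_ecball0 R n r1.
  have psiE x : ~ ecball 0 r1 x -> psi x = 0.
    move=> hx; apply: hr; rewrite ltNge; apply/negP => xr; apply: hx.
    by rewrite /ecball/= subr0 le_max xr orbT.
  pose Phi : vec -> measurableTypeR R := dual k b psi.
  have PH : holder beta (dual_const A3 L B (1 + H) V0) (2 * B * (V0 + A3)) Phi.
    split.
      by move=> x y; exact: (dual_hoelder mk mb mpsi L0 B0 H10 bL bB p01 psiH mr1 EV psiE k1 x y).
    by move=> y; eapply dual_bounded; eauto.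
  have C0 : 0 <= dual_const A3 L B (1 + H) V0 by eapply dual_const_ge0; eauto.
  have cV : cvgn (series (fun j => c j * \int[leb]_x (a j x * Phi x))).
    exact: (holder_pairing_cvg n0 beta0 C0 PH ha coo).
  have cV' : cvgn (series (fun j => c' j * \int[leb]_x (a' j x * Phi x))).
    exact: (holder_pairing_cvg n0 beta0 C0 PH ha' coo').
  have VV := hpair C0 PH cV cV'.
  have dual1 j : \int[leb]_x (T j x * psi x) = \int[leb]_x (a j x * Phi x).
    by rewrite TE; exact: (commutator_duality mk mb mpsi B0 A30 V00 bB p01 mr1 EV psiE k1 (ha j)).
  have dual2 j : \int[leb]_x (T' j x * psi x) = \int[leb]_x (a' j x * Phi x).
    by rewrite TE'; exact: (commutator_duality mk mb mpsi B0 A30 V00 bB p01 mr1 EV psiE k1 (ha' j)).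
  have uE N : \int[leb]_x (u N x * psi x) =
      series (fun j => c j * \int[leb]_x (a j x * Phi x)) N -
      series (fun j => c' j * \int[leb]_x (a' j x * Phi x)) N.
    have [e1 i1] := Rintegral_series c N (fun j => Ti psi j hpsi).
    have [e2 i2] := Rintegral_series c' N (fun j => Ti' psi j hpsi).
    have -> : series (fun j => c j * \int[leb]_x (a j x * Phi x)) N =
        \int[leb]_x series (fun j => c j * (T j x * psi x)) N.
      by rewrite e1; congr (series _ _); apply/funext => j; rewrite dual1.
    have -> : series (fun j => c' j * \int[leb]_x (a' j x * Phi x)) N =
        \int[leb]_x series (fun j => c' j * (T' j x * psi x)) N.
      by rewrite e2; congr (series _ _); apply/funext => j; rewrite dual2.
    rewrite -RintegralB// /Rintegral; congr fine; apply: lower_integral_ae.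
      by apply/measurable_EFinP; apply: measurable_funB; apply/measurable_EFinP; [case/integrableP: i1|case/integrableP: i2].
    apply: filterS2 Gae Gae' => x g1 g2; congr EFin.
    rewrite /u indicE mem_set// mul1r /s /s' /series/= mulrBl !mulr_suml.
    by congr (_ - _); apply: eq_bigr => j _; rewrite mulrA.
  have hlim2 : (fun N => \int[leb]_x (u N x * psi x)) @ \oo --> (0 : R).
    have -> : (fun N => \int[leb]_x (u N x * psi x)) =
      (series (fun j => c j * \int[leb]_x (a j x * Phi x)) \-
       series (fun j => c' j * \int[leb]_x (a' j x * Phi x))).
      by apply/funext => N; rewrite uE.
    have z0 : limn (series (fun j => c j * \int[leb]_x (a j x * Phi x))) -
      limn (series (fun j => c' j * \int[leb]_x (a' j x * Phi x))) = 0 by rewrite VV subrr.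
    by rewrite -z0; exact: (cvgB cV cV').
  by rewrite -(cvg_lim _ hlim)// (cvg_lim _ hlim2).
have hloc r : (\int[leb]_(x in ecball 0 r) `|h x|%:E < +oo)%E.
  by apply: le_lt_trans (GGloc r); apply: le_lower_integral => x _.
have := @cutoff_orthogonal_ae0 R n n0 h mh hloc hcut => hae.
have hae2 : {ae leb, forall x, (G x < +oo)%E /\ (G' x < +oo)%E}.
  by apply: filterS2 Gae Gae' => x p1 p2; split.
apply: filterS2 hae hae2 => x hx gx.
by move: hx; rewrite /h TE TE' indicE (mem_set (gx : Gam x)) mul1r => /eqP; rewrite subr_eq0 => /eqP.
Qed.

(** The truncations of [b] at integers are bounded and keep the constant [L]; outside one null set
    the identity holds for all of them, and it passes to the limit where both gauge sums are
    finite. *)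
Lemma comm_unique (b : vec -> measurableTypeR R) : measurable_fun setT b ->
  (forall x y, `|b x - b y| <= L * enorm (x - y) `^ beta) ->
  {ae leb, forall x, limn (series (fun j => c j * atom_comm k a b j x)) =
     limn (series (fun j => c' j * atom_comm k a' b j x))}.
Proof.
move=> mb bL.
have [w [Mw [cw w0 hMw]]] := summable_weight coo.
have [w' [Mw' [cw' w0' hMw']]] := summable_weight coo'.
have w00 j : 0 <= w j by exact: ltW.
have w00' j : 0 <= w' j by exact: ltW.
have Gae := gauge_finite_ae q0 A0 mk hweak ha w00 hMw.
have Gae' := gauge_finite_ae q0 A0 mk hweak ha' w00' hMw'.
have bae : {ae leb, forall x, forall m,
    limn (series (fun j => c j * atom_comm k a (clampf b m) j x)) =
    limn (series (fun j => c' j * atom_comm k a' (clampf b m) j x))}.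
  apply: ae_foralln => m; apply: (@comm_unique_bounded _ m%:R) => //.
  - exact: (measurable_clampf n0 beta0 L0 bL m).
  - exact: (clampf_hoelder bL m).
  - by move=> x; exact: clamp_le.
have gae : {ae leb, forall x, (gauge_sum k beta X D a w x < +oo)%E /\
    (gauge_sum k beta X' D' a' w' x < +oo)%E}.
  by apply: filterS2 Gae Gae' => x p1 p2; split.
apply: filterS2 bae gae => x hb [g1 g2].
have [u1 _ u3] := gauge_sum_good cw w0 g1; have [u1' _ u3'] := gauge_sum_good cw' w0' g2.
have h1 := atom_comm_clamp_cvg n0 beta0 beta1 mk ha mb L0 bL u1 (le_lt_trans u3 g1).
have h2 := atom_comm_clamp_cvg n0 beta0 beta1 mk ha' mb L0 bL u1' (le_lt_trans u3' g2).
have e0 : (fun m => limn (series (fun j => c j * atom_comm k a (clampf b m) j x))) =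
    (fun m => limn (series (fun j => c' j * atom_comm k a' (clampf b m) j x))).
  by apply/funext => m; exact: hb.
rewrite e0 in h1; exact: (cvg_unique (@Rhausdorff R) h1 h2).
Qed.

(** [g] is the sum along [c], but it is estimated along [c'], which can be chosen nearly optimal for
    the norm. The outer measure is there because [g] is arbitrary on a null set. *)
Lemma commutator_weak_bound (b : vec -> measurableTypeR R) (g : vec -> R) z lambda :
  measurable_fun setT b -> (forall x y, `|b x - b y| <= L * enorm (x - y) `^ beta) ->
  {ae leb, forall x, series (fun j => c j * atom_comm k a b j x) @ \oo --> g x} ->
  (\sum_(0 <= j <oo) `|c' j|%:E <= z%:E)%E -> 0 < z -> 0 < L -> 0 < lambda ->
  (mu_ext leb [set x | (lambda < `|g x|)%R] <=
   (A * (2 * (z * (atom_const (R := R) n beta + 1)) * L / lambda) `^ q)%:E)%E.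
Proof.
move=> mb bL hg hz z0 Lp l0.
have [w' [Mw' [cw' w0' hMw']]] := summable_weight coo'.
have w00' j : 0 <= w' j by exact: ltW.
have Gae' := gauge_finite_ae q0 A0 mk hweak ha' w00' hMw'.
have c0 (j : nat) : 0 <= `|c' j|%R by [].
pose G' := gauge_sum k beta X' D' a' (fun j => `|c' j|%R).
have mG' : measurable_fun setT G' by exact: (measurable_gauge_sum mk ha' c0).
pose E := [set x | ((lambda / L)%:E < G' x)%E].
have mE : measurable E by rewrite -[X in measurable X]setTI; apply: emeasurable_fun_o_infty.
have aux : {ae leb, forall x, limn (series (fun j => c j * atom_comm k a b j x)) =
    limn (series (fun j => c' j * atom_comm k a' b j x)) /\ (gauge_sum k beta X' D' a' w' x < +oo)%E}.
  by apply: filterS2 (comm_unique mb bL) Gae' => x p1 p2; split.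
have inE : {ae leb, forall x, lambda < `|g x| -> E x}.
  apply: filterS2 hg aux => x gx [ex gf] lg.
  have [u1 _ u3] := gauge_sum_good cw' w0' gf; have koo := le_lt_trans u3 gf.
  have [h1 [_ h3]] := atom_comm_series beta0 beta1 mk ha' mb L0 bL u1 koo.
  have eg : limn (series (fun j => c' j * atom_comm k a' b j x)) = g x by rewrite -ex; exact: cvg_lim.
  have hh := h3 _ h1; rewrite eg in hh.
  have G0 : (0 <= G' x)%E by exact: gauge_sum_ge0.
  have Gf : G' x \is a fin_num by rewrite ge0_fin_numE.
  move: hh; rewrite -/(G' x) /E/= -(fineK Gf) -EFinM lee_fin lte_fin => hh.
  by rewrite ltr_pdivrMr// mulrC; exact: lt_le_trans lg hh.
have [Nn [mNn Nn0 hN]] := inE; have eN : leb Nn = 0%E by exact: Nn0.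
apply: (@le_trans _ _ (leb (Nn `|` E))).
  rewrite -measurable_mu_extE; last exact: measurableU.
  apply: le_mu_ext => x /= lx; have [xE|xE] := pselect (E x); first by right.
  by left; apply: hN => /= h; exact: xE (h lx).
apply: le_trans (_ : (leb (Nn `|` E) <= leb Nn + leb E)%E) _; first exact: measureU2.
rewrite eN add0e.
have Ca0 : 0 <= atom_const (R := R) n beta by exact: atom_const_ge0.
have MM : z * atom_const (R := R) n beta <= z * (atom_const (R := R) n beta + 1).
  by rewrite ler_wpM2l ?(ltW z0)// lerDl.
have M0 : 0 < z * (atom_const (R := R) n beta + 1) by rewrite mulr_gt0// ltr_wpDl.
have h := gauge_weak A0 mk hweak ha' c0 hz MM M0 (divr_gt0 l0 Lp).
have e2 : 2 * (z * (atom_const (R := R) n beta + 1)) * L / lambda =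
    2 * (z * (atom_const (R := R) n beta + 1)) / (lambda / L) by rewrite invf_div !mulrA.
by rewrite e2; exact: h.
Qed.

End comm_unique.

(** Used because the infimum defining the norm need not be attained and the Lipschitz constant may
    be 0: estimates come for every t > T. If the bound failed at [T], it would fail midway between
    [T] and the t with C t^q = x. *)
Lemma le_powR_right_limit (R : realType) (x C q T : R) : 0 <= x -> 0 < C -> 0 < q -> 0 <= T ->
  (forall t, T < t -> x <= C * t `^ q) -> x <= C * T `^ q.
Proof.
move=> x0 C0 q0 T0 h; rewrite leNgt; apply/negP => hx.
have xC : 0 <= x / C by rewrite divr_ge0// ltW.
pose v := (x / C) `^ q^-1; have v0 : 0 <= v by rewrite powR_ge0.
have vq : C * v `^ q = x.
  by rewrite /v -powRrM mulVf ?gt_eqF// powRr1// mulrC divfK// gt_eqF.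
have Tv : T < v.
  rewrite ltNge; apply/negP => vT; move: hx; rewrite ltNge => /negP; apply.
  rewrite -vq; apply: ler_wpM2l; first exact: ltW.
  by apply: ge0_ler_powR; rewrite ?nnegrE// ltW.
have [Tt tv] := midf_lt Tv; have := h _ Tt; rewrite leNgt => /negP; apply.
rewrite -[X in _ < X]vq ltr_pM2l//; apply: gt0_ltr_powR; rewrite ?nnegrE//.
by rewrite divr_ge0// addr_ge0.
Qed.

(** * Reduction of the hypotheses to Borel data *)

Section rough_kernel.
Context (R : realType) (n : nat).
Local Notation vec := 'rV[R]_n.
Local Notation leb := (lebesgue_rV R n).
Variables (beta alpha : R).
Hypotheses (n0 : (0 < n)%N) (beta0 : 0 < beta) (beta1 : beta < 1).
Hypotheses (alpha0 : 0 < alpha) (alphan : alpha < n%:R - beta).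
Variables (Omega : vec -> R) (r : R).
Hypotheses (hOmega : homogeneous0 Omega) (hr : n%:R / (n%:R - alpha) <= r).
Hypothesis hOmegar : inLp (@sphere_measure R n) r Omega.
Hypothesis hdini : (\int[lebesgue_measure]_(delta in `]0%R, 1%R[)
  (integral_modulus Omega r delta * ((delta `^ (1 + beta))^-1)%:E) < +oo)%E.

Lemma rough_kernel_weak (q := n%:R / (n%:R - alpha)) :
  exists (W : vec -> measurableTypeR R) (N : set vec) (A A3 : R),
  [/\ measurable_fun setT W, [/\ measurable N, leb N = 0%E & forall x, ~ N x -> Omega x = W x],
      0 <= A /\ 0 <= A3, (\int[leb]_x cut 1 `|kern W alpha x| <= A3%:E)%E &
      forall x0 d y t, 0 < d -> enorm (y - x0) <= d -> 0 < t ->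
        (\int[leb]_x cut t (atom_kernel (kern W alpha) beta x0 d (x, y)) <= (A * t `^ (1 - q))%:E)%E].
Proof.
have nR : 0 < n%:R :> R by rewrite ltr0n.
have na : 0 < n%:R - alpha by rewrite subr_gt0; apply: lt_trans alphan _; rewrite ltrBlDr ltrDl.
have q0 : 0 < q by rewrite divr_gt0.
have q1 : 1 <= q by rewrite ler_pdivlMr// mul1r lerBlDr lerDl ltW.
have ab : alpha + beta < n%:R by rewrite -ltrBrDr.
have r1 : 1 <= r by apply: le_trans hr.
have [W [N [I [mW hom [mN N0 Ncone OW] I0 hI]]]] := borel_symbol n0 hOmega r1 hOmegar.
(* As q <= r, |W|^q <= 1 + |W|^r, and the constant 1 integrates to the volume of the unit ball. *)
pose IW := ballvol R n + I.
have IW0 : 0 <= IW by rewrite addr_ge0// ltW// ballvol_gt0.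
have mb := @measurable_ecball0 R n 1.
have hIW : (\int[leb]_(x in ecball 0 1) (`|W x| `^ q)%:E <= IW%:E)%E.
  apply: (@le_trans _ _ (\int[leb]_(x in ecball 0 1) (1%:E + (`|W x| `^ r)%:E))%E).
    apply: le_lower_integral => x _; first by rewrite lee_fin powR_ge0.
    rewrite -EFinD lee_fin.
    have [w1|w1] := leP `|W x| 1.
      apply: (@le_trans _ _ 1); last by rewrite lerDl powR_ge0.
      have := @ge0_ler_powR R q (ltW q0) `|W x| 1; rewrite powR1; apply; rewrite ?nnegrE//.
    apply: (@le_trans _ _ (`|W x| `^ r)); last by rewrite lerDr.
    by apply: ler_powR => //; exact: ltW.
  have e : leb (ecball 0 1) = (ballvol R n)%:E by rewrite leb_ecball// expr1n mul1r.
  have e1 : (\int[leb]_(x in ecball 0 1) 1%:E)%E = (ballvol R n)%:E.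
    by rewrite -[RHS]mul1e -e -integral_cst.
  rewrite ge0_integralD//.
  - by rewrite e1 EFinD; apply: leeD.
  - apply/measurable_EFinP; apply: measurable_funTS.
    apply: (measurableT_comp (measurable_powR r)).
    exact: (measurableT_comp (@normr_measurable R setT) mW).
have [A1 A10 h1] := kern_ball_bound alpha0 beta0 ab erefl mW hom IW0 hIW.
have [tau [K [tau0 htau hK]]] := annulus_modulus n0 beta0 q1 hr mW hom mN N0 Ncone OW IW0 hIW hdini.
have [A2 A20 h2] := kern_diff_bound alpha0 beta0 beta1 ab erefl mW hom IW0 hIW tau0 htau hK.
have [A3 A30 h3] := kern_weak_bound alpha0 beta0 ab erefl mW hom IW0 hIW.
have mk : measurable_fun setT (kern W alpha : vec -> measurableTypeR R) by exact: measurable_kern.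
have [A A0 hA] := atom_kernel_weak q1 mk A10 A20 A30 h1 h2 h3.
exists W, N, A, A3; split => //.
by have := h3 1 ltr01; rewrite powR1 mulr1.
Qed.

End rough_kernel.

Section decomposition.
Context (R : realType) (n : nat).
Local Notation vec := 'rV[R]_n.
Local Notation leb := (lebesgue_rV R n).
Variables (beta p l : R) (s : nat).
Hypotheses (n0 : (0 < n)%N) (beta0 : 0 < beta) (beta1 : beta < 1).
Hypotheses (hp : p = n%:R / (n%:R + beta)) (l1 : 1 < l).

(** Extracts all that is used of an atomic decomposition: Borel atoms, absolute summability of the
    coefficients, and the values of the distribution on mollifiers. *)
Lemma decomposition_borel (f : (vec -> R) -> R) c a : atomic_decomposition p l s f c a ->
  exists (X : nat -> vec) (D : R^nat) (a0 : nat -> vec -> measurableTypeR R),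
  [/\ forall j, borel_atom beta (X j) (D j) (a0 j),
      forall j, {ae leb, forall x, a j x = a0 j x},
      (\sum_(0 <= j <oo) `|c j|%:E <= coef_norm p c)%E /\ coef_norm p c \is a fin_num,
      (\sum_(0 <= j <oo) `|c j|%:E < +oo)%E &
      forall m y, series (fun j => c j * kap_pairing m.+1%:R (a0 j) y) @ \oo -->
        f (mollifier m.+1%:R y)].
Proof.
move=> [ha coo hf].
have nR : 0 < n%:R :> R by rewrite ltr0n.
have nb : 0 < n%:R + beta by rewrite addr_gt0.
have p0 : 0 < p by rewrite hp divr_gt0.
have p1 : 1 <= p^-1 by rewrite hp invf_div ler_pdivlMr// mul1r lerDl ltW.
have h3 j : exists z : vec * R * (vec -> measurableTypeR R),
    borel_atom beta z.1.1 z.1.2 z.2 /\ {ae leb, forall x, a j x = z.2 x}.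
  by have [x0 [d [a0 h]]] := atom_borel n0 beta0 hp l1 (ha j); exists (x0, d, a0).
have [F hF] := choice h3.
exists (fun j => (F j).1.1), (fun j => (F j).1.2), (fun j => (F j).2).
pose S := (\sum_(0 <= j <oo) (`|c j| `^ p)%:E)%E.
have Sf : S \is a fin_num.
  by rewrite ge0_fin_numE//; apply: nneseries_ge0 => j _ _; rewrite lee_fin powR_ge0.
have hS : (\sum_(0 <= j <oo) (`|c j| `^ p)%:E <= (fine S)%:E)%E by rewrite fineK.
have h1 := eseries_powR_le p1 (fun j => powR_ge0 `|c j| p) hS.
have e : (\sum_(0 <= i <oo) ((`|c i| `^ p) `^ p^-1)%:E = \sum_(0 <= i <oo) `|c i|%:E)%E.
  by apply: eq_eseriesr => j _; rewrite -powRrM mulfV ?gt_eqF// powRr1.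
rewrite e in h1.
have cE : coef_norm p c = (fine S `^ p^-1)%:E by rewrite /coef_norm -/S -(fineK Sf) poweR_EFin.
split.
- by move=> j; exact: (hF j).1.
- by move=> j; exact: (hF j).2.
- by rewrite cE.
- exact: le_lt_trans h1 (ltry _).
move=> m y; have r0 : 0 < m.+1%:R :> R by [].
have := hf _ (mollifier_test y r0).
rewrite (_ : (fun j => c j * \int[leb]_x (a j x * mollifier m.+1%:R y x)) =
   (fun j => c j * kap_pairing m.+1%:R (F j).2 y))//.
apply/funext => j; congr (_ * _); rewrite kap_pairingE /Rintegral; congr fine.
have [[_ ma _ _ _] aE] := hF j.
have mk : measurable_fun setT (fun x : vec => kap (m.+1%:R *: (x - y))).
  have h := measurable_fun_subv (@measurable_id _ vec setT) (@measurable_cst _ _ vec vec setT y).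
  have mkap : measurable_fun setT (@kap R n).
    exact: (measurable_kap n0 beta0 beta1).
  apply: measurableT_comp mkap _.
  by apply: measurable_fun_scalev; [exact: measurable_cst|exact: h].
apply: lower_integral_ae.
  by apply/measurable_EFinP; exact: (measurable_funM ma mk).
by apply: filterS aE => x ->; rewrite mollifier_kap.
Qed.

End decomposition.

Lemma commutator_borel (R : realType) (n : nat) (Omega : 'rV[R]_n -> R)
    (W b : 'rV[R]_n -> measurableTypeR R) (N : set 'rV[R]_n) (alpha : R)
    (a : 'rV[R]_n -> R) (a0 : 'rV[R]_n -> measurableTypeR R) (x : 'rV[R]_n) :
  measurable N -> lebesgue_rV R n N = 0%E -> (forall z, ~ N z -> Omega z = W z) ->
  measurable_fun setT W -> measurable_fun setT b -> measurable_fun setT a0 ->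
  {ae lebesgue_rV R n, forall y, a y = a0 y} ->
  commutator Omega alpha b a x =
    \int[lebesgue_rV R n]_y (comm (kern W alpha) b x y * a0 y) /\
  (\int[lebesgue_rV R n]_y `|commutator_kernel Omega alpha b x y * a y|%:E =
   \int[lebesgue_rV R n]_y `|comm (kern W alpha) b x y * a0 y|%:E)%E.
Proof.
move=> mN N0 OW mW mb ma aE.
have mk : measurable_fun setT (kern W alpha : 'rV[R]_n -> measurableTypeR R) by exact: measurable_kern.
have mc : measurable_fun setT (fun y => comm (kern W alpha) b x y * a0 y : measurableTypeR R).
  apply: (measurable_funM _ ma).
  exact: (measurableT_comp (measurable_comm_pair mk mb) (@measurable_pair1 _ _ 'rV[R]_n 'rV[R]_n x)).
have hae : {ae lebesgue_rV R n, forall y, commutator_kernel Omega alpha b x y * a y =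
    comm (kern W alpha) b x y * a0 y}.
  by apply: commutator_kernel_ae mN N0 OW _ _ x aE.
split.
  rewrite /commutator /Rintegral; congr fine; apply: lower_integral_ae.
    exact/measurable_EFinP.
  by apply: filterS hae => y ->.
apply: lower_integral_ae.
  by apply/measurable_EFinP; exact: (measurableT_comp (@normr_measurable R setT) mc).
by apply: filterS hae => y ->.
Qed.

Lemma Lip_norm_fin (R : realType) (n : nat) (beta : R) (b : 'rV[R]_n -> R) : (0 < n)%N ->
  (Lip_norm beta b < +oo)%E ->
  [/\ Lip_norm beta b \is a fin_num, 0 <= fine (Lip_norm beta b) &
      forall x y, `|b x - b y| <= fine (Lip_norm beta b) * enorm (x - y) `^ beta].
Proof.
move=> n0 bLip.
have ub x y : x != y -> ((`|b x - b y| / enorm (x - y) `^ beta)%:E <= Lip_norm beta b)%E.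
  by move=> xy; apply: ereal_sup_ubound; exists (x, y).
have Lip0 : (0 <= Lip_norm beta b)%E.
  (* A nonzero vector exists since n > 0, so the supremum is over a nonempty set and is not -oo. *)
  have v0 : (const_mx 1 : 'rV[R]_n) != 0.
    apply/eqP => /matrixP/(_ 0 (Ordinal n0)); rewrite !mxE => /eqP.
    by rewrite oner_eq0.
  by apply: le_trans (ub _ _ v0); rewrite lee_fin divr_ge0 ?powR_ge0.
have Lf : Lip_norm beta b \is a fin_num by rewrite ge0_fin_numE.
have L0 := fine_ge0 Lip0.
split => // x y; have [->|xy] := eqVneq x y; first by rewrite subrr normr0 mulr_ge0 ?powR_ge0.
have := ub x y xy; rewrite -(fineK Lf) lee_fin ler_pdivrMr// powR_gt0// enorm_gt0 subr_eq0.
by [].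
Qed.

Theorem theorem1p3 (R : realType) (n : nat) (hn : (2 <= n)%N)
    (beta alpha : R) (hbeta0 : 0 < beta) (hbeta1 : beta < 1)
    (halpha0 : 0 < alpha) (halpha : alpha < n%:R - beta)
    (Omega : 'rV[R]_n -> R) (hOmega : homogeneous0 Omega)
    (r : R) (hr : n%:R / (n%:R - alpha) <= r)
    (hOmegar : inLp (@sphere_measure R n) r Omega)
    (hdini : (\int[lebesgue_measure]_(delta in `]0%R, 1%R[)
                (integral_modulus Omega r delta *
                 ((delta `^ (1 + beta))^-1)%:E) < +oo)%E)
    (p : R) (hp : p = n%:R / (n%:R + beta))
    (l : R) (hl1 : 1 < l) (hl : l < n%:R / alpha)
    (s : nat) (hs : Num.floor (n%:R * (p^-1 - 1)) <= s%:Z) :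
  exists C : R, 0 < C /\
    forall b : 'rV[R]_n -> R, (Lip_norm beta b < +oo)%E ->
    forall f : ('rV[R]_n -> R) -> R, Hardy p l s f ->
      (forall c a, atomic_decomposition p l s f c a ->
         exists g, commutator_series Omega alpha b c a g) /\
      (forall g, commutator_Hardy p l s Omega alpha b f g ->
         forall lambda : R, 0 < lambda ->
           (mu_ext (lebesgue_rV R n) [set x | (lambda < `|g x|)%R] <=
            C%:E * (Lip_norm beta b * (lambda^-1)%:E * Hardy_norm p l s f)
                     `^ (n%:R / (n%:R - alpha)))%E).
Proof.
have n0 : (0 < n)%N by exact: leq_trans hn.
have nR : 0 < n%:R :> R by rewrite ltr0n.
have na : 0 < n%:R - alpha by lra.
have [W [N [A [A3 [mW [mN N0 OW] [A0 A30] k1 hweak]]]]] :=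
  rough_kernel_weak n0 hbeta0 hbeta1 halpha0 halpha hOmega hr hOmegar hdini.
set q := n%:R / (n%:R - alpha) in hweak *.
have q0 : 0 < q by rewrite divr_gt0.
pose k : 'rV[R]_n -> measurableTypeR R := kern W alpha.
have mk : measurable_fun setT k by exact: measurable_kern.
pose Ca := atom_const (R := R) n beta.
have Ca0 : 0 <= Ca by exact: atom_const_ge0.
have Ca1 : 0 < Ca + 1 by rewrite ltr_wpDl.
have C10 : 0 < 2 * (Ca + 1) by rewrite mulr_gt0.
(* 2 (Ca + 1) is the factor of the total mass in [commutator_weak_bound]; A + 1 replaces [A] to make
   the constant positive. *)
pose C := (A + 1) * (2 * (Ca + 1)) `^ q.
have C0 : 0 < C by rewrite mulr_gt0 ?powR_gt0// ltr_wpDl.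
exists C; split => // b bLip f [_ _].
have [Lf L0 bL] := Lip_norm_fin n0 bLip; set L := fine _ in L0 bL.
have mb : measurable_fun setT (b : 'rV[R]_n -> measurableTypeR R).
  exact: (hoelder_measurable n0 hbeta0 L0 bL).
split=> [c a hca|g [c [a [hca hg]]] lambda l0];
  have [X [D [a0 [ha aE [cn cf] coo hF]]]] := decomposition_borel n0 hbeta0 hbeta1 hp hl1 hca;
  have ma0 j : measurable_fun setT (a0 j) by have [] := ha j.
  have [w [Mw [cw w0 hMw]]] := summable_weight coo.
  have w00 j : 0 <= w j by exact: ltW.
  have Gae := gauge_finite_ae q0 A0 mk hweak ha w00 hMw.
  exists (fun x => limn (series (fun j => c j * atom_comm k a0 b j x))).
  apply: filterS Gae => x gx.
  have [u1 _ u3] := gauge_sum_good cw w0 gx.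
  have [h1 _] := atom_comm_series hbeta0 hbeta1 mk ha mb L0 bL u1 (le_lt_trans u3 gx).
  have hb j := commutator_borel alpha x mN N0 OW mW mb (ma0 j) (aE j).
  split=> [j|].
    rewrite (hb j).2; have [/integrableP[_ hi] _] := atom_comm_bound hbeta0 hbeta1 mk ha mb L0 bL (u1 j).
    exact: hi.
  rewrite (_ : (fun j => c j * commutator Omega alpha b (a j) x) =
    (fun j => c j * atom_comm k a0 b j x)); first exact: h1.
  by apply/funext => j; rewrite (hb j).1.
have hg0 : {ae lebesgue_rV R n, forall x, series (fun j => c j * atom_comm k a0 b j x) @ \oo --> g x}.
  apply: filterS hg => x [_ h].
  rewrite (_ : (fun j => c j * atom_comm k a0 b j x) =
    (fun j => c j * commutator Omega alpha b (a j) x)); first exact: h.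
  by apply/funext => j; rewrite (commutator_borel alpha x mN N0 OW mW mb (ma0 j) (aE j)).1.
have H0 : (0 <= Hardy_norm p l s f)%E.
  by apply: le_ereal_inf_tmp => _ [c' _ <-]; exact: poweR_ge0.
have Hf : Hardy_norm p l s f \is a fin_num.
  rewrite ge0_fin_numE//; apply: (@le_lt_trans _ _ (coef_norm p c)).
    by apply: ereal_inf_lbound; exists c => //; exists a.
  by rewrite -(fineK cf) ltry.
pose I := fine (Hardy_norm p l s f); have I0 : 0 <= I by rewrite fine_ge0.
(* Any L' > L is a positive constant for [b], and for any z > I some decomposition has coefficient
   norm below [z]. *)
have bound L' z : L < L' -> I < z ->
    (mu_ext (lebesgue_rV R n) [set x | (lambda < `|g x|)%R] <=
     (A * (2 * (z * (Ca + 1)) * L' / lambda) `^ q)%:E)%E.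
  move=> LL Iz; have z0 : 0 < z by exact: le_lt_trans Iz.
  have L'p : 0 < L' by exact: le_lt_trans LL.
  have bL' x y : `|b x - b y| <= L' * enorm (x - y) `^ beta.
    by apply: le_trans (bL x y) _; rewrite ler_wpM2r ?powR_ge0// ltW.
  have Hz : (Hardy_norm p l s f < z%:E)%E by rewrite -(fineK Hf) lte_fin.
  have [_ [c' [a' hca'] <-] cz] := ereal_inf_lt Hz.
  have [X' [D' [a0' [ha' _ [cn' _] coo' hF']]]] := decomposition_borel n0 hbeta0 hbeta1 hp hl1 hca'.
  have hpair := pairing_unique n0 hbeta0 hbeta1 ha coo ha' coo' hF hF'.
  apply: (commutator_weak_bound n0 hbeta0 hbeta1 q0 A0 mk A30 k1 hweak ha coo ha' coo' hpair
    (ltW L'p) mb bL' hg0 _ z0 L'p l0).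
  exact: le_trans cn' (ltW cz).
set m := mu_ext _ _ in bound *.
have m0 : (0 <= m)%E by exact: mu_ext_ge0.
have mf : m \is a fin_num.
  rewrite ge0_fin_numE//; apply: le_lt_trans (bound (L + 1) (I + 1) _ _) _; rewrite ?ltrDl//.
  exact: ltry.
have -> : (C%:E * (Lip_norm beta b * (lambda^-1)%:E * Hardy_norm p l s f) `^ q)%E =
    (C * (L * lambda^-1 * I) `^ q)%:E by rewrite -(fineK Lf) -(fineK Hf).
rewrite -(fineK mf) lee_fin.
apply: le_powR_right_limit => //; first by rewrite fine_ge0.
  by rewrite !mulr_ge0// invr_ge0 ltW.
move=> t ht.
have IL0 : 0 < I + L + 1 by rewrite ltr_wpDl// addr_ge0.
have tl : 0 < t * lambda - L * I.
  by rewrite subr_gt0 -ltr_pdivrMr// mulrAC.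
(* Since e <= 1, (I + e) (L + e) <= I L + e (I + L + 1), which this choice keeps below t lambda. *)
pose e := Num.min 1 ((t * lambda - L * I) / (I + L + 1)).
have e0 : 0 < e by rewrite lt_min ltr01 divr_gt0.
have e1 : e <= 1 by rewrite ge_min lexx.
have e2 : e * (I + L + 1) <= t * lambda - L * I by rewrite -ler_pdivlMr// ge_min lexx orbT.
have key : (I + e) * (L + e) <= t * lambda.
  have : e * e <= e by rewrite ler_piMl// ltW.
  by nra.
have t0 : 0 <= t by apply: le_trans (ltW ht); rewrite !mulr_ge0// invr_ge0 ltW.
rewrite -lee_fin (fineK mf); apply: le_trans (bound (L + e) (I + e) _ _) _; rewrite ?ltrDl// lee_fin.
have -> : 2 * ((I + e) * (Ca + 1)) * (L + e) / lambda =
    2 * (Ca + 1) * ((I + e) * (L + e) / lambda) by ring.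
have s0 : 0 <= (I + e) * (L + e) / lambda.
  by rewrite divr_ge0 ?mulr_ge0 ?addr_ge0// ltW.
rewrite powRM ?(ltW C10)// /C -[leRHS]mulrA; apply: ler_pM => //.
- by rewrite mulr_ge0 ?powR_ge0.
- by rewrite lerDl.
apply: ler_wpM2l; first exact: powR_ge0.
apply: ge0_ler_powR; rewrite ?nnegrE ?(ltW q0)//.
by rewrite ler_pdivrMr.
Qed.
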